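(* Let $L\neq\mathbb{Q}$ be a number field with absolute discriminant $d_L$. If the Dedekind zeta function $\zeta_L(s)$ admits a real zero $\beta_1\in(0,1)$, then $$1-\beta_1\ge d_L^{-c_3}\quad\text{with } c_3=11.7.$$
   Context: $\zeta_L(s)$ denotes the Dedekind zeta function of $L$. *)

(* Defs.v *)
From HB Require Import structures.
From mathcomp Require Import all_boot all_order all_algebra all_field.
From mathcomp Require Import complex finmap.
From mathcomp Require Import all_classical all_reals all_analysis.
From mathcomp.analysis.showcase Require Import summability.

Set Implicit Arguments.
Unset Strict Implicit.
Unset Printing Implicit Defensive.

Import Order.TTheory GRing.Theory Num.Theory. Import passmx.
Import numFieldNormedType.Exports.

Local Open Scope classical_set_scope.
Local Open Scope ring_scope.

Section NumberField.

Variable L : fieldExtType rat.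

Definition ring_of_integers : set L := integralOver (intr : int -> L).

Definition nonzero_ideal (I : set L) : Prop :=
  [/\ I `<=` ring_of_integers, I 0,
      (forall x y, I x -> I y -> I (x + y)),
      (forall a x, ring_of_integers a -> I x -> I (a * x))
    & exists2 x, I x & x != 0].

(* The carrier of the quotient of the ring of integers by I. *)
Definition ideal_cosets (I : set L) : set (set L) :=
  [set [set a + x | x in I] | a in ring_of_integers].

(* #|` fset_set A| is the cardinality of a finite set A and is 0 for an
   infinite one; the quotient by a nonzero ideal is always finite. *)
Definition ideal_norm (I : set L) : nat := #|` fset_set (ideal_cosets I)|.

Definition field_trace (x : L) : rat :=
  \tr (mxof (vbasis {:L}) (vbasis {:L}) (amull x)).

Definition integral_basis (b : (\dim {:L}).-tuple L) : Prop :=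
  basis_of {:L} b /\
  forall x : L, ring_of_integers x <->
    exists c : 'I_(\dim {:L}) -> int, x = \sum_i (c i)%:~R * b`_i.

Definition basis_disc (b : (\dim {:L}).-tuple L) : rat :=
  \det (\matrix_(i < \dim {:L}, j < \dim {:L}) field_trace (b`_i * b`_j)).

(* Integral bases always exist and share the same discriminant, so neither the
   default value nor the choice made by xget matters. *)
Definition absolute_disc : rat :=
  `|basis_disc (xget [tuple of nseq _ 0] integral_basis)|.

End NumberField.

(* A numFieldType carries the topology of its norm and is a normed module over
   itself; the next two definitions are instantiated at the field R[i]. *)
Definition holomorphic_at (K : numFieldType) (f : K -> K) (z : K) : Prop :=
  derivable f z 1.

(* Unordered summation: convergence along the directed set of the finite
   subsets of I. *)
Definition has_sum (K : numFieldType) (I : choiceType) (x : I -> K) (l : K) :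
    Prop :=
  partial_sum x @ totally --> l.

Section DedekindZeta.

Variable R : realType.

Definition cexp (z : R[i]) : R[i] :=
  (expR (complex.Re z))%:C%C * (cos (complex.Im z) +i* sin (complex.Im z))%C.

(* n ^ (- s) *)
Definition cpow_neg (n : nat) (s : R[i]) : R[i] :=
  cexp (- s * (ln n%:R)%:C%C).

(* Z is the analytic continuation to the complex plane minus 1 of the sum over
   the nonzero ideals I of N(I) ^ (- s), where 1 < Re s.  By the identity
   theorem, these conditions determine Z away from 1; its value at the pole 1
   is left unspecified. *)
Record is_dedekind_zeta (L : fieldExtType rat) (Z : R[i] -> R[i]) : Prop := {
  dedekind_zeta_series : forall s : R[i], 1 < complex.Re s ->
    has_sum
      (fun I : [set I : set L | nonzero_ideal I] =>
         cpow_neg (ideal_norm (val I)) s)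
      (Z s);
  dedekind_zeta_holomorphic : forall s : R[i], s != 1 -> holomorphic_at Z s
}.

End DedekindZeta.

(* Main.v *)
(** For a nonzero ideal J, compare the theta series of the lattice J^-1, for a
    conjugation-invariant weight normalised by N(J), with its main term: for
    0 < t <= 1,
      kappa <= t^(n/2) Theta(t) <= kappa + 32 n^2 (n+2) kappa^-2 t,
    where kappa >= d^(-1/2).  No Poisson summation is used: the lower bound and
    the monotonicity come from the parallelogram law, which gives
    Theta(t)^2 <= 2^n Theta(2t)^2, and the upper bound from the existence of
    short representatives of all classes of J^-1 modulo 2.

    Integrating over the weights and summing over the ideal classes turns these
    series into a function Psi whose Laplace transform is zeta_L times the
    transform of a rapidly decreasing phi.  Hence, for some V > 0 and
    rho >= V d^(-1/2), the function zeta_L(s) lap phi(s) - rho / (s - 1) + V / s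
    is the Laplace transform of a nonnegative function, holomorphic for
    Re s > 1 - 2 / n.  At a real zero beta close to 1 the continued identity reads
      rho / (1 - beta) + V / beta = (that transform at beta) <= V + 32 n^3 (n+2) d V,
    so 1 / (1 - beta) <= 64 d^(11/2) because n <= d.  If beta is not close to 1,
    or if there is no integral basis (never the case), the bound is trivial. *)

Require Import Defs.
From HB Require Import structures.
From mathcomp Require Import all_boot all_order all_algebra all_field.
From mathcomp Require Import complex finmap.
From mathcomp Require Import all_classical all_reals all_analysis.
From mathcomp.analysis.showcase Require Import summability.
From mathcomp Require Import measurable_realfun real_interval.
From mathcomp Require Import ring lra zify.

Set Implicit Arguments.
Unset Strict Implicit.
Unset Printing Implicit Defensive.

Import Order.TTheory GRing.Theory Num.Theory. Import passmx.
Import numFieldNormedType.Exports.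

Local Open Scope classical_set_scope.
Local Open Scope ring_scope.

(** Zeta knows the ideals through cardinalities of quotients, while the discriminant is a
    determinant; both are tied to theta series by one notion, the density of a subset of L, read off
    from its theta series near 0. Densities are additive, invariant under shifts and divided by the
    norm of x under multiplication by x, so indices become ratios of densities; finiteness of
    quotients, norms of x I and the lower bound on kappa come from this. Inverse ideals appear
    because the nonzero x in J^-1, up to units, correspond to the ideals x J in the class of J.
    Weights of product N(J)^2 force Q(x) >= n for nonzero x, by the inequality of means; this
    minimum bounds Theta(1/2) by 2, which yields 2^n < 4 d, hence n <= d, and feeds the search for
    short vectors. At a zero of zeta the factor lap phi drops out whatever its value. The exponent:
    32 n^3 (n + 2) d d^(1/2) <= 64 d^(11/2), and 64 <= d^6 turns this into d^(23/2), below the power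
    11.7. *)

#[local] Arguments Normc.normc {R} x : simpl never.

(** * Closure properties of holomorphic functions *)

Section HolomorphicAlgebra.
Variable K : numFieldType.
Implicit Types (f g : K -> K) (z c : K).

Lemma holoB f g z : holomorphic_at f z -> holomorphic_at g z ->
  holomorphic_at (fun w => f w - g w) z.
Proof. by move=> hf hg; exact: derivableB. Qed.

Lemma holoD f g z : holomorphic_at f z -> holomorphic_at g z ->
  holomorphic_at (fun w => f w + g w) z.
Proof. by move=> hf hg; exact: derivableD. Qed.

Lemma holoM f g z : holomorphic_at f z -> holomorphic_at g z ->
  holomorphic_at (fun w => f w * g w) z.
Proof. by move=> hf hg; exact: derivableM. Qed.

Lemma holo_cst c z : holomorphic_at (fun=> c) z.
Proof. exact: derivable_cst. Qed.

Lemma holo_subr c z : holomorphic_at (fun w => w - c) z.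
Proof. by apply: holoB; [exact: derivable_id|exact: holo_cst]. Qed.

Lemma holo_inv_subr c z : z != c -> holomorphic_at (fun w => (w - c)^-1) z.
Proof.
move=> zc; apply: derivableV; last exact: holo_subr.
by rewrite subr_eq0.
Qed.

Lemma holoX f n z : holomorphic_at f z -> holomorphic_at (fun w => f w ^+ n) z.
Proof.
move=> hf; elim: n => [|n IH].
  by under eq_fun do rewrite expr0; exact: holo_cst.
by under eq_fun do rewrite exprS; exact: holoM.
Qed.

End HolomorphicAlgebra.

(** * Complex differentiability in terms of real and imaginary parts *)

Section ComplexDifferentiability.
Variable R : realType.
Implicit Types (f g : R[i] -> R[i]) (z h : R[i]).

Local Notation cabs := (@Normc.normc R).

Lemma norm_cabs z : `|z| = ((cabs z)%:C)%C.
Proof. by case: z. Qed.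

Lemma cabs_ge0 z : 0 <= cabs z.
Proof. by rewrite -ler0c -norm_cabs. Qed.

Lemma cabsM z h : cabs (z * h) = cabs z * cabs h.
Proof. exact: Normc.normcM. Qed.

Lemma cabsV z : cabs z^-1 = (cabs z)^-1.
Proof. exact: Normc.normcV. Qed.

Lemma cabsD z h : cabs (z + h) <= cabs z + cabs h.
Proof. exact: le_normcD. Qed.

Lemma cabsN z : cabs (- z) = cabs z.
Proof. exact: normcN. Qed.

Lemma cabsB z h : cabs (z - h) <= cabs z + cabs h.
Proof. by rewrite (le_trans (cabsD _ _))// cabsN. Qed.

Lemma cabs_dist z h : cabs (z - h) = cabs (h - z).
Proof. by rewrite -cabsN opprB. Qed.

Lemma cabs0 : cabs 0 = 0.
Proof. exact: Normc.normc0. Qed.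

Lemma cabs_real (x : R) : cabs (x%:C)%C = `|x|.
Proof. by rewrite /Normc.normc /= expr0n addr0 sqrtr_sqr. Qed.

Lemma cabs_gt0 z : (0 < cabs z) = (z != 0).
Proof.
rewrite lt_def cabs_ge0 andbT; apply/idP/idP; apply: contra => /eqP.
  by move=> ->; rewrite cabs0.
by move=> /Normc.eq0_normc ->.
Qed.

Lemma cabsX z n : cabs (z ^+ n) = cabs z ^+ n.
Proof.
elim: n => [|n IH]; first by rewrite !expr0 (Normc.normc1 R).
by rewrite !exprS cabsM IH.
Qed.

Lemma Re_le_cabs z : `|complex.Re z| <= cabs z.
Proof.
case: z => a b; rewrite /Normc.normc /= -sqrtr_sqr ler_wsqrtr// lerDl.
exact: sqr_ge0.
Qed.

Lemma Im_le_cabs z : `|complex.Im z| <= cabs z.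
Proof.
case: z => a b; rewrite /Normc.normc /= -sqrtr_sqr ler_wsqrtr// lerDr.
exact: sqr_ge0.
Qed.

Lemma cabs_le_ReIm z : cabs z <= `|complex.Re z| + `|complex.Im z|.
Proof.
case: z => a b; rewrite /Normc.normc /=.
have h0 : 0 <= `|a| + `|b| by rewrite addr_ge0.
rewrite -[leRHS]ger0_norm// -sqrtr_sqr ler_wsqrtr//.
rewrite -[a ^+ 2]real_normK ?num_real// -[b ^+ 2]real_normK ?num_real//.
by have := mulr_ge0 (normr_ge0 a) (normr_ge0 b); nra.
Qed.

Lemma complex_ext z h : complex.Re z = complex.Re h -> complex.Im z = complex.Im h ->
  z = h.
Proof. by case: z => a b; case: h => c d /= -> ->. Qed.

Lemma cReD z h : complex.Re (z + h) = complex.Re z + complex.Re h.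
Proof. by case: z; case: h. Qed.
Lemma cImD z h : complex.Im (z + h) = complex.Im z + complex.Im h.
Proof. by case: z; case: h. Qed.
Lemma cReB z h : complex.Re (z - h) = complex.Re z - complex.Re h.
Proof. by case: z; case: h. Qed.
Lemma cImB z h : complex.Im (z - h) = complex.Im z - complex.Im h.
Proof. by case: z; case: h. Qed.
Lemma cReM z h :
  complex.Re (z * h) = complex.Re z * complex.Re h - complex.Im z * complex.Im h.
Proof. by case: z; case: h. Qed.
Lemma cImM z h :
  complex.Im (z * h) = complex.Re z * complex.Im h + complex.Im z * complex.Re h.
Proof. by case: z; case: h. Qed.

(** A form of differentiability without quotient: h = 0 is harmless, and the affine part can be
    subtracted under a contour integral. *)
Definition cdiff f z D := forall e : R, 0 < e -> exists2 eta : R, 0 < eta &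
  forall h, cabs h < eta -> cabs (f (z + h) - f z - D * h) <= e * cabs h.

Definition ccont f z := forall e : R, 0 < e -> exists2 eta : R, 0 < eta &
  forall h, cabs h < eta -> cabs (f (z + h) - f z) <= e.

Lemma complex_gt0 z : 0 < z -> z = ((complex.Re z)%:C)%C /\ 0 < complex.Re z.
Proof. by case: z => a b; rewrite ltcE/= => /andP[/eqP -> ->]. Qed.

Lemma holoP f z : holomorphic_at f z <-> exists D, cdiff f z D.
Proof.
split.
  move=> /cvg_ex[D /cvgrPdist_le hD]; exists D => e e0.
  have e0' : 0 < (e%:C)%C :> R[i] by rewrite ltcR.
  have /nbhs_ballP[r r0 hr] := hD _ e0'.
  have [rE rp] := complex_gt0 r0.
  exists (complex.Re r) => // h hh.
  have [->|h0] := eqVneq h 0; first by rewrite addr0 subrr mulr0 subr0 cabs0 mulr0.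
  have := hr h; rewrite -ball_normE/= sub0r normrN norm_cabs rE ltcR => /(_ hh h0).
  rewrite norm_cabs lecR => hle.
  have -> : f (z + h) - f z - D * h = - (D - h^-1 *: (f (h *: 1 + z) - f z)) * h.
    rewrite /GRing.scale/= mulr1 [h + z]addrC mulNr mulrBl mulrAC mulVf// mul1r.
    by rewrite opprB.
  by rewrite cabsM cabsN ler_wpM2r// cabs_ge0.
move=> [D hD]; apply/cvg_ex; exists D; apply/cvgrPdist_le => e e0.
have [eE ep] := complex_gt0 e0.
have [eta eta0 heta] := hD _ ep.
apply/nbhs_ballP; exists (eta%:C)%C; first by rewrite /= ltcR.
move=> h; rewrite -ball_normE/= sub0r normrN norm_cabs ltcR => hh h0.
rewrite eE norm_cabs lecR.
have := heta _ hh; rewrite -ler_pdivrMr ?cabs_gt0//; apply: le_trans.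
rewrite -cabsV -cabsM -cabsN opprB.
rewrite le_eqVlt; apply/orP; left; apply/eqP; congr cabs.
rewrite /GRing.scale/= mulr1 [h + z]addrC mulrBl mulfK//.
by rewrite [h^-1 * _]mulrC.
Qed.

Lemma cdiff_cont f z D : cdiff f z D -> ccont f z.
Proof.
move=> hD e e0; have [eta eta0 heta] := hD 1 ltr01.
exists (Num.min eta (e / (1 + cabs D))).
  by rewrite lt_min eta0 divr_gt0// ltr_wpDr ?cabs_ge0.
move=> h; rewrite lt_min => /andP[h1 h2].
rewrite -[f (z + h) - f z](subrK (D * h)) (le_trans (cabsD _ _))//.
rewrite cabsM (le_trans (lerD (heta _ h1) (lexx _)))//.
rewrite -mulrDl mulrC -ler_pdivlMr ?ltW// ltr_wpDr ?cabs_ge0//.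
Qed.

Lemma ccontB f g z : ccont f z -> ccont g z -> ccont (fun w => f w - g w) z.
Proof.
move=> hf hg e e0; have e2 : 0 < e / 2 by rewrite divr_gt0.
have [a a0 ha] := hf _ e2; have [b b0 hb] := hg _ e2.
exists (Num.min a b); first by rewrite lt_min a0.
move=> h; rewrite lt_min => /andP[/ha h1 /hb h2].
have -> : f (z + h) - g (z + h) - (f z - g z) =
   (f (z + h) - f z) - (g (z + h) - g z) by ring.
by rewrite (le_trans (cabsB _ _))// (splitr e) lerD.
Qed.

Lemma cdiff_affine p q z0 z : cdiff (fun w => p + q * (w - z0)) z q.
Proof.
move=> e e0; exists 1 => // h _.
rewrite (_ : _ - _ - _ = 0) ?cabs0 ?mulr_ge0 ?cabs_ge0 ?ltW//.
by ring.
Qed.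

Definition path_cont (a b : R) (g : R -> R[i]) := forall x, a <= x <= b ->
  {for x, continuous (fun t => complex.Re (g t))} /\
  {for x, continuous (fun t => complex.Im (g t))}.

Lemma path_contB a b (g k : R -> R[i]) : path_cont a b g -> path_cont a b k ->
  path_cont a b (fun x => g x - k x).
Proof.
move=> hg hk x xab; have [g1 g2] := hg x xab; have [k1 k2] := hk x xab; split.
  rewrite (_ : (fun t => _) =
    (fun t => complex.Re (g t)) \- (fun t => complex.Re (k t))).
    exact: continuousB.
  by apply/funext => t /=; rewrite cReB.
rewrite (_ : (fun t => _) =
  (fun t => complex.Im (g t)) \- (fun t => complex.Im (k t))).
  exact: continuousB.
by apply/funext => t /=; rewrite cImB.
Qed.

Lemma path_cont_horiz a b y f : (forall x, a <= x <= b -> ccont f (Complex x y)) ->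
  path_cont a b (fun x => f (Complex x y)).
Proof.
move=> hf x xab; split; apply/cvgrPdist_le => e e0;
  have [eta eta0 heta] := hf x xab e e0;
  apply/nbhs_ballP; exists eta => // t ht;
  (have {}ht : `|x - t| < eta by exact: ht);
  (have := heta (Complex (t - x) 0); rewrite -[Complex (t - x) 0]/(((t - x)%:C)%C));
  rewrite cabs_real distrC => /(_ ht);
  (rewrite (_ : Complex x y + _ = Complex t y);
    last by apply: complex_ext; rewrite ?cReD ?cImD/=; ring);
  rewrite cabs_dist; apply: le_trans; rewrite -?cReB -?cImB.
  exact: Re_le_cabs.
exact: Im_le_cabs.
Qed.

Lemma cabs_imag (x : R) : cabs (Complex 0 x) = `|x|.
Proof. by rewrite /Normc.normc /= expr0n add0r sqrtr_sqr. Qed.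

Lemma path_cont_vert a b x f : (forall y, a <= y <= b -> ccont f (Complex x y)) ->
  path_cont a b (fun y => f (Complex x y)).
Proof.
move=> hf y xab; split; apply/cvgrPdist_le => e e0;
  have [eta eta0 heta] := hf y xab e e0;
  apply/nbhs_ballP; exists eta => // t ht;
  (have {}ht : `|y - t| < eta by exact: ht);
  (have := heta (Complex 0 (t - y)));
  rewrite cabs_imag distrC => /(_ ht);
  (rewrite (_ : Complex x y + _ = Complex x t);
    last by apply: complex_ext; rewrite ?cReD ?cImD/=; ring);
  rewrite cabs_dist; apply: le_trans; rewrite -?cReB -?cImB.
  exact: Re_le_cabs.
exact: Im_le_cabs.
Qed.

(** * Integrals along segments and around rectangles *)

Local Notation mu := (@lebesgue_measure R).

Definition cint (a b : R) (g : R -> R[i]) : R[i] :=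
  Complex (\int[mu]_(x in `[a, b]) complex.Re (g x))
          (\int[mu]_(x in `[a, b]) complex.Im (g x)).

Lemma itv_cont_integrable a b (u : R -> R) :
  (forall x, a <= x <= b -> {for x, continuous u}) ->
  mu.-integrable `[a, b] (EFin \o u).
Proof.
move=> hu; apply: continuous_compact_integrable; first exact: segment_compact.
apply: continuous_in_subspaceT => x; rewrite inE/= in_itv/=; exact: hu.
Qed.

Lemma path_cont_Re a b (g : R -> R[i]) : path_cont a b g ->
  mu.-integrable `[a, b] (EFin \o (fun x => complex.Re (g x))).
Proof. by move=> hg; apply: itv_cont_integrable => x /hg[]. Qed.
Lemma path_cont_Im a b (g : R -> R[i]) : path_cont a b g ->
  mu.-integrable `[a, b] (EFin \o (fun x => complex.Im (g x))).
Proof. by move=> hg; apply: itv_cont_integrable => x /hg[]. Qed.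

Lemma eq_cint a b (g k : R -> R[i]) : (forall x, a <= x <= b -> g x = k x) ->
  cint a b g = cint a b k.
Proof.
move=> gk; rewrite /cint; congr Complex; apply: eq_Rintegral => x;
  by rewrite inE/= in_itv/= => /gk ->.
Qed.

Lemma cintB a b (g k : R -> R[i]) : path_cont a b g -> path_cont a b k ->
  cint a b (fun x => g x - k x) = cint a b g - cint a b k.
Proof.
move=> hg hk; rewrite /cint [RHS]/GRing.add/=; congr Complex.
  rewrite -RintegralB//; [|exact: path_cont_Re..].
  by apply: eq_Rintegral => x _; rewrite cReB.
rewrite -RintegralB//; [|exact: path_cont_Im..].
by apply: eq_Rintegral => x _; rewrite cImB.
Qed.

Lemma cint_split a m b (g : R -> R[i]) : a <= m -> m <= b -> path_cont a b g ->
  cint a b g = cint a m g + cint m b g.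
Proof.
have key (u : R -> R) : a <= m -> m <= b ->
  mu.-integrable `[a, b] (EFin \o u) ->
  \int[mu]_(x in `[a, b]) u x = \int[mu]_(x in `[a, m]) u x + \int[mu]_(x in `[m, b]) u x.
  move=> am mb hu.
  have := @Rintegral_itvB R u (BLeft a) (BRight b) m hu.
  rewrite !bnd_simp => /(_ am mb) /eqP; rewrite subr_eq => /eqP ->.
  rewrite addrC; congr (_ + _); rewrite Rintegral_itv_obnd_cbnd//.
  apply: (integrableS _ _ _ hu) => // x; rewrite /= !in_itv/= => /andP[x1 x2].
  by rewrite x2 andbT (le_trans am)// ltW.
move=> am mb hg; rewrite /cint [RHS]/GRing.add/=.
by rewrite (key (fun x => complex.Re (g x)))// ?(key (fun x => complex.Im (g x)))//;
  [exact: path_cont_Im|exact: path_cont_Re].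
Qed.

Lemma Rint_cst a b (r : R) : a <= b -> \int[mu]_(x in `[a, b]) r = r * (b - a).
Proof.
move=> ab; rewrite Rintegral_cst//; congr (_ * _).
have := @lebesgue_measure_itv R `[a, b]; rewrite /= lte_fin => /(congr1 fine) /= h.
apply: (etrans h); case: ltP => // ba.
by have -> : a = b; [apply/le_anti; rewrite ab|rewrite subrr].
Qed.

Lemma cint_cst a b (c : R[i]) : a <= b -> cint a b (fun=> c) = ((b - a)%:C)%C * c.
Proof.
move=> ab; rewrite /cint !Rint_cst//; case: c => c1 c2 /=.
by rewrite [RHS]/GRing.mul/= !mul0r subr0 addr0 ![(b - a) * _]mulrC.
Qed.

Lemma Rint_bound a b (u : R -> R) (M : R) : a <= b ->
  mu.-integrable `[a, b] (EFin \o u) ->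
  (forall x, a <= x <= b -> `|u x| <= M) ->
  `|\int[mu]_(x in `[a, b]) u x| <= M * (b - a).
Proof.
move=> ab iu hM.
have ic (r : R) : mu.-integrable `[a, b] (EFin \o (fun=> r)).
  by apply: itv_cont_integrable => x _; exact: cst_continuous.
rewrite ler_norml -mulNr -!Rint_cst//; apply/andP; split; apply: le_Rintegral => //= x;
  rewrite in_itv/= => /hM; by rewrite ler_norml => /andP[].
Qed.

(** The factor 2 comes from bounding the real and imaginary parts separately; the later arguments
    are insensitive to it. *)
Lemma cint_bound a b (g : R -> R[i]) (M : R) : a <= b -> path_cont a b g ->
  (forall x, a <= x <= b -> cabs (g x) <= M) ->
  cabs (cint a b g) <= 2 * M * (b - a).
Proof.
move=> ab hg hM; rewrite (le_trans (cabs_le_ReIm _))//= -mulrA mulr_natl mulr2n.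
apply: lerD; apply: Rint_bound => //.
- exact: path_cont_Re.
- by move=> x /hM; apply: le_trans; exact: Re_le_cabs.
- exact: path_cont_Im.
- by move=> x /hM; apply: le_trans; exact: Im_le_cabs.
Qed.

Definition in_rect (a b c d : R) z :=
  (a <= complex.Re z <= b) && (c <= complex.Im z <= d).

Definition on_boundary (a b c d : R) z := in_rect a b c d z &&
  [|| complex.Re z == a, complex.Re z == b, complex.Im z == c | complex.Im z == d].

(** The counterclockwise contour integral, with opposite sides paired under one integral sign. *)
Definition rect_int f (a b c d : R) : R[i] :=
  cint a b (fun x => f (Complex x c) - f (Complex x d)) +
  'i%C * cint c d (fun y => f (Complex b y) - f (Complex a y)).

Lemma eq_rect_int f g a b c d : a <= b -> c <= d ->
  (forall z, on_boundary a b c d z -> f z = g z) ->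
  rect_int f a b c d = rect_int g a b c d.
Proof.
move=> ab cd fg; rewrite /rect_int; congr (_ + _ * _); apply: eq_cint => t ht.
  by congr (_ - _); apply: fg; rewrite /on_boundary /in_rect/= ht ?lexx ?cd ?eqxx ?orbT.
by congr (_ - _); apply: fg; rewrite /on_boundary /in_rect/= ht ?lexx ?ab ?eqxx ?orbT.
Qed.

Lemma rect_int_horiz f a b c d y : a <= b -> c <= y <= d ->
  (forall z, on_boundary a b c d z -> ccont f z) ->
  path_cont a b (fun x => f (Complex x c)) /\ path_cont a b (fun x => f (Complex x d)).
Proof.
move=> ab /andP[cy yd] hf; have cd := le_trans cy yd.
split; apply: path_cont_horiz => x xab; apply: hf;
  by rewrite /on_boundary /in_rect/= xab ?lexx ?cd ?eqxx ?orbT.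
Qed.

Lemma rect_int_vert f a b c d x : c <= d -> a <= x <= b ->
  (forall z, on_boundary a b c d z -> ccont f z) ->
  path_cont c d (fun y => f (Complex a y)) /\ path_cont c d (fun y => f (Complex b y)).
Proof.
move=> ab /andP[cy yd] hf; have cd := le_trans cy yd.
split; apply: path_cont_vert => y xab; apply: hf;
  by rewrite /on_boundary /in_rect/= xab ?lexx ?cd ?eqxx ?orbT.
Qed.

Lemma rect_intB f g a b c d : a <= b -> c <= d ->
  (forall z, on_boundary a b c d z -> ccont f z) ->
  (forall z, on_boundary a b c d z -> ccont g z) ->
  rect_int (fun z => f z - g z) a b c d = rect_int f a b c d - rect_int g a b c d.
Proof.
move=> ab cd hf hg.
have aab : a <= a <= b by rewrite lexx.
have ccd : c <= c <= d by rewrite lexx.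
have [f1 f2] := rect_int_horiz ab ccd hf.
have [f3 f4] := rect_int_vert cd aab hf.
have [g1 g2] := rect_int_horiz ab ccd hg.
have [g3 g4] := rect_int_vert cd aab hg.
rewrite /rect_int !cintB//; [ring|exact: path_contB..].
Qed.

Lemma rect_int_splitx f a m b c d : a <= m -> m <= b -> c <= d ->
  (forall z, on_boundary a m c d z -> ccont f z) ->
  (forall z, on_boundary m b c d z -> ccont f z) ->
  rect_int f a b c d = rect_int f a m c d + rect_int f m b c d.
Proof.
move=> am mb cd h1 h2; have ab := le_trans am mb.
have ccd : c <= c <= d by rewrite lexx.
have aam : a <= a <= m by rewrite lexx.
have mmb : m <= m <= b by rewrite lexx.
have [p1 p2] := rect_int_horiz am ccd h1.
have [p3 p4] := rect_int_vert cd aam h1.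
have [q1 q2] := rect_int_horiz mb ccd h2.
have [q3 q4] := rect_int_vert cd mmb h2.
have P (y : R) : y = c \/ y = d -> path_cont a b (fun x => f (Complex x y)).
  move=> hy; apply: path_cont_horiz => x /andP[x1 x2].
  have [xm|mx] := leP x m; [apply: h1|apply: h2];
    rewrite /on_boundary /in_rect/= ?x1 ?x2 ?xm ?(ltW mx)/=;
    by case: hy => ->; rewrite ?lexx ?cd ?eqxx ?orbT.
have Pc := P c (or_introl erefl); have Pd := P d (or_intror erefl).
rewrite /rect_int !cintB// (cint_split am mb Pc) (cint_split am mb Pd).
ring.
Qed.

Lemma rect_int_splity f a b c m d : a <= b -> c <= m -> m <= d ->
  (forall z, on_boundary a b c m z -> ccont f z) ->
  (forall z, on_boundary a b m d z -> ccont f z) ->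
  rect_int f a b c d = rect_int f a b c m + rect_int f a b m d.
Proof.
move=> ab cm md h1 h2; have cd := le_trans cm md.
have aab : a <= a <= b by rewrite lexx.
have ccm : c <= c <= m by rewrite lexx.
have mmd : m <= m <= d by rewrite lexx.
have [p1 p2] := rect_int_horiz ab ccm h1.
have [p3 p4] := rect_int_vert cm aab h1.
have [q1 q2] := rect_int_horiz ab mmd h2.
have [q3 q4] := rect_int_vert md aab h2.
have P (x : R) : x = a \/ x = b -> path_cont c d (fun y => f (Complex x y)).
  move=> hx; apply: path_cont_vert => y /andP[x1 x2].
  have [xm|mx] := leP y m; [apply: h1|apply: h2];
    rewrite /on_boundary /in_rect/= ?x1 ?x2 ?xm ?(ltW mx)/=;
    by case: hx => ->; rewrite ?lexx ?ab ?eqxx ?orbT.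
have Pa := P a (or_introl erefl); have Pb := P b (or_intror erefl).
rewrite /rect_int !cintB// (cint_split cm md Pa) (cint_split cm md Pb).
ring.
Qed.

Lemma cabs_i : cabs 'i%C = 1.
Proof. by rewrite cabs_imag normr1. Qed.

Lemma rect_int_bound f a b c d M : a <= b -> c <= d ->
  (forall z, on_boundary a b c d z -> ccont f z) ->
  (forall z, on_boundary a b c d z -> cabs (f z) <= M) ->
  cabs (rect_int f a b c d) <= 4 * M * ((b - a) + (d - c)).
Proof.
move=> ab cd hf hM.
have aab : a <= a <= b by rewrite lexx.
have ccd : c <= c <= d by rewrite lexx.
have [f1 f2] := rect_int_horiz ab ccd hf.
have [f3 f4] := rect_int_vert cd aab hf.
rewrite /rect_int (le_trans (cabsD _ _))// cabsM cabs_i mul1r mulrDr.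
have M2 : 4 * M = 2 * (M + M) by ring.
rewrite M2; apply: lerD; apply: cint_bound => //; try exact: path_contB.
  move=> x xab; rewrite (le_trans (cabsB _ _))// lerD// hM//;
    by rewrite /on_boundary /in_rect/= xab ?lexx ?cd ?eqxx ?orbT.
move=> y yab; rewrite (le_trans (cabsB _ _))// lerD// hM//;
  by rewrite /on_boundary /in_rect/= yab ?lexx ?ab ?eqxx ?orbT.
Qed.

Lemma rect_int_affine p q z0 a b c d : a <= b -> c <= d ->
  rect_int (fun w => p + q * (w - z0)) a b c d = 0.
Proof.
move=> ab cd; rewrite /rect_int.
rewrite (@eq_cint a b _ (fun=> q * Complex 0 (c - d))); last first.
  move=> x _; transitivity (q * (Complex x c - Complex x d)); first by ring.
  by congr (_ * _); rewrite /GRing.add/= subrr.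
rewrite (@eq_cint c d _ (fun=> q * ((b - a)%:C)%C)); last first.
  move=> y _; transitivity (q * (Complex b y - Complex a y)); first by ring.
  by congr (_ * _); rewrite /GRing.add/= subrr.
rewrite !cint_cst//.
rewrite (_ : Complex 0 (c - d) = - ('i%C * ((d - c)%:C)%C)); first by ring.
by apply: complex_ext => /=; ring.
Qed.

(** * Goursat's theorem by bisection, and its version with a removable puncture *)

Definition quad_step f (q : R * R * R * R) : R * R * R * R :=
  let: (a, b, c, d) := q in
  let m := (a + b) / 2 in let k := (c + d) / 2 in
  let M := cabs (rect_int f a b c d) / 4 in
  if M <= cabs (rect_int f a m c k) then (a, m, c, k) else
  if M <= cabs (rect_int f m b c k) then (m, b, c, k) else
  if M <= cabs (rect_int f a m k d) then (a, m, k, d) else (m, b, k, d).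

Lemma on_boundary_in a b c d z : on_boundary a b c d z -> in_rect a b c d z.
Proof. by case/andP. Qed.

Lemma in_rect_sub a b c d a' b' c' d' z : a <= a' -> b' <= b -> c <= c' -> d' <= d ->
  in_rect a' b' c' d' z -> in_rect a b c d z.
Proof.
move=> h1 h2 h3 h4 /andP[/andP[z1 z2] /andP[z3 z4]].
by rewrite /in_rect (le_trans h1 z1) (le_trans z2 h2) (le_trans h3 z3) (le_trans z4 h4).
Qed.

(** If three quarters stay below a quarter of the total, the triangle inequality forces the fourth
    above it; this justifies the default branch of [quad_step]. *)
Lemma quad_stepP f a b c d : a <= b -> c <= d ->
  (forall z, in_rect a b c d z -> ccont f z) ->
  let: (a', b', c', d') := quad_step f (a, b, c, d) in
  [/\ a <= a', a' <= b' & b' <= b] /\ [/\ c <= c', c' <= d' & d' <= d] /\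
  [/\ b' - a' = (b - a) / 2, d' - c' = (d - c) / 2 &
    cabs (rect_int f a b c d) / 4 <= cabs (rect_int f a' b' c' d')].
Proof.
move=> ab cd hf; rewrite /quad_step.
set m := (a + b) / 2; set k := (c + d) / 2.
have am : a <= m by rewrite /m; lra.
have mb : m <= b by rewrite /m; lra.
have ck : c <= k by rewrite /k; lra.
have kd : k <= d by rewrite /k; lra.
have h2 : m - a = (b - a) / 2 by rewrite /m; lra.
have h3 : b - m = (b - a) / 2 by rewrite /m; lra.
have h4 : k - c = (d - c) / 2 by rewrite /k; lra.
have h5 : d - k = (d - c) / 2 by rewrite /k; lra.
have hc a' b' c' d' : a <= a' -> b' <= b -> c <= c' -> d' <= d ->
    forall z, on_boundary a' b' c' d' z -> ccont f z.
  move=> ? ? ? ? z /on_boundary_in hz; apply: hf; exact: in_rect_sub hz.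
have e1 : rect_int f a b c d = (rect_int f a m c k + rect_int f m b c k) +
    (rect_int f a m k d + rect_int f m b k d).
  rewrite (rect_int_splity ab ck kd) ?(rect_int_splitx am mb ck) ?(rect_int_splitx am mb kd)//;
  by apply: hc.
case: ifPn => [i1|]; first by do !split.
rewrite -ltNge => i1; case: ifPn => [i2|]; first by do !split.
rewrite -ltNge => i2; case: ifPn => [i3|]; first by do !split.
rewrite -ltNge => i3; do !split => //.
rewrite leNgt; apply/negP => i4.
have := cabsD (rect_int f a m c k + rect_int f m b c k)
  (rect_int f a m k d + rect_int f m b k d).
have := cabsD (rect_int f a m c k) (rect_int f m b c k).
have := cabsD (rect_int f a m k d) (rect_int f m b k d).
rewrite -e1; move: i1 i2 i3 i4.
lra.
Qed.

(** The nested quarters meet in a point where f is differentiable; near it f is affine up to a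
    relative error e, and affine functions integrate to 0. *)
Lemma goursat f a b c d : a <= b -> c <= d ->
  (forall z, in_rect a b c d z -> exists D, cdiff f z D) ->
  rect_int f a b c d = 0.
Proof.
move=> ab cd hf.
have hfc z : in_rect a b c d z -> ccont f z by move=> /hf[D]; exact: cdiff_cont.
pose q n := iter n (quad_step f) (a, b, c, d).
pose A n := (q n).1.1.1; pose B n := (q n).1.1.2.
pose C n := (q n).1.2; pose E n := (q n).2.
have inv n : [/\ [/\ a <= A n, A n <= B n & B n <= b], [/\ c <= C n, C n <= E n & E n <= d],
   B n - A n = (b - a) / 2 ^+ n, E n - C n = (d - c) / 2 ^+ n &
   cabs (rect_int f a b c d) / 4 ^+ n <= cabs (rect_int f (A n) (B n) (C n) (E n))].
  elim: n => [|n [[i1 i2 i3] [i4 i5 i6] i7 i8 i9]].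
    by rewrite /A /B /C /E /= !expr0 !divr1.
  have hfc' z : in_rect (A n) (B n) (C n) (E n) z -> ccont f z.
    by move=> hz; apply: hfc; exact: in_rect_sub hz.
  have := quad_stepP i2 i5 hfc'.
  have -> : (A n, B n, C n, E n) = q n by rewrite /A /B /C /E; case: (q n) => [[[]]].
  rewrite /A /B /C /E -/(q n.+1) (_ : quad_step f (q n) = q n.+1)//.
  case: (q n.+1) => [[[a' b'] c'] d'] /= [[j1 j2 j3] [[j4 j5 j6] [j7 j8 j9]]].
  split.
  - by split => //; [exact: le_trans j1|exact: le_trans i3].
  - by split => //; [exact: le_trans j4|exact: le_trans i6].
  - by rewrite j7 i7 exprSr invfM mulrA.
  - by rewrite j8 i8 exprSr invfM mulrA.
  - by apply: le_trans j9; rewrite exprSr invfM mulrA ler_wpM2r// invr_ge0.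
have step n : [/\ A n <= A n.+1, B n.+1 <= B n, C n <= C n.+1 & E n.+1 <= E n].
  have [[i1 i2 i3] [i4 i5 i6] _ _ _] := inv n.
  have hfc' z : in_rect (A n) (B n) (C n) (E n) z -> ccont f z.
    by move=> hz; apply: hfc; exact: in_rect_sub hz.
  have := quad_stepP i2 i5 hfc'.
  have -> : (A n, B n, C n, E n) = q n by rewrite /A /B /C /E; case: (q n) => [[[]]].
  rewrite (_ : quad_step f (q n) = q n.+1)// /A /B /C /E.
  by case: (q n.+1) => [[[a' b'] c'] d'] /= [[j1 j2 j3] [[j4 j5 j6] _]].
have monoA n m : (n <= m)%N -> A n <= A m.
  elim: m => [|m IH]; first by rewrite leqn0 => /eqP ->.
  rewrite leq_eqVlt => /predU1P[->//|]; rewrite ltnS => /IH h.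
  by have [+ _ _ _] := step m; exact: le_trans.
have monoB n m : (n <= m)%N -> B m <= B n.
  elim: m => [|m IH]; first by rewrite leqn0 => /eqP ->.
  rewrite leq_eqVlt => /predU1P[->//|]; rewrite ltnS => /IH h.
  by have [_ h2 _ _] := step m; exact: le_trans h.
have monoC n m : (n <= m)%N -> C n <= C m.
  elim: m => [|m IH]; first by rewrite leqn0 => /eqP ->.
  rewrite leq_eqVlt => /predU1P[->//|]; rewrite ltnS => /IH h.
  by have [_ _ + _] := step m; exact: le_trans.
have monoE n m : (n <= m)%N -> E m <= E n.
  elim: m => [|m IH]; first by rewrite leqn0 => /eqP ->.
  rewrite leq_eqVlt => /predU1P[->//|]; rewrite ltnS => /IH h.
  by have [_ _ _ h2] := step m; exact: le_trans h.
have AB n m : A n <= B m.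
  apply: (le_trans (monoA _ _ (leq_maxl n m))); have [[_ + _] _ _ _ _] := inv (maxn n m).
  by move=> /le_trans; apply; apply: monoB; exact: leq_maxr.
have CE n m : C n <= E m.
  apply: (le_trans (monoC _ _ (leq_maxl n m))); have [_ [_ + _] _ _ _] := inv (maxn n m).
  by move=> /le_trans; apply; apply: monoE; exact: leq_maxr.
have hsA : has_sup (range A).
  by split; [exists (A 0%N), 0%N|exists (B 0%N) => _ [n _ <-]].
have hsC : has_sup (range C).
  by split; [exists (C 0%N), 0%N|exists (E 0%N) => _ [n _ <-]].
pose x := sup (range A); pose y := sup (range C).
have xn n : A n <= x <= B n.
  apply/andP; split; first by apply: ub_le_sup; [exact: hsA.2|exists n].
  by apply: ge_sup; [exact: hsA.1|move=> _ [m _ <-]].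
have yn n : C n <= y <= E n.
  apply/andP; split; first by apply: ub_le_sup; [exact: hsC.2|exists n].
  by apply: ge_sup; [exact: hsC.1|move=> _ [m _ <-]].
pose z0 := Complex x y.
have [D hD] : exists D, cdiff f z0 D.
  apply: hf; rewrite /in_rect/=; have := xn 0%N; have := yn 0%N.
  by rewrite /A /B /C /E /= => -> ->.
pose s := (b - a) + (d - c).
have s0 : 0 <= s by rewrite /s; lra.
(* A rectangle of half-perimeter s / 2^n on which the affine approximation has relative error e
   contributes at most 4 e (s / 2^n)^2; the factor 4^n lost in the bisection restores s^2. *)
suff key e : 0 < e -> cabs (rect_int f a b c d) <= e * (4 * (s * s)).
  apply/eqP; rewrite -[_ == 0]negbK -cabs_gt0 -leNgt; apply/ler_addgt0Pl => e e0.
  have s1 : 0 < 4 * (s * s) + 1 by have := mulr_ge0 s0 s0; lra.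
  apply: (le_trans (key (e / (4 * (s * s) + 1)) _)); first exact: divr_gt0.
  rewrite addr0 mulrAC ler_pdivrMr// ler_pM2l//; lra.
move=> e0; have [eta eta0 heta] := hD e e0.
have [n hn] : exists n, s / 2 ^+ n < eta.
  have [n _ hn] := near_infty_natSinv_expn_lt (PosNum (divr_gt0 eta0 (ltr_pwDr ltr01 s0))).
  exists n; have := hn n (leqnn n) => /=.
  rewrite ltr_pdivlMr ?ltr_pwDr//; apply: le_lt_trans.
  rewrite mulrC mul1r ler_wpM2l ?invr_ge0 ?exprn_ge0//; lra.
have [[i1 i2 i3] [i4 i5 i6] i7 i8 i9] := inv n.
pose aff w := f z0 + D * (w - z0).
have hin z : on_boundary (A n) (B n) (C n) (E n) z -> ccont f z.
  by move=> /on_boundary_in hz; apply: hfc; exact: in_rect_sub hz.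
have haff z : ccont aff z by apply: cdiff_cont; exact: cdiff_affine.
have e1 : rect_int f (A n) (B n) (C n) (E n) =
   rect_int (fun w => f w - aff w) (A n) (B n) (C n) (E n).
  by rewrite rect_intB// /aff rect_int_affine// subr0.
have sn : s / 2 ^+ n = (B n - A n) + (E n - C n) by rewrite i7 i8 -mulrDl.
have bd : cabs (rect_int f (A n) (B n) (C n) (E n)) <=
    4 * (e * (s / 2 ^+ n)) * ((B n - A n) + (E n - C n)).
  rewrite e1; apply: rect_int_bound => //.
    by move=> z hz; apply: ccontB => //; exact: hin.
  move=> z /on_boundary_in /andP[/andP[z1 z2] /andP[z3 z4]].
  have hz : cabs (z - z0) <= s / 2 ^+ n.
    rewrite (le_trans (cabs_le_ReIm _))// cReB cImB /= sn.
    have /andP[x1 x2] := xn n; have /andP[y1 y2] := yn n.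
    apply: lerD; rewrite ler_norml; lra.
  have := heta (z - z0); rewrite addrCA subrr addr0 => /(_ (le_lt_trans hz hn)).
  rewrite /aff opprD addrA => /le_trans; apply.
  by rewrite ler_pM2l.
move: (le_trans i9 bd); rewrite -sn ler_pdivrMr ?exprn_gt0//.
move=> /le_trans; apply; rewrite le_eqVlt; apply/orP; left; apply/eqP.
have -> : (4 : R) ^+ n = 2 ^+ n * 2 ^+ n.
  by rewrite -exprMn; congr (_ ^+ _); ring.
by field; rewrite expf_neq0.
Qed.

(** Four rectangles around the puncture are removed by [goursat]; what remains is the boundary of a
    square of half-side e, where f is bounded, so the integral is O(e). *)
Lemma goursat_punctured f a b c d x1 y1 M r : a < x1 -> x1 < b -> c < y1 -> y1 < d ->
  (forall z, in_rect a b c d z -> z != Complex x1 y1 -> exists D, cdiff f z D) ->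
  0 < r -> (forall h, 0 < cabs h < r -> cabs (f (Complex x1 y1 + h)) <= M) ->
  rect_int f a b c d = 0.
Proof.
move=> ax xb cy yd hf r0 hM.
have hfc z : in_rect a b c d z -> z != Complex x1 y1 -> ccont f z.
  by move=> h1 h2; have [D] := hf _ h1 h2; exact: cdiff_cont.
suff key e : 0 < e -> e < r / 2 -> e < x1 - a -> e < b - x1 -> e < y1 - c ->
    e < d - y1 -> cabs (rect_int f a b c d) <= e * (16 * M).
  have M0 : 0 <= M.
    apply: (le_trans (cabs_ge0 _)); apply: (hM ((r / 2)%:C)%C).
    by rewrite cabs_real ger0_norm; lra.
  apply/eqP; rewrite -[_ == 0]negbK -cabs_gt0 -leNgt; apply/ler_addgt0Pl => e e0.
  rewrite addr0.
  pose e' := Num.min (e / (16 * M + 1)) (Num.min (r / 3) (Num.min ((x1 - a) / 2)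
    (Num.min ((b - x1) / 2) (Num.min ((y1 - c) / 2) ((d - y1) / 2))))).
  have e'0 : 0 < e' by rewrite /e' !lt_min divr_gt0 ?ltr_wpDl//; lra.
  apply: (le_trans (key e' e'0 _ _ _ _ _)).
  - by rewrite /e' !gt_min; apply/orP; right; apply/orP; left; lra.
  - by rewrite /e' !gt_min; do 2 (apply/orP; right); apply/orP; left; lra.
  - by rewrite /e' !gt_min; do 3 (apply/orP; right); apply/orP; left; lra.
  - by rewrite /e' !gt_min; do 4 (apply/orP; right); apply/orP; left; lra.
  - by rewrite /e' !gt_min; do 5 (apply/orP; right); lra.
  have : e' <= e / (16 * M + 1) by rewrite /e' ge_min lexx.
  rewrite ler_pdivlMr; last lra.
  by apply: le_trans; rewrite ler_pM2l//; lra.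
move=> e0 er ea eb ec ed.
have nz w x y : (w = complex.Re x - x1 \/ w = complex.Im x - y1) -> w != 0 ->
   y = Complex x1 y1 -> x != y.
  by move=> hw w0 ->; apply: contraNneq w0 => xy; case: hw => ->; rewrite xy/= subrr.
have g1 : rect_int f a (x1 - e) c d = 0.
  apply: goursat; [lra|lra|] => z hz; apply: hf.
    by apply: in_rect_sub hz => //; lra.
  by apply: (nz _ _ _ (or_introl erefl)) => //; move: hz => /andP[/andP[z1 z2] _]; lra.
have g2 : rect_int f (x1 + e) b c d = 0.
  apply: goursat; [lra|lra|] => z hz; apply: hf.
    by apply: in_rect_sub hz => //; lra.
  by apply: (nz _ _ _ (or_introl erefl)) => //; move: hz => /andP[/andP[z1 z2] _]; lra.
have g3 : rect_int f (x1 - e) (x1 + e) c (y1 - e) = 0.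
  apply: goursat; [lra|lra|] => z hz; apply: hf.
    by apply: in_rect_sub hz => //; lra.
  by apply: (nz _ _ _ (or_intror erefl)) => //; move: hz => /andP[_ /andP[z1 z2]]; lra.
have g4 : rect_int f (x1 - e) (x1 + e) (y1 + e) d = 0.
  apply: goursat; [lra|lra|] => z hz; apply: hf.
    by apply: in_rect_sub hz => //; lra.
  by apply: (nz _ _ _ (or_intror erefl)) => //; move: hz => /andP[_ /andP[z1 z2]]; lra.
have bc a' b' c' d' z : a <= a' -> b' <= b -> c <= c' -> d' <= d ->
  a' != x1 -> b' != x1 -> c' != y1 -> d' != y1 ->
  on_boundary a' b' c' d' z -> ccont f z.
  move=> ? ? ? ? n1 n2 n3 n4 /andP[hz hz2]; apply: hfc; first exact: in_rect_sub hz.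
  by case/or4P: hz2 => /eqP hz2; [apply: (nz _ _ _ (or_introl erefl)) => //..|
     apply: (nz _ _ _ (or_intror erefl)) => //|apply: (nz _ _ _ (or_intror erefl)) => //];
     rewrite hz2 subr_eq0.
have m1 : rect_int f a b c d = rect_int f (x1 - e) (x1 + e) (y1 - e) (y1 + e).
  rewrite (@rect_int_splitx f a (x1 - e)); [|lra|lra|lra| |]; last 2 first.
  - by move=> z; apply: bc; lra.
  - by move=> z; apply: bc; lra.
  rewrite g1 add0r (@rect_int_splitx f (x1 - e) (x1 + e)); [|lra|lra|lra| |]; last 2 first.
  - by move=> z; apply: bc; lra.
  - by move=> z; apply: bc; lra.
  rewrite g2 addr0 (@rect_int_splity f _ _ c (y1 - e)); [|lra|lra|lra| |]; last 2 first.
  - by move=> z; apply: bc; lra.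
  - by move=> z; apply: bc; lra.
  rewrite g3 add0r (@rect_int_splity f _ _ (y1 - e) (y1 + e)); [|lra|lra|lra| |]; last 2 first.
  - by move=> z; apply: bc; lra.
  - by move=> z; apply: bc; lra.
  by rewrite g4 addr0.
rewrite m1.
have -> : e * (16 * M) = 4 * M * ((x1 + e - (x1 - e)) + (y1 + e - (y1 - e))) by ring.
apply: rect_int_bound; [lra|lra| |].
  by move=> z; apply: bc; lra.
move=> z /andP[/andP[/andP[z1 z2] /andP[z3 z4]] hz].
have -> : z = Complex x1 y1 + (z - Complex x1 y1) by rewrite addrCA subrr addr0.
apply: hM; rewrite cabs_gt0 subr_eq0; apply/andP; split.
  by case/or4P: hz => /eqP hz; [apply: (nz _ _ _ (or_introl erefl)) => //..|
     apply: (nz _ _ _ (or_intror erefl)) => //|apply: (nz _ _ _ (or_intror erefl)) => //];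
     rewrite hz; lra.
apply: (le_lt_trans (cabs_le_ReIm _)); rewrite cReB cImB/=.
have : `|complex.Re z - x1| <= e by rewrite ler_norml; lra.
have : `|complex.Im z - y1| <= e by rewrite ler_norml; lra.
lra.
Qed.

(** * Cauchy's estimate and the identity theorem *)

Lemma holo_eq_near f g z (r : R) : 0 < r -> (forall h, cabs h < r -> f (z + h) = g (z + h)) ->
  holomorphic_at f z -> holomorphic_at g z.
Proof.
move=> r0 fg /holoP[D hD]; apply/holoP; exists D => e /hD[eta eta0 heta].
exists (Num.min r eta); first by rewrite lt_min r0.
move=> h; rewrite lt_min => /andP[h1 h2].
rewrite -fg// (_ : g z = f z); first exact: heta.
by have := fg 0; rewrite cabs0 addr0 => ->.
Qed.

Lemma holo_rect_bounded f a b c d : a <= b -> c <= d ->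
  (forall z, in_rect a b c d z -> holomorphic_at f z) ->
  exists2 M : R, 0 <= M & forall z, on_boundary a b c d z -> cabs (f z) <= M.
Proof.
move=> ab cd hf.
have hc z : in_rect a b c d z -> ccont f z.
  by move=> /hf /holoP[D]; exact: cdiff_cont.
have key (p q : R) (g : R -> R[i]) : p <= q -> path_cont p q g ->
    exists M, forall x, p <= x <= q -> cabs (g x) <= M.
  move=> pq hg.
  have cw (u : R -> R) : (forall x, p <= x <= q -> {for x, continuous u}) ->
      {within `[p, q], continuous (fun x => `|u x|)}.
    move=> hu; apply: continuous_in_subspaceT => x; rewrite inE/= in_itv/= => /hu hx.
    by apply: continuous_comp => //; exact: norm_continuous.
  have [x1 _ h1] := EVT_max pq (cw _ (fun x hx => (hg x hx).1)).
  have [x2 _ h2] := EVT_max pq (cw _ (fun x hx => (hg x hx).2)).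
  exists (`|complex.Re (g x1)| + `|complex.Im (g x2)|) => x hx.
  rewrite (le_trans (cabs_le_ReIm _))// lerD//; first by apply: h1; rewrite in_itv.
  by apply: h2; rewrite in_itv.
have [M1 h1] := key a b _ ab (path_cont_horiz (fun x (hx : a <= x <= b) =>
   hc (Complex x c) (introT andP (conj hx (introT andP (conj (lexx c) cd)))))).
have [M2 h2] := key a b _ ab (path_cont_horiz (fun x (hx : a <= x <= b) =>
   hc (Complex x d) (introT andP (conj hx (introT andP (conj cd (lexx d))))))).
have [M3 h3] := key c d _ cd (path_cont_vert (fun x (hx : c <= x <= d) =>
   hc (Complex a x) (introT andP (conj (introT andP (conj (lexx a) ab)) hx)))).
have [M4 h4] := key c d _ cd (path_cont_vert (fun x (hx : c <= x <= d) =>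
   hc (Complex b x) (introT andP (conj (introT andP (conj ab (lexx b))) hx)))).
exists (`|M1| + `|M2| + `|M3| + `|M4|); first by rewrite !addr_ge0.
have n1 := normr_ge0 M1; have n2 := normr_ge0 M2.
have n3 := normr_ge0 M3; have n4 := normr_ge0 M4.
have l1 := ler_norm M1; have l2 := ler_norm M2.
have l3 := ler_norm M3; have l4 := ler_norm M4.
move=> [x y] /andP[/andP[/= hx hy]] /or4P[] /eqP e.
- by have := h3 y hy; rewrite -e; lra.
- by have := h4 y hy; rewrite -e; lra.
- by have := h1 x hx; rewrite -e; lra.
- by have := h2 x hx; rewrite -e; lra.
Qed.

Lemma rect_intZ (k : R[i]) f a b c d : a <= b -> c <= d ->
  (forall z, on_boundary a b c d z -> ccont f z) ->
  rect_int (fun w => k * f w) a b c d = k * rect_int f a b c d.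
Proof.
move=> ab cd hf.
have aab : a <= a <= b by rewrite lexx.
have ccd : c <= c <= d by rewrite lexx.
have [f1 f2] := rect_int_horiz ab ccd hf.
have [f3 f4] := rect_int_vert cd aab hf.
have key p q (g : R -> R[i]) : path_cont p q g -> cint p q (fun x => k * g x) = k * cint p q g.
  move=> hg; have i1 := path_cont_Re hg; have i2 := path_cont_Im hg.
  have z1 r : mu.-integrable `[p, q] (EFin \o (fun x => r * complex.Re (g x))).
    apply: itv_cont_integrable => x /hg[hx _].
    by apply: continuousM => //; exact: cst_continuous.
  have z2 r : mu.-integrable `[p, q] (EFin \o (fun x => r * complex.Im (g x))).
    apply: itv_cont_integrable => x /hg[_ hx].
    by apply: continuousM => //; exact: cst_continuous.
  apply: complex_ext; rewrite ?cReM ?cImM /cint/=.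
    rewrite -!RintegralZl// -RintegralB//.
    by apply: eq_Rintegral => x _; rewrite cReM.
  rewrite -!RintegralZl// -RintegralD//.
  by apply: eq_Rintegral => x _; rewrite cImM.
rewrite /rect_int mulrDr mulrCA -!key; [|exact: path_contB..].
by congr (_ + _ * _); apply: eq_cint => t _; rewrite mulrBr.
Qed.

Lemma Rint_ge_cst a b (u : R -> R) (m : R) : a <= b ->
  mu.-integrable `[a, b] (EFin \o u) ->
  (forall x, a <= x <= b -> m <= u x) -> m * (b - a) <= \int[mu]_(x in `[a, b]) u x.
Proof.
move=> ab iu hm; rewrite -Rint_cst//; apply: le_Rintegral => //=.
by apply: itv_cont_integrable => x _; exact: cst_continuous.
Qed.

(** Stands in for the value 2 pi i: all four sides contribute nonnegative imaginary parts, and the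
    right side a positive one. *)
Lemma winding_pos a b c d x1 y1 : a < x1 -> x1 < b -> c < y1 -> y1 < d ->
  0 < complex.Im (rect_int (fun z => (z - Complex x1 y1)^-1) a b c d).
Proof.
move=> ax xb cy yd.
have ab : a <= b by lra. have cd : c <= d by lra.
have hc z : on_boundary a b c d z -> ccont (fun z => (z - Complex x1 y1)^-1) z.
  move=> /andP[_ hz]; have : holomorphic_at (fun z => (z - Complex x1 y1)^-1) z.
    apply: holo_inv_subr; apply/eqP => zE; move: hz; rewrite zE/= => /or4P[] /eqP; lra.
  by move=> /holoP[D]; exact: cdiff_cont.
have aab : a <= a <= b by rewrite lexx.
have ccd : c <= c <= d by rewrite lexx.
have [f1 f2] := rect_int_horiz ab ccd hc.
have [f3 f4] := rect_int_vert cd aab hc.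
rewrite /rect_int cImD cImM/= mul0r add0r mul1r.
apply: ltr_wpDl.
  rewrite -[leLHS](mul0r (b - a)); apply: Rint_ge_cst => //.
    by have := path_cont_Im (path_contB f1 f2).
  move=> x hx.
  rewrite opprK -mulNr; apply: addr_ge0; apply: mulr_ge0;
    by [lra|rewrite invr_ge0 addr_ge0 ?sqr_ge0].
(* A lower bound for the contribution of the right side: vertical offsets from [y1] are at most d -
   c. *)
pose m := (b - x1) / ((b - x1) ^+ 2 + ((d - c) ^+ 2)).
have m0 : 0 < m.
  by rewrite divr_gt0//; [lra|rewrite ltr_pwDl// ?exprn_gt0 ?sqr_ge0//; lra].
apply: (@lt_le_trans _ _ (m * (d - c))); first by rewrite mulr_gt0//; lra.
apply: Rint_ge_cst => //; first by have := path_cont_Re (path_contB f4 f3).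
move=> y hy.
rewrite -[leLHS]addr0; apply: lerD; last first.
  by rewrite -mulNr; apply: mulr_ge0; [lra|rewrite invr_ge0 addr_ge0 ?sqr_ge0].
rewrite /m ler_pM2l; last lra.
rewrite lef_pV2 ?posrE.
- rewrite lerD2l -subr_ge0 subr_sqr mulr_ge0//; lra.
- by rewrite ltr_pwDl// ?exprn_gt0 ?sqr_ge0//; lra.
- by rewrite ltr_pwDl// ?exprn_gt0 ?sqr_ge0//; lra.
Qed.

(** The quotient (f z - f z1) / (z - z1) is bounded near z1, so the punctured theorem gives f z1
    times the winding integral as the integral of f z / (z - z1). The constant K depends on the
    rectangle and the point only, which allows the use of a whole sequence of functions in
    [identity_square]. *)
Lemma cauchy_estimate a b c d x1 y1 : a < x1 -> x1 < b -> c < y1 -> y1 < d ->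
  exists2 K : R, 0 <= K & forall f M,
    (forall z, in_rect a b c d z -> holomorphic_at f z) ->
    (forall z, on_boundary a b c d z -> cabs (f z) <= M) ->
    cabs (f (Complex x1 y1)) <= K * M.
Proof.
move=> ax xb cy yd.
have ab : a <= b by lra. have cd : c <= d by lra.
pose z1 := Complex x1 y1.
have bdz z : on_boundary a b c d z -> z != z1.
  move=> /andP[_ hz]; apply/eqP => zE; move: hz; rewrite zE/= => /or4P[] /eqP; lra.
have hi z : z != z1 -> holomorphic_at (fun w => (w - z1)^-1) z by exact: holo_inv_subr.
have hW := winding_pos ax xb cy yd; rewrite -/z1 in hW.
set W := rect_int _ a b c d in hW.
have hir z : in_rect a b c d z -> True by [].
have [Mi Mi0 hMi] : exists2 M : R, 0 <= M &
    forall z, on_boundary a b c d z -> cabs ((z - z1)^-1) <= M.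
  pose m := Num.min (Num.min (x1 - a) (b - x1)) (Num.min (y1 - c) (d - y1)).
  have m0 : 0 < m by rewrite /m !lt_min; apply/andP; split; apply/andP; split; lra.
  exists m^-1 => [|z /andP[hz hz2]]; first by rewrite invr_ge0 ltW.
  rewrite cabsV lef_pV2 ?posrE ?cabs_gt0 ?subr_eq0 ?bdz// /on_boundary ?hz//.
  have r1 := Re_le_cabs (z - z1); have r2 := Im_le_cabs (z - z1).
  rewrite cReB/= in r1; rewrite cImB/= in r2.
  case/or4P: hz2 => /eqP e; rewrite e in r1 r2.
  - by apply: le_trans r1; rewrite ler0_norm ?opprB /m ?ge_min ?lexx//; lra.
  - by apply: le_trans r1; rewrite ger0_norm /m ?ge_min ?lexx ?orbT//; lra.
  - by apply: le_trans r2; rewrite ler0_norm ?opprB /m ?ge_min ?lexx ?orbT//; lra.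
  - by apply: le_trans r2; rewrite ger0_norm /m ?ge_min ?lexx ?orbT//; lra.
exists (4 * Mi * ((b - a) + (d - c)) / complex.Im W).
  by rewrite divr_ge0 ?mulr_ge0//; lra.
move=> f M hf hM.
pose g z := (f z - f z1) * (z - z1)^-1.
have z1in : in_rect a b c d z1 by rewrite /in_rect/=; lra.
have cb z : on_boundary a b c d z -> ccont (fun w => f w * (w - z1)^-1) z.
  move=> hz; have /holoP[D] : holomorphic_at (fun w => f w * (w - z1)^-1) z.
    by apply: holoM; [apply/hf/on_boundary_in|apply/hi/bdz].
  exact: cdiff_cont.
have cw z : on_boundary a b c d z -> ccont (fun w => (w - z1)^-1) z.
  by move=> hz; have /holoP[D] := hi _ (bdz _ hz); exact: cdiff_cont.
have cw' z : on_boundary a b c d z -> ccont (fun w => f z1 * (w - z1)^-1) z.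
  move=> hz; have /holoP[D] : holomorphic_at (fun w => f z1 * (w - z1)^-1) z.
    by apply: holoM; [exact: holo_cst|apply/hi/bdz].
  exact: cdiff_cont.
have g0 : rect_int g a b c d = 0.
  have /holoP[D hD] := hf _ z1in.
  have [eta eta0 heta] := hD 1 ltr01.
  apply: (@goursat_punctured g a b c d x1 y1 (1 + cabs D) eta) => //.
    move=> z hz zz; apply/holoP; apply: holoM; last exact: hi.
    by apply: holoB; [exact: hf|exact: holo_cst].
  move=> h /andP[h0 /heta hh].
  rewrite /g -/z1 [z1 + h - z1]addrAC subrr add0r cabsM cabsV ler_pdivrMr// mulrDl mul1r.
  rewrite -[f _ - f z1](subrK (D * h)) (le_trans (cabsD _ _))// cabsM lerD2r.
  by rewrite mul1r in hh.
have eW : rect_int (fun w => f w * (w - z1)^-1) a b c d = f z1 * W.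
  rewrite -[LHS]subr0 -[in LHS]g0.
  have -> : rect_int g a b c d = rect_int (fun w => f w * (w - z1)^-1) a b c d - f z1 * W.
    rewrite -rect_intZ// -rect_intB//; apply: eq_rect_int => // z _.
    by rewrite /g mulrBl.
  by rewrite opprB addrCA subrr addr0.
have := @rect_int_bound (fun w => f w * (w - z1)^-1) a b c d (M * Mi) ab cd cb.
rewrite eW cabsM => /(_ _)/wrap[].
  move=> z hz; rewrite cabsM ler_pM ?cabs_ge0//; [exact: hM|exact: hMi].
move=> h; rewrite mulrAC ler_pdivlMr//.
apply: (@le_trans _ _ (cabs (f z1) * cabs W)).
  by rewrite ler_wpM2l ?cabs_ge0// (le_trans (ler_norm _))// Im_le_cabs.
by apply: (le_trans h); rewrite le_eqVlt; apply/orP; left; apply/eqP; ring.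
Qed.

(** Since f vanishes near z0, f(z) / (z - z0)^n is holomorphic on the whole square for every n; one
    Cauchy estimate for all n gives |f z1| <= K M (|z1 - z0| / r)^n, which tends to 0. *)
Lemma identity_square f x0 y0 (r e : R) z1 : 0 < e ->
  (forall z, in_rect (x0 - r) (x0 + r) (y0 - r) (y0 + r) z -> holomorphic_at f z) ->
  (forall h, cabs h < e -> f (Complex x0 y0 + h) = 0) ->
  cabs (z1 - Complex x0 y0) < r -> f z1 = 0.
Proof.
move=> e0 hf fz zr.
set z0 := Complex x0 y0 in fz zr *.
have r0 : 0 < r by apply: le_lt_trans zr; exact: cabs_ge0.
have b1 := Re_le_cabs (z1 - z0); have b2 := Im_le_cabs (z1 - z0).
have [/andP[p1 p2] /andP[p3 p4]] :
   (- r < complex.Re (z1 - z0) < r) /\ (- r < complex.Im (z1 - z0) < r).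
  by split; rewrite -ltr_norml; apply: le_lt_trans zr.
rewrite cReB/= in p1 p2; rewrite cImB/= in p3 p4.
have z1E : z1 = Complex (complex.Re z1) (complex.Im z1) by case: (z1).
have [K K0 hK] := @cauchy_estimate (x0 - r) (x0 + r) (y0 - r) (y0 + r)
  (complex.Re z1) (complex.Im z1) ltac:(lra) ltac:(lra) ltac:(lra) ltac:(lra).
have [M M0 hM] := @holo_rect_bounded f (x0 - r) (x0 + r) (y0 - r) (y0 + r)
   ltac:(lra) ltac:(lra) hf.
pose q := cabs (z1 - z0) / r.
have q1 : q < 1 by rewrite /q ltr_pdivrMr// mul1r.
have q0 : 0 <= q by rewrite /q divr_ge0 ?cabs_ge0 ?ltW.
have [z10|z10] := eqVneq z1 z0; first by have := fz 0; rewrite addr0 cabs0 z10 => ->.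
have key n : cabs (f z1) <= K * M * q ^+ n.
  pose g z := f z * (z - z0)^-1 ^+ n.
  have hg z : in_rect (x0 - r) (x0 + r) (y0 - r) (y0 + r) z -> holomorphic_at g z.
    move=> hz; have [->|zz0] := eqVneq z z0.
      (* At z0 itself, n = 0 gives back f, and for n > 0 the function is identically 0 in a
         neighbourhood. *)
      case: n @g => [|n] g.
        by rewrite /g; under eq_fun do rewrite expr0 mulr1; apply: hf; rewrite /in_rect/=; lra.
      apply: (@holo_eq_near (fun=> 0) _ _ e) => //; last exact: holo_cst.
      by move=> h he; rewrite /g fz// mul0r.
    by apply: holoM; [exact: hf|apply: holoX; exact: holo_inv_subr].
  have hgM z : on_boundary (x0 - r) (x0 + r) (y0 - r) (y0 + r) z ->
      cabs (g z) <= M * r^-1 ^+ n.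
    move=> hz; rewrite /g cabsM cabsX cabsV; apply: ler_pM.
    - exact: cabs_ge0.
    - by rewrite exprn_ge0// invr_ge0 cabs_ge0.
    - exact: hM.
    rewrite lerXn2r ?nnegrE ?invr_ge0 ?cabs_ge0 ?(ltW r0)//.
    have rz : r <= cabs (z - z0).
      have r1 := Re_le_cabs (z - z0); have r2 := Im_le_cabs (z - z0).
      rewrite cReB/= in r1; rewrite cImB/= in r2.
      case/andP: hz => _ /or4P[] /eqP ez.
      - by apply: le_trans r1; rewrite ez ler0_norm; lra.
      - by apply: le_trans r1; rewrite ez ger0_norm; lra.
      - by apply: le_trans r2; rewrite ez ler0_norm; lra.
      - by apply: le_trans r2; rewrite ez ger0_norm; lra.
    by rewrite lef_pV2 ?posrE// (lt_le_trans r0).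
  have := hK g _ hg hgM; rewrite -z1E /g cabsM cabsX cabsV.
  rewrite [X in _ * X <= _]exprVn ler_pdivrMr ?exprn_gt0 ?cabs_gt0 ?subr_eq0//.
  move=> /le_trans; apply; rewrite le_eqVlt; apply/orP; left; apply/eqP.
  by rewrite /q expr_div_n exprVn; ring.
have : (fun n => K * M * q ^+ n) @ \oo --> (0 : R).
  rewrite -(mulr0 (K * M)); apply: cvgMr; apply: cvg_expr; rewrite ger0_norm//.
move=> /cvgrPdist_lt hl.
apply/eqP; rewrite -[_ == 0]negbK -cabs_gt0; apply/negP => f0.
have [N _ hN] := hl _ f0; have := hN N (leqnn N) => /=.
have KMq : 0 <= K * M * q ^+ N by apply: mulr_ge0; [exact: mulr_ge0|exact: exprn_ge0].
by rewrite sub0r normrN ger0_norm// ltNge key.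
Qed.
End ComplexDifferentiability.

(** * Invariance of Lebesgue measure under translation and reflection *)

Section LebesgueTranslation.
Variable R : realType.
Local Notation mu := (@lebesgue_measure R).

Lemma measurable_shift (a : R) : measurable_fun [set: R] (fun x : R => x + a).
Proof. exact: measurable_funD. Qed.

Lemma lebesgue_shift (a : R) (A : set R) : measurable A ->
  mu ((fun x => x + a) @^-1` A) = mu A.
Proof.
move=> mA; symmetry.
have mf : measurable_fun [set: measurableTypeR R]
    (fun x : measurableTypeR R => (x + a : measurableTypeR R)) := measurable_shift a.
pose nuM : {measure set (measurableTypeR R) -> \bar R} :=
  measure_function_pushforward__canonical__measure_function_Measure mu mf.
apply: (@lebesgue_measure_unique R nuM) => // X [[p q] /= _ <-].
rewrite /pushforward.
have -> : (fun x : R => x + a) @^-1` `]p, q]%classic = `]p - a, q - a]%classic.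
  by apply/seteqP; split => x /=; rewrite !in_itv/= ltrBlDr lerBrDr.
have e1 := @lebesgue_measure_itv R `]p, q].
have e2 := @lebesgue_measure_itv R `]p - a, q - a].
apply: (etrans e1); apply: etrans (esym e2) => /=.
rewrite !lte_fin ltrD2r; case: ifP => // _.
by rewrite -!EFinB opprB addrA subrK.
Qed.

Lemma ge0_integral_shift (f : R -> \bar R) (a : R) : measurable_fun [set: R] f ->
  (forall x, 0 <= f x)%E ->
  (\int[mu]_x f (x + a)%R = \int[mu]_x f x)%E.
Proof.
move=> mf f0; have ms := measurable_shift a.
have := @ge0_integral_pushforward _ _ (measurableTypeR R) (measurableTypeR R) R
  (fun x => x + a) ms (@lebesgue_measure R : {measure set (measurableTypeR R) -> \bar R})
  setT f measurableT mf (fun y _ => f0 y).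
rewrite preimage_setT => <-; apply: eq_measure_integral => A mA _.
exact: lebesgue_shift.
Qed.

Lemma integral_shift (f : R -> \bar R) (a : R) : measurable_fun [set: R] f ->
  (\int[mu]_x f (x + a)%R = \int[mu]_x f x)%E.
Proof.
move=> mf; rewrite integralE [RHS]integralE; congr (_ - _)%E.
  apply: etrans (ge0_integral_shift a (measurable_funepos mf) _); last by [].
  by apply: eq_integral => x _; rewrite !funeposE.
apply: etrans (ge0_integral_shift a (measurable_funeneg mf) _); last by [].
by apply: eq_integral => x _; rewrite !funenegE.
Qed.

Lemma lebesgue_oppr (A : set R) : measurable A -> mu ((fun x => - x) @^-1` A) = mu A.
Proof.
move=> mA; symmetry.
have mf : measurable_fun [set: measurableTypeR R]
    (fun x : measurableTypeR R => (- x : measurableTypeR R)).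
  by apply: continuous_measurable_fun; exact: opp_continuous.
pose nuM : {measure set (measurableTypeR R) -> \bar R} :=
  measure_function_pushforward__canonical__measure_function_Measure mu mf.
apply: (@lebesgue_measure_unique R nuM) => // X [[p q] /= _ <-].
rewrite /pushforward.
have -> : (fun x : R => - x) @^-1` `]p, q]%classic = `[- q, - p[%classic.
  by apply/seteqP; split => x /=; rewrite !in_itv/= ltrNr lerNl => /andP[-> ->].
have e1 := @lebesgue_measure_itv R `]p, q].
have e2 := @lebesgue_measure_itv R `[- q, - p[.
apply: (etrans e1); apply: etrans (esym e2) => /=.
rewrite !lte_fin ltrN2; case: ifP => // _.
by rewrite -!EFinB opprK addrC.
Qed.

Lemma ge0_integral_oppr (f : R -> \bar R) : measurable_fun [set: R] f ->
  (forall x, 0 <= f x)%E -> (\int[mu]_x f (- x)%R = \int[mu]_x f x)%E.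
Proof.
move=> mf f0.
have ms : measurable_fun [set: measurableTypeR R]
    (fun x : measurableTypeR R => (- x : measurableTypeR R)).
  by apply: continuous_measurable_fun; exact: opp_continuous.
have := @ge0_integral_pushforward _ _ (measurableTypeR R) (measurableTypeR R) R
  (fun x => - x) ms (@lebesgue_measure R : {measure set (measurableTypeR R) -> \bar R})
  setT f measurableT mf (fun y _ => f0 y).
rewrite preimage_setT => <-; apply: eq_measure_integral => A mA _.
exact: lebesgue_oppr.
Qed.

End LebesgueTranslation.

(** * The complex exponential and its second-order remainder *)

Section ComplexExponential.
Variable R : realType.
Local Notation cabs := (@Normc.normc R).
Implicit Types (z w : R[i]) (x y : R).

Lemma MVT_origin (f df : R -> R) : (forall x, is_derive x 1 f (df x)) ->
  forall y, exists2 c, `|c| <= `|y| & f y - f 0 = df c * y.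
Proof.
move=> hd y.
have hc p q : {within `[p, q], continuous f}.
  apply: continuous_subspaceT => x.
  by apply: differentiable_continuous; apply/derivable1_diffP; have [] := hd x.
have [y0|y0] := leP 0 y.
  have [c] := MVT_segment y0 (fun x _ => hd x) (hc 0 y).
  rewrite in_itv/= => /andP[c0 cy] e; exists c; last by rewrite e subr0.
  by rewrite !ger0_norm.
have [c] := MVT_segment (ltW y0) (fun x _ => hd x) (hc y 0).
rewrite in_itv/= => /andP[c0 cy] e; exists c; last by rewrite -opprB e; ring.
by rewrite !ler0_norm// ?lerN2// ltW.
Qed.

Lemma sin_le_norm y : `|sin y| <= `|y|.
Proof.
have [c _] := MVT_origin (@is_derive_sin R) y; rewrite sin0 subr0 => ->.
by rewrite normrM ler_piMl// cos_max.
Qed.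

Lemma cos1_le_sqr y : `|cos y - 1| <= y ^+ 2.
Proof.
have [c hc] := MVT_origin (@is_derive_cos R) y; rewrite cos0 => ->.
rewrite normrM normrN -real_normK ?num_real// expr2 ler_wpM2r//.
exact: le_trans (sin_le_norm _) hc.
Qed.

Lemma sin_sub_le_sqr y : `|sin y - y| <= y ^+ 2.
Proof.
have [c hc] := MVT_origin (@is_derive_sin R) y; rewrite sin0 subr0 => ->.
rewrite -[X in _ - X]mul1r -mulrBl normrM -[leRHS]real_normK ?num_real// expr2 ler_wpM2r//.
have [c' hc'] := MVT_origin (@is_derive_cos R) c; rewrite cos0 => ->.
rewrite normrM normrN (le_trans _ hc)// ler_piMl//; exact: sin_max.
Qed.

Lemma expR_sub1_le x : `|expR x - 1| <= `|x| * expR `|x|.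
Proof.
have h1 := expR_ge1Dx x; have h2 := expR_ge1Dx (- x).
have [x0|x0] := leP 0 x.
  rewrite (ger0_norm x0) ger0_norm; last lra.
  have : expR x * (1 - x) <= expR x * expR (- x) by rewrite ler_pM2l ?expR_gt0.
  rewrite expRxMexpNx_1; lra.
have e1 : expR x <= 1 by rewrite -expR0 ler_expR ltW.
rewrite (ltr0_norm x0) ler0_norm; last lra.
have : 1 <= expR (- x) by lra.
nra.
Qed.

Lemma expR_sub1x_le x : `|expR x - 1 - x| <= x ^+ 2 * expR `|x|.
Proof.
have h1 := expR_ge1Dx x; have h2 := expR_ge1Dx (- x).
rewrite ger0_norm; last lra.
have h3 : expR x * (1 - x) <= 1.
  have : expR x * (1 - x) <= expR x * expR (- x) by rewrite ler_pM2l ?expR_gt0.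
  by rewrite expRxMexpNx_1.
have h4 : expR x - 1 - x <= x * (expR x - 1) by lra.
apply: (le_trans h4); apply: (le_trans (ler_norm _)); rewrite normrM.
rewrite -[X in X ^+ 2 * _]/x -real_normK ?num_real// expr2 -mulrA.
by rewrite ler_wpM2l// expR_sub1_le.
Qed.

Lemma Re_cexp z : complex.Re (cexp z) = expR (complex.Re z) * cos (complex.Im z).
Proof. by rewrite /cexp cReM/= mul0r subr0. Qed.

Lemma Im_cexp z : complex.Im (cexp z) = expR (complex.Re z) * sin (complex.Im z).
Proof. by rewrite /cexp cImM/= mul0r addr0. Qed.

Lemma cexp0 : cexp (0 : R[i]) = 1.
Proof. by apply: complex_ext; rewrite ?Re_cexp ?Im_cexp/= expR0 ?cos0 ?sin0 mul1r. Qed.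

Lemma cexpD z w : cexp (z + w) = cexp z * cexp w.
Proof.
apply: complex_ext.
  rewrite Re_cexp cReM !Re_cexp !Im_cexp cReD cImD expRD cosD; ring.
rewrite Im_cexp cImM !Re_cexp !Im_cexp cReD cImD expRD sinD; ring.
Qed.

Lemma cabs_cexp z : cabs (cexp z) = expR (complex.Re z).
Proof.
rewrite /cexp cabsM cabs_real ger0_norm ?expR_ge0//.
by rewrite /Normc.normc cos2Dsin2 sqrtr1 mulr1.
Qed.

(** Obtained from real mean value bounds on exp, sin and cos; the quadratic order is what
    differentiation under the integral sign requires. *)
Lemma cexp_taylor2 z : cabs (cexp z - 1 - z) <= 4 * (cabs z) ^+ 2 * expR (cabs z).
Proof.
have a := Re_le_cabs z; have b := Im_le_cabs z.
set m := cabs z in a b *; have m0 : 0 <= m by exact: cabs_ge0.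
set x := complex.Re z in a *; set y := complex.Im z in b *.
have em : 1 <= expR m by rewrite -expR0 ler_expR.
have ex : expR x <= expR m by rewrite ler_expR (le_trans (ler_norm _)).
have exn : expR `|x| <= expR m by rewrite ler_expR.
have x2 : x ^+ 2 <= m ^+ 2 by rewrite -real_normK ?num_real// ler_sqr ?nnegrE.
have y2 : y ^+ 2 <= m ^+ 2 by rewrite -real_normK ?num_real// ler_sqr ?nnegrE.
have em0 := expR_ge0 m; have ex0 := expR_ge0 x; have exn0 := expR_ge0 `|x|.
have m20 := sqr_ge0 m.
apply: (le_trans (cabs_le_ReIm _)).
have -> : 4 * m ^+ 2 * expR m = 2 * (m ^+ 2 * expR m) + 2 * (m ^+ 2 * expR m) by ring.
apply: lerD.
  have -> : complex.Re (cexp z - 1 - z) = (expR x - 1 - x) + expR x * (cos y - 1).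
    rewrite !cReB Re_cexp/= -/x -/y; ring.
  apply: (le_trans (ler_normD _ _)); rewrite mulr_natl mulr2n; apply: lerD.
    apply: (le_trans (expR_sub1x_le x)); apply: ler_pM => //; exact: sqr_ge0.
  rewrite normrM (ger0_norm ex0) [leRHS]mulrC; apply: ler_pM => //.
  exact: le_trans (cos1_le_sqr _) y2.
have -> : complex.Im (cexp z - 1 - z) = (expR x - 1) * sin y + (sin y - y).
  rewrite !cImB Im_cexp/= -/x -/y; ring.
apply: (le_trans (ler_normD _ _)); rewrite mulr_natl mulr2n; apply: lerD.
  rewrite normrM; apply: (@le_trans _ _ ((m * expR m) * m)); last first.
    by rewrite mulrAC expr2.
  apply: ler_pM => //; last exact: le_trans (sin_le_norm _) b.
  by apply: (le_trans (expR_sub1_le x)); apply: ler_pM.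
apply: (le_trans (sin_sub_le_sqr y)); apply: (le_trans y2).
by rewrite ler_peMr.
Qed.

End ComplexExponential.

(** * Laplace transforms over the whole real line *)

Section LaplaceTransform.
Variable R : realType.
Local Notation cabs := (@Normc.normc R).
Local Notation mu := (@lebesgue_measure R).
Implicit Types (F G : R -> R[i]) (h : R -> R) (s k : R[i]).

Definition cmeas F := measurable_fun setT (fun w => complex.Re (F w)) /\
  measurable_fun setT (fun w => complex.Im (F w)).

Definition cintegrable F :=
  mu.-integrable setT (EFin \o (fun w => complex.Re (F w))) /\
  mu.-integrable setT (EFin \o (fun w => complex.Im (F w))).

Definition cintT F : R[i] :=
  Complex (\int[mu]_w complex.Re (F w)) (\int[mu]_w complex.Im (F w)).

Lemma cintegrable_dom F (g : R -> R) : cmeas F ->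
  mu.-integrable setT (EFin \o g) -> (forall w, cabs (F w) <= g w) -> cintegrable F.
Proof.
move=> [m1 m2] ig hg; split; apply: (le_integrable measurableT _ _ ig) => //=.
- exact/measurable_EFinP.
- move=> w _; rewrite lee_fin (le_trans (Re_le_cabs _))// (le_trans (hg w))// ler_norm//.
- exact/measurable_EFinP.
- move=> w _; rewrite lee_fin (le_trans (Im_le_cabs _))// (le_trans (hg w))// ler_norm//.
Qed.

Lemma cintT_bound F (g : R -> R) : cmeas F ->
  mu.-integrable setT (EFin \o g) -> (forall w, cabs (F w) <= g w) ->
  cabs (cintT F) <= 2 * \int[mu]_w g w.
Proof.
move=> mF ig hg; have [i1 i2] := cintegrable_dom mF ig hg.
rewrite (le_trans (cabs_le_ReIm _))//= mulr_natl mulr2n.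
have key (u : R -> R) : mu.-integrable setT (EFin \o u) -> (forall w, `|u w| <= g w) ->
    `|\int[mu]_w u w| <= \int[mu]_w g w.
  move=> iu hu; apply: (le_trans (le_normr_Rintegral measurableT iu)).
  apply: le_Rintegral => //; exact: (integrable_abse iu).
apply: lerD; apply: key => // w; apply: le_trans (hg w);
  [exact: Re_le_cabs|exact: Im_le_cabs].
Qed.

Lemma eq_cintT F G : F =1 G -> cintT F = cintT G.
Proof. by move=> /funext ->. Qed.

Lemma cintTB F G : cintegrable F -> cintegrable G ->
  cintT (fun w => F w - G w) = cintT F - cintT G.
Proof.
move=> [f1 f2] [g1 g2]; apply: complex_ext; rewrite ?cReB ?cImB/=.
  by rewrite -RintegralB//; apply: eq_Rintegral => w _; rewrite cReB.
by rewrite -RintegralB//; apply: eq_Rintegral => w _; rewrite cImB.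
Qed.

Lemma cintTD F G : cintegrable F -> cintegrable G ->
  cintT (fun w => F w + G w) = cintT F + cintT G.
Proof.
move=> [f1 f2] [g1 g2]; apply: complex_ext; rewrite ?cReD ?cImD/=.
  by rewrite -RintegralD//; apply: eq_Rintegral => w _; rewrite cReD.
by rewrite -RintegralD//; apply: eq_Rintegral => w _; rewrite cImD.
Qed.

Lemma integrableZ (u : R -> R) (r : R) : mu.-integrable setT (EFin \o u) ->
  mu.-integrable setT (EFin \o (fun w => r * u w)).
Proof. by move=> iu; have := integrableZl measurableT r iu. Qed.

Lemma cintTZ k F : cintegrable F -> cintT (fun w => k * F w) = k * cintT F.
Proof.
move=> [f1 f2]; apply: complex_ext; rewrite ?cReM ?cImM/=.
  rewrite -!RintegralZl// -RintegralB//; [|exact: integrableZ..].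
  by apply: eq_Rintegral => w _; rewrite cReM.
rewrite -!RintegralZl// -RintegralD//; [|exact: integrableZ..].
by apply: eq_Rintegral => w _; rewrite cImM.
Qed.

Lemma integrable_addR (u v : R -> R) : mu.-integrable setT (EFin \o u) ->
  mu.-integrable setT (EFin \o v) -> mu.-integrable setT (EFin \o (fun w => u w + v w)).
Proof. by move=> iu iv; have := integrableD measurableT iu iv. Qed.

Lemma integrable_subR (u v : R -> R) : mu.-integrable setT (EFin \o u) ->
  mu.-integrable setT (EFin \o v) -> mu.-integrable setT (EFin \o (fun w => u w - v w)).
Proof. by move=> iu iv; have := integrableB measurableT iu iv. Qed.

Lemma cintegrableB F G : cintegrable F -> cintegrable G -> cintegrable (fun w => F w - G w).
Proof.
move=> [f1 f2] [g1 g2]; split; rewrite /comp.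
  by under eq_fun do rewrite cReB; exact: integrable_subR.
by under eq_fun do rewrite cImB; exact: integrable_subR.
Qed.

Lemma cintegrableZ k F : cintegrable F -> cintegrable (fun w => k * F w).
Proof.
move=> [f1 f2]; split; rewrite /comp.
  under eq_fun do rewrite cReM.
  by apply: integrable_subR; exact: integrableZ.
under eq_fun do rewrite cImM.
by apply: integrable_addR; exact: integrableZ.
Qed.

Lemma cmeasM F G : cmeas F -> cmeas G -> cmeas (fun w => F w * G w).
Proof.
move=> [f1 f2] [g1 g2]; split.
  under eq_fun do rewrite cReM; apply: measurable_funB; exact: measurable_funM.
under eq_fun do rewrite cImM; apply: measurable_funD; exact: measurable_funM.
Qed.

Lemma cmeasB F G : cmeas F -> cmeas G -> cmeas (fun w => F w - G w).
Proof.
move=> [f1 f2] [g1 g2]; split.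
  by under eq_fun do rewrite cReB; apply: measurable_funB.
by under eq_fun do rewrite cImB; apply: measurable_funB.
Qed.

Lemma cmeas_real (u : R -> R) : measurable_fun setT u -> cmeas (fun w => ((u w)%:C)%C).
Proof. by move=> mu; split => //=; exact: measurable_cst. Qed.

Lemma cmeas_cst k : cmeas (fun=> k).
Proof. by split; exact: measurable_cst. Qed.

Lemma cmeas_cexp k : cmeas (fun w => cexp (k * (w%:C)%C)).
Proof.
split.
  rewrite (_ : (fun w : R => _) = (fun w : R => expR (complex.Re k * w) * cos (complex.Im k * w))).
    apply: measurable_funM; apply: measurableT_comp => //.
    apply: continuous_measurable_fun; exact: continuous_cos.
  by apply/funext => w; rewrite Re_cexp cReM cImM/= !mulr0 subr0 add0r.
rewrite (_ : (fun w : R => _) = (fun w : R => expR (complex.Re k * w) * sin (complex.Im k * w))).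
  apply: measurable_funM; apply: measurableT_comp => //.
  apply: continuous_measurable_fun; exact: continuous_sin.
by apply/funext => w; rewrite Im_cexp cReM cImM/= !mulr0 subr0 add0r.
Qed.

(** The kernel is e^(s w), without a minus sign: this is a Mellin transform in the variable e^w, and
    the half-line w < 0 has transform 1 / s. *)
Definition lap h s : R[i] := cintT (fun w => ((h w)%:C)%C * cexp (s * (w%:C)%C)).

Definition lap_dom h (sg : R) := mu.-integrable setT (EFin \o (fun w => h w * expR (sg * w))).

Lemma cmeas_lap h s : measurable_fun setT h ->
  cmeas (fun w => ((h w)%:C)%C * cexp (s * (w%:C)%C)).
Proof. by move=> mh; apply: cmeasM; [exact: cmeas_real|exact: cmeas_cexp]. Qed.

Lemma cabs_lap h s w : 0 <= h w ->
  cabs (((h w)%:C)%C * cexp (s * (w%:C)%C)) = h w * expR (complex.Re s * w).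
Proof. by move=> h0; rewrite cabsM cabs_real ger0_norm// cabs_cexp cReM/= mulr0 subr0. Qed.

Lemma lap_integrable h s : measurable_fun setT h -> (forall w, 0 <= h w) ->
  lap_dom h (complex.Re s) -> cintegrable (fun w => ((h w)%:C)%C * cexp (s * (w%:C)%C)).
Proof.
move=> mh h0 hd; apply: (cintegrable_dom (cmeas_lap s mh) hd) => w.
by rewrite cabs_lap.
Qed.

Lemma lap_bound h s : measurable_fun setT h -> (forall w, 0 <= h w) ->
  lap_dom h (complex.Re s) ->
  cabs (lap h s) <= 2 * \int[mu]_w (h w * expR (complex.Re s * w)).
Proof.
move=> mh h0 hd; apply: (cintT_bound (cmeas_lap s mh) hd) => w.
by rewrite cabs_lap.
Qed.

Lemma lap_real h (x : R) : lap h (x%:C)%C = ((\int[mu]_w (h w * expR (x * w)))%:C)%C.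
Proof.
apply: complex_ext => /=.
  by apply: eq_Rintegral => w _; rewrite !mul0r !mulr0 !subr0 addr0 cos0 mulr1.
under eq_Rintegral do rewrite !mul0r !mulr0 !addr0 sin0 !mulr0.
by rewrite /Rintegral integral0.
Qed.

Lemma lapB h h' s : measurable_fun setT h -> measurable_fun setT h' ->
  (forall w, 0 <= h w) -> (forall w, 0 <= h' w) ->
  lap_dom h (complex.Re s) -> lap_dom h' (complex.Re s) ->
  lap (fun w => h w - h' w) s = lap h s - lap h' s.
Proof.
move=> m1 m2 p1 p2 d1 d2; rewrite /lap -cintTB; [|exact: lap_integrable..].
by apply: eq_cintT => w; rewrite rmorphB mulrBl.
Qed.

Lemma lapD h h' s : measurable_fun setT h -> measurable_fun setT h' ->
  (forall w, 0 <= h w) -> (forall w, 0 <= h' w) ->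
  lap_dom h (complex.Re s) -> lap_dom h' (complex.Re s) ->
  lap (fun w => h w + h' w) s = lap h s + lap h' s.
Proof.
move=> m1 m2 p1 p2 d1 d2; rewrite /lap -cintTD; [|exact: lap_integrable..].
by apply: eq_cintT => w; rewrite rmorphD mulrDl.
Qed.

Lemma lapZ h (c : R) s : measurable_fun setT h -> (forall w, 0 <= h w) ->
  lap_dom h (complex.Re s) ->
  lap (fun w => c * h w) s = (c%:C)%C * lap h s.
Proof.
move=> m1 p1 d1; rewrite /lap -cintTZ; [|exact: lap_integrable].
by apply: eq_cintT => w; rewrite rmorphM mulrA.
Qed.

Lemma lap_expR h (c : R) s :
  lap (fun w => h w * expR (c * w)) s = lap h (s + (c%:C)%C).
Proof.
rewrite /lap; apply: eq_cintT => w.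
have -> : ((h w * expR (c * w))%:C)%C = ((h w)%:C)%C * cexp ((c%:C)%C * (w%:C)%C).
  rewrite rmorphM; congr (_ * _); apply: complex_ext;
    by rewrite ?Re_cexp ?Im_cexp cReM cImM/= !mul0r ?mulr0 ?subr0 ?addr0 ?add0r
      ?cos0 ?sin0 ?mulr1 ?mulr0.
by rewrite mulrDl cexpD; ring.
Qed.

Lemma integrable_shift (u : R -> R) (a : R) : mu.-integrable setT (EFin \o u) ->
  mu.-integrable setT (EFin \o (fun w => u (w + a))).
Proof.
move=> /integrableP[mu1 fu]; apply/integrableP; split.
  apply: (measurableT_comp mu1); exact: measurable_shift.
by rewrite (ge0_integral_shift (f := fun x => `|(EFin \o u) x|%E))//; exact: measurableT_comp.
Qed.

Lemma lap_shift h (a : R) s : measurable_fun setT h -> (forall w, 0 <= h w) ->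
  lap_dom h (complex.Re s) ->
  lap (fun w => h (w + a)) s = cexp (- s * (a%:C)%C) * lap h s.
Proof.
move=> mh h0 hd.
have [i1 i2] := lap_integrable mh h0 hd.
pose F w := ((h w)%:C)%C * cexp (s * (w%:C)%C).
have sh (u : R -> R) : mu.-integrable setT (EFin \o u) -> \int[mu]_w u (w + a) = \int[mu]_w u w.
  move=> /integrableP[mu' _]; rewrite /Rintegral; congr fine.
  exact: (integral_shift (f := EFin \o u)).
have -> : lap h s = cintT (fun w => F (w + a)).
  rewrite /lap /cintT; congr Complex; symmetry.
    exact: (sh (fun w => complex.Re (F w)) i1).
  exact: (sh (fun w => complex.Im (F w)) i2).
rewrite -cintTZ; last by split; [exact: (integrable_shift a i1)|exact: (integrable_shift a i2)].
apply: eq_cintT => w; rewrite /F rmorphD/= mulrDr cexpD.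
have e : cexp (- s * (a%:C)%C) * cexp (s * (a%:C)%C) = 1.
  by rewrite -cexpD mulNr addNr cexp0.
by rewrite -[LHS]mulr1 -e; ring.
Qed.

Lemma expR_abs_le (x : R) : expR `|x| <= expR x + expR (- x).
Proof.
have a := expR_ge0 x; have b := expR_ge0 (- x).
by have [h|h] := leP 0 x; rewrite ?(ger0_norm h) ?(ltr0_norm h); lra.
Qed.

Lemma sqr_le_expR (e w : R) : 0 < e -> w ^+ 2 <= 2 / e ^+ 2 * expR (e * `|w|).
Proof.
move=> e0; have ew : 0 <= e * `|w| by rewrite mulr_ge0// ltW.
have := expR_ge1Dxn 1 ew; rewrite (_ : 2`!%:R = 2)//.
rewrite -[w ^+ 2]real_normK ?num_real// exprMn => h.
rewrite mulrAC ler_pdivlMr ?exprn_gt0//; lra.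
Qed.

(** Differentiation under the integral sign. With e at most a quarter of the distance from Re s to
    the ends of the strip, the integrands at the abscissas sg + 2 e and sg - 2 e together dominate h
    e^(sg w) e^(2 e |w|), and this weight absorbs the factor |w| of the derivative and the quadratic
    remainder. *)
Lemma lap_holomorphic h (a b : R) s : measurable_fun setT h -> (forall w, 0 <= h w) ->
  (forall sg, a < sg < b -> lap_dom h sg) ->
  a < complex.Re s < b -> holomorphic_at (lap h) s.
Proof.
move=> mh h0 hd /andP[as1 sb].
set sg := complex.Re s in as1 sb.
pose e := Num.min (sg - a) (b - sg) / 4.
have e0 : 0 < e by rewrite divr_gt0// lt_min; lra.
have ea : 4 * e <= sg - a.
  by rewrite /e mulrC divfK// ge_min lexx.
have eb : 4 * e <= b - sg.
  by rewrite /e mulrC divfK// ge_min lexx orbT.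
clearbody e.
have d1 : lap_dom h (sg + 2 * e) by apply: hd; lra.
have d2 : lap_dom h (sg - 2 * e) by apply: hd; lra.
pose G w := h w * expR ((sg + 2 * e) * w) + h w * expR ((sg - 2 * e) * w).
have iG : mu.-integrable setT (EFin \o G).
  exact: integrable_addR.
pose M := \int[mu]_w G w.
have M0 : 0 <= M.
  by apply: Rintegral_ge0 => w _; rewrite addr_ge0// mulr_ge0// expR_ge0.
have GE w : h w * expR (sg * w) * expR (2 * e * `|w|) <= G w.
  have -> : 2 * e * `|w| = `|2 * e * w| by rewrite normrM ger0_norm// mulr_ge0// ltW.
  rewrite /G -mulrA -mulrDr ler_wpM2l//.
  apply: (le_trans (ler_wpM2l (expR_ge0 _) (expR_abs_le _))).
  rewrite mulrDr -!expRD le_eqVlt; apply/orP; left; apply/eqP.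
  by congr (expR _ + expR _); ring.
pose F w := ((h w)%:C)%C * cexp (s * (w%:C)%C).
have mF : cmeas F by exact: cmeas_lap.
have iF : cintegrable F by apply: lap_integrable => //; apply: hd; rewrite -/sg; lra.
have iFw : cintegrable (fun w => F w * (w%:C)%C).
  have iG' := integrableZ (2 * e)^-1 iG.
  apply: (cintegrable_dom _ iG'); first by apply: cmeasM => //; apply: cmeas_real.
  move=> w; rewrite cabsM cabs_lap// cabs_real -/sg mulrC.
  apply: (@le_trans _ _ ((2 * e)^-1 * (h w * expR (sg * w) * expR (2 * e * `|w|)))).
    rewrite [leRHS]mulrCA [leLHS]mulrC; apply: ler_wpM2l.
      by rewrite mulr_ge0// expR_ge0.
    rewrite mulrC ler_pdivlMr ?mulr_gt0//.
    by have := expR_ge1Dx (2 * e * `|w|); lra.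
  by apply: ler_wpM2l => //; rewrite invr_ge0 mulr_ge0 ?(ltW e0).
have key k : cabs k <= e -> cabs (lap h (s + k) - lap h s -
    cintT (fun w => F w * (w%:C)%C) * k) <= 16 / e ^+ 2 * M * cabs k ^+ 2.
  move=> ke.
  have /andP[k1 k2] : - e <= complex.Re k <= e.
    by rewrite -ler_norml (le_trans (Re_le_cabs _)).
  pose F' w := ((h w)%:C)%C * cexp ((s + k) * (w%:C)%C).
  have iF' : cintegrable F'.
    by apply: lap_integrable => //; apply: hd; rewrite cReD -/sg; lra.
  have mF' : cmeas F' by exact: cmeas_lap.
  have -> : lap h (s + k) - lap h s - cintT (fun w => F w * (w%:C)%C) * k =
      cintT (fun w => (F' w - F w) - k * (F w * (w%:C)%C)).
    have iD : cintegrable (fun w => F' w - F w) by exact: cintegrableB.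
    rewrite cintTB//; last exact: cintegrableZ.
    by rewrite cintTB// cintTZ// mulrC.
  have iG' := integrableZ (8 / e ^+ 2 * cabs k ^+ 2) iG.
  apply: (le_trans (cintT_bound _ iG' _)).
  - apply: cmeasB; first exact: cmeasB.
    by apply: cmeasM; [exact: cmeas_cst|apply: cmeasM => //; exact: cmeas_real].
  - move=> w.
    have -> : F' w - F w - k * (F w * (w%:C)%C) =
       F w * (cexp (k * (w%:C)%C) - 1 - k * (w%:C)%C).
      by rewrite /F' /F mulrDl cexpD; ring.
    rewrite cabsM cabs_lap// -/sg.
    have hw0 : 0 <= h w * expR (sg * w) by rewrite mulr_ge0// expR_ge0.
    apply: (@le_trans _ _ (8 / e ^+ 2 * cabs k ^+ 2 *
       (h w * expR (sg * w) * expR (2 * e * `|w|)))); last first.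
      by apply: ler_wpM2l => //; rewrite mulr_ge0 ?divr_ge0 ?exprn_ge0 ?cabs_ge0 ?(ltW e0).
    rewrite [leRHS]mulrCA; apply: ler_wpM2l => //.
    apply: (le_trans (cexp_taylor2 _)).
    rewrite cabsM cabs_real exprMn real_normK ?num_real//.
    have e1 : expR (cabs k * `|w|) <= expR (e * `|w|) by rewrite ler_expR ler_wpM2r.
    have e2 := sqr_le_expR w e0.
    have -> : expR (2 * e * `|w|) = expR (e * `|w|) * expR (e * `|w|).
      by rewrite -expRD; congr expR; ring.
    have -> : 8 / e ^+ 2 * cabs k ^+ 2 * (expR (e * `|w|) * expR (e * `|w|)) =
       4 * (cabs k ^+ 2 * (2 / e ^+ 2 * expR (e * `|w|))) * expR (e * `|w|) by ring.
    apply: ler_pM => //.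
      by apply: mulr_ge0 => //; apply: mulr_ge0; exact: sqr_ge0.
    by rewrite ler_wpM2l// ler_wpM2l// sqr_ge0.
  rewrite RintegralZl// -/M le_eqVlt; apply/orP; left; apply/eqP; ring.
apply/holoP; exists (cintT (fun w => F w * (w%:C)%C)) => eps eps0.
pose K := 16 / e ^+ 2 * M + 1.
have K0 : 0 < K.
  by rewrite /K ltr_wpDl// mulr_ge0// divr_ge0// exprn_ge0// ltW.
exists (Num.min e (eps / K)); first by rewrite lt_min e0 divr_gt0.
move=> k; rewrite lt_min => /andP[/ltW/key h1].
rewrite ltr_pdivlMr// => h2; apply: (le_trans h1).
rewrite expr2 mulrA ler_wpM2r ?cabs_ge0//.
have := cabs_ge0 k; rewrite /K in h2; nra.
Qed.

Definition neg_ind (w : R) : R := ((w < 0)%R : bool)%:R.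

Lemma measurable_neg_ind : measurable_fun setT neg_ind.
Proof.
rewrite (_ : neg_ind = \1_(`]-oo, 0[%classic : set R)); first exact: measurable_indic.
by apply/funext => w; rewrite /neg_ind indicE mem_setE in_itv.
Qed.

Lemma neg_ind_ge0 w : 0 <= neg_ind w.
Proof. by rewrite ler0n. Qed.

Lemma lap_neg_ind_dom (sg : R) : 0 < sg -> lap_dom neg_ind sg.
Proof.
move=> s0.
have me : measurable_fun setT (fun w => neg_ind w * expR (sg * w)).
  apply: measurable_funM; first exact: measurable_neg_ind.
  exact: measurableT_comp.
(* Integrability is read off from the exponential density, reflected to the negative half-line. *)
have ip : mu.-integrable setT (EFin \o (fun w => exponential_pdf sg (- w))).
  have mp := measurable_exponential_pdf sg.
  apply/integrableP; split.
    apply/measurable_EFinP; apply: (measurableT_comp mp).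
    by apply: continuous_measurable_fun; exact: opp_continuous.
  under eq_integral do rewrite gee0_abs ?lee_fin ?exponential_pdf_ge0 ?(ltW s0)//.
  rewrite (@ge0_integral_oppr R (fun x => (exponential_pdf sg x)%:E)).
  - by rewrite integral_exponential_pdf// ltry.
  - exact/measurable_EFinP.
  - by move=> x; rewrite lee_fin exponential_pdf_ge0// ltW.
apply: (le_integrable measurableT _ _ (integrableZ sg^-1 ip)) => //=.
  exact/measurable_EFinP.
move=> w _; rewrite lee_fin /neg_ind; case: ltP => w0; last by rewrite mul0r normr0.
rewrite mul1r exponential_pdfE ?oppr_ge0 ?(ltW w0)// mulrA mulVf ?gt_eqF// mul1r.
by rewrite mulrNN.
Qed.

Lemma neg_ind_shift_dom (a sg : R) : 0 <= a -> 0 < sg -> lap_dom (fun w => neg_ind (w + a)) sg.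
Proof.
move=> a0 s0; apply: (le_integrable measurableT _ _ (lap_neg_ind_dom s0)) => //=.
  apply/measurable_EFinP; apply: measurable_funM; last exact: measurableT_comp.
  by apply: (measurableT_comp measurable_neg_ind); exact: measurable_shift.
move=> w _; rewrite lee_fin !normrM ler_wpM2r// !ger0_norm ?neg_ind_ge0//.
rewrite /neg_ind ler_nat; case: ltP => // h.
by rewrite lt_neqAle (_ : w <= 0) ?andbT; [case: eqP => // e; move: h; rewrite e; lra|lra].
Qed.

(** Subtracting from [neg_ind] its translate by a leaves the indicator of an interval of length a
    ending at 0. Its transform is a + O(a^2) on one side and (1 - e^(-s a)) L = s a L + O(a^2) on
    the other; dividing by a and letting a tend to 0 gives s L = 1. *)
Lemma lap_neg_ind s : 0 < complex.Re s -> lap neg_ind s = s^-1.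
Proof.
move=> s0; set L := lap neg_ind s.
have sn0 : s != 0 by apply/eqP => sE; move: s0; rewrite sE ltxx.
pose C2 := 4 * cabs s ^+ 2 * expR (cabs s).
have C20 : 0 <= C2 by rewrite !mulr_ge0 ?expR_ge0 ?exprn_ge0 ?cabs_ge0.
pose C1 := cabs s + C2.
have C10 : 0 <= C1 by rewrite addr_ge0 ?cabs_ge0.
suff key a : 0 < a <= 1 -> cabs (s * L - 1) <= a * (C2 * cabs L + 2 * C1).
  suff /Normc.eq0_normc/eqP : cabs (s * L - 1) = 0.
    by rewrite subr_eq0 => /eqP e; apply: (mulfI sn0); rewrite e mulfV.
  apply/le_anti; rewrite cabs_ge0 andbT; apply/ler_addgt0Pl => e e0; rewrite addr0.
  pose K := C2 * cabs L + 2 * C1 + 1.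
  have K0 : 0 < K by rewrite ltr_wpDl// addr_ge0 ?mulr_ge0 ?cabs_ge0.
  have m0 : 0 < Num.min 1 (e / K) by rewrite lt_min ltr01 divr_gt0.
  apply: (le_trans (key (Num.min 1 (e / K)) _)).
    by rewrite m0 ge_min lexx.
  have : Num.min 1 (e / K) <= e / K by rewrite ge_min lexx orbT.
  rewrite ler_pdivlMr// => h; apply: le_trans h; rewrite ler_wpM2l ?(ltW m0)//.
  by rewrite /K lerDl.
move=> /andP[a0 a1].
pose J w := neg_ind w - neg_ind (w + a).
have JE w : J w = \1_(`[- a, 0[%classic : set R) w.
  rewrite /J /neg_ind indicE mem_setE in_itv/=.
  rewrite (_ : (w + a < 0) = (w < - a)); last by rewrite -[RHS](ltrD2r a) addNr.
  have [h1|h1] := ltP w (- a); have [h2|h2] := ltP w 0; rewrite /= ?subrr ?subr0//.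
  by move: h1 h2; lra.
have J0 w : 0 <= J w by rewrite JE indicE ler0n.
have mJ : measurable_fun setT J.
  by rewrite (_ : J = \1_(`[- a, 0[%classic : set R)); [exact: measurable_indic|exact/funext].
have mn := measurable_neg_ind.
have mns : measurable_fun setT (fun w : R => neg_ind (w + a)).
  by apply: (measurableT_comp mn); exact: measurable_shift.
have dn := lap_neg_ind_dom s0.
have dns := neg_ind_shift_dom (ltW a0) s0.
have eJ : lap J s = L - cexp (- s * (a%:C)%C) * L.
  rewrite /J lapB//; try by move=> w; exact: neg_ind_ge0.
  by rewrite lap_shift//; exact: neg_ind_ge0.
have iJ : mu.-integrable setT (EFin \o J).
  apply/integrableP; split; first exact/measurable_EFinP.
  under eq_integral => x _ do rewrite /= ger0_norm// JE.
  rewrite integral_indic// setIT.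
  have h := @lebesgue_measure_itv R `[- a, 0[.
  have : (lebesgue_measure (`[(- a)%R, 0%R[%classic : set R) < +oo)%E.
    by rewrite h; case: ifP => _; rewrite ltry.
  by [].
have intJ : \int[mu]_w J w = a.
  rewrite /Rintegral.
  under eq_integral do rewrite JE.
  rewrite integral_indic// setIT.
  have h := @lebesgue_measure_itv R `[- a, 0[; apply: (etrans (congr1 fine h)).
  by rewrite /= lte_fin oppr_lt0 a0/= sub0r opprK.
have dJ : lap_dom J (complex.Re s).
  have := integrable_subR dn dns; congr (_.-integrable _ _); apply/funext => w /=.
  by rewrite -mulrBl.
have bJ : cabs (lap J s - (a%:C)%C) <= 2 * (C1 * a * a).
  have -> : lap J s - (a%:C)%C = cintT (fun w => ((J w)%:C)%C * (cexp (s * (w%:C)%C) - 1)).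
    have -> : (a%:C)%C = cintT (fun w => ((J w)%:C)%C).
      by apply: complex_ext => /=; rewrite ?intJ// /Rintegral integral0.
    rewrite -cintTB.
    - by apply: eq_cintT => w; rewrite mulrBr mulr1.
    - exact: (lap_integrable mJ J0 dJ).
    - split => //=; rewrite (_ : EFin \o _ = cst 0%E)//; exact: integrable0.
  apply: (le_trans (cintT_bound _ (integrableZ (C1 * a) iJ) _)).
  - apply: cmeasM; first exact: cmeas_real.
    by apply: cmeasB; [exact: cmeas_cexp|exact: cmeas_cst].
  - move=> w; rewrite cabsM cabs_real ger0_norm// JE indicE mem_setE in_itv/=.
    have [/andP[w1 w2]|_] := boolP (- a <= w < 0); last by rewrite mul0r mulr0.
    rewrite mul1r mulr1.
    have wa : `|w| <= a by rewrite ler0_norm; lra.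
    rewrite -[cexp _ - 1](subrK (s * (w%:C)%C)) (le_trans (cabsD _ _))//.
    have t := cexp_taylor2 (s * (w%:C)%C).
    rewrite cabsM cabs_real in t *.
    have e1 : expR (cabs s * `|w|) <= expR (cabs s).
      by rewrite ler_expR ler_piMr ?cabs_ge0// (le_trans wa).
    rewrite /C1 mulrDl addrC lerD//; first by rewrite ler_wpM2l// cabs_ge0.
    apply: (le_trans t); rewrite /C2 exprMn.
    have wa2 : `|w| ^+ 2 <= a by rewrite expr2 -[leRHS]mulr1 ler_pM// (le_trans wa).
    apply: (@le_trans _ _ (4 * (cabs s ^+ 2 * a) * expR (cabs s))).
      apply: ler_pM => //; first by rewrite mulr_ge0// mulr_ge0// sqr_ge0.
      by rewrite ler_wpM2l// ler_wpM2l// sqr_ge0.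
    by rewrite le_eqVlt; apply/orP; left; apply/eqP; ring.
  by rewrite RintegralZl// intJ.
have bE : cabs (s * (a%:C)%C - (1 - cexp (- s * (a%:C)%C))) <= C2 * a * a.
  have := cexp_taylor2 (- s * (a%:C)%C).
  rewrite (_ : cexp _ - 1 - _ = s * (a%:C)%C - (1 - cexp (- s * (a%:C)%C))); last by ring.
  move=> /le_trans; apply; rewrite cabsM cabsN cabs_real (ger0_norm (ltW a0)).
  have e1 : expR (cabs s * a) <= expR (cabs s) by rewrite ler_expR ler_piMr ?cabs_ge0.
  rewrite /C2 (_ : 4 * cabs s ^+ 2 * _ * a * a = 4 * (cabs s * a) ^+ 2 * expR (cabs s)); last by ring.
  by apply: ler_wpM2l => //; rewrite mulr_ge0// sqr_ge0.
rewrite -(ler_pM2l a0) -[a in leLHS](ger0_norm (ltW a0)) -cabs_real -cabsM.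
have -> : (a%:C)%C * (s * L - 1) =
   (s * (a%:C)%C - (1 - cexp (- s * (a%:C)%C))) * L + (lap J s - (a%:C)%C).
  by rewrite eJ; ring.
rewrite (le_trans (cabsD _ _))// cabsM.
have -> : a * (a * (C2 * cabs L + 2 * C1)) = C2 * a * a * cabs L + 2 * (C1 * a * a) by ring.
by rewrite lerD// ler_wpM2r// cabs_ge0.
Qed.

End LaplaceTransform.

(** * Unordered sums of nonnegative extended reals *)

Section EsumExtra.
Variable R : realType.
Local Open Scope ereal_scope.

Lemma esum_ub (T : choiceType) (A : set T) (f : T -> \bar R) (M : \bar R) :
  (forall F, fsets A F -> \sum_(x \in F) f x <= M) -> \esum_(x in A) f x <= M.
Proof. by move=> h; apply: ge_ereal_sup => _ [F hF <-]; exact: h. Qed.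

Lemma esum_lb (T : choiceType) (A F : set T) (f : T -> \bar R) :
  fsets A F -> \sum_(x \in F) f x <= \esum_(x in A) f x.
Proof. by move=> hF; apply: ereal_sup_ubound; exists F. Qed.

Lemma esumZl (T : choiceType) (A : set T) (f : T -> \bar R) (k : R) : (0 <= k)%R ->
  (forall x, A x -> 0 <= f x) ->
  \esum_(x in A) (k%:E * f x) = k%:E * \esum_(x in A) f x.
Proof.
move=> k0 f0.
have le (c : R) (g : T -> \bar R) : (0 <= c)%R -> (forall x, A x -> 0 <= g x) ->
   \esum_(x in A) (c%:E * g x) <= c%:E * \esum_(x in A) g x.
  move=> c0 g0; apply: esum_ub => F [fF FA].
  rewrite fsbig_finite//= big_seq -ge0_sume_distrr; last first.
    by move=> x; rewrite in_fset_set// inE => /FA /g0.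
  rewrite -big_seq; apply: lee_wpmul2l; first by rewrite lee_fin.
  by rewrite -fsbig_finite//; exact: esum_lb.
apply/eqP; rewrite eq_le le//=.
have [->|kn0] := eqVneq k 0%R.
  by rewrite mul0e; apply: esum_ge0 => x _; rewrite mul0e.
have {}k0 : (0 < k)%R by rewrite lt_def kn0.
have kf0 x : A x -> 0 <= k%:E * f x.
  by move=> /f0 h; apply: mule_ge0 => //; rewrite lee_fin ltW.
have ki : (0 <= k^-1)%R by rewrite invr_ge0 ltW.
have := le k^-1%R _ ki kf0.
under eq_esum do rewrite muleA -EFinM mulVf ?gt_eqF// mul1e.
by rewrite lee_pdivlMl.
Qed.

Lemma esum_setS (T : choiceType) (A B : set T) (f : T -> \bar R) : A `<=` B ->
  \esum_(x in A) f x <= \esum_(x in B) f x.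
Proof.
move=> AB; apply: esum_ub => F [fF FA]; apply: esum_lb; split => //.
exact: subset_trans AB.
Qed.

Lemma esum_setU (T : choiceType) (A B : set T) (f : T -> \bar R) :
  (forall x, 0 <= f x) -> [disjoint A & B] ->
  \esum_(x in A `|` B) f x = \esum_(x in A) f x + \esum_(x in B) f x.
Proof.
move=> f0 dAB; rewrite (esumID A)//; congr (_ + _).
  congr (esum _ _); apply/seteqP; split => x; first by case.
  by move=> Ax; split => //; left.
congr (esum _ _); rewrite setIUl setICr set0U; apply: setIidl => x Bx Ax.
by move/disj_set2P: dAB => /seteqP[+ _] => /(_ x (conj Ax Bx)).
Qed.

Lemma esum_real (T : choiceType) (A : set T) (f : T -> \bar R) (M : R) :
  (forall x, A x -> 0 <= f x) -> \esum_(x in A) f x <= M%:E ->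
  exists2 r : R, (0 <= r)%R & \esum_(x in A) f x = r%:E.
Proof.
move=> f0 h; have h0 : 0 <= \esum_(x in A) f x by exact: esum_ge0.
exists (fine (\esum_(x in A) f x)); first exact: fine_ge0.
by rewrite fineK// ge0_fin_numE// (le_lt_trans h)// ltry.
Qed.

End EsumExtra.

(** * Gaussian sums over the integers *)

Section GaussianSum1.
Variable R : realType.
Local Notation mu := (@lebesgue_measure R).
Implicit Types (A x y : R).

Definition gaussA A x : R := expR (- (pi * A * x ^+ 2)).

Lemma gaussA_ge0 A x : 0 <= gaussA A x.
Proof. exact: expR_ge0. Qed.

Lemma gaussA_le1 A x : 0 <= A -> gaussA A x <= 1.
Proof.
move=> A0; rewrite -expR0 ler_expR oppr_le0 mulr_ge0 ?sqr_ge0 ?mulr_ge0 ?pi_ge0//.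
Qed.

Lemma gaussA_decr A x y : 0 <= A -> 0 <= x -> x <= y -> gaussA A y <= gaussA A x.
Proof.
move=> A0 x0 xy; rewrite ler_expR lerN2 ler_wpM2l ?mulr_ge0 ?pi_ge0//.
by rewrite ler_sqr ?nnegrE// (le_trans x0).
Qed.

Lemma gaussAN A x : gaussA A (- x) = gaussA A x.
Proof. by rewrite /gaussA sqrrN. Qed.

Lemma continuous_gaussA A : continuous (gaussA A).
Proof.
move=> x; apply: continuous_comp; last exact: continuous_expR.
apply: cvgN; apply: cvgMr; exact: exprn_continuous.
Qed.

Lemma measurable_gaussA A : measurable_fun setT (gaussA A).
Proof. by apply: continuous_measurable_fun; exact: continuous_gaussA. Qed.

Lemma integral_gaussA A : 0 < A ->
  (\int[mu]_x (gaussA A x)%:E = (Num.sqrt A)^-1%:E)%E.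
Proof.
(* [s] is the standard deviation for which the normal density is proportional to [gaussA A]. *)
move=> A0; pose s := Num.sqrt (2 * pi * A)^-1.
have pA : 0 < 2 * pi * A by rewrite !mulr_gt0// pi_gt0.
have s0 : 0 < s by rewrite sqrtr_gt0 invr_gt0.
have s2 : s ^+ 2 = (2 * pi * A)^-1 by rewrite sqr_sqrtr// invr_ge0 ltW.
have pi0 : pi != 0 :> R by rewrite gt_eqF// pi_gt0.
have An0 : A != 0 by rewrite gt_eqF.
have fld (p B x : R) : p != 0 -> B != 0 ->
    - x ^+ 2 / ((2 * p * B)^-1 * 2) = - (p * B * x ^+ 2) /\ (2 * p * B)^-1 * p * 2 = B^-1.
  by move=> p0 B0; split; field; rewrite ?p0 ?B0.
have key (x : R) : normal_fun 0 s x = gaussA A x.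
  rewrite /normal_fun /gaussA subr0 -mulr_natr s2; congr expR.
  exact: (fld _ _ _ pi0 An0).1.
have := @integral_normal_pdf R 0 s.
have c0 : 0 < normal_peak s by rewrite normal_peak_gt0// gt_eqF.
under eq_integral => x _.
  rewrite normal_pdfE ?gt_eqF//.
  rewrite key EFinM.
  over.
rewrite ge0_integralZl//; last 3 first.
  by apply/measurable_EFinP; exact: measurable_gaussA.
  by move=> x _; rewrite lee_fin gaussA_ge0.
  by rewrite lee_fin ltW.
move=> h.
have : ((normal_peak s)^-1%:E * ((normal_peak s)%:E * \int[mu]_x (gaussA A x)%:E) =
   (normal_peak s)^-1%:E)%E by rewrite h mule1.
rewrite muleA -EFinM mulVf ?gt_eqF// mul1e => ->.
rewrite /normal_peak invrK s2 -mulr_natr -sqrtrV ?(ltW A0)//; congr (Num.sqrt _)%:E.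
exact: (fld _ _ 0 pi0 An0).2.
Qed.

Lemma integral0y_gaussA A : 0 < A ->
  (\int[mu]_(x in `[0%R, +oo[) (gaussA A x)%:E = ((Num.sqrt A)^-1 / 2)%:E)%E.
Proof.
move=> A0; have := integral_gaussA A0.
rewrite (@ge0_symfun_integralT R (gaussA A)); last 3 first.
- by move=> x; exact: gaussA_ge0.
- exact: continuous_gaussA.
- by move=> x /=; rewrite gaussAN.
rewrite (_ : [set x | (0 <= x)%R] = `[0%R, +oo[%classic); last first.
  by apply/seteqP; split => x/=; rewrite in_itv/= andbT.
move=> h; have : (2^-1%:E * (2%:E * \int[mu]_(x in `[0%R, +oo[) (gaussA A x)%:E) =
   2^-1%:E * (Num.sqrt A)^-1%:E)%E by rewrite h.
by rewrite muleA -EFinM mulVf// mul1e => ->; rewrite -EFinM mulrC.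
Qed.

Lemma itv0y_bigcup : `[0%R, +oo[%classic = \bigcup_k `[k%:R, k.+1%:R[%classic :> set R.
Proof.
apply/seteqP; split => x /=.
  rewrite in_itv/= andbT => x0; exists (Num.trunc x) => //=.
  by rewrite in_itv/=; exact: truncn_itv.
move=> [k _ /=]; rewrite !in_itv/= andbT => /andP[kx _].
exact: le_trans kx.
Qed.

Lemma gauss_int_test A : 0 < A ->
  ((\sum_(k <oo) (gaussA A k.+1%:R)%:E <= ((Num.sqrt A)^-1 / 2)%:E) /\
   (((Num.sqrt A)^-1 / 2)%:E <= \sum_(k <oo) (gaussA A k%:R)%:E))%E.
Proof.
move=> A0; rewrite -integral0y_gaussA// itv0y_bigcup.
rewrite ge0_integral_bigcup//; last 3 first.
- apply/measurable_EFinP/measurable_funTS; exact: measurable_gaussA.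
- by move=> x _; rewrite lee_fin gaussA_ge0.
- apply/trivIsetP => i j _ _ ij; apply/seteqP; split => // x [/=].
  rewrite !in_itv/= => /andP[a1 a2] /andP[a3 a4].
  have : (i < j.+1)%N by rewrite -(ltr_nat R) (le_lt_trans a1).
  have : (j < i.+1)%N by rewrite -(ltr_nat R) (le_lt_trans a3).
  by rewrite !ltnS => h1 h2; move: ij; rewrite eqn_leq h1 h2.
have cst (k : nat) (c : R) : (0 <= c)%R -> (\int[mu]_(x in `[k%:R, k.+1%:R[) c%:E = c%:E)%E.
  move=> c0; rewrite integral_cst//.
  rewrite -[RHS]mule1; congr (_ * _)%E.
  have h := @lebesgue_measure_itv R `[k%:R, k.+1%:R[; apply: (etrans h).
  by rewrite /= lte_fin ltr_nat ltnSn -EFinB -natrB// subSnn.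
split; apply: lee_nneseries => //.
- by move=> k _; rewrite lee_fin gaussA_ge0.
- move=> k _; rewrite -[leLHS](cst k) ?gaussA_ge0//; apply: ge0_le_integral => //.
  + by move=> x _; rewrite lee_fin gaussA_ge0.
  + by apply/measurable_EFinP/measurable_funTS; exact: measurable_gaussA.
  + move=> x; rewrite /= in_itv/= => /andP[kx xk].
    by rewrite lee_fin gaussA_decr ?(ltW A0) ?(ltW xk)// (le_trans _ kx).
- by move=> k _ _; apply: integral_ge0 => x _; rewrite lee_fin gaussA_ge0.
- move=> k _; rewrite -[leRHS](cst k) ?gaussA_ge0//; apply: ge0_le_integral => //.
  + by move=> x _; rewrite lee_fin gaussA_ge0.
  + by apply/measurable_EFinP/measurable_funTS; exact: measurable_gaussA.
  + move=> x; rewrite /= in_itv/= => /andP[kx xk].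
    by rewrite lee_fin gaussA_decr ?(ltW A0).
Qed.

(** By monotonicity the shifted sum lies between the sums over k >= 1 and over k >= 0. These enclose
    the integral and differ by the term at 0, which is at most 1. *)
Lemma half_gauss_sum A y : 0 < A -> 0 <= y <= 1 ->
  (((Num.sqrt A)^-1 / 2 - 1)%:E <= \sum_(k <oo) (gaussA A (k%:R + y))%:E /\
   \sum_(k <oo) (gaussA A (k%:R + y))%:E <= ((Num.sqrt A)^-1 / 2 + 1)%:E)%E.
Proof.
move=> A0 /andP[y0 y1]; have [t1 t2] := gauss_int_test A0.
have g0 (x : R) : (0 <= (gaussA A x)%:E)%E by rewrite lee_fin gaussA_ge0.
have t3 : (\sum_(k <oo) (gaussA A k%:R)%:E =
   (gaussA A 0)%:E + \sum_(k <oo) (gaussA A k.+1%:R)%:E)%E.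
  rewrite (@nneseries_recl R xpredT (fun k => (gaussA A k%:R)%:E))//; congr (_ + _)%E.
  by rewrite -(@nneseries_addn R (fun k => (gaussA A k%:R)%:E) 1%N)//; apply: eq_eseriesr => k _; rewrite addn1.
have g1 : ((gaussA A 0)%:E <= 1)%E by rewrite lee_fin gaussA_le1// ltW.
split.
  apply: (@le_trans _ _ (\sum_(k <oo) (gaussA A k.+1%:R)%:E)%E); last first.
    apply: lee_nneseries => // k _; rewrite lee_fin gaussA_decr ?(ltW A0) ?addr_ge0//.
    by rewrite -natr1 lerD2l.
  rewrite EFinB leeBlDl//; apply: (le_trans t2); rewrite t3; exact: leeD.
apply: (@le_trans _ _ (\sum_(k <oo) (gaussA A k%:R)%:E)%E).
  apply: lee_nneseries => // k _; rewrite lee_fin gaussA_decr ?(ltW A0)//.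
  by rewrite lerDl.
by rewrite t3 EFinD addeC; exact: leeD.
Qed.

(** The error 2 is uniform in A and in the shift y. This uniformity is what allows the induction on
    the dimension, where y depends on the other coordinates. *)
Lemma gauss_sum A y : 0 < A -> exists2 r : R,
  (\esum_(c in [set: int]) (gaussA A (c%:~R + y))%:E)%E = r%:E &
  `|r - (Num.sqrt A)^-1| <= 2.
Proof.
move=> A0.
have g0 (x : R) : (0 <= (gaussA A x)%:E)%E by rewrite lee_fin gaussA_ge0.
pose m := Num.floor y.
have y01 : 0 <= y - m%:~R <= 1.
  have /andP[h1 h2] := floor_itv y.
  by rewrite subr_ge0 h1 lerBlDl (le_trans (ltW h2))// intrD1 addrC.
have e1 : (\esum_(c in [set: int]) (gaussA A (c%:~R + y))%:E =
   \esum_(c in [set: int]) (gaussA A (c%:~R + (y - m%:~R)))%:E)%E.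
  rewrite (@reindex_esum R _ _ setT setT (fun c : int => c - m)); last first.
    split => //; first by move=> a b _ _ /= /addIr.
    by move=> c _; exists (c + m) => //; rewrite addrK.
  by apply: eq_esum => c _; rewrite intrB -addrA [- _ + y]addrC.
pose P := [set Posz k | k in [set: nat]]; pose N := [set Negz k | k in [set: nat]].
have PN : [set: int] = P `|` N.
  by apply/seteqP; split => // -[k|k] _; [left|right]; exists k.
have dPN : [disjoint P & N].
  by apply/disj_set2P/seteqP; split => // x [[k _ <-] [l _]].
rewrite e1 PN esum_setU// !esum_image//; try by move=> a b _ _ [].
rewrite -!nneseries_esumT//.
have [l1 u1] := half_gauss_sum A0 y01.
have y01' : 0 <= 1 - (y - m%:~R) <= 1 by move: y01; lra.
have [l2 u2] := half_gauss_sum A0 y01'.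
(* [Negz k] stands for -(k + 1), so after reflection the negative half is a half sum with the
   complementary shift. *)
have e2 : (\sum_(k <oo) (gaussA A ((Negz k)%:~R + (y - m%:~R)))%:E =
   \sum_(k <oo) (gaussA A (k%:R + (1 - (y - m%:~R))))%:E)%E.
  apply: eq_eseriesr => k _; rewrite -gaussAN; congr ((gaussA A _)%:E).
  by rewrite NegzE mulrNz -pmulrn -natr1; lra.
rewrite e2.
have fin (u : \bar R) (a b : R) : (a%:E <= u)%E -> (u <= b%:E)%E -> u = (fine u)%:E.
  move=> h1 h2; rewrite fineK// fin_real// (lt_le_trans _ h1) ?ltNyr//.
  by rewrite (le_lt_trans h2)// ltry.
move: l1 u1 l2 u2; rewrite (_ : (\sum_(k <oo) (gaussA A ((Posz k)%:~R + (y - m%:~R)))%:E)%E =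
   (\sum_(k <oo) (gaussA A (k%:R + (y - m%:~R)))%:E)%E)//.
set u := (X in (_ <= X)%E -> _); move=> l1 u1.
set v := (X in (_ <= X)%E -> _); move=> l2 u2.
exists (fine u + fine v); first by rewrite EFinD -(fin _ _ _ l1 u1) -(fin _ _ _ l2 u2).
have E1 := fin _ _ _ l1 u1; have E2 := fin _ _ _ l2 u2.
have {}u1 : (u <= ((Num.sqrt A)^-1 / 2 + 1)%:E)%E by exact: u1.
have {}u2 : (v <= ((Num.sqrt A)^-1 / 2 + 1)%:E)%E by exact: u2.
rewrite E1 lee_fin in l1; rewrite E1 lee_fin in u1.
rewrite E2 lee_fin in l2; rewrite E2 lee_fin in u2.
rewrite ler_norml; lra.
Qed.

End GaussianSum1.

(** * Theta series of positive definite quadratic forms at small t *)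

Section GaussianSumN.
Variable R : realType.

Definition qform n (S : 'M[R]_n) (v : 'rV[R]_n) : R := (v *m S *m v^T) 0 0.

Definition posdef n (S : 'M[R]_n) := S^T = S /\ forall v, v != 0 -> 0 < qform S v.

Definition lattice_theta n (S : 'M[R]_n) (t : R) (y : 'rV[R]_n) : \bar R :=
  (\esum_(c in [set: 'rV[int]_n]) (expR (- (pi * t * qform S (map_mx intr c + y))))%:E)%E.

(** Completing the square in the first coordinate; it fibres an n-dimensional Gaussian sum into
    one-dimensional ones. *)
Lemma schur_complement n (S : 'M[R]_(1 + n)) : posdef S ->
  exists (a : R) (l : 'rV[R]_n) (S' : 'M[R]_n), [/\ 0 < a, posdef S', \det S = a * \det S' &
    forall (x : R) (u : 'rV[R]_n),
      qform S (row_mx x%:M u) = a * (x + (l *m u^T) 0 0) ^+ 2 + qform S' u].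
Proof.
move=> [symS pS].
pose a := S 0 0; pose b : 'rV[R]_n := ursubmx S; pose S0 : 'M[R]_n := drsubmx S.
have aE : ulsubmx S = a%:M.
  apply/matrixP => i j; rewrite !ord1 !mxE eqxx mulr1n /a; congr (S _ _); exact/val_inj.
have bE : dlsubmx S = b^T.
  by rewrite /b -[in LHS]symS trmx_ursub -?trmx_dlsub.
have SE : S = block_mx a%:M b b^T S0 by rewrite -aE -bE submxK.
have symS0 : S0^T = S0 by rewrite /S0 trmx_drsub symS.
have a0 : 0 < a.
  have := pS (row_mx 1%:M 0); rewrite /qform SE.
  rewrite mul_row_block mul1mx !mul0mx addr0 mul1mx addr0 tr_row_mx mul_row_col trmx0 mulmx0 addr0.
  rewrite trmx1 mulmx1 mxE eqxx mulr1n; apply.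
  by apply/eqP => /(congr1 lsubmx)/matrixP/(_ 0 0); rewrite row_mxKl !mxE eqxx => /eqP; rewrite oner_eq0.
pose l : 'rV[R]_n := a^-1 *: b.
pose S' := S0 - a *: (l^T *m l).
have q x u : qform S (row_mx x%:M u) = a * (x + (l *m u^T) 0 0) ^+ 2 + qform S' u.
  rewrite /qform SE mul_row_block tr_row_mx mul_row_col tr_scalar_mx.
  rewrite !mulmxDl !mul_scalar_mx !mul_mx_scalar -!scalemxAl.
  have sc (p q : 'M[R]_1) : (p + q) 0 0 = p 0 0 + q 0 0 by rewrite mxE.
  rewrite !sc.
  have e1 : (l *m u^T) 0 0 = a^-1 * (b *m u^T) 0 0 by rewrite /l -scalemxAl mxE.
  have e2 : (u *m b^T) 0 0 = (b *m u^T) 0 0.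
    by rewrite -[LHS]/((u *m b^T) 0 0) -[u in LHS]trmxK -trmx_mul mxE.
  have e3 : (u *m (a *: (l^T *m l)) *m u^T) 0 0 = a * ((l *m u^T) 0 0) ^+ 2.
    rewrite -scalemxAr -scalemxAl mxE (_ : u *m _ *m _ = u *m l^T *m (l *m u^T)); last by rewrite !mulmxA.
    have -> : u *m l^T = ((l *m u^T) 0 0)%:M.
      rewrite -[u in LHS]trmxK -trmx_mul; apply/matrixP => i j.
      by rewrite !ord1 !mxE eqxx mulr1n.
    by rewrite mul_scalar_mx mxE expr2.
  have scB (p q : 'M[R]_1) : (p - q) 0 0 = p 0 0 - q 0 0 by rewrite !mxE.
  rewrite /S' mulmxBr mulmxBl scB e3 e1.
  have e4 (k : R) (M : 'M[R]_1) : (k *: M) 0 0 = k * M 0 0 by rewrite mxE.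
  have e5 : (a%:M : 'M[R]_1) 0 0 = a by rewrite mxE eqxx mulr1n.
  rewrite !e4 e2 e5; move: (a) a0 => a' a0'; field; rewrite ?gt_eqF//.
exists a, l, S'; split => //.
- split.
    by rewrite /S' linearB linearZ /= trmx_mul trmxK symS0.
  move=> u u0; have := pS (row_mx (- (l *m u^T) 0 0)%:M u); rewrite q addNr expr0n mulr0 add0r.
  by apply; apply: contraNneq u0 => /(congr1 rsubmx); rewrite row_mxKr linear0 => ->.
- have -> : S = block_mx 1%:M 0 l^T 1%:M *m block_mx a%:M 0 0 S' *m block_mx 1%:M l 0 1%:M.
    rewrite !mulmx_block !mul0mx !mulmx0 !mul1mx !mulmx1 !addr0 !add0r SE.
    have al : a *: l = b by rewrite /l scalerA mulfV ?scale1r// gt_eqF.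
    congr block_mx.
    + by rewrite mul_scalar_mx al.
    + by rewrite mul_mx_scalar -al linearZ.
    + by rewrite mul_mx_scalar -scalemxAl /S' addrC subrK.
  by rewrite !det_mulmx det_lblock det_ublock det_ublock !det1 !mul1r mulr1 det_scalar1.
Qed.

Lemma lattice_theta_ge0 n (S : 'M[R]_n) t y : (0 <= lattice_theta S t y)%E.
Proof. by apply: esum_ge0 => c _; rewrite lee_fin expR_ge0. Qed.

(** Induction on the dimension: for fixed last coordinates the sum over the first one is a
    one-dimensional Gaussian sum, known up to an error 2 that does not depend on those coordinates.
    After normalisation this error has relative size sqrt(t a). *)
Lemma lattice_theta_asymp n (S : 'M[R]_n) : posdef S -> 0 < \det S /\
  exists2 C : R, 0 <= C & forall (t : R) (y : 'rV[R]_n), 0 < t <= 1 ->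
    exists2 r : R, lattice_theta S t y = r%:E &
      `|Num.sqrt (t ^+ n * \det S) * r - 1| <= C * Num.sqrt t.
Proof.
elim: n S => [|n IH] S pS.
  split; first by rewrite det_mx00.
  exists 0 => // t y _; exists 1; last first.
    by rewrite det_mx00 expr0 mul1r sqrtr1 mul1r subrr normr0 mul0r.
  rewrite /lattice_theta (_ : [set: 'rV[int]_0] = [set 0]); last first.
    by apply/seteqP; split => // c _ /=; apply/matrixP => i [].
  rewrite esum_set1 ?lee_fin ?expR_ge0//.
  by rewrite /qform mxE big_ord0 mulr0 oppr0 expR0.
have [a [l [S' [a0 pS' dS q]]]] := schur_complement pS.
have [d0 [C C0 hC]] := IH S' pS'.
split; first by rewrite dS mulr_gt0.
exists (C + 2 * Num.sqrt a * (1 + C)).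
  by rewrite addr_ge0// !mulr_ge0 ?sqrtr_ge0 ?addr_ge0.
move=> t y /andP[t0 t1].
pose y0 : R := y 0 0; pose y' : 'rV[R]_n := @rsubmx R 1 1 n y.
have yE : y = row_mx y0%:M y' :> 'rV[R]_(1 + n).
  rewrite -[LHS](@hsubmxK R 1 1 n); congr row_mx; apply/matrixP => i j.
  by rewrite !ord1 !mxE eqxx mulr1n /y0; congr (y _ _); exact/val_inj.
have t01 : 0 < t <= 1 by rewrite t0.
have [r' hr' br'] := hC t y' t01.
have ta : 0 < t * a by rewrite mulr_gt0.
pose I c' := (\esum_(c0 in [set: int]) (gaussA (t * a) (c0%:~R + (y0 + (l *m (map_mx intr c' + y')^T) 0 0)))%:E)%E.
pose g (c' : 'rV[int]_n) := expR (- (pi * t * qform S' (map_mx intr c' + y'))).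
have thE : lattice_theta S t y = (\esum_(c' in [set: 'rV[int]_n]) ((g c')%:E * I c'))%E.
  have -> : (\esum_(c' in [set: 'rV[int]_n]) ((g c')%:E * I c') =
    \esum_(c' in [set: 'rV[int]_n]) \esum_(c0 in [set: int]) ((g c')%:E *
     (gaussA (t * a) (c0%:~R + (y0 + (l *m (map_mx intr c' + y')^T) 0 0)))%:E))%E.
    apply: eq_esum => c' _; rewrite esumZl ?expR_ge0// => c0 _.
    by rewrite lee_fin gaussA_ge0.
  rewrite esum_esum; last by move=> c' c0 _ _; rewrite -EFinM lee_fin mulr_ge0 ?expR_ge0 ?gaussA_ge0.
  rewrite /lattice_theta.
  rewrite (@reindex_esum R _ _ ([set: 'rV[int]_n] `*`` (fun=> [set: int])) setT
    (fun k : 'rV[int]_n * int => row_mx (k.2)%:M k.1 : 'rV[int]_(1 + n))); last first.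
    split => //.
    - move=> [u1 x1] [u2 x2] _ _ /= e.
      have := congr1 (@rsubmx _ 1 1 n) e; rewrite !row_mxKr => ->.
      have := congr1 (@lsubmx _ 1 1 n) e; rewrite !row_mxKl => /matrixP/(_ 0 0).
      by rewrite !mxE eqxx !mulr1n => ->.
    - move=> c _; exists (@rsubmx _ 1 1 n c, c 0 0) => //=.
      rewrite -[RHS](@hsubmxK _ 1 1 n); congr row_mx; apply/matrixP => i j.
      by rewrite !ord1 !mxE eqxx mulr1n; congr (c _ _); exact/val_inj.
  apply: eq_esum => -[c' c0] _ /=.
  have -> : map_mx intr (row_mx c0%:M c' : 'rV[int]_(1 + n)) + y =
      row_mx (c0%:~R + y0)%:M (map_mx intr c' + y').
    by rewrite yE map_row_mx map_scalar_mx/= add_row_mx raddfD.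
  rewrite q.
  rewrite /g /gaussA -EFinM -expRD; congr ((expR _)%:E).
  rewrite addrA; ring.
have Ib c' : exists2 r : R, I c' = r%:E & `|r - (Num.sqrt (t * a))^-1| <= 2.
  exact: gauss_sum.
set w := Num.sqrt (t * a) in Ib.
have w0 : 0 < w by rewrite sqrtr_gt0.
have r'0 : 0 <= r' by rewrite -lee_fin -hr' lattice_theta_ge0.
have upp : (lattice_theta S t y <= ((w^-1 + 2) * r')%:E)%E.
  rewrite thE EFinM -hr' /lattice_theta -esumZl; last 2 first.
    by rewrite addr_ge0// invr_ge0 ltW.
    by move=> c _; rewrite lee_fin expR_ge0.
  apply: le_esum => c' _; have [s -> bs] := Ib c'.
  rewrite -!EFinM lee_fin mulrC ler_wpM2r ?expR_ge0//.
  by move: bs; rewrite ler_norml; lra.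
have [r r0 rE] : exists2 r : R, 0 <= r & lattice_theta S t y = r%:E.
  by apply: esum_real upp => c _; rewrite lee_fin expR_ge0.
exists r => //.
have upr : r <= (w^-1 + 2) * r' by rewrite -lee_fin -rE.
have low : (w^-1 - 2) * r' <= r.
  (* If the lower factor is not positive the bound is trivial; otherwise it is nonnegative and can
     be pulled out of the sum. *)
  have [h|h] := leP (w^-1 - 2) 0.
    by apply: le_trans r0; rewrite mulr_le0_ge0.
  rewrite -lee_fin -rE thE EFinM -hr' /lattice_theta -esumZl; last 2 first.
    exact: ltW.
    by move=> c _; rewrite lee_fin expR_ge0.
  apply: le_esum => c' _; have [s -> bs] := Ib c'.
  rewrite -!EFinM lee_fin [leRHS]mulrC ler_wpM2r ?expR_ge0//.
  by move: bs; rewrite ler_norml; lra.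
set D := Num.sqrt (t ^+ n * \det S') in br'.
have DE : Num.sqrt (t ^+ n.+1 * \det S) = w * D.
  rewrite /w /D -sqrtrM ?(ltW ta)//; congr Num.sqrt; rewrite dS exprS; ring.
have D0 : 0 <= D by exact: sqrtr_ge0.
rewrite DE.
have wE : w = Num.sqrt a * Num.sqrt t by rewrite /w mulrC sqrtrM// ltW.
set st := Num.sqrt t in wE br' *.
have st0 : 0 <= st by exact: sqrtr_ge0.
have st1 : st <= 1 by rewrite -sqrtr1 ler_wsqrtr.
have sa0 : 0 <= Num.sqrt a by exact: sqrtr_ge0.
pose X := w * D * r; pose X' := D * r'.
have X'0 : 0 <= X' by rewrite mulr_ge0.
have X1 : X <= X' + 2 * w * X'.
  have : w * D * r <= w * D * ((w^-1 + 2) * r') by rewrite ler_wpM2l// mulr_ge0// ltW.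
  rewrite (_ : w * D * ((w^-1 + 2) * r') = X' + 2 * w * X')//.
  by rewrite /X'; field; rewrite gt_eqF.
have X2 : X' - 2 * w * X' <= X.
  have : w * D * ((w^-1 - 2) * r') <= w * D * r by rewrite ler_wpM2l// mulr_ge0// ltW.
  rewrite (_ : w * D * ((w^-1 - 2) * r') = X' - 2 * w * X')//.
  by rewrite /X'; field; rewrite gt_eqF.
have X'1 : X' <= 1 + C.
  by move: br'; rewrite -/X' ler_norml => /andP[_ h]; have := ler_wpM2l C0 st1; lra.
have k1 : 2 * w * X' <= 2 * (Num.sqrt a * st) * (1 + C).
  by rewrite wE ler_wpM2l// !mulr_ge0.
move: br'; rewrite -/X -/X' !ler_norml; lra.
Qed.
End GaussianSumN.

(** * Exchange of countable sums and integrals *)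

Section CountableSums.
Context d (T : measurableType d) (R : realType) (mu : {measure set T -> \bar R}).
Local Open Scope ereal_scope.

(** The enumeration is fixed before the family [a], so the same one serves for all points t in
    [measurable_esum] and [integral_esum]. *)
Lemma esum_nat (I : choiceType) (A : set I) : countable A -> exists2 i0 : nat -> option I,
  (forall k i, i0 k = Some i -> A i) &
  forall a : I -> \bar R, (forall i, A i -> 0 <= a i) ->
   \esum_(i in A) a i = \sum_(k <oo) (if i0 k is Some i then a i else 0).
Proof.
move=> /countable_injP[f fI].
pose P k i := A i /\ f i = k.
pose i0 k := if pselect (exists i, P k i) is left e then Some (projT1 (cid e)) else None.
have i0A k i : i0 k = Some i -> P k i.
  by rewrite /i0; case: pselect => // e [<-]; case: (cid e).
have i0f i : A i -> i0 (f i) = Some i.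
  move=> Ai; rewrite /i0; case: pselect => [e|]; last by case; exists i.
  by case: (cid e) => j /= [Aj fj]; congr Some; apply: fI; rewrite ?inE.
exists i0; first by move=> k i /i0A[].
move=> a a0; pose b k := if i0 k is Some i then a i else 0.
have b0 k : 0 <= b k.
  by rewrite /b; case e : (i0 k) => [i|//]; apply: a0; have [] := i0A _ _ e.
rewrite nneseries_esumT//; apply/eqP; rewrite eq_le; apply/andP; split.
  have -> : \esum_(i in A) a i = \esum_(k in f @` A) b k.
    rewrite (@reindex_esum R _ _ A (f @` A) f).
      by apply: eq_esum => i Ai; rewrite /b i0f.
    split => //; by move=> i Ai; exists i.
  exact: esum_setS.
have -> : \esum_(k in [set: nat]) b k = \esum_(k in f @` A) b k.
  rewrite [LHS](esumID (f @` A))// setTI setTI [X in _ + X]esum1 ?adde0//.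
  move=> k nk; rewrite /b; case e : (i0 k) => [i|//]; exfalso; apply: nk.
  by have [Ai fi] := i0A _ _ e; exists i.
rewrite (@reindex_esum R _ _ A (f @` A) f).
  by rewrite le_eqVlt; apply/orP; left; apply/eqP; apply: eq_esum => i Ai; rewrite /b i0f.
by split => //; move=> i Ai; exists i.
Qed.

Lemma measurable_esum (I : choiceType) (A : set I) (f : I -> T -> \bar R) : countable A ->
  (forall i, A i -> measurable_fun setT (f i)) -> (forall i t, A i -> 0 <= f i t) ->
  measurable_fun setT (fun t => \esum_(i in A) f i t).
Proof.
move=> /esum_nat[i0 i0A h] mf f0.
have -> : (fun t => \esum_(i in A) f i t) =
   (fun t => \sum_(k <oo) (if i0 k is Some i then f i t else 0)).
  by apply/funext => t; apply: (h (f^~ t)) => i; exact: f0.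
apply: ge0_emeasurable_sum => [k t _ _|k _].
  by case e : (i0 k) => [i|//]; apply: f0; exact: i0A e.
case e : (i0 k) => [i|//]; apply: mf; exact: i0A e.
Qed.

Lemma integral_esum (I : choiceType) (A : set I) (f : I -> T -> \bar R) : countable A ->
  (forall i, A i -> measurable_fun setT (f i)) -> (forall i t, A i -> 0 <= f i t) ->
  \int[mu]_t (\esum_(i in A) f i t) = \esum_(i in A) \int[mu]_t f i t.
Proof.
move=> /esum_nat[i0 i0A h] mf f0.
rewrite h; last by move=> i Ai; apply: integral_ge0 => t _; exact: f0.
have e t : \esum_(i in A) f i t = \sum_(k <oo) (if i0 k is Some i then f i t else 0).
  by apply: (h (f^~ t)) => i; exact: f0.
under eq_integral do rewrite e.
rewrite integral_nneseries//; last 2 first.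
- move=> k; case ek : (i0 k) => [i|//]; apply: mf; exact: i0A ek.
- by move=> k t _; case ek : (i0 k) => [i|//]; apply: f0; exact: i0A ek.
apply: eq_eseriesr => k _; case: (i0 k) => [i //|]; exact: integral0.
Qed.

Lemma integral_gt0 (f : T -> \bar R) : measurable_fun setT f -> (forall t, 0 < f t) ->
  0 < mu setT -> 0 < \int[mu]_t f t.
Proof.
move=> mf f0 m0; rewrite lt_def integral_ge0 ?andbT => [|t _]; last exact/ltW.
apply/eqP => e.
have /ae_eq_integral_abs : \int[mu]_t `|f t| = 0.
  by rewrite -[RHS]e; apply: eq_integral => t _; rewrite gee0_abs// ltW.
move=> /(_ measurableT mf) [A [mA A0 h]].
have AT : A = setT.
  apply/seteqP; split => // t _; apply: h => /= /(_ I) e'.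
  by have := f0 t; rewrite e' ltxx.
by move: m0; rewrite -AT A0 ltxx.
Qed.

End CountableSums.

(** * Products of sigma-finite measures *)

Section SigmaFiniteProduct.
Context d1 d2 (T1 : measurableType d1) (T2 : measurableType d2) (R : realType).
Variables (m1 : {sigma_finite_measure set T1 -> \bar R})
  (m2 : {sigma_finite_measure set T2 -> \bar R}).

Definition sigma_finite_prod_fun := product_measure1 m1 m2.

HB.instance Definition _ := Measure.on sigma_finite_prod_fun.

Lemma sigma_finite_prodP : sigma_finite setT sigma_finite_prod_fun.
Proof.
have /sigma_finiteP[F [FT Fnd Fm]] := sigma_finiteT m1.
have /sigma_finiteP[G [GT Gnd Gm]] := sigma_finiteT m2.
exists (fun k => F k `*` G k).
  apply/seteqP; split => // -[x y] _.
  have [i _ Fx] : (\bigcup_k F k) x by rewrite -FT.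
  have [j _ Gy] : (\bigcup_k G k) y by rewrite -GT.
  exists (maxn i j) => //; split => /=.
    by have /subsetPset := Fnd _ _ (leq_maxl i j); apply.
  by have /subsetPset := Gnd _ _ (leq_maxr i j); apply.
move=> k; have [mF Ff] := Fm k; have [mG Gf] := Gm k.
split; first exact: measurableX.
rewrite /sigma_finite_prod_fun product_measure1E//.
by apply: lte_mul_pinfty => //; rewrite ge0_fin_numE.
Qed.

HB.instance Definition _ :=
  Measure_isSigmaFinite.Build _ _ _ sigma_finite_prod_fun sigma_finite_prodP.

Definition sigma_finite_prod : {sigma_finite_measure set (T1 * T2)%type -> \bar R} :=
  sigma_finite_prod_fun.

End SigmaFiniteProduct.

(** * Euclidean space through coordinates and translations *)

Section TranslationSpace.
Variable R : realType.
Local Notation mu := (@lebesgue_measure R).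

(* R^n with Lebesgue measure, kept abstract: only the coordinates and the
   translations are needed, and the space is built by induction on n. *)
Record translation_space (n : nat) := TranslationSpace {
  ts_disp : measure_display;
  ts_type : measurableType ts_disp;
  ts_measure : {sigma_finite_measure set ts_type -> \bar R};
  ts_coord : 'I_n -> ts_type -> R;
  ts_trans : ('I_n -> R) -> ts_type -> ts_type;
  ts_coord_meas : forall i, measurable_fun setT (ts_coord i);
  ts_trans_meas : forall a, measurable_fun setT (ts_trans a);
  ts_coord_trans : forall a t i, ts_coord i (ts_trans a t) = ts_coord i t + a i;
  ts_integral_trans : forall a (F : ts_type -> \bar R), measurable_fun setT F ->
    (forall t, 0%E <= F t)%E ->
    (\int[ts_measure]_t F (ts_trans a t) = \int[ts_measure]_t F t)%E;
  ts_exp_fin : forall k : R, 0 < k ->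
    (\int[ts_measure]_t (expR (- (k * \sum_i `|ts_coord i t|)))%:E < +oo)%E;
  ts_nonzero : (0 < ts_measure setT)%E }.

Lemma integral_expR_abs (k : R) : 0 < k ->
  (\int[mu]_x (expR (- (k * `|x|)))%:E < +oo)%E.
Proof.
move=> k0.
have c : continuous (fun x : R => expR (- (k * `|x|))).
  move=> x; apply: continuous_comp; last exact: continuous_expR.
  by apply: cvgN; apply: cvgMr; exact: norm_continuous.
rewrite (@ge0_symfun_integralT R (fun x => expR (- (k * `|x|))))//; last first.
  by move=> x /=; rewrite normrN.
rewrite lte_mul_pinfty//.
apply: (@le_lt_trans _ _ (\int[mu]_x (k^-1 * exponential_pdf k x)%:E)%E).
  rewrite integral_mkcond; apply: ge0_le_integral => //.
  - by move=> x _; rewrite patchE; case: ifP => // _; rewrite lee_fin expR_ge0.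
  - apply/(measurable_restrictT _ _).1.
      by rewrite (_ : [set x | _] = `[0%R, +oo[%classic)//; apply/seteqP; split => x/=; rewrite in_itv/= andbT.
    apply/measurable_EFinP/measurable_funTS; exact: continuous_measurable_fun.
  - by apply/measurable_EFinP; apply: measurable_funM => //; exact: measurable_exponential_pdf.
  - move=> x _; rewrite patchE; case: ifPn; last first.
      by move=> _; rewrite lee_fin mulr_ge0 ?invr_ge0 ?(ltW k0)// exponential_pdf_ge0// ltW.
    rewrite inE /= => x0; rewrite lee_fin exponential_pdfE//= mulrA mulVf ?gt_eqF// mul1r.
    by rewrite ger0_norm// mulNr.
under eq_integral do rewrite EFinM.
rewrite ge0_integralZl//; last 3 first.
- by apply/measurable_EFinP; exact: measurable_exponential_pdf.
- by move=> x _; rewrite lee_fin exponential_pdf_ge0// ltW.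
- by rewrite lee_fin invr_ge0 ltW.
by rewrite integral_exponential_pdf// mule1 ltry.
Qed.

Definition translation_space0 : translation_space 0.
Proof.
refine (@TranslationSpace 0 _ unit (\d_ tt) (fun _ _ => 0) (fun _ t => t) _ _ _ _ _ _) => //.
- by move=> a t [].
- by move=> k k0; rewrite integral_dirac//= diracT mul1e ltry.
- by rewrite [X in (_ < X)%E](_ : _ = 1%E) ?lte01//; exact: diracT.
Defined.

Definition translation_spaceS n (X : translation_space n) : translation_space n.+1.
Proof.
pose T := ts_type X.
pose m := sigma_finite_prod (@lebesgue_measure R) (ts_measure X).
pose c (i : 'I_n.+1) (t : measurableTypeR R * T) : R :=
  if unlift ord0 i is Some j then ts_coord j t.2 else t.1.
pose tr (a : 'I_n.+1 -> R) (t : measurableTypeR R * T) : measurableTypeR R * T :=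
  (t.1 + a ord0, ts_trans (fun j => a (lift ord0 j)) t.2).
have mtr a : measurable_fun setT (tr a).
  apply/measurable_fun_pairP; split.
    apply: (measurableT_comp (f := fun x : R => x + a ord0)) => //.
    exact: measurable_shift.
  exact: (measurableT_comp (ts_trans_meas (fun j => a (lift ord0 j))) measurable_snd).
apply: (@TranslationSpace n.+1 _ (measurableTypeR R * T)%type m c tr) => //.
- move=> i; rewrite /c; case: unliftP => [j _|_]; last exact: measurable_fst.
  exact: (measurableT_comp (ts_coord_meas j) measurable_snd).
- by move=> a t i; rewrite /c; case: unliftP => [j ->|->] //=; exact: ts_coord_trans.
- move=> a F mF F0.
  have mFt : measurable_fun setT (F \o tr a) by exact: measurableT_comp.
  rewrite (@fubini_tonelli1 _ _ _ _ _ _ _ (F \o tr a))//=.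
  rewrite (@fubini_tonelli1 _ _ _ _ _ _ _ F)//=.
  rewrite -(@ge0_integral_shift R (fubini_F (ts_measure X) F) (a ord0)); last 2 first.
  + exact: measurable_fun_fubini_tonelli_F.
  + by move=> x; apply: integral_ge0 => y _; exact: F0.
  apply: eq_integral => x _; rewrite /fubini_F /=.
  rewrite -(@ts_integral_trans _ X (fun j => a (lift ord0 j)) (fun y => F (x + a ord0, y)))//.
  apply: measurableT_comp => //; exact: measurable_pair1.
- move=> k k0.
  have E t : (expR (- (k * \sum_i `|c i t|)))%:E =
    ((expR (- (k * `|t.1|)))%:E * (expR (- (k * \sum_i `|ts_coord i t.2|)))%:E)%E.
    rewrite -EFinM -expRD; congr ((expR _)%:E).
    rewrite big_ord_recl /c unlift_none mulrDr opprD; congr (_ - _ * _).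
    by apply: eq_bigr => j _; rewrite liftK.
  have mE1 : measurable_fun setT (fun x : R => (expR (- (k * `|x|)))%:E).
    apply/measurable_EFinP; apply: measurableT_comp => //; apply: measurableT_comp => //.
    by apply: measurable_funM => //; exact: measurableT_comp.
  have mE2 : measurable_fun setT (fun t : T => (expR (- (k * \sum_i `|ts_coord i t|)))%:E).
    apply/measurable_EFinP; apply: measurableT_comp => //; apply: measurableT_comp => //.
    apply: measurable_funM => //; apply: measurable_sum => i; apply: measurableT_comp => //.
    exact: ts_coord_meas.
  under eq_integral do rewrite E.
  rewrite (@fubini_tonelli1 _ _ _ _ _ _ _ (fun t : measurableTypeR R * T =>
    ((expR (- (k * `|t.1|)))%:E * (expR (- (k * \sum_i `|ts_coord i t.2|)))%:E)%E))/=; last 2 first.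
  + apply: emeasurable_funM; first exact: (measurableT_comp mE1 measurable_fst).
    exact: (measurableT_comp mE2 measurable_snd).
  + by move=> t; rewrite mule_ge0// lee_fin expR_ge0.
  rewrite /fubini_F /=.
  set I := (\int[ts_measure X]_t (expR (- (k * \sum_i `|ts_coord i t|)))%:E)%E.
  have I0 : (0 <= I)%E by apply: integral_ge0 => t _; rewrite lee_fin expR_ge0.
  have If : (I < +oo)%E by exact: ts_exp_fin.
  have Ix (x : R) : (\int[ts_measure X]_t ((expR (- (k * `|x|)))%:E *
      (expR (- (k * \sum_i `|ts_coord i t|)))%:E) = (expR (- (k * `|x|)))%:E * (fine I)%:E)%E.
    by rewrite ge0_integralZl ?lee_fin ?expR_ge0// -/I fineK// ge0_fin_numE.
  under eq_integral do rewrite Ix.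
  rewrite ge0_integralZr//; last by rewrite lee_fin fine_ge0.
  apply: lte_mul_pinfty => //.
  + by apply: integral_ge0 => t _; rewrite lee_fin expR_ge0.
  + rewrite ge0_fin_numE; first exact: integral_expR_abs.
    by apply: integral_ge0 => t _; rewrite lee_fin expR_ge0.
  + exact: ltry.
- have -> : m setT = (mu setT * ts_measure X setT)%E.
    by rewrite -setXTT; exact: product_measure1E.
  rewrite mule_gt0 ?ts_nonzero//.
  rewrite (lt_le_trans (y := lebesgue_measure `[0%R, 1%R]%classic))//.
    have h := @lebesgue_measure_itv R `[0%R, 1%R]; rewrite (h : lebesgue_measure _ = _) /=.
    by rewrite lte_fin ltr01 -EFinB subr0.
  by apply: le_measure => //; rewrite inE.
Defined.

Fixpoint translation_spaceN n : translation_space n :=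
  if n is k.+1 then translation_spaceS (translation_spaceN k) else translation_space0.

End TranslationSpace.

(** * Complex embeddings, trace and discriminant *)

Section Embeddings.
Variables (R : realType) (L : fieldExtType rat).
Local Notation C := R[i].
Local Notation n := (\dim {:L}).

Lemma roiM (x y : L) : ring_of_integers x -> ring_of_integers y -> ring_of_integers (x * y).
Proof. exact: integral_mul. Qed.

Lemma roiB (x y : L) : ring_of_integers x -> ring_of_integers y -> ring_of_integers (x - y).
Proof. exact: integral_sub. Qed.

Lemma roiD (x y : L) : ring_of_integers x -> ring_of_integers y -> ring_of_integers (x + y).
Proof. exact: integral_add. Qed.

Lemma roi_int (z : int) : @ring_of_integers L z%:~R.
Proof. exact: integral_id. Qed.

Lemma roi0 : @ring_of_integers L 0. Proof. exact: (roi_int 0). Qed.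

Lemma roi1 : @ring_of_integers L 1. Proof. exact: (roi_int 1). Qed.

Lemma roiN (x : L) : ring_of_integers x -> ring_of_integers (- x).
Proof. by move=> hx; rewrite -sub0r; apply: roiB => //; exact: roi0. Qed.

Lemma rmorph_ratC (f : {rmorphism L -> C}) (q : rat) : f q%:A = ratr q.
Proof. exact: (fmorph_eq_rat (f \o in_alg L)). Qed.

Lemma rmorph_scaleC (f : {rmorphism L -> C}) (q : rat) x : f (q *: x) = ratr q * f x.
Proof. by rewrite -mulr_algl rmorphM rmorph_ratC. Qed.

Lemma conjc_ratr (q : rat) : ((ratr q : C)^* )%C = ratr q.
Proof. exact: (fmorph_eq_rat (@conjc R \o ratr)). Qed.

(** For a primitive element [th], the embeddings correspond to the roots of its minimal polynomial.
    Complex conjugation permutes these roots, the coefficients being rational, and [cj] is the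
    induced map on indices. *)
Lemma embeddings_exist : exists (sg : 'I_n -> {rmorphism L -> C}) (cj : 'I_n -> 'I_n) (th : L),
  (forall i x, sg (cj i) x = ((sg i x)^* )%C) /\ injective (fun i => sg i th).
Proof.
have ch0 : [pchar L] =i pred0 by move=> p; rewrite (pchar_lalg L) pchar_num.
have sep1 : separable 1%AS {:L} by apply/separableP => y _; exact: pcharf0_separable.
pose th := separable_generator 1%VS ({:L}%VS : {vspace L}).
have thE : <<1; th>>%VS = {:L}%VS.
  by rewrite -(@eq_adjoin_separable_generator _ _ {:L}%AS 1%AS)// subvf.
have /polyOver1P[p0 p0E] := minPolyOver 1%AS th.
have p0m : p0 \is monic by rewrite -(map_monic (in_alg L)) -p0E monic_minPoly.
have p0s : size p0 = n.+1.
  rewrite -(size_map_poly (in_alg L)) -p0E size_minPoly.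
  by rewrite -[in RHS]thE (dim_Fadjoin 1%AS th) dimv1 muln1.
have p0sep : separable_poly p0.
  by rewrite -(separable_map (in_alg L)) -p0E; exact: pcharf0_separable.
pose P : {poly C} := map_poly ratr p0.
have [r rE] := closed_field_poly_normal P.
have Pm : P \is monic by rewrite map_monic.
rewrite (monicP Pm) scale1r in rE.
have ur : uniq r by rewrite -separable_prod_XsubC -rE separable_map.
have sr : size r == n.
  by rewrite -eqSS -(size_prod_XsubC r id) -rE size_map_poly p0s.
have rP x : (x \in r) = root P x by rewrite rE root_prod_XsubC.
(* Two polynomials with the same value at [th] differ by a multiple of the minimal polynomial, so
   evaluation at a root x is well defined on L. *)
have wd (q1 q2 : {poly rat}) (x : C) : root P x ->
    (map_poly (in_alg L) q1).[th] = (map_poly (in_alg L) q2).[th] ->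
    (map_poly ratr q1).[x] = (map_poly ratr q2).[x].
  move=> Px e; apply/eqP; rewrite -subr_eq0 -hornerN -hornerD -rmorphB -/(root _ _).
  suff : P %| map_poly ratr (q1 - q2).
    by move=> /dvdpP[u eu]; rewrite -[X in root X]/(map_poly ratr _) eu rootM Px orbT.
  rewrite dvdp_map -(dvdp_map (in_alg L)) -p0E.
  apply: minPoly_dvdp; first by apply/polyOver1P; exists (q1 - q2).
  by rewrite /root rmorphB hornerD hornerN e subrr.
have rep (x : L) : exists q : {poly rat}, x = (map_poly (in_alg L) q).[th].
  have /Fadjoin_polyP[q /polyOver1P[q0 ->] ->] : x \in <<1%AS; th>>%VS by rewrite thE memvf.
  by exists q0.
pose qof x := projT1 (cid (rep x)).
have qofE x : (map_poly (in_alg L) (qof x)).[th] = x by rewrite /qof; case: (cid (rep x)).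
have morph (x : C) : root P x -> {f : {rmorphism L -> C} | forall q : {poly rat},
    f (map_poly (in_alg L) q).[th] = (map_poly ratr q).[x]}.
  move=> Px; pose f y := (map_poly ratr (qof y)).[x].
  have fE q : f (map_poly (in_alg L) q).[th] = (map_poly ratr q).[x].
    by apply: wd => //; rewrite qofE.
  have fB : zmod_morphism f.
    move=> u v; rewrite -[u]qofE -[v]qofE -hornerN -hornerD -rmorphB !fE.
    by rewrite rmorphB hornerD hornerN.
  have fM : monoid_morphism f.
    split; first by rewrite -[1](hornerC 1 th) -[1%:P](rmorph1 (map_poly (in_alg L))) fE rmorph1 hornerC.
    by move=> u v; rewrite -[u]qofE -[v]qofE -hornerM -rmorphM !fE rmorphM hornerM.
  pose F : {rmorphism L -> C} := HB.pack f
    (GRing.isZmodMorphism.Build L C f fB) (GRing.isMonoidMorphism.Build L C f fM).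
  by exists F.
have rootr (i : 'I_n) : root P r`_i by rewrite -rP mem_nth// (eqP sr).
pose sg i := projT1 (morph _ (rootr i)).
have sgE i q : sg i (map_poly (in_alg L) q).[th] = (map_poly ratr q).[r`_i].
  by rewrite /sg; case: (morph _ _).
have sgth i : sg i th = r`_i.
  by have := sgE i 'X; rewrite !map_polyX !hornerX.
have conjq (q : {poly rat}) (x : C) : ((map_poly ratr q).[x]^* )%C = (map_poly ratr q).[(x^* )%C].
  rewrite -[LHS]horner_map -map_poly_comp; congr horner; apply: eq_map_poly => c.
  exact: conjc_ratr.
have cjP (i : 'I_n) : exists j : 'I_n, r`_j = ((r`_i)^* )%C.
  have : ((r`_i)^* )%C \in r by rewrite rP /root -conjq (eqP (rootr i)) rmorph0.
  move=> /(nthP 0)[j]; rewrite (eqP sr) => jn e; by exists (Ordinal jn).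
pose cj i := projT1 (cid (cjP i)).
exists sg, cj, th; split.
  move=> i x; rewrite -[x]qofE !sgE conjq; congr horner.
  by rewrite /cj; case: (cid (cjP i)).
move=> i j /=; rewrite !sgth => /eqP; rewrite nth_uniq ?(eqP sr)// => /eqP e; exact/val_inj.
Qed.

Variables (sg : 'I_n -> {rmorphism L -> C}) (th : L).
Hypothesis sg_inj : injective (fun i => sg i th).

Definition emb_mx (e : n.-tuple L) : 'M[C]_n := \matrix_(k, i) sg i e`_k.

(** A linear relation between the embeddings holds on all powers of [th], hence is killed by the
    Vandermonde matrix of its distinct conjugates. *)
Lemma emb_mx_unit (e : n.-tuple L) : basis_of {:L} e -> emb_mx e \in unitmx.
Proof.
move=> be; rewrite -unitmx_tr -row_free_unit; apply: inj_row_free => v ve.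
have v0 x : \sum_i v 0 i * sg i x = 0.
  rewrite (coord_basis be (memvf x)).
  under eq_bigr => i _ do rewrite rmorph_sum big_distrr/=.
  rewrite exchange_big/= big1// => k _.
  have /matrixP/(_ 0 k) := ve; rewrite !mxE => h.
  transitivity (ratr (coord e k x) * \sum_j v 0 j * (emb_mx e)^T j k); last by rewrite h mulr0.
  rewrite big_distrr/=.
  by apply: eq_bigr => i _; rewrite rmorph_scaleC !mxE mulrCA.
pose a : 'rV[C]_n := \row_i sg i th.
have V : Vandermonde n a \in unitmx.
  rewrite unitmxE det_Vandermonde unitfE; apply/prodf_neq0 => i _; apply/prodf_neq0 => j ij.
  rewrite !mxE subr_eq0; apply: contraTneq ij => /sg_inj ->; by rewrite ltnn.
have vV : v *m (Vandermonde n a)^T = 0.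
  apply/matrixP => i k; rewrite !mxE -[RHS](v0 (th ^+ k)); apply: eq_bigr => j _.
  by rewrite !mxE rmorphXn/= ord1.
by rewrite -[v](mulmxK (_ : (Vandermonde n a)^T \in unitmx)) ?unitmx_tr// vV mul0mx.
Qed.

(** Conjugation by [emb_mx e] diagonalises the matrix of multiplication by x. The basis is
    arbitrary, so the same sum computes the trace in the default basis and in an integral one. *)
Lemma emb_trace (e : n.-tuple L) (A : 'M[rat]_n) (x : L) : basis_of {:L} e ->
  (forall k : 'I_n, x * e`_k = \sum_l A k l *: e`_l) -> ratr (\tr A) = \sum_i sg i x.
Proof.
move=> be hA; have ue := emb_mx_unit be.
pose D : 'M[C]_n := diag_mx (\row_i sg i x).
have h : map_mx ratr A *m emb_mx e = emb_mx e *m D.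
  apply/matrixP => k i; rewrite mul_mx_diag !mxE -rmorphM mulrC hA rmorph_sum.
  by apply: eq_bigr => l _; rewrite !mxE rmorph_scaleC.
have -> : \sum_i sg i x = \tr D by rewrite mxtrace_diag; apply: eq_bigr => i _; rewrite mxE.
rewrite -[D](mulKmx ue) -h mulmxA mxtrace_mulC mulmxA mulmxV// mul1mx.
by rewrite /mxtrace rmorph_sum; apply: eq_bigr => i _; rewrite mxE.
Qed.

Lemma emb_field_trace x : ratr (field_trace x) = \sum_i sg i x.
Proof.
rewrite /field_trace; apply: (emb_trace (vbasisP _)) => k.
have bf : basis_of {:L} (vbasis {:L}) := vbasisP _.
have -> : x * (vbasis {:L})`_k = amull x (vecof (vbasis {:L}) (delta_mx 0 k)).
  by rewrite vecof_delta lfunE.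
by rewrite (hom_vecof (vbasis {:L}) bf) /vecof; apply: eq_bigr => l _; rewrite -rowE mxE.
Qed.

Lemma emb_disc (e : n.-tuple L) : basis_of {:L} e ->
  ratr (basis_disc e) = (\det (emb_mx e)) ^+ 2.
Proof.
move=> be; rewrite expr2 -{2}det_tr -det_mulmx /basis_disc -det_map_mx; congr (\det _).
apply/matrixP => k l; rewrite [RHS]mxE mxE mxE -[LHS]/(ratr _) emb_field_trace; apply: eq_bigr => i _.
by rewrite !mxE rmorphM.
Qed.

Lemma basis_disc_neq0 (e : n.-tuple L) : basis_of {:L} e -> basis_disc e != 0.
Proof.
move=> be; have := emb_disc be; apply: contra_eq_neq => ->; rewrite rmorph0 eq_sym.
by rewrite expf_neq0// -unitfE -unitmxE emb_mx_unit.
Qed.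

(** In an integral basis, multiplication by an algebraic integer has an integral matrix, so traces
    of integers are integers; positivity is nondegeneracy of the trace form. *)
Lemma integral_basis_disc_int (e : n.-tuple L) : integral_basis e ->
  exists2 N : nat, (0 < N)%N & `|basis_disc e| = N%:R.
Proof.
move=> [be he].
have ei (k : 'I_n) : ring_of_integers e`_k.
  apply/he; exists (fun l => (l == k)%:Z); rewrite (bigD1 k)//= eqxx mul1r big1 ?addr0// => l /negPf ->.
  by rewrite mul0r.
have ti (x : L) : ring_of_integers x -> exists z : int, field_trace x = z%:~R.
  move=> hx.
  have c (k : 'I_n) : exists c : 'I_n -> int, x * e`_k = \sum_l (c l)%:~R * e`_l.
    by apply: (he _).1; apply: roiM.
  pose A : 'M[rat]_n := \matrix_(k, l) (projT1 (cid (c k)) l)%:~R.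
  have hA (k : 'I_n) : x * e`_k = \sum_l A k l *: e`_l.
    rewrite (projT2 (cid (c k))); apply: eq_bigr => l _.
    by rewrite mxE -mulr_algl; congr (_ * _); rewrite -[RHS]/(in_alg L _) rmorph_int.
  exists (\sum_k projT1 (cid (c k)) k).
  apply: (@fmorph_inj _ _ (ratr : {rmorphism rat -> C})).
  rewrite [LHS]emb_field_trace -(emb_trace be hA); congr ratr.
  by rewrite /mxtrace rmorph_sum; apply: eq_bigr => k _; rewrite mxE.
have tij (k l : 'I_n) : exists z : int, field_trace (e`_k * e`_l) = z%:~R.
  by apply: ti; apply: roiM.
pose B : 'M[int]_n := \matrix_(k, l) projT1 (cid (tij k l)).
have dB : basis_disc e = (\det B)%:~R.
  rewrite /basis_disc -det_map_mx; congr (\det _); apply/matrixP => k l; rewrite !mxE.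
  exact: projT2 (cid (tij k l)).
exists `|\det B|%N; last by rewrite dB -intr_norm -abszE.
by rewrite absz_gt0; have := basis_disc_neq0 be; rewrite dB intr_eq0.
Qed.

End Embeddings.

(** * Densities of subsets of L, and indices as their ratios *)

Section Density.
Variables (R : realType) (L : fieldExtType rat).
Local Notation C := R[i].
Local Notation n := (\dim {:L}).
Local Notation cabs := (@Normc.normc R).
Variables (sg : 'I_n -> {rmorphism L -> C}) (cj : 'I_n -> 'I_n).
Implicit Types (tau : 'I_n -> R) (x y v a : L) (A B : set L).

Definition sqf tau x : R := \sum_i tau i * cabs (sg i x) ^+ 2.
Definition enorm x : R := \prod_i cabs (sg i x).
(** Invariance under [cj] is what makes the imaginary parts cancel in [det_gram], so that the
    determinant of the Gram matrix splits into weight and discriminant. *)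
Definition weight tau := (forall i, 0 < tau i) /\ (forall i, tau (cj i) = tau i).
Definition twist tau x : 'I_n -> R := fun i => tau i * cabs (sg i x) ^+ 2.
Definition dscale (t : R) tau : 'I_n -> R := fun i => t * tau i.
Definition theta tau A v : \bar R := (\esum_(x in A) (expR (- (pi * sqf tau (x + v))))%:E)%E.
Definition covol tau : R := Num.sqrt (\prod_i tau i).
Definition ntheta tau A v : \bar R := ((covol tau)%:E * theta tau A v)%E.
(* c is the number of points of A per unit of volume, i.e. the inverse of the
   covolume when A is a lattice; indices of subgroups are quotients of it. *)
Definition has_dens A (c : R) := forall tau v, weight tau ->
  (fun k => ntheta (dscale (2^-1 ^+ k) tau) A v) @ \oo --> c%:E.

Hypothesis sg_cj : forall i x, sg (cj i) x = ((sg i x)^* )%C.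

Lemma cabs_sg_gt0 i x : x != 0 -> 0 < cabs (sg i x).
Proof. by move=> x0; rewrite cabs_gt0 fmorph_eq0. Qed.

Lemma enorm_gt0 x : x != 0 -> 0 < enorm x.
Proof. by move=> x0; apply: prodr_gt0 => i _; exact: cabs_sg_gt0. Qed.

Lemma weight1 : weight (fun=> 1).
Proof. by split. Qed.

Lemma weight_dscale t tau : 0 < t -> weight tau -> weight (dscale t tau).
Proof. by move=> t0 [p s]; split => i; rewrite /dscale ?mulr_gt0// s. Qed.

Lemma cabs_conj (z : C) : cabs (z^* )%C = cabs z.
Proof. by case: z => a b; rewrite /Normc.normc /= sqrrN. Qed.

Lemma weight_twist tau x : x != 0 -> weight tau -> weight (twist tau x).
Proof.
move=> x0 [p s]; split => i; rewrite /twist; first by rewrite mulr_gt0// exprn_gt0// cabs_sg_gt0.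
by rewrite s sg_cj cabs_conj.
Qed.

Lemma sqf_twist tau x y : sqf tau (x * y) = sqf (twist tau x) y.
Proof.
by apply: eq_bigr => i _; rewrite rmorphM cabsM exprMn mulrA.
Qed.

Lemma sqf_dscale t tau x : sqf (dscale t tau) x = t * sqf tau x.
Proof. by rewrite /sqf big_distrr/=; apply: eq_bigr => i _; rewrite /dscale mulrA. Qed.

Lemma dscaleA s t tau : dscale s (dscale t tau) = dscale (s * t) tau.
Proof. by apply/funext => i; rewrite /dscale mulrA. Qed.

Lemma dscale_twist t tau x : twist (dscale t tau) x = dscale t (twist tau x).
Proof. by apply/funext => i; rewrite /twist /dscale mulrA. Qed.

Lemma covol_ge0 tau : 0 <= covol tau.
Proof. exact: sqrtr_ge0. Qed.

Lemma covol_twist tau x : weight tau -> covol (twist tau x) = covol tau * enorm x.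
Proof.
move=> [p _]; rewrite /covol /twist big_split/= sqrtrM; last first.
  by apply: prodr_ge0 => i _; rewrite ltW.
rewrite prodrXl sqrtr_sqr ger0_norm//; apply: prodr_ge0 => i _; exact: cabs_ge0.
Qed.

Lemma covol_dscale t tau : 0 <= t -> covol (dscale t tau) = Num.sqrt t ^+ n * covol tau.
Proof.
move=> t0; rewrite /covol /dscale big_split/= prodr_const card_ord sqrtrM ?exprn_ge0//.
by congr (_ * _); elim: (n) => [|m IH]; rewrite ?expr0 ?sqrtr1// !exprS sqrtrM// IH.
Qed.

Lemma theta_ge0 tau A v : (0 <= theta tau A v)%E.
Proof. by apply: esum_ge0 => x _; rewrite lee_fin expR_ge0. Qed.

Lemma theta_setS tau A B v : A `<=` B -> (theta tau A v <= theta tau B v)%E.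
Proof. exact: esum_setS. Qed.

Lemma ntheta_setS tau A B v : A `<=` B -> (ntheta tau A v <= ntheta tau B v)%E.
Proof. by move=> AB; apply: lee_wpmul2l; rewrite ?lee_fin ?covol_ge0//; exact: theta_setS. Qed.

Lemma theta_setU tau A B v : [disjoint A & B] ->
  theta tau (A `|` B) v = (theta tau A v + theta tau B v)%E.
Proof. by move=> dAB; apply: esum_setU => // x; rewrite lee_fin expR_ge0. Qed.

Lemma ntheta_setU tau A B v : [disjoint A & B] ->
  ntheta tau (A `|` B) v = (ntheta tau A v + ntheta tau B v)%E.
Proof.
by move=> dAB; rewrite /ntheta theta_setU// ge0_muleDr ?theta_ge0.
Qed.

Lemma theta_shift tau A a v : theta tau [set a + x | x in A] v = theta tau A (a + v).
Proof.
rewrite /theta esum_image; last first.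
- by move=> x y _ _ /addrI.
by apply: eq_esum => x _; rewrite addrCA addrA.
Qed.

Lemma theta_scale tau A x v : x != 0 ->
  theta tau [set x * y | y in A] v = theta (twist tau x) A (v / x).
Proof.
move=> x0; rewrite /theta esum_image; last first.
  by move=> y z _ _ /(mulfI x0).
by apply: eq_esum => y _; rewrite -sqf_twist mulrDr mulrCA mulfV// mulr1.
Qed.

(** Multiplication by x turns tau into [twist sg tau x], whose covolume is larger by the norm of x,
    and v into v / x; [has_dens] quantifies over all weights and shifts to absorb both changes. *)
Lemma has_dens_scale A c x : x != 0 -> has_dens A c ->
  has_dens [set x * y | y in A] (c / enorm x).
Proof.
move=> x0 hA tau v wt.
have N0 := enorm_gt0 x0.
have e k : ntheta (dscale (2^-1 ^+ k) tau) [set x * y | y in A] v =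
   ((enorm x)^-1%:E * ntheta (dscale (2^-1 ^+ k) (twist tau x)) A (v / x))%E.
  have k0 : 0 < 2^-1 ^+ k :> R by rewrite exprn_gt0.
  rewrite /ntheta theta_scale// dscale_twist muleA -EFinM; congr (_%:E * _)%E.
  rewrite -dscale_twist covol_twist; last exact: weight_dscale.
  by rewrite mulrCA mulVf ?mulr1// gt_eqF.
under eq_fun do rewrite e.
rewrite mulrC EFinM; apply: cvgeZl => //; apply: hA.
exact: weight_twist.
Qed.

Lemma has_dens_le A B c c' : A `<=` B -> has_dens A c -> has_dens B c' -> c <= c'.
Proof.
move=> AB hA hB; have h := hA _ 0 weight1; have h' := hB _ 0 weight1.
rewrite -lee_fin -(cvg_lim (@ereal_hausdorff R) h) -(cvg_lim (@ereal_hausdorff R) h').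
apply: lee_lim; [by apply/cvg_ex; exists c%:E|by apply/cvg_ex; exists c'%:E|].
by apply: nearW => k; exact: ntheta_setS.
Qed.

Lemma has_dens_unique A c c' : has_dens A c -> has_dens A c' -> c = c'.
Proof.
by move=> h h'; apply/le_anti; rewrite (has_dens_le _ h h')// (has_dens_le _ h' h).
Qed.

Lemma has_dens_shift A c a : has_dens A c -> has_dens [set a + x | x in A] c.
Proof.
by move=> hA tau v wt; under eq_fun do rewrite /ntheta theta_shift; exact: hA.
Qed.

Lemma has_dens_setU A B c c' : [disjoint A & B] -> has_dens A c -> has_dens B c' ->
  has_dens (A `|` B) (c + c').
Proof.
move=> dAB hA hB tau v wt; under eq_fun do rewrite ntheta_setU//.
by rewrite EFinD; apply: cvgeD => //; [exact: hA|exact: hB].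
Qed.

Lemma has_dens_set0 : has_dens set0 0.
Proof.
move=> tau v _; under eq_fun do rewrite /ntheta /theta esum_set0 mule0.
exact: cvg_cst.
Qed.

Definition subgroup A := A 0 /\ forall x y, A x -> A y -> A (x - y).

Lemma subgroupN A x : subgroup A -> A x -> A (- x).
Proof. by move=> [A0 AB] Ax; rewrite -sub0r; exact: AB. Qed.

Lemma subgroupD A x y : subgroup A -> A x -> A y -> A (x + y).
Proof. by move=> sA Ax Ay; rewrite -[y]opprK; apply: sA.2 => //; exact: subgroupN. Qed.

Lemma subgroup_mulrn A x k : subgroup A -> A x -> A (x *+ k).
Proof. by move=> sA Ax; elim: k => [|k IH]; [exact: sA.1|rewrite mulrS; exact: subgroupD]. Qed.

Lemma subgroup_scale A x : subgroup A -> subgroup [set x * y | y in A].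
Proof.
move=> [A0 AB]; split; first by exists 0; rewrite ?mulr0.
by move=> _ _ [y Ay <-] [z Az <-]; exists (y - z); [exact: AB|rewrite mulrBr].
Qed.

Definition incong B (s : seq L) := pairwise (fun a a' => `[< ~ B (a - a') >]) s.
Definition cosets B (s : seq L) : set L := [set x | exists2 a, a \in s & B (x - a)].

Lemma cosets_cons B a s : cosets B (a :: s) = [set a + x | x in B] `|` cosets B s.
Proof.
apply/seteqP; split => x.
  move=> [a']; rewrite inE => /orP[/eqP ->|a's] h; last by right; exists a'.
  by left; exists (x - a) => //; rewrite addrC subrK.
case; first by move=> [y By <-]; exists a; rewrite ?mem_head// addrC addKr.
by move=> [a' a's h]; exists a' => //; rewrite inE a's orbT.
Qed.

Lemma has_dens_cosets B s c : subgroup B -> has_dens B c -> incong B s ->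
  has_dens (cosets B s) ((size s)%:R * c).
Proof.
move=> sB hB; elim: s => [_|a s IH /=].
  rewrite mul0r (_ : cosets B [::] = set0); first exact: has_dens_set0.
  by apply/seteqP; split => // x [].
rewrite /incong/= => /andP[/allP ha hs]; rewrite cosets_cons -natr1 mulrDl mul1r addrC.
apply: has_dens_setU; [|exact: has_dens_shift|exact: IH].
apply/disj_set2P/seteqP; split => // _ [[y By <-] [a' a's h]].
have /asboolP := ha _ a's; apply.
by rewrite (_ : a - a' = (a + y - a') - y); [exact: sB.2|rewrite addrAC addrK].
Qed.

(** Disjoint cosets of density c fit into a set of density c', so the number of classes is at most
    c' / c. All finiteness of indices comes from here. *)
Lemma incong_bound A B s c c' : subgroup B -> has_dens B c -> incong B s ->
  cosets B s `<=` A -> has_dens A c' -> (size s)%:R * c <= c'.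
Proof. by move=> sB hB hs sA hA; apply: has_dens_le hA; [exact: sA|exact: has_dens_cosets]. Qed.

Lemma incong_cons B a s : subgroup B -> incong B s -> ~ cosets B s a -> incong B (a :: s).
Proof.
move=> sB hs na; rewrite /incong/=; apply/andP; split => //; apply/allP => a' a's; apply/asboolP => h.
by apply: na; exists a'.
Qed.

(** If no incongruent family exhausted A, it could always be prolonged, and families of every length
    would exist. *)
Lemma transversal_bounded A B N : subgroup A -> subgroup B -> B `<=` A ->
  (forall s, incong B s -> (forall a, a \in s -> A a) -> (size s <= N)%N) ->
  exists s : seq L, [/\ incong B s, (forall a, a \in s -> A a) & A = cosets B s].
Proof.
move=> sA sB BA hN; apply: contrapT => no.
have long k : exists s : seq L, [/\ incong B s, (forall a, a \in s -> A a) & size s = k].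
  elim: k => [|k [s [hs As sk]]]; first by exists [::].
  have sub : cosets B s `<=` A.
    by move=> x [a /As Aa /BA Ba]; rewrite -(subrK a x); exact: subgroupD.
  have [a Aa na] : exists2 a, A a & ~ cosets B s a.
    apply: contrapT => h; apply: no; exists s; split => //; apply/seteqP; split => // x Ax.
    by apply: contrapT => nx; apply: h; exists x.
  exists (a :: s); split => /=; [exact: incong_cons| |by rewrite sk].
  by move=> a'; rewrite inE => /orP[/eqP ->//|/As].
have [s [hs As sk]] := long N.+1.
by have := hN s hs As; rewrite sk ltnn.
Qed.

Lemma transversal_exists A B D c c' : subgroup A -> subgroup B -> B `<=` A -> A `<=` D ->
  has_dens B c -> 0 < c -> has_dens D c' ->
  exists2 s : seq L, incong B s & A = cosets B s.
Proof.
move=> sA sB BA AD hB c0 hD.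
have [|s [hs _ e]] := @transversal_bounded A B (Num.trunc (c' / c)) sA sB BA; last by exists s.
move=> s hs As; have : (size s)%:R * c <= c'.
  apply: (incong_bound sB hB hs _ hD) => x [a /As Aa /BA Ba].
  by apply: AD; rewrite -(subrK a x); exact: subgroupD.
rewrite -ler_pdivlMr// => h; rewrite leqNgt; apply/negP => h'.
have := le_lt_trans h (truncnS_gt (c' / c)); rewrite ltr_nat ltnS leqNgt h' //.
Qed.

Lemma has_dens_between A B D c c' : subgroup A -> subgroup B -> B `<=` A -> A `<=` D ->
  has_dens B c -> 0 < c -> has_dens D c' ->
  exists s : seq L, [/\ incong B s, A = cosets B s, (0 < size s)%N &
    has_dens A ((size s)%:R * c)].
Proof.
move=> sA sB BA AD hB c0 hD.
have [s hs e] := transversal_exists sA sB BA AD hB c0 hD.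
exists s; split => //; last by rewrite e; exact: has_dens_cosets.
by case: (s) e => // e; have := sA.1; rewrite e => -[].
Qed.

(* An infinite family of classes modulo B would give A infinite density. *)
Lemma pigeonhole A B c c' (f : nat -> L) : subgroup B -> has_dens B c -> 0 < c ->
  has_dens A c' -> (forall x y, A x -> B y -> A (x + y)) -> (forall k, A (f k)) ->
  exists i j, (i < j)%N /\ B (f j - f i).
Proof.
move=> sB hB c0 hA AB Af; apply: contrapT => no.
pose k := (Num.trunc (c' / c)).+1.
have inc m l : incong B [seq f i | i <- iota m l].
  elim: l m => [//|l IH] m; rewrite /incong /= -/(incong _ _) IH andbT.
  apply/allP => _ /mapP[i + ->]; rewrite mem_iota => /andP[mi _]; apply/asboolP => h.
  by apply: no; exists m, i; split => //; rewrite -opprB; exact: subgroupN.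
have : (size [seq f i | i <- iota 0 k])%:R * c <= c'.
  apply: (incong_bound sB hB (inc _ _) _ hA) => x [_ /mapP[i _ ->] h].
  by rewrite -(subrK (f i) x) addrC; exact: AB.
rewrite -ler_pdivlMr// size_map size_iota leNgt => /negP; apply.
exact: truncnS_gt.
Qed.

End Density.

(** * The density of the ring of integers *)

Section OrderDensity.
Variables (R : realType) (L : fieldExtType rat).
Local Notation C := R[i].
Local Notation n := (\dim {:L}).
Local Notation cabs := (@Normc.normc R).
Local Notation cRe := (@complex.Re R).
Local Notation cIm := (@complex.Im R).
Variables (sg : 'I_n -> {rmorphism L -> C}) (cj : 'I_n -> 'I_n) (th : L).
Hypothesis sg_cj : forall i x, sg (cj i) x = ((sg i x)^* )%C.
Hypothesis sg_inj : injective (fun i => sg i th).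
Variable b : n.-tuple L.
Hypothesis bP : integral_basis b.

Lemma cj_inj : injective cj.
Proof.
move=> i j e; apply: sg_inj => /=; apply: (can_inj (@conjcK R)).
by rewrite -!sg_cj e.
Qed.

Lemma cabs_sqr (z : C) : cabs z ^+ 2 = cRe z ^+ 2 + cIm z ^+ 2.
Proof. by case: z => x y; rewrite /Normc.normc /= sqr_sqrtr// addr_ge0// sqr_ge0. Qed.

Definition gram (tau : 'I_n -> R) : 'M[R]_n := \matrix_(k, l) \sum_i
  tau i * (cRe (sg i b`_k) * cRe (sg i b`_l) + cIm (sg i b`_k) * cIm (sg i b`_l)).

Definition lincomb (c : 'rV[R]_n) i : C := \sum_k ((c 0 k)%:C)%C * sg i b`_k.

Lemma cRe_sum (I : Type) (r : seq I) (P : pred I) (F : I -> C) :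
  cRe (\sum_(i <- r | P i) F i) = \sum_(i <- r | P i) cRe (F i).
Proof. exact: (raddf_sum (@complex.Re R)). Qed.

Lemma cIm_sum (I : Type) (r : seq I) (P : pred I) (F : I -> C) :
  cIm (\sum_(i <- r | P i) F i) = \sum_(i <- r | P i) cIm (F i).
Proof. exact: (raddf_sum (@complex.Im R)). Qed.

Lemma qform_gram tau c : qform (gram tau) c = \sum_i tau i * cabs (lincomb c i) ^+ 2.
Proof.
have X i : cRe (lincomb c i) = \sum_k c 0 k * cRe (sg i b`_k).
  by rewrite cRe_sum; apply: eq_bigr => k _; rewrite cReM /= mul0r subr0.
have Y i : cIm (lincomb c i) = \sum_k c 0 k * cIm (sg i b`_k).
  by rewrite cIm_sum; apply: eq_bigr => k _; rewrite cImM /= mul0r addr0.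
transitivity (\sum_i \sum_k \sum_l tau i * (c 0 k * cRe (sg i b`_k) * (c 0 l * cRe (sg i b`_l)) +
   c 0 k * cIm (sg i b`_k) * (c 0 l * cIm (sg i b`_l)))).
  rewrite /qform mxE.
  under eq_bigr => l _ do rewrite mxE big_distrl/=.
  rewrite [RHS]exchange_big/= exchange_big/=; apply: eq_bigr => k _.
  rewrite [RHS]exchange_big/=; apply: eq_bigr => l _.
  rewrite !mxE big_distrr big_distrl/=; apply: eq_bigr => i _; ring.
apply: eq_bigr => i _; rewrite cabs_sqr X Y !expr2 !big_distrlr/= -big_split/= big_distrr/=.
by apply: eq_bigr => k _; rewrite -big_split big_distrr.
Qed.

Lemma ratrC (q : rat) : ratr q = ((ratr q)%:C)%C :> C.
Proof. by rewrite -(fmorph_eq_rat (real_complex R \o ratr)). Qed.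

(** The Gram matrix is E D E^*, with E = [emb_mx sg b] and D the diagonal of the weights: the
    imaginary part of each entry of the product is 0, since reindexing by [cj] changes its sign. *)
Lemma det_gram tau : weight cj tau ->
  \det (gram tau) = (\prod_i tau i) * ratr `|basis_disc b|.
Proof.
move=> [_ ts].
have E : map_mx (real_complex R) (gram tau) =
   emb_mx sg b *m diag_mx (\row_i ((tau i)%:C)%C) *m (map_mx (@conjc R) (emb_mx sg b))^T.
  apply/matrixP => k l; rewrite mul_mx_diag !mxE.
  under [RHS]eq_bigr => i _ do rewrite !mxE.
  apply: complex_ext.
    rewrite cRe_sum /=; apply: eq_bigr => i _.
    by case: (sg i b`_k) => x y; case: (sg i b`_l) => z w /=; ring.
  rewrite cIm_sum /=.
  pose F i := cIm (sg i b`_k * ((tau i)%:C)%C * ((sg i b`_l)^* )%C).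
  rewrite -/(\sum_i F i); apply/eqP; rewrite eq_sym; apply/eqP.
  have : \sum_i F i = - \sum_i F i.
    rewrite [LHS](reindex_inj cj_inj)/= -sumrN; apply: eq_bigr => i _.
    rewrite /F ts !sg_cj; case: (sg i b`_k) => x y; case: (sg i b`_l) => z w /=; ring.
  by move: (\sum_i F i) => s; lra.
have := congr1 (fun M => \det M) E; rewrite det_map_mx !det_mulmx det_diag det_tr det_map_mx.
have -> : \prod_i (\row_i ((tau i)%:C)%C : 'rV[C]_n) 0 i = ((\prod_i tau i)%:C)%C.
  by rewrite rmorph_prod; apply: eq_bigr => i _; rewrite mxE.
set z := \det (emb_mx sg b) => h.
have zz : z * (z^* )%C = ((ratr `|basis_disc b|)%:C)%C.
  have : cabs (z ^+ 2) = ratr `|basis_disc b|.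
    by rewrite -(emb_disc sg_inj bP.1) ratrC cabs_real -ratr_norm.
  rewrite expr2 cabsM -expr2 cabs_sqr => <-; apply: complex_ext => /=;
   by case: (z) => x y /=; ring.
by move: h; rewrite mulrAC zz mulrC -rmorphM => /(congr1 cRe).
Qed.

Lemma posdef_gram tau : weight cj tau -> posdef (gram tau).
Proof.
move=> [tp _]; split.
  apply/matrixP => k l; rewrite !mxE; apply: eq_bigr => i _; ring.
move=> v v0; rewrite qform_gram.
have t0 i : 0 <= tau i * cabs (lincomb v i) ^+ 2 by rewrite mulr_ge0 ?sqr_ge0// ltW.
rewrite lt_def sumr_ge0// andbT; apply: contraNneq v0 => /eqP.
rewrite psumr_eq0// => /allP h.
have l0 i : lincomb v i = 0.
  have /implyP/(_ isT) := h i (mem_index_enum i).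
  by rewrite mulf_eq0 gt_eqF//= sqrf_eq0 => /eqP/Normc.eq0_normc.
have u := emb_mx_unit sg_inj bP.1.
have : map_mx (real_complex R) v *m emb_mx sg b = 0.
  apply/matrixP => i j; rewrite !mxE -[RHS](l0 j); apply: eq_bigr => k _.
  by rewrite !mxE !ord1.
move=> /(congr1 (mulmx^~ (invmx (emb_mx sg b)))); rewrite mul0mx mulmxK// => /matrixP e.
by apply/eqP/matrixP => i j; have := e i j; rewrite !mxE => /(congr1 cRe).
Qed.

Definition bcomb (c : 'rV[int]_n) : L := \sum_k (c 0 k)%:~R * b`_k.

Lemma bcombE c : bcomb c = \sum_k ((c 0 k)%:~R : rat) *: b`_k.
Proof.
apply: eq_bigr => k _; rewrite -mulr_algl; congr (_ * _).
by rewrite -[RHS]/(in_alg L _) rmorph_int.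
Qed.

Lemma bcomb_bij : set_bij setT (@ring_of_integers L) bcomb.
Proof.
split.
- by move=> c _; apply: (bP.2 _).2; exists (fun k => c 0 k).
- move=> c c' _ _; rewrite !bcombE => e; apply/matrixP => i k; rewrite ord1.
  have := congr1 (coord b k) e; rewrite !coord_sum_free; try exact: (basis_free bP.1).
  by move=> /intr_inj.
- move=> x /(bP.2 _).1 [c ->]; exists (\row_k c k) => //.
  by apply: eq_bigr => k _; rewrite mxE.
Qed.

Lemma theta_lattice tau (t : R) (v : L) :
  theta sg (dscale t tau) (@ring_of_integers L) v =
  lattice_theta (gram tau) t (\row_k ratr (coord b k v)).
Proof.
rewrite /theta (reindex_esum _ _ _ _ bcomb_bij); apply: eq_esum => c _.
rewrite sqf_dscale mulrA qform_gram; congr ((expR (- (_ * _)))%:E).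
apply: eq_bigr => i _; congr (_ * cabs _ ^+ 2).
rewrite bcombE {1}(coord_basis bP.1 (memvf v)) -big_split/= rmorph_sum.
apply: eq_bigr => k _; rewrite -scalerDl rmorph_scaleC; congr (_ * _).
by rewrite !mxE ratrC rmorphD/= ratr_int.
Qed.

(** By [det_gram] the square root of the Gram determinant is [covol tau] times the root of the
    discriminant. The first factor cancels the normalisation of [ntheta], so the limit depends
    neither on the weight nor on the shift. *)
Theorem roi_has_dens : has_dens sg cj (@ring_of_integers L) (Num.sqrt (ratr `|basis_disc b|))^-1.
Proof.
move=> tau v wt; have [D0 [K K0 hK]] := lattice_theta_asymp (posdef_gram wt).
pose D : R := ratr `|basis_disc b|.
have dE := det_gram wt; rewrite -/D in dE.
have N0 : 0 < \prod_i tau i by apply: prodr_gt0 => i _; exact: wt.1.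
have Dp : 0 < D by move: D0; rewrite dE pmulr_rgt0.
have sD : 0 < Num.sqrt D by rewrite sqrtr_gt0.
pose q : R := Num.sqrt 2^-1.
have key k : exists2 u : R, ntheta sg (dscale (2^-1 ^+ k) tau) (@ring_of_integers L) v = u%:E &
   (Num.sqrt D)^-1 - K / Num.sqrt D * q ^+ k <= u <= (Num.sqrt D)^-1 + K / Num.sqrt D * q ^+ k.
  have t0 : 0 < 2^-1 ^+ k :> R by rewrite exprn_gt0.
  have t01 : 0 < (2^-1 ^+ k : R) <= 1.
    by rewrite t0/= exprn_ile1//; lra.
  have [r rE hr] := hK _ (\row_k ratr (coord b k v)) t01.
  have sq : Num.sqrt (2^-1 ^+ k) = q ^+ k.
    rewrite /q; elim: (k) => [|m IH]; first by rewrite !expr0 sqrtr1.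
    by rewrite !exprS sqrtrM// IH.
  rewrite /ntheta theta_lattice rE -EFinM; eexists; first by [].
  set u := _ * r.
  have uE : Num.sqrt ((2^-1 ^+ k) ^+ n * \det (gram tau)) * r = u * Num.sqrt D.
    rewrite dE mulrA sqrtrM ?mulr_ge0 ?exprn_ge0 ?(ltW N0) ?(ltW t0)//.
    rewrite mulrAC; congr (_ * _ * _).
    rewrite sqrtrM ?exprn_ge0 ?(ltW t0)// covol_dscale ?(ltW t0)//; congr (_ * _).
    elim: (n) => [|m IH]; first by rewrite !expr0 sqrtr1.
    by rewrite !exprS sqrtrM ?(ltW t0)// IH.
  move: hr; rewrite uE sq ler_norml => /andP[h1 h2].
  have e : u = (Num.sqrt D)^-1 + (u * Num.sqrt D - 1) / Num.sqrt D by field; rewrite gt_eqF.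
  rewrite {1 2}e !lerD2l mulrAC -mulNr; rewrite ![_ / Num.sqrt D]mulrC.
  by rewrite mulrN -mulrN !ler_wpM2l ?invr_ge0 ?(ltW sD)//; move: h1 h2; lra.
have fin k : ntheta sg (dscale (2^-1 ^+ k) tau) (@ring_of_integers L) v \is a fin_num.
  by have [u -> _] := key k.
have q1 : `|q| < 1.
  rewrite ger0_norm ?sqrtr_ge0// -[ltRHS]sqrtr1 ltr_sqrt//; lra.
have lim : (fun k => (Num.sqrt D)^-1 + K / Num.sqrt D * q ^+ k) @ \oo --> (Num.sqrt D)^-1.
  rewrite -[X in _ --> X]addr0; apply: cvgD; first exact: cvg_cst.
  rewrite -[X in _ --> X](mulr0 (K / Num.sqrt D)); apply: cvgMr; exact: cvg_expr.
have lim' : (fun k => (Num.sqrt D)^-1 - K / Num.sqrt D * q ^+ k) @ \oo --> (Num.sqrt D)^-1.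
  rewrite -[X in _ --> X]subr0; apply: cvgB; first exact: cvg_cst.
  rewrite -[X in _ --> X](mulr0 (K / Num.sqrt D)); apply: cvgMr; exact: cvg_expr.
apply: cvg_EFin; first exact: nearW.
apply: (squeeze_cvgr _ lim' lim); apply: nearW => k /=.
by have [u -> h] := key k.
Qed.

End OrderDensity.

(** * Fractional ideals and their norms through densities *)

Section Ideals.
Variables (R : realType) (L : fieldExtType rat).
Local Notation n := (\dim {:L}).
Variables (sg : 'I_n -> {rmorphism L -> R[i]}) (cj : 'I_n -> 'I_n).
Hypothesis sg_cj : forall i x, sg (cj i) x = ((sg i x)^* )%C.
Local Notation O := (@ring_of_integers L).
Local Notation has_dens := (has_dens sg cj).
Variable c0 : R.
Hypotheses (c0_gt0 : 0 < c0) (O_dens : has_dens O c0).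
Implicit Types (I J P M A B : set L) (x y z a p q : L).

Lemma roi_subgroup : subgroup O.
Proof. by split; [exact: roi0|exact: roiB]. Qed.

Definition fractional M := [/\ subgroup M, (forall a x, O a -> M x -> M (a * x)),
  (exists2 x, M x & x != 0) & (exists2 y, y != 0 & forall x, M x -> O (y * x))].

Lemma principal_dens x : x != 0 -> has_dens [set x * y | y in O] (c0 / enorm sg x).
Proof. by move=> x0; exact: has_dens_scale. Qed.

Lemma principal_dens_gt0 x : x != 0 -> 0 < c0 / enorm sg x.
Proof. by move=> x0; rewrite divr_gt0 ?enorm_gt0. Qed.

(** The default 0 only concerns sets without a density; a density is unique when it exists. *)
Definition dens A : R := xget 0 [set c | has_dens A c].

Lemma dens_unique A c : has_dens A c -> dens A = c.
Proof.
move=> h; have : has_dens A (dens A) by apply: (@xgetPex _ 0 [set c | has_dens A c]); exists c.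
by move=> h'; exact: has_dens_unique h' h.
Qed.

Lemma fractional_between M : fractional M -> exists x y, [/\ x != 0, y != 0,
  [set x * z | z in O] `<=` M & M `<=` [set y * z | z in O]].
Proof.
move=> [sM OM [x Mx x0] [y y0 yM]]; exists x, y^-1; split; rewrite ?invr_eq0//.
  by move=> _ [z Oz <-]; rewrite mulrC; exact: OM.
by move=> z /yM h; exists (y * z) => //; rewrite mulKf.
Qed.

(** A fractional ideal lies between two principal ones, whose densities are explicit; it is
    therefore a finite union of cosets of the smaller one. *)
Lemma fractional_dens M : fractional M -> has_dens M (dens M) /\ 0 < dens M.
Proof.
move=> fM; have [x [y [x0 y0 xM My]]] := fractional_between fM.
have [sM _ _ _] := fM.
have [s [_ _ s0 h]] := has_dens_between sM (subgroup_scale x roi_subgroup) xM My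
  (principal_dens x0) (principal_dens_gt0 x0) (principal_dens y0).
by rewrite (dens_unique h); split => //; rewrite mulr_gt0 ?ltr0n// principal_dens_gt0.
Qed.

Lemma index_exists M M' : fractional M -> fractional M' -> M `<=` M' ->
  exists s : seq L, [/\ incong M s, M' = cosets M s & dens M' = (size s)%:R * dens M].
Proof.
move=> fM fM' MM'; have [sM _ _ _] := fM; have [sM' _ _ _] := fM'.
have [hM M0] := fractional_dens fM; have [hM' _] := fractional_dens fM'.
have [s [hs e _ h]] := has_dens_between sM' sM MM' (@subset_refl _ _) hM M0 hM'.
by exists s; split => //; exact: dens_unique.
Qed.

Lemma index_lower M M' s : fractional M -> fractional M' -> incong M s ->
  cosets M s `<=` M' -> (size s)%:R * dens M <= dens M'.
Proof.
move=> fM fM' hs sub; have [sM _ _ _] := fM.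
exact: (incong_bound sM (fractional_dens fM).1 hs sub (fractional_dens fM').1).
Qed.

Lemma incong_sub B s : subgroup B -> exists s', [/\ incong B s', (size s' <= size s)%N &
  cosets B s `<=` cosets B s'].
Proof.
move=> sB; elim: s => [|a s [s' [hs' ss' sub]]]; first by exists [::]; split.
have [h|h] := pselect (cosets B s' a).
  exists s'; split => //; first exact: leqW.
  rewrite cosets_cons => x [[y By <-]|/sub//].
  have [a' a's Ba] := h; exists a' => //.
  by rewrite addrAC; exact: subgroupD.
exists (a :: s'); split; [exact: incong_cons|by []|].
by rewrite !cosets_cons => x [xa|/sub]; [left|right].
Qed.

Lemma index_upper M M' s : fractional M -> fractional M' -> M' `<=` cosets M s ->
  dens M' <= (size s)%:R * dens M.
Proof.
move=> fM fM' sub; have [sM _ _ _] := fM.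
have [s' [hs' ss' sub']] := incong_sub s sM.
have [hM M0] := fractional_dens fM.
apply: (@le_trans _ _ ((size s')%:R * dens M)); last by rewrite ler_wpM2r ?ler_nat// ltW.
apply: has_dens_le (fractional_dens fM').1 (has_dens_cosets sM hM hs').
exact: subset_trans sub sub'.
Qed.

Lemma dens_scale M x : fractional M -> x != 0 ->
  dens [set x * y | y in M] = dens M / enorm sg x.
Proof. by move=> fM x0; apply: dens_unique; apply: has_dens_scale => //; exact: (fractional_dens fM).1. Qed.

Lemma roi_fractional : fractional O.
Proof.
split; [exact: roi_subgroup|exact: roiM|by exists 1; [exact: roi1|exact: oner_neq0]|].
by exists 1; [exact: oner_neq0|move=> x; rewrite mul1r].
Qed.

Lemma dens_roi : dens O = c0.
Proof. exact: dens_unique. Qed.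

Lemma ideal_fractional I : nonzero_ideal I -> fractional I.
Proof.
move=> [IO I0 ID IM [x Ix x0]]; split => //; last 2 first.
- by exists x.
- by exists 1; [exact: oner_neq0|move=> y /IO; rewrite mul1r].
split => // u v Iu Iv; apply: ID => //; rewrite -mulN1r; apply: IM => //.
by apply: roiN; exact: roi1.
Qed.

Lemma fractional_ideal I : fractional I -> I `<=` O -> nonzero_ideal I.
Proof.
move=> [sI OI [x Ix x0] _] IO; split => //; first exact: sI.1.
- by move=> u v; exact: subgroupD.
- by exists x.
Qed.

Lemma ideal_normE I s : nonzero_ideal I -> incong I s -> O = cosets I s -> ideal_norm I = size s.
Proof.
move=> nI; have [sI _ _ _] := ideal_fractional nI.
pose cs a := [set a + x | x in I].
have csP a a' : cs a = cs a' -> I (a - a').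
  move=> e; have : cs a a by exists 0; rewrite ?addr0//; exact: sI.1.
  by rewrite e => -[x Ix <-]; rewrite addrC addKr.
move=> hs OE.
have cE : ideal_cosets I = [set` [fset x in [seq cs a | a <- s]]%fset].
  apply/seteqP; split => A /=; rewrite !inE.
    move=> [a]; rewrite OE => -[a' a's h] <-; apply/mapP; exists a' => //.
    apply/seteqP; split => _ [x Ix <-].
      by exists (a - a' + x); [exact: subgroupD|rewrite addrA [a' + _]addrC subrK].
    exists (x - (a - a')); first exact: sI.2.
    by rewrite opprB addrCA [a + _]addrC subrK addrC.
  move=> /mapP[a as' ->]; exists a => //; rewrite OE; exists a => //.
  by rewrite subrr; exact: sI.1.
rewrite /ideal_norm cE set_fsetK card_fseq undup_id ?size_map//.
elim: (s) hs => [//|a t IH] /=; rewrite /incong /= => /andP[/allP h ht]; rewrite IH// andbT.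
by apply/mapP => -[a' a't /csP]; have /asboolP := h _ a't.
Qed.

(** Turns norms into ratios of densities. Positivity also shows that the value 0, reserved for
    infinite quotients, never occurs. *)
Lemma ideal_norm_dens I : nonzero_ideal I ->
  (ideal_norm I)%:R * dens I = c0 /\ (0 < ideal_norm I)%N.
Proof.
move=> nI; have fI := ideal_fractional nI; have [IO _ _ _ _] := nI.
have [s [hs e dE]] := index_exists fI roi_fractional IO.
rewrite (ideal_normE nI hs e) -dE dens_roi; split => //.
by case: (s) e => // e; have := roi0 L; rewrite e => -[].
Qed.

(** The larger ideal contains at least two classes of the smaller one. This strict decrease drives
    the inductions on the norm, in place of a chain condition. *)
Lemma ideal_norm_lt I J x : nonzero_ideal I -> nonzero_ideal J -> J `<=` I -> I x -> ~ J x ->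
  (ideal_norm I < ideal_norm J)%N.
Proof.
move=> nI nJ JI Ix Jx; have fI := ideal_fractional nI; have fJ := ideal_fractional nJ.
have [sJ _ _ _] := fJ; have [sI _ _ _] := fI.
have hs : incong J [:: x; 0] by rewrite /incong /= subr0 !andbT; apply/asboolP.
have sub : cosets J [:: x; 0] `<=` I.
  move=> z [a as' h]; rewrite -(subrK a z); apply: subgroupD => //; first exact: JI.
  by move: as'; rewrite !inE => /orP[] /eqP -> //; exact: sI.1.
have /= h2 := index_lower fJ fI hs sub.
have [eI pI] := ideal_norm_dens nI; have [eJ pJ] := ideal_norm_dens nJ.
have [_ dJ] := fractional_dens fJ.
rewrite -(ltr_nat R) -(ltr_pM2r dJ) eJ -eI ltr_pM2l ?ltr0n//.
by apply: lt_le_trans h2; rewrite mulrDl mul1r ltrDl.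
Qed.

Lemma ideal_norm_scale I x : nonzero_ideal I -> x != 0 ->
  nonzero_ideal [set x * y | y in I] ->
  (ideal_norm [set x * y | y in I])%:R = enorm sg x * (ideal_norm I)%:R :> R.
Proof.
move=> nI x0 nxI; have [e1 _] := ideal_norm_dens nI; have [e2 _] := ideal_norm_dens nxI.
have [_ dI] := fractional_dens (ideal_fractional nI).
have N0 := enorm_gt0 sg x0.
move: e2; rewrite dens_scale//; last exact: ideal_fractional.
rewrite -e1 => e; have dn0 : dens I != 0 by rewrite gt_eqF.
apply: (mulIf dn0); rewrite -mulrA -e; field; by rewrite gt_eqF.
Qed.

(** Pigeonhole instead of a determinant: two of the elements y^k a, with a in M, are congruent
    modulo a O, so y^j - y^i = c is integral and y is a root of the monic polynomial X^j - X^i -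
    c. *)
Lemma stable_integral M y : fractional M -> (forall x, M x -> M (y * x)) -> O y.
Proof.
move=> fM yM; have [sM OM [a Ma a0] _] := fM.
have yk k : M (y ^+ k * a).
  by elim: k => [|k IH]; rewrite ?expr0 ?mul1r// exprS -mulrA; exact: yM.
have [i [j [ij [c Oc e]]]] : exists i j, (i < j)%N /\ [set a * z | z in O] (y ^+ j * a - y ^+ i * a).
  apply: (pigeonhole (subgroup_scale a roi_subgroup) (principal_dens a0)
    (principal_dens_gt0 a0) (fractional_dens fM).1) => //.
  move=> u _ Mu [z Oz <-]; apply: subgroupD => //; rewrite mulrC; exact: OM.
have {e}cE : c = y ^+ j - y ^+ i.
  by apply: (mulfI a0); rewrite e -mulrBl mulrC.
pose p : {poly L} := 'X^j - ('X^i + c%:P).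
have sz : (size ('X^i + c%:P : {poly L})%R < size ('X^j : {poly L})%R)%N.
  rewrite size_polyXn ltnS (leq_trans (size_polyD _ _))// geq_max size_polyXn ij.
  by rewrite (leq_trans (size_polyC_leq1 _))// (leq_trans _ ij).
apply: (@integral_root_monic _ _ intr y p).
- by rewrite monicE lead_coefDl ?size_polyN// lead_coefXn.
- by rewrite /root /p !hornerE cE [y ^+ i + _]addrC subrK subrr.
- move=> _ /(nthP 0)[k _ <-]; rewrite /p coefB coefD coefXn coefXn coefC.
  apply: roiB; first exact: (roi_int L (k == j)%:Z).
  apply: roiD; first exact: (roi_int L (k == i)%:Z).
  by case: ifP => // _; exact: roi0.
Qed.

(** * Maximal ideals and products of maximal ideals *)

Definition maxideal P := [/\ nonzero_ideal P, ~ P 1 &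
  forall I, nonzero_ideal I -> P `<=` I -> ~ I 1 -> I `<=` P].

Lemma maxideal_exists J : nonzero_ideal J -> ~ J 1 -> exists2 P, maxideal P & J `<=` P.
Proof.
have [m] := ubnP (ideal_norm J); elim: m J => // m IH J Jm nJ J1.
have [h|h] := pselect (maxideal J); first by exists J.
have [I nI [JI I1] nIJ] : exists2 I, nonzero_ideal I & [/\ J `<=` I, ~ I 1 & ~ (I `<=` J)].
  apply: contrapT => no; apply: h; split => // I nI JI I1; apply: contrapT => nIJ.
  by apply: no; exists I.
have [x Ix Jx] : exists2 x, I x & ~ J x.
  apply: contrapT => no; apply: nIJ => x Ix; apply: contrapT => Jx; by apply: no; exists x.
have lt := ideal_norm_lt nI nJ JI Ix Jx.
have [P mP IP] := IH I (leq_trans lt Jm) nI I1.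
by exists P => //; exact: subset_trans IP.
Qed.

Lemma ideal_sum_principal I a : nonzero_ideal I -> O a ->
  nonzero_ideal [set x + a * c | x in I & c in O].
Proof.
move=> [IO I0 ID IM [x Ix x0]] Oa; split.
- by move=> _ [u Iu [c Oc <-]]; apply: roiD; [exact: IO|exact: roiM].
- by exists 0 => //; exists 0; [exact: roi0|rewrite mulr0 addr0].
- move=> _ _ [u Iu [c Oc <-]] [v Iv [c' Oc' <-]]; exists (u + v); first exact: ID.
  by exists (c + c'); [exact: roiD|rewrite mulrDr addrACA].
- move=> r _ Or [u Iu [c Oc <-]]; exists (r * u); first exact: IM.
  by exists (r * c); [exact: roiM|rewrite mulrDr mulrCA].
- by exists x => //; exists x => //; exists 0; [exact: roi0|rewrite mulr0 addr0].
Qed.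

Lemma maxideal_unit P a : maxideal P -> O a -> ~ P a -> exists2 c, O c & P (1 - a * c).
Proof.
move=> [nP P1 mP] Oa Pa; have nI := ideal_sum_principal nP Oa.
have [[p Pp [c Oc e]]|no] := pselect ([set x + a * c | x in P & c in O] 1).
  by exists c => //; rewrite -e addrK.
exfalso; apply: Pa; apply: (mP _ nI _ no).
  by move=> x Px; exists x => //; exists 0; [exact: roi0|rewrite mulr0 addr0].
have [_ P0 _ _ _] := nP; exists 0 => //; exists 1; first exact: roi1.
by rewrite mulr1 add0r.
Qed.

Lemma maxideal_prime P a b : maxideal P -> O a -> O b -> P (a * b) -> P a \/ P b.
Proof.
move=> mP Oa Ob Pab; have [|Pa] := pselect (P a); [by left|right].
have [c Oc h] := maxideal_unit mP Oa Pa.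
have [[_ _ PD PM _] _ _] := mP.
rewrite (_ : b = b * (1 - a * c) + c * (a * b)); last by ring.
by apply: PD; apply: PM.
Qed.

(** The inclusion of the product of [ps] in I, expressed by successive colon sets, so that no finite
    sums of products have to be formed. *)
Fixpoint contains_prod (ps : seq (set L)) I : Prop :=
  if ps is P :: ps' then forall p, P p -> contains_prod ps' [set x | I (p * x)] else I 1.

Lemma contains_prodS ps I J : I `<=` J -> contains_prod ps I -> contains_prod ps J.
Proof.
elim: ps I J => [|P ps IH] I J IJ /=; first exact: IJ.
by move=> h p /h; apply: IH => x; exact: IJ.
Qed.

Lemma contains_prod_cat ps1 ps2 I1 I : contains_prod ps1 I1 ->
  (forall x, I1 x -> contains_prod ps2 [set y | I (x * y)]) -> contains_prod (ps1 ++ ps2) I.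
Proof.
elim: ps1 I1 I => [|P ps1 IH] I1 I /=.
  by move=> h /(_ _ h); apply: contains_prodS => y /=; rewrite mul1r.
move=> h1 h2 p Pp; apply: (IH _ _ (h1 _ Pp)) => x /= /h2.
by apply: contains_prodS => y /=; rewrite mulrA.
Qed.

Lemma contains_prod_mid ps1 P ps2 I p : contains_prod (ps1 ++ P :: ps2) I -> P p ->
  contains_prod (ps1 ++ ps2) [set x | I (p * x)].
Proof.
elim: ps1 I => [|Q ps1 IH] I /=; first by move=> h; exact: h.
move=> h Pp q Qq; have := IH _ (h _ Qq) Pp.
by apply: contains_prodS => x /=; rewrite mulrCA.
Qed.

(** The element z is a product of members of the ideals in [ps]; the second clause records this as
    membership in every set that contains the product. *)
Lemma not_contains_prod ps I : ~ contains_prod ps I ->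
  exists z, ~ I z /\ forall J, contains_prod ps J -> J z.
Proof.
elim: ps I => [|P ps IH] I /=; first by move=> h; exists 1.
move=> h; have [p Pp hp] : exists2 p, P p & ~ contains_prod ps [set x | I (p * x)].
  apply: contrapT => no; apply: h => p Pp; apply: contrapT => hp; by apply: no; exists p.
have [z [nz hz]] := IH _ hp; exists (p * z); split => // J hJ.
exact: (hz [set x | J (p * x)] (hJ _ Pp)).
Qed.

(** Induction on the norm. If a b lies in I with a and b outside, the products for I + a O and I + b
    O are concatenated; otherwise I is prime, and then maximal because its quotient is finite. *)
Lemma contains_prod_exists I : nonzero_ideal I ->
  exists2 ps, (forall P, P \in ps -> maxideal P) & contains_prod ps I.
Proof.
have [m] := ubnP (ideal_norm I); elim: m I => // m IH I Im nI.
have [I1|I1] := pselect (I 1); first by exists [::].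
have [IO I0 ID IM _] := nI.
have [[a [b [[Oa Ob] [Ia Ib] Iab]]]|pr] := pselect (exists a b, [/\ O a /\ O b, ~ I a /\ ~ I b & I (a * b)]).
  have bigger c : O c -> ~ I c -> exists2 ps, (forall P, P \in ps -> maxideal P) &
      contains_prod ps [set x + c * r | x in I & r in O].
    move=> Oc Ic; have nJ := ideal_sum_principal nI Oc.
    apply: (IH _ _ nJ); apply: (@leq_trans (ideal_norm I)); last by rewrite -ltnS.
    apply: (ideal_norm_lt nJ nI _ _ Ic).
      by move=> x Ix; exists x => //; exists 0; [exact: roi0|rewrite mulr0 addr0].
    by exists 0 => //; exists 1; [exact: roi1|rewrite mulr1 add0r].
  have [ps1 m1 h1] := bigger _ Oa Ia; have [ps2 m2 h2] := bigger _ Ob Ib.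
  exists (ps1 ++ ps2).
    by move=> P; rewrite mem_cat => /orP[/m1|/m2].
  apply: (contains_prod_cat h1) => _ [u Iu [r Or <-]].
  apply: contains_prodS h2 => _ [v Iv [r' Or' <-]] /=.
  rewrite (_ : (u + a * r) * (v + b * r') = (v + b * r') * u + (a * r * v + r * r' * (a * b))); last by ring.
  apply: (ID); first by apply: IM => //; apply: roiD; [exact: IO|exact: roiM].
  by apply: (ID); apply: (IM) => //; exact: roiM.
exists [:: I]; last by move=> p Ip /=; rewrite mulr1.
move=> P; rewrite inE => /eqP ->; split => // J nJ IJ J1 x Jx; apply: contrapT => Ix.
have [JO _ JD JM _] := nJ; have [sI _ _ _] := ideal_fractional nI.
have [sJ _ _ _] := ideal_fractional nJ.
have Ox := JO _ Jx.
have Oxk k : O (x ^+ k).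
  by elim: k => [|k IHk]; rewrite ?expr0 ?exprS; [exact: roi1|exact: roiM].
(* Two powers of x agree modulo I. As I is prime and contains no power of x, some x^(j-i) - 1 lies
   in I, which puts 1 in J. *)
have [i [j [ij h]]] : exists i j, (i < j)%N /\ I (x ^+ j - x ^+ i).
  apply: (pigeonhole sI (fractional_dens (ideal_fractional nI)).1
    (fractional_dens (ideal_fractional nI)).2 O_dens) => //.
  by move=> u v Ou /IO; exact: roiD.
have prime u v : O u -> O v -> I (u * v) -> I u \/ I v.
  move=> Ou Ov Iuv; have [|Iu] := pselect (I u); [by left|right].
  by apply: contrapT => Iv; apply: pr; exists u, v.
have xk k : ~ I (x ^+ k).
  elim: k => [|k IHk]; rewrite ?expr0// exprS => /(prime _ _ Ox (Oxk k)) [].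
    exact: Ix.
  exact: IHk.
have : I (x ^+ i * (x ^+ (j - i) - 1)) by rewrite mulrBr mulr1 -exprD subnKC// ltnW.
move=> /prime; case=> //.
- by apply: roiB => //; exact: roi1.
- exact: xk.
move=> /IJ h'; apply: J1; rewrite (_ : 1 = x ^+ (j - i) - (x ^+ (j - i) - 1)); last by rewrite opprB addrC subrK.
apply: sJ.2 => //; rewrite -(subnSK ij) exprS mulrC; exact: JM.
Qed.

(** [c] collects factors outside P: as long as the head Q differs from P, it has an element outside
    P, and c times this element is still outside P since P is prime. *)
Lemma maxideal_mem_prod P ps c : maxideal P -> (forall Q, Q \in ps -> maxideal Q) ->
  O c -> ~ P c -> contains_prod ps [set x | P (c * x)] ->
  exists ps1 ps2, ps = ps1 ++ P :: ps2.
Proof.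
move=> mP; elim: ps c => [|Q ps IH] c mps Oc Pc /=; first by rewrite mulr1.
move=> h; have [->|QP] := eqVneq Q P; first by exists [::], ps.
have [[QO _ _ _ _] Q1 mQ] : maxideal Q by apply: mps; rewrite mem_head.
have [nP P1 _] := mP.
have [q Qq Pq] : exists2 q, Q q & ~ P q.
  apply: contrapT => no; move/eqP: QP; apply.
  have QP : Q `<=` P by move=> q Qq; apply: contrapT => Pq; apply: no; exists q.
  by apply/seteqP; split => //; exact: mQ.
have [||||ps1 [ps2 ->]] := IH (c * q).
- by move=> Q' h'; apply: mps; rewrite inE h' orbT.
- by apply: roiM => //; exact: QO.
- by move=> /(maxideal_prime mP Oc (QO _ Qq)) [].
- by apply: contains_prodS (h _ Qq) => x /=; rewrite mulrA.
by exists (Q :: ps1), ps2.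
Qed.

(** Take a nonzero a in P and a product of maximal ideals of minimal length inside a O. One factor
    is P; by minimality the product of the others contains some z outside a O, and y = z / a
    works. *)
Lemma maxideal_inverse P : maxideal P -> exists2 y, ~ O y & forall p, P p -> O (y * p).
Proof.
move=> mP; have [nP P1 _] := mP; have [PO _ _ PM [a Pa a0]] := nP.
pose aO := [set a * c | c in O].
have naO : nonzero_ideal aO.
  split.
  - by move=> _ [c Oc <-]; apply: roiM => //; exact: PO.
  - by exists 0; [exact: roi0|rewrite mulr0].
  - by move=> _ _ [c Oc <-] [c' Oc' <-]; exists (c + c'); [exact: roiD|rewrite mulrDr].
  - by move=> r _ Or [c Oc <-]; exists (r * c); [exact: roiM|rewrite mulrCA].
  - by exists a => //; exists 1; [exact: roi1|rewrite mulr1].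
pose pr m := `[< exists ps, [/\ size ps = m, (forall Q, Q \in ps -> maxideal Q) & contains_prod ps aO] >].
have ex : exists m, pr m.
  have [ps mps hps] := contains_prod_exists naO; exists (size ps).
  by apply/asboolP; exists ps.
case: (ex_minnP ex) => m /asboolP[ps [sz mps hps]] minm.
have aOP : aO `<=` P by move=> _ [c Oc <-]; rewrite mulrC; exact: PM.
have [ps1 [ps2 psE]] : exists ps1 ps2, ps = ps1 ++ P :: ps2.
  apply: (maxideal_mem_prod mP mps (roi1 L) P1).
  by apply: contains_prodS hps => x /aOP /=; rewrite mul1r.
have no : ~ contains_prod (ps1 ++ ps2) aO.
  move=> h; have /minm : pr (size (ps1 ++ ps2)).
    apply/asboolP; exists (ps1 ++ ps2); split => // Q; rewrite mem_cat => hQ.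
    by apply: mps; rewrite psE mem_cat inE; case/orP: hQ => ->; rewrite ?orbT.
  by rewrite -sz psE !size_cat /= addnS ltnn.
have [z [nz hz]] := not_contains_prod no.
exists (z / a).
  by move=> Oy; apply: nz; exists (z / a) => //; rewrite mulrCA mulfV// mulr1.
move=> p Pp; rewrite psE in hps.
have [c Oc e] := hz _ (contains_prod_mid hps Pp).
by rewrite mulrAC [z * p]mulrC -e mulrAC mulfV// mul1r.
Qed.

(** * Inverse ideals *)

Definition inv_ideal J : set L := [set x | forall z, J z -> O (x * z)].

Lemma inv_ideal_fractional J : nonzero_ideal J -> fractional (inv_ideal J).
Proof.
move=> [JO J0 JD JM [x Jx x0]]; split.
- split; first by move=> z _; rewrite mul0r; exact: roi0.
  by move=> u v hu hv z Jz; rewrite mulrBl; apply: roiB; [exact: hu|exact: hv].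
- by move=> a u Oa hu z Jz; rewrite -mulrA; apply: roiM => //; exact: hu.
- by exists 1; [move=> z /JO; rewrite mul1r|exact: oner_neq0].
- by exists x => // u /(_ _ Jx); rewrite mulrC.
Qed.

(* The inequality means that the norm of the inverse of J is at most 1 / N(J).
   Descend from J to J + y J, where y is non-integral and y P is integral for a
   maximal ideal P containing J; the second part is what survives of the
   invertibility of J. *)
Lemma dens_inverse J : nonzero_ideal J -> c0 ^+ 2 <= dens J * dens (inv_ideal J) /\
  forall P, maxideal P -> exists a b, [/\ inv_ideal J a, J b & ~ P (a * b)].
Proof.
have [m] := ubnP (ideal_norm J); elim: m J => // m IH J Jm nJ.
have [JO J0 JD JM Jx] := nJ.
have [J1|J1] := pselect (J 1).
  have JE : J = O by apply/seteqP; split => // x Ox; rewrite -[x]mulr1; exact: JM.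
  have iE : inv_ideal J = O.
    apply/seteqP; split => x; first by move=> /(_ _ J1); rewrite mulr1.
    by move=> Ox z /JO; exact: roiM.
  rewrite iE JE dens_roi expr2; split => // P [_ P1 _].
  by exists 1, 1; split; [exact: roi1|exact: roi1|rewrite mulr1].
have [P mP JP] := maxideal_exists nJ J1.
have [nP P1 mxP] := mP; have [PO P0 PD PM _] := nP.
have [y Oy yP] := maxideal_inverse mP.
have fP := ideal_fractional nP; have fJ := ideal_fractional nJ.
(* P + y P is an ideal containing P. If it were proper, maximality would give y P inside P and y
   would be integral; so it contains 1. *)
have [p [q [Pp Pq pq]]] : exists p q, [/\ P p, P q & 1 = p + y * q].
  pose I := [set p + y * q | p in P & q in P].
  have IO : I `<=` O by move=> _ [p Pp [q Pq <-]]; apply: roiD; [exact: PO|exact: yP].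
  have PI : P `<=` I by move=> p Pp; exists p => //; exists 0 => //; rewrite mulr0 addr0.
  have nI : nonzero_ideal I.
    split => //; first exact: PI.
    - move=> _ _ [u Pu [v Pv <-]] [u' Pu' [v' Pv' <-]]; exists (u + u'); first exact: PD.
      by exists (v + v'); [exact: PD|rewrite mulrDr addrACA].
    - move=> r _ Or [u Pu [v Pv <-]]; exists (r * u); first exact: PM.
      by exists (r * v); [exact: PM|rewrite mulrDr [y * _]mulrCA].
    - by have [_ _ _ _ [x Px x0]] := nP; exists x => //; exact: PI.
  have [[p Pp [q Pq e]]|no] := pselect (I 1); first by exists p, q.
  exfalso; apply: Oy; apply: (stable_integral fP) => x Px.
  apply: (mxP _ nI PI no); exists 0 => //; exists x => //; by rewrite add0r.
(* This ideal lies in O because J is inside P, and it is strictly larger than J, since y J inside J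
   would make y integral. *)
pose J1' := [set u + y * v | u in J & v in J].
have J1O : J1' `<=` O.
  by move=> _ [u Ju [v Jv <-]]; apply: roiD; [exact: JO|apply: yP; exact: JP].
have JJ1 : J `<=` J1' by move=> u Ju; exists u => //; exists 0 => //; rewrite mulr0 addr0.
have nJ1 : nonzero_ideal J1'.
  split => //; first exact: JJ1.
  - move=> _ _ [u Ju [v Jv <-]] [u' Ju' [v' Jv' <-]]; exists (u + u'); first exact: JD.
    by exists (v + v'); [exact: JD|rewrite mulrDr addrACA].
  - move=> r _ Or [u Ju [v Jv <-]]; exists (r * u); first exact: JM.
    by exists (r * v); [exact: JM|rewrite mulrDr [y * _]mulrCA].
  - by have [x Jx' x0] := Jx; exists x => //; exact: JJ1.
have PJ1 u x : P u -> J1' x -> J (u * x).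
  move=> Pu [v Jv [w Jw <-]]; rewrite mulrDr; apply: JD; first by apply: JM => //; exact: PO.
  by rewrite mulrA [u * y]mulrC; apply: JM => //; exact: yP.
have [z Jz Jyz] : exists2 z, J z & ~ J (y * z).
  apply: contrapT => no; apply: Oy; apply: (stable_integral fJ) => z Jz.
  by apply: contrapT => Jyz; apply: no; exists z.
have lt : (ideal_norm J1' < ideal_norm J)%N.
  apply: (ideal_norm_lt nJ1 nJ JJ1 _ Jyz); exists 0 => //; exists z => //; by rewrite add0r.
have [hd hl] := IH J1' (leq_trans lt Jm) nJ1.
have fJ1 := ideal_fractional nJ1.
have fi := inv_ideal_fractional nJ; have fi1 := inv_ideal_fractional nJ1.
have i1i : inv_ideal J1' `<=` inv_ideal J by move=> x hx w /JJ1; exact: hx.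
have yi x : inv_ideal J1' x -> inv_ideal J (y * x).
  move=> hx w Jw.
  have -> : y * x * w = (y * p) * (x * w) + (y * q) * (x * (y * w)).
    by rewrite -[LHS]mulr1 pq; ring.
  have xw : O (x * w) by apply: hx; exact: JJ1.
  have xyw : O (x * (y * w)).
    by apply: hx; exists 0 => //; exists w => //; rewrite add0r.
  by apply: roiD; apply: roiM => //; exact: yP.
have [t [ht tE dt]] := index_exists fP roi_fractional PO.
(* The index of J in J1' is at most N(P). By induction there is a b outside P, with a inverse r
   modulo P, and then x in J1' is determined modulo J by the class of a x modulo P. *)
have up : dens J1' <= (size t)%:R * dens J.
  have [a [b [ha hb hab]]] := hl P mP.
  have Oab : O (a * b) by exact: ha.
  have [r Or h] := maxideal_unit mP Oab hab.
  rewrite -(size_map (fun c => c * (r * b)) t); apply: index_upper => // x Jx1.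
  have : O (a * x) by exact: ha.
  rewrite tE => -[c ct Pc]; exists (c * (r * b)); first by apply/mapP; exists c.
  have -> : x - c * (r * b) = (1 - a * b * r) * x + (a * x - c) * (r * b) by ring.
  apply: JD; first exact: PJ1.
  by apply: PJ1 => //; have [_ _ _ h1 _] := nJ1; exact: h1.
(* Dually, the inverse of J has at least N(P) classes modulo that of J1': the multiples c x by a
   transversal modulo P are incongruent. *)
have lo : (size t)%:R * dens (inv_ideal J1') <= dens (inv_ideal J).
  have [x hx hx1] : exists2 x, inv_ideal J x & ~ inv_ideal J1' x.
    apply: contrapT => no; apply: Oy; apply: (stable_integral fi1) => x /yi hx.
    by apply: contrapT => hx1; apply: no; exists (y * x).
  (* K is an ideal that contains P and not 1, hence lies in P by maximality; so the class of c x
     determines c modulo P. *)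
  pose K := [set c | O c /\ inv_ideal J1' (c * x)].
  have PK : P `<=` K.
    move=> u Pu; split; first exact: PO.
    by move=> w Jw; rewrite [u * x]mulrC -mulrA; apply: hx; exact: PJ1.
  have [si1 s1M _ _] := fi1.
  have nK : nonzero_ideal K.
    split.
    - by move=> c [].
    - by exact: PK.
    - move=> u v [Ou hu] [Ov hv]; split; first exact: roiD.
      by rewrite mulrDl; exact: (subgroupD si1 hu hv).
    - by move=> r u Or [Ou hu]; split; [exact: roiM|rewrite -mulrA; exact: s1M].
    - by have [_ _ _ _ [w Pw w0]] := nP; exists w => //; exact: PK.
  have KP : K `<=` P by apply: mxP => // -[_]; rewrite mul1r.
  have Ot c : c \in t -> O c.
    move=> ct; rewrite tE; exists c => //; rewrite subrr; exact: P0.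
  rewrite -(size_map (fun c => c * x) t); apply: index_lower => //.
    elim: (t) ht Ot => [//|c s IHs] /=; rewrite /incong /= => /andP[/allP hc hs] Os.
    apply/andP; split; last by apply: IHs => // c' h'; apply: Os; rewrite inE h' orbT.
    apply/allP => _ /mapP[c' c's ->]; apply/asboolP => h.
    have /asboolP := hc _ c's; apply; apply: KP; split; last by rewrite mulrBl.
    by apply: roiB; apply: Os; rewrite ?mem_head// inE c's orbT.
  move=> w [_ /mapP[c ct ->] h]; rewrite -(subrK (c * x) w).
  have [si si2 _ _] := fi.
  by apply: (subgroupD si); [exact: i1i|apply: si2 => //; exact: Ot].
split.
  have t0 : 0 < (size t)%:R :> R.
    rewrite ltr0n; case: (t) tE => // e; by have := roi0 L; rewrite e => -[].
  have [_ d1] := fractional_dens fi1; have [_ dJ] := fractional_dens fJ.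
  apply: (le_trans hd); apply: (@le_trans _ _ ((size t)%:R * dens J * dens (inv_ideal J1'))).
    by rewrite ler_wpM2r// ltW.
  by rewrite mulrAC mulrC ler_wpM2l// ltW.
(* The pair for J comes from that of J1': for P itself it is multiplied by y and q, as y q = 1 - p
   is 1 modulo P; for another P', by an element of P outside P'. *)
move=> P' mP'; have [a1 [b1 [ha hb hab]]] := hl P' mP'.
have Oab : O (a1 * b1) by exact: ha.
have [e|PP'] := eqVneq P P'.
  exists (y * a1), (q * b1); split; [exact: yi|exact: PJ1|].
  rewrite -e in hab *; move=> h; apply: hab.
  rewrite (_ : a1 * b1 = a1 * b1 * p + y * a1 * (q * b1)); last by rewrite -[LHS]mulr1 pq; ring.
  by apply: PD => //; exact: PM.
have [nP' P'1 _] := mP'.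
have [c Pc P'c] : exists2 c, P c & ~ P' c.
  apply: contrapT => no; move/eqP: PP'; apply.
  have sub : P `<=` P' by move=> c Pc; apply: contrapT => h; apply: no; exists c.
  by apply/seteqP; split => //; exact: mxP.
exists a1, (c * b1); split; [exact: i1i|exact: PJ1|].
rewrite mulrCA => /(maxideal_prime mP' (PO _ Pc) Oab) []; [exact: P'c|exact: hab].
Qed.

End Ideals.

(** * Theta series of a lattice and its classes modulo 2 *)

Section ThetaBounds.
Variables (R : realType) (L : fieldExtType rat).
Local Notation n := (\dim {:L}).
Local Notation cabs := (@Normc.normc R).
Variables (sg : 'I_n -> {rmorphism L -> R[i]}) (tau : 'I_n -> R).
Hypothesis tau_gt0 : forall i, 0 < tau i.
Local Notation Q := (sqf sg tau).
Implicit Types (A B G : set L) (t : R) (x y a : L).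

Lemma two_neq0 : (2 : L) != 0.
Proof. by rewrite -[2](rmorph_nat (in_alg L)) fmorph_eq0. Qed.

Lemma sqr_sum_le (I : Type) (r : seq I) (f : I -> R) :
  (\sum_(i <- r) f i) ^+ 2 <= (size r)%:R * \sum_(i <- r) f i ^+ 2.
Proof.
elim: r => [|i r IH]; first by rewrite !big_nil mulr0 expr0n.
rewrite !big_cons /= -natr1; set S := \sum_(_ <- r) _ in IH *; set T := \sum_(_ <- r) _ in IH *.
have T0 : 0 <= T by apply: sumr_ge0 => j _; exact: sqr_ge0.
case: (size r) IH => [|k] IH.
  move: IH; rewrite mul0r => IH; have /eqP : S ^+ 2 = 0 by apply/le_anti; rewrite IH sqr_ge0.
  by rewrite sqrf_eq0 => /eqP ->; rewrite add0r mul1r addr0 lerDl.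
have k0 : 0 < k.+1%:R :> R by rewrite ltr0n.
have h : 2 * S * f i <= k.+1%:R * f i ^+ 2 + T.
  rewrite -(ler_pM2l k0); have := sqr_ge0 (S - k.+1%:R * f i); rewrite sqrrB; nra.
have -> : (f i + S) ^+ 2 = f i ^+ 2 + 2 * S * f i + S ^+ 2 by ring.
have -> : (k.+1%:R + 1) * (f i ^+ 2 + T) = k.+1%:R * f i ^+ 2 + k.+1%:R * T + f i ^+ 2 + T by ring.
by move: h IH; lra.
Qed.

Lemma sqf_ge0 x : 0 <= Q x.
Proof. by apply: sumr_ge0 => i _; rewrite mulr_ge0 ?sqr_ge0// ltW. Qed.

Lemma sqf0 : Q 0 = 0.
Proof. by rewrite /sqf big1// => i _; rewrite rmorph0 cabs0 expr0n mulr0. Qed.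

Lemma sqf_parallelogram x y : Q (x + y) + Q (x - y) = 2 * Q x + 2 * Q y.
Proof.
rewrite /sqf !big_distrr -!big_split/=; apply: eq_bigr => i _.
rewrite rmorphD rmorphB !cabs_sqr.
by case: (sg i x) => a b; case: (sg i y) => c d /=; ring.
Qed.

Lemma sqfN x : Q (- x) = Q x.
Proof. by apply: eq_bigr => i _; rewrite rmorphN cabsN. Qed.

Lemma sqf_scale (q : rat) x : Q (q *: x) = ratr q ^+ 2 * Q x.
Proof.
rewrite /sqf big_distrr/=; apply: eq_bigr => i _.
rewrite rmorph_scaleC cabsM ratrC cabs_real exprMn real_normK ?num_real//; ring.
Qed.

Lemma sqf_mul2 x : Q (2 * x) = 4 * Q x.
Proof.
rewrite /sqf big_distrr/=; apply: eq_bigr => i _; rewrite rmorphM rmorph_nat cabsM.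
have -> : cabs 2 = 2 by rewrite -[2](rmorph_nat (real_complex R)) cabs_real ger0_norm.
ring.
Qed.

Lemma sqf_sum (I : Type) (r : seq I) (f : I -> L) :
  Q (\sum_(i <- r) f i) <= (size r)%:R * \sum_(i <- r) Q (f i).
Proof.
rewrite /sqf exchange_big/= big_distrr/=; apply: ler_sum => i _.
rewrite -mulr_sumr [leRHS]mulrCA ler_wpM2l ?(ltW (tau_gt0 i))//.
apply: le_trans (sqr_sum_le _ _); rewrite ler_sqr ?nnegrE ?cabs_ge0 ?sumr_ge0//; last first.
  by move=> *; exact: cabs_ge0.
rewrite rmorph_sum; elim: r => [|j r IH]; first by rewrite !big_nil cabs0.
by rewrite !big_cons (le_trans (cabsD _ _))// lerD2l.
Qed.

Definition gterm t x : R := expR (- (pi * t * Q x)).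
Definition Theta A t : \bar R := (\esum_(x in A) (gterm t x)%:E)%E.
Definition rTheta A t : R := fine (Theta A t).

Lemma gterm_ge0 t x : 0 <= gterm t x. Proof. exact: expR_ge0. Qed.

Lemma Theta_ge0 A t : (0 <= Theta A t)%E.
Proof. by apply: esum_ge0 => x _; rewrite lee_fin gterm_ge0. Qed.

Lemma theta_dscale A t : theta sg (dscale t tau) A 0 = Theta A t.
Proof. by apply: eq_esum => x _; rewrite addr0 sqf_dscale mulrA. Qed.

Lemma esum_cosets B s (f : L -> \bar R) : subgroup B -> (forall x, 0%E <= f x)%E -> incong B s ->
  (\esum_(x in cosets B s) f x = \sum_(a <- s) \esum_(x in B) f (a + x)%R)%E.
Proof.
move=> sB f0; elim: s => [_|a s IH].
  rewrite big_nil (_ : cosets B [::] = set0) ?esum_set0//.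
  by apply/seteqP; split => // x [].
rewrite /incong/= => /andP[/allP ha hs]; rewrite cosets_cons big_cons -IH//.
rewrite esum_setU//; last first.
  apply/disj_set2P/seteqP; split => // _ [[y By <-] [a' a's h]].
  have /asboolP := ha _ a's; apply.
  by rewrite (_ : a - a' = (a + y - a') - y); [exact: sB.2|rewrite addrAC addrK].
by congr (_ + _)%E; rewrite esum_image//; move=> x y _ _ /addrI.
Qed.

Lemma esum_shift B a (f : L -> \bar R) : subgroup B -> B a ->
  (\esum_(x in B) f (a + x)%R = \esum_(x in B) f x)%E.
Proof.
move=> sB Ba; rewrite [RHS](@reindex_esum R _ _ B B (fun x => a + x))//; split.
- by move=> x Bx; exact: subgroupD.
- by move=> x y _ _ /addrI.
- by move=> x Bx; exists (x - a); [exact: sB.2|rewrite addrC subrK].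
Qed.

Lemma esum_opp B (f : L -> \bar R) : subgroup B ->
  (\esum_(x in B) f (- x)%R = \esum_(x in B) f x)%E.
Proof.
move=> sB; rewrite [RHS](@reindex_esum R _ _ B B (fun x => - x))//; split.
- by move=> x; exact: subgroupN.
- by move=> x y _ _ /oppr_inj.
- by move=> x Bx; exists (- x); [exact: subgroupN|rewrite opprK].
Qed.

Lemma Theta_anti A t t' : t <= t' -> (Theta A t' <= Theta A t)%E.
Proof.
move=> tt'; apply: le_esum => x _; rewrite lee_fin ler_expR lerN2 ler_wpM2r ?sqf_ge0//.
by rewrite ler_wpM2l// pi_ge0.
Qed.

Section Lattice.
Variable A : set L.
Hypotheses (sA : subgroup A) (finA : forall t, 0 < t -> (Theta A t < +oo)%E).
Let A2 := [set 2 * x | x in A].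

Lemma rThetaE t : 0 < t -> Theta A t = (rTheta A t)%:E.
Proof. by move=> t0; rewrite /rTheta fineK// ge0_fin_numE ?Theta_ge0// finA. Qed.

Lemma rTheta_ge0 t : 0 <= rTheta A t.
Proof. by rewrite fine_ge0 ?Theta_ge0. Qed.

Let sA2 : subgroup A2. Proof. exact: subgroup_scale. Qed.
Let A2A : A2 `<=` A.
Proof. by move=> _ [x Ax <-]; rewrite mulr_natl; exact: subgroup_mulrn. Qed.

Lemma rTheta_le t t' : 0 < t -> t <= t' -> rTheta A t' <= rTheta A t.
Proof.
move=> t0 tt'; rewrite -lee_fin -!rThetaE ?(lt_le_trans t0 tt')//; exact: Theta_anti.
Qed.

Lemma Theta_sqr t : 0 < t -> (\esum_(u in A) ((gterm t u)%:E * \esum_(w in A2) (gterm t (u + w)%R)%:E) =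
  Theta A (2 * t) * Theta A (2 * t))%E.
Proof.
move=> t0; transitivity (\esum_(u in A) \esum_(w in A2) ((gterm t u)%:E * (gterm t (u + w)%R)%:E))%E.
  apply: eq_esum => u _; rewrite esumZl ?gterm_ge0// => w _; by rewrite lee_fin gterm_ge0.
rewrite esum_esum; last by move=> u w _ _; rewrite -EFinM lee_fin mulr_ge0 ?gterm_ge0.
transitivity (\esum_(x in A) ((gterm (2 * t) x)%:E * Theta A (2 * t)))%E; last first.
  rewrite rThetaE ?mulr_gt0//.
  under eq_esum do rewrite muleC.
  rewrite esumZl ?rTheta_ge0//; last by move=> x _; rewrite lee_fin gterm_ge0.
  by rewrite -rThetaE ?mulr_gt0.
transitivity (\esum_(x in A) \esum_(y in A) ((gterm (2 * t) x)%:E * (gterm (2 * t) y)%:E))%E; last first.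
  apply: eq_esum => u _; rewrite esumZl ?gterm_ge0// => w _; by rewrite lee_fin gterm_ge0.
rewrite esum_esum; last by move=> u w _ _; rewrite -EFinM lee_fin mulr_ge0 ?gterm_ge0.
(* The substitution u = x + y, u + w = x - y; a displacement w in 2 A is exactly what makes x and y
   lie in A. *)
rewrite (@reindex_esum R _ _ (A `*`` (fun=> A)) (A `*`` (fun=> A2))
   (fun k => (k.1 + k.2, - (2 * k.2)))); last first.
  split.
  - move=> [x y] [/= Ax Ay]; split => /=; first exact: subgroupD.
    by exists (- y); [exact: subgroupN|rewrite mulrN].
  - move=> [x y] [x' y'] _ _ /= [e1 /oppr_inj e2].
    have n2 := two_neq0.
    by move: e1; rewrite (mulfI n2 e2) => /addIr ->.
  - move=> [u w] [/= Au [y Ay <-]]; exists (u + y, - y) => /=.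
      by split => /=; [exact: subgroupD|exact: subgroupN].
    by rewrite addrK mulrN opprK.
apply: eq_esum => -[x y] [_ _] /=; rewrite -!EFinM -!expRD; congr ((expR _)%:E).
have -> : x + y - 2 * y = x - y by ring.
rewrite -!opprD -!mulrDr sqf_parallelogram; ring.
Qed.

(* After Cauchy-Schwarz over the classes modulo 2 A there remains the sum over
   the congruent pairs; these are the (x + y, x - y), and the parallelogram law
   factors it. *)
Lemma rTheta_double s t : incong A2 s -> A = cosets A2 s -> 0 < t ->
  rTheta A t ^+ 2 <= (size s)%:R * rTheta A (2 * t) ^+ 2.
Proof.
move=> hs AE t0; have t20 : 0 < 2 * t by rewrite mulr_gt0.
pose S a := (\esum_(x in A2) (gterm t (a + x)%R)%:E)%E.
have sAs a : a \in s -> A a by move=> as'; rewrite AE; exists a => //; rewrite subrr; exact: sA2.1.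
have Sfin a : a \in s -> S a = (fine (S a))%:E.
  move=> /sAs Aa; rewrite fineK// ge0_fin_numE; last by apply: esum_ge0 => x _; rewrite lee_fin gterm_ge0.
  apply: le_lt_trans (finA t0); rewrite -[leRHS](esum_shift (fun x => (gterm t x)%:E) sA Aa).
  exact: esum_setS.
have e1 : rTheta A t = \sum_(a <- s) fine (S a).
  apply: EFin_inj; rewrite -rThetaE// /Theta {1}AE esum_cosets//; last by move=> x; rewrite lee_fin gterm_ge0.
  rewrite -sumEFin big_seq [RHS]big_seq; apply: eq_bigr => a as'; exact: Sfin.
have e2 : \sum_(a <- s) (fine (S a)) ^+ 2 = rTheta A (2 * t) ^+ 2.
  apply: EFin_inj; rewrite expr2 EFinM -rThetaE// -Theta_sqr// {1}AE esum_cosets//; last first.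
    move=> x; rewrite mule_ge0 ?lee_fin ?gterm_ge0// esum_ge0// => w _; by rewrite lee_fin gterm_ge0.
  rewrite -sumEFin big_seq [RHS]big_seq; apply: eq_bigr => a as'.
  transitivity (\esum_(x in A2) ((fine (S a))%:E * (gterm t (a + x)%R)%:E))%E.
    rewrite esumZl; [|by rewrite fine_ge0// esum_ge0// => w _; rewrite lee_fin gterm_ge0|
      by move=> x _; rewrite lee_fin gterm_ge0].
    by rewrite -/(S a) Sfin// expr2 EFinM.
  apply: eq_esum => x A2x; rewrite muleC; congr (_ * _)%E; rewrite -Sfin//.
  rewrite -[LHS](esum_shift (fun w => (gterm t (a + w)%R)%:E) sA2 A2x).
  by apply: eq_esum => w _; rewrite addrA.
by rewrite e1 -e2; exact: sqr_sum_le.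
Qed.

(* On the class of a short vector a' modulo 2 A, average over x and - x. *)
Lemma rTheta_quad s t (K : R) : incong A2 s -> A = cosets A2 s -> 0 < t ->
  (forall a, A a -> exists2 a', A2 (a - a') & Q a' <= K) ->
  (size s)%:R * expR (- (pi * t * K)) * rTheta A (4 * t) <= rTheta A t.
Proof.
move=> hs AE t0 hK; have t40 : 0 < 4 * t by rewrite mulr_gt0.
rewrite -lee_fin -rThetaE// /Theta {2}AE esum_cosets//; last by move=> x; rewrite lee_fin gterm_ge0.
have sAs a : a \in s -> A a by move=> as'; rewrite AE; exists a => //; rewrite subrr; exact: sA2.1.
have key a : a \in s -> ((expR (- (pi * t * K)) * rTheta A (4 * t))%:E <=
    \esum_(x in A2) (gterm t (a + x)%R)%:E)%E.
  move=> /sAs /hK [a' ha' Qa'].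
  have -> : (\esum_(x in A2) (gterm t (a + x)%R)%:E = \esum_(x in A2) (gterm t (a' + x)%R)%:E)%E.
    rewrite -[RHS](esum_shift (fun w => (gterm t (a' + w)%R)%:E) sA2 ha').
    by apply: eq_esum => w _; rewrite addrA [a' + _]addrC subrK.
  set S := (\esum_(x in A2) _)%E.
  have S2 : S = (\esum_(x in A2) (gterm t (x - a')%R)%:E)%E.
    rewrite -(esum_opp (fun x => (gterm t (x - a'))%:E) sA2); apply: eq_esum => x _.
    by rewrite -opprD /gterm sqfN addrC.
  have S0 : (0 <= S)%E by apply: esum_ge0 => x _; rewrite lee_fin gterm_ge0.
  (* S is added to its copy under x -> - x. The scaling Q(2 x) = 4 Q(x) then produces the theta
     value at 4 t. *)
  have : (2%:E * (expR (- (pi * t * K)) * rTheta A (4 * t))%:E <= S + S)%E.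
    rewrite {2}S2 -esumD; try by move=> x _; rewrite lee_fin gterm_ge0.
    have -> : (2%:E * (expR (- (pi * t * K)) * rTheta A (4 * t))%:E =
       \esum_(x in A2) (2 * expR (- (pi * t * K)) * gterm t x)%:E)%E.
      under eq_esum do rewrite EFinM.
      rewrite esumZl; [|by rewrite mulr_ge0 ?expR_ge0|by move=> x _; rewrite lee_fin gterm_ge0].
      transitivity ((2 * expR (- (pi * t * K)))%:E * (rTheta A (4 * t))%:E)%E.
        by rewrite -!EFinM mulrA.
      congr (mule _ _).
      rewrite -rThetaE// /Theta /A2 esum_image; last first.
        by move=> x y _ _; apply: mulfI; exact: two_neq0.
      by apply: eq_esum => x _; rewrite /gterm sqf_mul2; congr ((expR _)%:E); ring.
    apply: le_esum => x _; rewrite -EFinD lee_fin.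
    have par := sqf_parallelogram a' x.
    apply: (@le_trans _ _ (2 * expR (- (pi * t * (Q a' + Q x))))).
      rewrite -mulrA ler_wpM2l// /gterm -expRD ler_expR -opprD lerN2 -mulrDr ler_wpM2l ?lerD2r//.
      by rewrite mulr_ge0 ?pi_ge0// ltW.
    rewrite /gterm -[x - a']opprB sqfN.
    (* Inequality of the arithmetic and geometric means for e^p and e^q, with p + q given by the
       parallelogram law. *)
    set p := - (pi * t * Q (a' + x)); set q := - (pi * t * Q (a' - x)).
    have -> : - (pi * t * (Q a' + Q x)) = p / 2 + q / 2.
      by rewrite /p /q -mulrDl -opprD -mulrDr par; field.
    rewrite expRD {2}(_ : p = p / 2 + p / 2); last by field.
    rewrite {2}(_ : q = q / 2 + q / 2); last by field.
    rewrite !expRD; have := sqr_ge0 (expR (p / 2) - expR (q / 2)); rewrite sqrrB; nra.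
  clearbody S; case: S S0 {S2} => [r _|_ _|]; [|by rewrite leey|by []].
  by rewrite -EFinM -EFinD !lee_fin; lra.
rewrite -mulrA.
rewrite (_ : (size s)%:R * _ = \sum_(a <- s) (expR (- (pi * t * K)) * rTheta A (4 * t))); last first.
  by rewrite big_const_seq count_predT iter_addr_0 mulr_natl.
rewrite -sumEFin big_seq [leRHS]big_seq; exact: lee_sum.
Qed.

End Lattice.

(** * Independence modulo 2 and short representatives *)

Lemma subgroup_mulrz G x (z : int) : subgroup G -> G x -> G (x *~ z).
Proof.
move=> sG Gx; case: z => k; first exact: subgroup_mulrn.
by rewrite NegzE mulrNz; apply: subgroupN => //; exact: subgroup_mulrn.
Qed.

(** Infinite descent on the sum of the absolute values of an integer relation. An odd coefficient
    would put the sum of the vectors with odd coefficients in 2 G; if all coefficients are even, the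
    relation can be halved. *)
Lemma free_of_parity G (gs : seq L) : subgroup G ->
  (forall g, g \in gs -> G g) ->
  (forall m : bitseq, size m = size gs -> has id m ->
     ~ [set 2 * x | x in G] (\sum_(g <- mask m gs) g)) -> free gs.
Proof.
move=> sG Gg par; pose r := size gs; pose X : r.-tuple L := in_tuple gs.
suff intfree (z : 'I_r -> int) : \sum_(i < r) (z i)%:~R *: X`_i = 0 -> forall i, z i = 0.
  apply/(@freeP _ _ _ X) => k hk i.
  (* [D] is a common denominator of the rational coefficients, and [z] the proportional integer
     relation. *)
  pose D := \prod_(j < r) denq (k j).
  have D0 : D != 0 by apply/prodf_neq0 => j _; exact: denq_neq0.
  pose z j := numq (k j) * \prod_(l < r | l != j) denq (k l).
  have zE j : (z j)%:~R = D%:~R * k j :> rat.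
    have DE : D = denq (k j) * \prod_(l < r | l != j) denq (k l) by rewrite /D (bigD1 j).
    rewrite DE /z !intrM [X in _ = _ * X](esym (divq_num_den (k j))).
    have : (denq (k j))%:~R != 0 :> rat by rewrite intr_eq0 denq_neq0.
    by move=> h; field.
  have := intfree z; rewrite (eq_bigr (fun j => D%:~R *: (k j *: X`_j))); last first.
    by move=> j _; rewrite zE scalerA.
  rewrite -scaler_sumr hk scaler0 => /(_ erefl i) /(congr1 (fun x : int => x%:~R : rat)).
  rewrite zE => /eqP; rewrite mulf_eq0 intr_eq0 (negPf D0) /= => /eqP //.
have [N] := ubnP (\sum_i `|z i|)%N; elim: N z => // N IH z zN hz.
have [ev|/existsP[i0 od]] := boolP [forall i, (2 %| z i)%Z]; last first.
  exfalso.
  pose m := [seq ~~ (2 %| z i)%Z | i <- enum 'I_r].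
  have sm : size m = size gs by rewrite size_map size_enum_ord.
  have hm : has id m by apply/hasP; exists true => //; apply/mapP; exists i0; rewrite ?mem_enum//; symmetry.
  apply: (par m sm hm).
  have -> : \sum_(g <- mask m gs) g = \sum_(i < r | ~~ (2 %| z i)%Z) X`_i.
    have -> : gs = [seq X`_(val i) | i : 'I_r <- enum 'I_r].
      by rewrite -[LHS](mkseq_nth 0) /mkseq -val_enum_ord -map_comp.
    by rewrite -map_mask big_map /m -filter_mask big_filter big_enum_cond.
  exists (- \sum_(i < r) X`_i *~ (z i %/ 2)%Z).
    apply: subgroupN => //; elim/big_ind: _ => [|u v Gu Gv|i _]; first exact: sG.1.
      exact: subgroupD.
    by apply: subgroup_mulrz => //; apply: Gg; rewrite mem_nth.
  have zr i : z i = (z i %/ 2)%Z * 2 + (~~ (2 %| z i)%Z)%:Z.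
    rewrite [LHS](divz_eq _ 2); congr (_ + _).
    have h0 : (0 <= z i %% 2)%Z by rewrite modz_ge0.
    have h1 : (z i %% 2 < 2)%Z by rewrite ltz_pmod.
    have -> : (2 %| z i)%Z = ((z i %% 2)%Z == 0) by apply/dvdz_mod0P/eqP.
    by move: h0 h1; case: (z i %% 2)%Z => [[|[|k]]|k].
  rewrite mulrN; apply/eqP; rewrite eq_sym -subr_eq0 opprK; apply/eqP.
  rewrite big_mkcond/= -[RHS]hz mulr_sumr -big_split/=; apply: eq_bigr => i _.
  rewrite [in RHS]zr intrD scalerDl addrC; congr (_ + _).
    by rewrite mulr_natl intrM mulrC -scalerA !scaler_int pmulrn.
  by case: ifP => _; rewrite ?scale1r ?scale0r.
have z2 i : z i = (z i %/ 2)%Z * 2 by rewrite divzK//; exact: (forallP ev).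
have S2 : (\sum_i `|z i| = (\sum_i `|(z i %/ 2)%Z|) * 2)%N.
  by rewrite big_distrl/=; apply: eq_bigr => i _; rewrite {1}z2 abszM.
have h2 i : (z i %/ 2)%Z = 0.
  have [e|ne] := eqVneq (\sum_i `|(z i %/ 2)%Z|)%N 0%N.
    move/eqP: e; rewrite sum_nat_eq0 => /forallP/(_ i) /=; by rewrite absz_eq0 => /eqP.
  apply: (IH (fun i => (z i %/ 2)%Z) _ _ i).
    by rewrite -ltnS (leq_trans _ zN)// S2 ltnS muln2 -addnn -addn1 leq_add2l lt0n.
  have n2 : (2%:R : rat) != 0 by [].
  apply: (scalerI n2); rewrite scaler0 -[RHS]hz scaler_sumr; apply: eq_bigr => k _.
  by rewrite scalerA [in RHS]z2 intrM mulrC.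
by move=> i; rewrite z2 h2 mul0r.
Qed.

Lemma incong_size B (s S : seq L) : (forall a, a \in s -> cosets B S a) -> subgroup B -> incong B s ->
  (size s <= size S)%N.
Proof.
move=> sS sB hs; pose f a := xget 0 [set c | c \in S /\ B (a - c)].
have fP a : a \in s -> f a \in S /\ B (a - f a).
  by move=> /sS [c cS Bc]; apply: (@xgetPex _ 0 [set c | c \in S /\ B (a - c)]); exists c.
rewrite -(size_map f); apply: uniq_leq_size; last by move=> _ /mapP[a /fP[fa _] ->].
elim: s fP hs {sS} => [//|a s IH] fP; rewrite /incong /= => /andP[/allP ha hs].
rewrite IH ?andbT//; last by move=> b bs; apply: fP; rewrite inE bs orbT.
apply/mapP => -[b bs e]; have /asboolP := ha _ bs; apply.
have [_ h1] := fP a (mem_head _ _); have [_ h2] : f b \in S /\ B (b - f b) by apply: fP; rewrite inE bs orbT.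
by rewrite (_ : a - b = (a - f a) - (b - f b)); [exact: sB.2|rewrite e; ring].
Qed.

(** A maximal family independent modulo 2 G is linearly free by [free_of_parity], so it has at most
    dim V members, and by maximality its subset sums meet every class. *)
Lemma two_index G (V : {vspace L}) : subgroup G -> (forall g, G g -> g \in V) ->
  exists s : seq L, [/\ incong [set 2 * x | x in G] s, G = cosets [set 2 * x | x in G] s &
    (size s <= 2 ^ \dim V)%N].
Proof.
move=> sG GV; set G2 := [set 2 * x | x in G].
have sG2 : subgroup G2 by exact: subgroup_scale.
have G2G : G2 `<=` G by move=> _ [x Gx <-]; rewrite mulr_natl; exact: subgroup_mulrn.
pose good gs := (forall g, g \in gs -> G g) /\
  (forall m : bitseq, size m = size gs -> has id m -> ~ G2 (\sum_(g <- mask m gs) g)).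
pose P r := `[< exists2 gs, size gs = r & good gs >].
have exP : exists r, P r.
  exists 0%N; apply/asboolP; exists [::] => //; split => // m.
  by move=> /size0nil ->.
have bdP r : P r -> (r <= \dim V)%N.
  move=> /asboolP[gs <- [Gg par]]; have fg := free_of_parity sG Gg par.
  have /eqP <- : \dim <<gs>> == size gs by [].
  by apply: dimvS; apply/span_subvP => g /Gg/GV.
case: (ex_maxnP exP bdP) => r /asboolP[gs sr [Gg par]] maxr.
pose sm (m : bitseq) : L := \sum_(g <- mask m gs) g.
have Gsm m : G (sm m).
  rewrite /sm big_seq; elim/big_ind: _ => [|u v|g /mem_mask]; [exact: sG.1|exact: subgroupD|exact: Gg].
pose S := [seq sm (val m) | m <- enum {: r.-tuple bool}].
have szS : size S = (2 ^ r)%N by rewrite size_map -cardE card_tuple card_bool.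
have cov g : G g -> cosets G2 S g.
  move=> Gg'; apply: contrapT => no.
  suff /maxr : P r.+1 by rewrite ltnn.
  apply/asboolP; exists (g :: gs); first by rewrite /= sr.
  split => [h|]; first by rewrite inE => /orP[/eqP ->//|/Gg].
  move=> [//|[] m] /= [szm].
    move=> _ h; apply: no; exists (sm m).
      have tm : size m == r by rewrite szm sr.
      by apply/mapP; exists (Tuple tm); rewrite ?mem_enum.
    rewrite big_cons in h.
    (* Signs do not matter modulo 2 G: if g + sm m lies in 2 G, then g is in the class of sm m. *)
    rewrite (_ : g - sm m = (g + sm m) - 2 * sm m); last by ring.
    by apply: sG2.2 => //; exists (sm m).
  by move=> hm; exact: par.
have [|s [hs Gs e]] := @transversal_bounded _ G G2 (size S) sG sG2 G2G.
  by move=> s hs Gs; apply: (incong_size _ sG2 hs) => a /Gs; exact: cov.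
exists s; split => //; apply: (@leq_trans (size S)).
  by apply: (incong_size _ sG2 hs) => a /Gs; exact: cov.
rewrite szS leq_exp2l//; apply: bdP; apply/asboolP; by exists gs.
Qed.

(** Removing from each coordinate its nearest even integer leaves coordinates in [-1, 1]. The factor
    n^2 consists of n summands and the n of [sqf_sum]. *)
Lemma short_reps A (ys : seq L) (B : R) : subgroup A -> free ys -> size ys = n ->
  (forall y, y \in ys -> A y /\ Q y <= B) ->
  forall a, A a -> exists2 a', [set 2 * x | x in A] (a - a') & Q a' <= n%:R ^+ 2 * B.
Proof.
move=> sA fy sy yP a Aa.
have sy' : size ys == n by rewrite sy.
pose X : n.-tuple L := Tuple sy'.
have bX : basis_of {:L} X by rewrite basisEfree fy subvf /= sy.
pose q (i : 'I_n) : rat := coord X i a.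
(* 2 m i is an even integer at distance at most 1 from q i. *)
pose m (i : 'I_n) := Num.floor ((q i + 1) / 2).
pose th (i : 'I_n) : rat := q i - 2 * (m i)%:~R.
have thb i : `|th i| <= 1.
  have /andP[h1 h2] := floor_itv ((q i + 1) / 2); rewrite -/(m i) intrD in h2.
  by rewrite ler_norml /th; move: h1 h2; lra.
pose a' := \sum_(i < n) th i *: X`_i.
have Xi (i : 'I_n) : X`_i \in ys by rewrite mem_nth// sy.
exists a'.
  exists (\sum_(i < n) X`_i *~ m i).
    elim/big_ind: _ => [|u v Gu Gv|i _]; [exact: sA.1|exact: subgroupD|].
    by apply: subgroup_mulrz => //; exact: (yP _ (Xi i)).1.
  rewrite {1}(coord_basis bX (memvf a)) /a' -sumrB mulr_sumr; apply: eq_bigr => i _.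
  rewrite -scalerBl /th opprB addrC subrK -scalerA scaler_int scaler_nat mulr_natl//.
have B0 (i : 'I_n) : 0 <= Q X`_i <= B by rewrite sqf_ge0 (yP _ (Xi i)).2.
apply: (le_trans (sqf_sum _ _)).
have -> : size (index_enum 'I_n) = n by rewrite /index_enum -enumT size_enum_ord.
rewrite expr2 -mulrA ler_wpM2l//.
rewrite (_ : n%:R * B = \sum_(i < n) B); last by rewrite sumr_const card_ord mulr_natl.
apply: ler_sum => i _; rewrite sqf_scale.
have h1 : (ratr (th i) : R) ^+ 2 <= 1.
  rewrite -real_normK ?num_real// exprn_ile1// -ratr_norm -[leRHS](rmorph1 (ratr : {rmorphism rat -> R})).
  by rewrite ler_rat.
have /andP[h2 h3] := B0 i; have := sqr_ge0 (ratr (th i) : R); nra.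
Qed.

(** cos(3/2) > 0 by two duplications starting from |sin(3/8)| <= 3/8, while the cosine decreases up
    to its zero pi / 2. *)
Lemma pi_ge3 : 3 <= pi :> R.
Proof.
have c0 (x : R) : 0 <= x -> 1 - x ^+ 2 * 2 <= cos (x *+ 2).
  move=> x0; rewrite cos_mulr2n cos2sin2 -[sin _ ^+ 2]real_normK ?num_real// -mulr_natr.
  have := sin_le_norm x; rewrite [X in _ <= X]ger0_norm//.
  have := normr_ge0 (sin x); move: `|sin x| => u u0 ux.
  have : u ^+ 2 <= x ^+ 2 by apply: lerXn2r; rewrite ?nnegrE.
  lra.
have c : 1 - (3 / 8) ^+ 2 * 2 <= cos (3 / 4) :> R.
  have h38 : 0 <= 3 / 8 :> R by lra.
  by have := c0 _ h38; rewrite (_ : (3 / 8) *+ 2 = 3 / 4 :> R)// -mulr_natr; field.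
have c2 : 0 < cos (3/2) :> R.
  rewrite (_ : 3 / 2 = (3/4) *+ 2); last by rewrite -mulr_natr; field.
  by rewrite cos_mulr2n -mulr_natr; move: (cos (3/4 : R)) c => u; nra.
rewrite leNgt; apply/negP => h.
have p2 := pi_ge2 R.
have : cos (3/2) < cos (pi / 2) :> R.
  by rewrite ltr_cos ?in_itv/=; [lra|apply/andP; split; lra|apply/andP; split; lra].
by rewrite cos_pihalf => h'; move: (lt_trans c2 h'); rewrite ltxx.
Qed.

(** Four squarings of 1 + 3/32 with rounding. With pi >= 3 it gives e^(pi/2) > 4, on which the decay
    estimates rest. *)
Lemma expR_3half : 4 < expR (3 / 2) :> R.
Proof.
have h : 1 + 3 / 32 <= expR (3 / 32) :> R by exact: expR_ge1Dx.
have e0 : 0 <= 1 + 3 / 32 :> R by lra.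
rewrite (_ : 3 / 2 = 16%:R * (3 / 32)); last by field.
rewrite expRM_natl; apply: (@lt_le_trans _ _ ((1 + 3 / 32) ^+ 16)); last by apply: lerXn2r; rewrite ?nnegrE ?expR_ge0.
have sq (u v w : R) : 0 <= u -> u <= v -> w <= u ^+ 2 -> w <= v ^+ 2.
  by move=> u0 uv h'; apply: (le_trans h'); apply: lerXn2r; rewrite ?nnegrE// (le_trans u0).
rewrite (_ : 16 = 2 * (2 * (2 * 2)))%N// !exprM.
have s1 : 119 / 100 <= (1 + 3 / 32) ^+ 2 :> R by lra.
have s2 : 141 / 100 <= ((1 + 3 / 32) ^+ 2) ^+ 2 :> R by apply: (sq _ _ _ _ s1); lra.
have s3 : 198 / 100 <= (((1 + 3 / 32) ^+ 2) ^+ 2) ^+ 2 :> R by apply: (sq _ _ _ _ s2); lra.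
have s3' : 203 / 100 <= (((1 + 3 / 32) ^+ 2) ^+ 2) ^+ 2 :> R by lra.
apply: (@lt_le_trans _ _ ((203 / 100) ^+ 2)); first by lra.
by apply: (sq _ _ _ _ s3'); lra.
Qed.

(** * Lattices whose nonzero vectors satisfy Q >= n *)

Section MinimalLattice.
Variables (A : set L) (kappa : R) (s : seq L) (dg : nat).
Hypothesis dgE : dg = n.
Hypotheses (sA : subgroup A) (finA : forall t, 0 < t -> (Theta A t < +oo)%E).
Hypotheses (hs : incong [set 2 * x | x in A] s) (AE : A = cosets [set 2 * x | x in A] s)
  (ss : size s = (2 ^ dg)%N) (n2 : (2 <= dg)%N).
Hypothesis minQ : forall x, A x -> x != 0 -> dg%:R <= Q x.
Hypothesis kappa_gt0 : 0 < kappa.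
Let g t := Num.sqrt t ^+ dg * rTheta A t.
Hypothesis glim : forall t e : R, 0 < t -> 0 < e -> exists k0, forall k, (k0 <= k)%N ->
  `|g (t * 2^-1 ^+ k) - kappa| <= e.

Lemma sqrtX2 (t : R) k : 0 <= t -> (Num.sqrt t ^+ k) ^+ 2 = t ^+ k.
Proof. by move=> t0; rewrite -exprM mulnC exprM sqr_sqrtr. Qed.

(** Stated for an arbitrary subgroup with at most 2^m classes modulo 2: it serves for A with m = n
    and, in [short_basis], for a subgroup of smaller rank. *)
Lemma rTheta_half B (r : seq L) m t : subgroup B -> (forall t, 0 < t -> (Theta B t < +oo)%E) ->
  incong [set 2 * x | x in B] r -> B = cosets [set 2 * x | x in B] r -> (size r <= 2 ^ m)%N ->
  0 < t -> rTheta B t <= Num.sqrt 2 ^+ m * rTheta B (2 * t).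
Proof.
move=> sB fB hr BE rm t0.
rewrite -ler_sqr ?nnegrE ?rTheta_ge0//; last by rewrite mulr_ge0 ?exprn_ge0 ?sqrtr_ge0 ?rTheta_ge0.
rewrite exprMn sqrtX2//; apply: (le_trans (rTheta_double sB fB hr BE t0)).
by rewrite ler_wpM2r ?sqr_ge0// -natrX ler_nat.
Qed.

Lemma g_half t : 0 < t -> g (t / 2) <= g t.
Proof.
move=> t0; have t2 : 0 < t / 2 by rewrite divr_gt0.
have h := @rTheta_half A s dg (t / 2) sA finA hs AE (eq_leq ss) t2.
rewrite (_ : 2 * (t / 2) = t) in h; last by field.
apply: (@le_trans _ _ (Num.sqrt (t / 2) ^+ dg * (Num.sqrt 2 ^+ dg * rTheta A t))).
  by rewrite ler_wpM2l// exprn_ge0// sqrtr_ge0.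
by rewrite mulrA -exprMn -sqrtrM ?(ltW t2)// (_ : t / 2 * 2 = t)//; field.
Qed.

Lemma g_halves t k : 0 < t -> g (t * 2^-1 ^+ k) <= g t.
Proof.
move=> t0; elim: k => [|k IH]; first by rewrite expr0 mulr1.
apply: le_trans IH; rewrite exprSr mulrA; apply: g_half.
by rewrite mulr_gt0// exprn_gt0.
Qed.

Lemma kappa_le_g t : 0 < t -> kappa <= g t.
Proof.
move=> t0; apply/ler_addgt0Pl => e e0; have [k0 h] := glim t0 e0.
have := h _ (leqnn k0); have := g_halves k0 t0; rewrite ler_norml; lra.
Qed.

(** The inequality g(4 u) <= e^(pi u K) g(u) is iterated at u = t/4, t/16, ...; the exponents add up
    to pi K t / 3, and g tends to kappa. *)
Lemma g_upper K t : (forall a, A a -> exists2 a', [set 2 * x | x in A] (a - a') & Q a' <= K) ->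
  0 <= K -> 0 < t -> g t <= kappa * expR (pi * K / 3 * t).
Proof.
move=> hK K0 t0.
have g_quad (u : R) : 0 < u -> g (4 * u) <= expR (pi * u * K) * g u.
  move=> u0; have := rTheta_quad sA finA hs AE u0 hK; rewrite ss natrX => h.
  have e : Num.sqrt (4 * u) = 2 * Num.sqrt u.
    by rewrite sqrtrM// (_ : 4 = 2 ^+ 2) ?sqrtr_sqr ?ger0_norm//; ring.
  rewrite /g e exprMn; set X := expR (pi * u * K).
  have X0 : 0 < X by exact: expR_gt0.
  have h' : 2 ^+ dg * rTheta A (4 * u) <= X * rTheta A u.
    by move: h; rewrite expRN -/X mulrAC ler_pdivrMr// [_ * X]mulrC.
  rewrite [X * _]mulrCA [2 ^+ dg * _]mulrC -mulrA ler_wpM2l// exprn_ge0// sqrtr_ge0//.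
have it j : g t <= expR (pi * K / 3 * t * (1 - 4^-1 ^+ j)) * g (t * 4^-1 ^+ j).
  elim: j => [|j IH]; first by rewrite expr0 subrr mulr0 expR0 mul1r mulr1.
  have tj : 0 < t * 4^-1 ^+ j.+1 by rewrite mulr_gt0// exprn_gt0.
  have := g_quad _ tj; rewrite (_ : 4 * _ = t * 4^-1 ^+ j); last by rewrite exprS; field.
  move=> h; apply: (le_trans IH).
  rewrite -(ler_pM2l (expR_gt0 (pi * K / 3 * t * (1 - 4^-1 ^+ j)))) in h.
  apply: (le_trans h); rewrite mulrA le_eqVlt; apply/orP; left; apply/eqP.
  rewrite [RHS](_ : _ = expR (pi * K / 3 * t * (1 - 4^-1 ^+ j)) *
    expR (pi * (t * 4^-1 ^+ j.+1) * K) * g (t * 4^-1 ^+ j.+1)); first by rewrite !mulrA.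
  by congr (_ * _); rewrite -expRD; congr expR; rewrite exprS; field.
set E := expR (pi * K / 3 * t); have E0 : 0 < E by exact: expR_gt0.
apply/ler_addgt0Pl => e e0.
have eE : 0 < e / E by rewrite divr_gt0.
have [k0 h] := glim t0 eE.
(* The limit is known along powers of 1/2; 4^-k0 is the power of index 2 k0. *)
have := h (k0 * 2)%N (leq_pmulr _ _); rewrite exprM (_ : (2^-1 ^+ k0) ^+ 2 = 4^-1 ^+ k0 :> R); last first.
  by rewrite -exprM mulnC exprM; congr (_ ^+ _); field.
rewrite ler_norml => /(_ isT) /andP[_ h1].
apply: (le_trans (it k0)).
have g0 : 0 <= g (t * 4^-1 ^+ k0) by rewrite mulr_ge0 ?exprn_ge0 ?sqrtr_ge0// rTheta_ge0.
apply: (@le_trans _ _ (E * g (t * 4^-1 ^+ k0))).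
  rewrite ler_wpM2r// ler_expR ler_piMr//.
    by apply: mulr_ge0; [apply: divr_ge0 => //; apply: mulr_ge0 => //; exact: pi_ge0|exact: ltW].
have : E * g (t * 4^-1 ^+ k0) <= E * (kappa + e / E) by rewrite ler_wpM2l ?(ltW E0)//; move: h1; lra.
by rewrite (_ : E * (kappa + e / E) = e + kappa * E)//; field; rewrite gt_eqF.
Qed.

(** The 1 is the term of the zero vector; every other term has Q >= n and loses at least the factor
    e^(-pi n (t - t0)). *)
Lemma rTheta_decay t0 t : 0 < t0 -> t0 <= t ->
  rTheta A t <= 1 + expR (- (pi * dg%:R * (t - t0))) * (rTheta A t0 - 1).
Proof.
move=> t00 tt; have t1 : 0 < t by exact: lt_le_trans tt.
pose A' := A `\ 0.
have split (u : R) : 0 < u -> Theta A u = (1 + Theta A' u)%E.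
  move=> u0; rewrite /Theta {1}(_ : A = [set 0] `|` A'); last first.
    apply/seteqP; split => x; last by case=> [->|[]//]; exact: sA.1.
    by move=> Ax; have [->|x0] := eqVneq x 0; [left|right; split => //; exact/eqP].
  rewrite esum_setU//; last 2 first.
    by move=> x; rewrite lee_fin gterm_ge0.
    by apply/disj_set2P; rewrite /A' setDE setICA setICr setI0.
  by rewrite esum_set1 ?lee_fin ?gterm_ge0// /gterm sqf0 mulr0 oppr0 expR0.
have fA' (u : R) : 0 < u -> Theta A' u = (rTheta A u - 1)%:E.
  move=> u0; have := split _ u0; rewrite (rThetaE finA u0) EFinB => ->.
  by rewrite addeAC subee// add0e.
rewrite -lerBlDl -lee_fin EFinM -!fA'// -esumZl ?expR_ge0//; last by move=> x _; rewrite lee_fin gterm_ge0.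
apply: le_esum => x [Ax x0]; rewrite -EFinM lee_fin /gterm -expRD ler_expR.
have hQ := minQ Ax (introN eqP x0).
have : 0 <= pi * (t - t0) * (Q x - dg%:R) by rewrite mulr_ge0 ?mulr_ge0 ?pi_ge0 ?subr_ge0.
nra.
Qed.

Lemma sqrt2_decay : expR (- (pi / 4)) * Num.sqrt 2 < 1 :> R.
Proof.
have s20 : 0 <= Num.sqrt 2 :> R by exact: sqrtr_ge0.
have e0 : 0 < expR (- (pi / 4)) :> R by exact: expR_gt0.
rewrite -(@ltr_pXn2r _ 4)// ?nnegrE ?mulr_ge0 ?(ltW e0)//.
rewrite expr1n exprMn -expRM_natl (_ : 4%:R * - (pi / 4) = - pi); last by field.
have -> : Num.sqrt 2 ^+ 4 = 4 :> R.
  by rewrite (_ : 4 = 2 * 2)%N// exprM sqr_sqrtr//; ring.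
rewrite expRN ltr_pdivrMl ?expR_gt0// mulr1 (lt_le_trans expR_3half)// ler_expR.
have := pi_ge3; lra.
Qed.

(** Each dimension contributes e^(-pi/4) sqrt 2 < 1, and two of them already 2 e^(-pi/2) < 1/2; this
    is where n >= 2 enters. *)
Lemma decay_n : expR (- (pi * dg%:R / 4)) * Num.sqrt 2 ^+ dg < 1 / 2 :> R.
Proof.
have -> : expR (- (pi * dg%:R / 4)) = expR (- (pi / 4)) ^+ dg :> R.
  by rewrite -expRM_natl; congr expR; field.
rewrite -exprMn; set q := expR _ * _.
have q0 : 0 <= q by rewrite mulr_ge0 ?expR_ge0 ?sqrtr_ge0.
have q1 : q <= 1 by exact: ltW sqrt2_decay.
apply: (@le_lt_trans _ _ (q ^+ 2)); first by rewrite ler_wiXn2l.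
rewrite /q exprMn sqr_sqrtr// -expRM_natl (_ : 2%:R * - (pi / 4) = - (pi / 2)); last by field.
rewrite expRN mulrC ltr_pdivrMr ?expR_gt0//.
have : expR (3 / 2) <= expR (pi / 2) :> R by rewrite ler_expR; have := pi_ge3; lra.
have := expR_3half; lra.
Qed.

(** The decay from 1/4 to 1/2 is played against Theta(1/4) <= 2^(n/2) Theta(1/2). The product of the
    two factors is below 1/2, so Theta(1/2) < 1 + Theta(1/2) / 2. *)
Lemma rTheta_half_lt2 : rTheta A (1 / 2) < 2.
Proof.
have h0 : 0 < 1 / 4 :> R by lra.
have h1 := @rTheta_decay (1 / 4) (1 / 2) h0.
have h2 := @rTheta_half A s dg (1 / 4) sA finA hs AE (eq_leq ss) h0.
rewrite (_ : 2 * (1 / 4) = 1 / 2) in h2; last by field.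
set a := expR (- (pi * dg%:R / 4)) : R.
have a0 : 0 < a by exact: expR_gt0.
rewrite (_ : pi * dg%:R * (1 / 2 - 1 / 4) = pi * dg%:R / 4) -/a in h1; last by field.
have h14 : 1 / 4 <= 1 / 2 :> R by lra.
have {}h1 := h1 h14.
have q := decay_n; rewrite -/a in q.
set T := rTheta A (1 / 2) in h1 h2 *; set T' := rTheta A (1 / 4) in h1 h2.
have h3 : a * T' <= a * (Num.sqrt 2 ^+ dg * T) by rewrite ler_wpM2l// ltW.
rewrite mulrA in h3.
have T0 : 0 <= T by exact: rTheta_ge0.
set w := a * Num.sqrt 2 ^+ dg in h3 q.
have : w * T <= 1 / 2 * T by rewrite ler_wpM2r// ltW.
move: h1; rewrite mulrBr mulr1; lra.
Qed.

(** Combines kappa <= g(1/2) with Theta(1/2) < 2. With kappa >= d^(-1/2) it reads 2^n < 4 d, the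
    source of n <= d. *)
Lemma kappa_lt : kappa * Num.sqrt 2 ^+ dg < 2.
Proof.
have h : 0 < 1 / 2 :> R by lra.
have := kappa_le_g h; rewrite /g => h1.
have s2 : 0 < Num.sqrt 2 ^+ dg :> R by rewrite exprn_gt0// sqrtr_gt0.
have : kappa * Num.sqrt 2 ^+ dg <= rTheta A (1 / 2).
  rewrite -(ler_pM2r s2) in h1; apply: (le_trans h1); rewrite mulrAC -exprMn -sqrtrM//.
  by rewrite (_ : 1 / 2 * 2 = 1) ?sqrtr1 ?expr1n ?mul1r//; field.
by move=> /le_lt_trans; apply; exact: rTheta_half_lt2.
Qed.

Lemma kappa_lt1 : kappa < 1.
Proof.
have := kappa_lt; have : 2 <= Num.sqrt 2 ^+ dg :> R.
  apply: (@le_trans _ _ (Num.sqrt 2 ^+ 2)); first by rewrite sqr_sqrtr.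
  by rewrite ler_weXn2l// -[leLHS]sqrtr1 ler_sqrt// ler1n.
move: (Num.sqrt 2 ^+ dg) => S S2 h; rewrite ltNge; apply/negP => k1.
have : 1 * 2 <= kappa * S by apply: ler_pM.
by rewrite mul1r leNgt h.
Qed.

(** On [1/2, 1] the bound Theta(1/2) < 2 and monotonicity suffice; smaller t are doubled into this
    range with [g_half]. *)
Lemma g_le2 t : 0 < t <= 1 -> g t <= 2.
Proof.
move=> /andP[t0 t1].
have step k (u : R) : 2^-1 ^+ k.+1 <= u -> u <= 1 -> g u <= 2.
  elim: k u => [|k IH] u.
    rewrite expr1 => u2 u1; rewrite -[leRHS]mul1r; apply: ler_pM.
    - by rewrite exprn_ge0// sqrtr_ge0.
    - exact: rTheta_ge0.
    - by rewrite exprn_ile1 ?sqrtr_ge0// -[leRHS]sqrtr1 ler_wsqrtr.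
    - apply: ltW; apply: le_lt_trans rTheta_half_lt2; apply: rTheta_le => //; lra.
  move=> u2 u1; have [h|h] := leP (1 / 2) u.
    apply: (IH _ _ u1); apply: le_trans h; rewrite div1r exprS ler_piMr ?invr_ge0//.
    by rewrite exprn_ile1 ?invr_ge0// invf_le1// ler1n.
  have u0 : 0 < u by apply: lt_le_trans u2; rewrite exprn_gt0.
  have := @g_half (2 * u); rewrite (_ : 2 * u / 2 = u); last by field.
  move=> hg; apply: (le_trans (hg _)); first by rewrite mulr_gt0.
  apply: IH; last by lra.
  by move: u2; rewrite [_ ^+ k.+2]exprS; lra.
apply: (step (Num.trunc t^-1)) => //.
set k := Num.trunc _.
have : t^-1 < k.+1%:R by exact: truncnS_gt.
rewrite invf_plt ?posrE ?ltr0n// => h; apply: le_trans (ltW h).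
by rewrite exprVn lef_pV2 ?posrE ?exprn_gt0 ?ltr0n// -natrX ler_nat ltnW// ltn_expl.
Qed.

Lemma mul_expand j m : (j.+1 * m.+2 = m.+1 * j + (j + m.+2))%N.
Proof. by clear; lia. Qed.

(* Otherwise the short vectors lie in a hyperplane, whose lattice has too few
   classes modulo 2 for Theta to grow like t ^ (- n / 2). *)
Lemma short_basis : exists ys : seq L, [/\ free ys, size ys = n &
  forall y, y \in ys -> A y /\ Q y <= 8 * (dg + 2)%:R / kappa ^+ 2].
Proof.
set B := 8 * _ / _.
pose P r := `[< exists ys : seq L, [/\ free ys, size ys = r & forall y, y \in ys -> A y /\ Q y <= B] >].
have exP : exists r, P r by exists 0%N; apply/asboolP; exists [::]; split => //; exact: nil_free.
have bdP r : P r -> (r <= n)%N.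
  move=> /asboolP[ys [fy <- _]]; have /eqP <- : \dim <<ys>> == size ys by [].
  exact: (dimvS (subvf _)).
case: (ex_maxnP exP bdP) => r Pr maxr.
have [rn|rn] := eqVneq r n.
  by move/asboolP: Pr => [ys [h1 h2 h3]]; exists ys; rewrite h2 rn.
exfalso; have rn1 : (r <= dg.-1)%N by rewrite dgE; have := bdP _ Pr; lia.
move/asboolP: Pr => [ys [fy sr yP]].
pose V := <<ys>>%VS; have dV : \dim V = r by rewrite -sr; apply/eqP.
have shortV x : A x -> Q x <= B -> x \in V.
  move=> Ax Qx; apply: contraT => xV.
  have /maxr : P r.+1; last by rewrite ltnn.
  apply/asboolP; exists (x :: ys); split => /=; [by rewrite free_cons xV|by rewrite sr|].
  by move=> y; rewrite inE => /orP[/eqP ->|/yP].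
pose G := A `&` [set x | x \in V].
have sG : subgroup G.
  split; first by split; [exact: sA.1|exact: mem0v].
  by move=> x y [Ax xV] [Ay yV]; split; [exact: sA.2|exact: rpredB].
have GA : G `<=` A by move=> x [].
have finG t : 0 < t -> (Theta G t < +oo)%E.
  by move=> t0; apply: le_lt_trans (finA t0); exact: esum_setS.
have [sq [hq GE zq]] := @two_index G V sG (fun x => @proj2 _ _).
rewrite dV in zq.
have zq' : (size sq <= 2 ^ dg.-1)%N by rewrite (leq_trans zq)// leq_exp2l.
(* A rank of at most n - 1 costs only a factor 2^((n-1)/2) per halving of t. *)
have GT j : rTheta G (1 / 2 * 2^-1 ^+ j) <= (Num.sqrt 2 ^+ dg.-1) ^+ j * 2.
  elim: j => [|j IH].
    rewrite !expr0 mulr1 [leRHS]mul1r; apply: le_trans (ltW rTheta_half_lt2).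
    have h : 0 < 1 / 2 :> R by lra.
    by rewrite -lee_fin -(rThetaE finG h) -(rThetaE finA h); exact: esum_setS.
  have tj : 0 < 1 / 2 * 2^-1 ^+ j.+1 :> R by rewrite mulr_gt0// exprn_gt0.
  apply: (le_trans (rTheta_half sG finG hq GE zq' tj)).
  rewrite (_ : 2 * (1 / 2 * _) = 1 / 2 * 2^-1 ^+ j); last by rewrite exprS; field.
  by rewrite [(_ ^+ dg.-1) ^+ j.+1]exprS -[leRHS]mulrA ler_wpM2l// exprn_ge0// sqrtr_ge0.
(* t will be the power of 1/2 with 1 / (2 X) <= t < 1 / X: large enough for the vectors with Q > B
   to be negligible, small enough to contradict kappa <= g t. *)
pose X := 16 / kappa ^+ 2.
have k20 : 0 < kappa ^+ 2 by rewrite exprn_gt0.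
have X1 : 1 < X.
  rewrite ltr_pdivlMr// mul1r (@lt_trans _ _ 1)//; last by lra.
  by rewrite expr_lt1 ?(ltW kappa_gt0) ?kappa_lt1.
have exj : exists m : nat, X < 2 ^+ m.
  exists (Num.trunc X).+1; apply: (lt_le_trans (truncnS_gt X)).
  by rewrite -natrX ler_nat ltnW// ltn_expl.
case: (ex_minnP exj) => [[|j]] Xj minj; first by move: Xj; rewrite expr0; have := X1; lra.
have jX : 2 ^+ j <= X by rewrite leNgt; apply/negP => /minj; rewrite ltnn.
pose t : R := 1 / 2 * 2^-1 ^+ j.
have tE : t^-1 = 2 ^+ j.+1 by rewrite /t exprVn exprS; field; rewrite expf_neq0.
have t0 : 0 < t by rewrite -invr_gt0 tE exprn_gt0.
have t20 : 0 < t / 2 by rewrite divr_gt0.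
have tB : (dg + 2)%:R / 4 <= t * B.
  have : t^-1 <= 2 * X by rewrite tE exprS ler_wpM2l.
  rewrite -[leLHS]mul1r ler_pdivrMr// => h.
  rewrite /B natrD; have -> : t * (8 * (dg%:R + 2%:R) / kappa ^+ 2) = (2 * X * t) * ((dg%:R + 2%:R) / 4).
    by rewrite /X; field; rewrite gt_eqF.
  by rewrite -[leLHS]mul1r ler_wpM2r// divr_ge0// addr_ge0.
(* Outside G one has Q x > B, so half of the exponent yields the constant e^(-pi t B / 2) and the
   other half a theta term at t / 2. *)
have rest : rTheta A t <= rTheta G t + expR (- (pi * t / 2 * B)) * rTheta A (t / 2).
  rewrite -lee_fin EFinD EFinM -(rThetaE finA t0) -(rThetaE finG t0) -(rThetaE finA t20).
  rewrite /Theta {1}(_ : A = G `|` (A `\` G)); last first.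
    apply/seteqP; split => x; last by case=> [[]|[]].
    by move=> Ax; have [Gx|Gx] := pselect (G x); [left|right].
  rewrite esum_setU; [|by move=> x; rewrite lee_fin gterm_ge0|by apply/disj_set2P; rewrite setDE setICA setICr setI0].
  apply: leeD2l; apply: (@le_trans _ _ (\esum_(x in A `\` G) ((expR (- (pi * t / 2 * B)))%:E * (gterm (t / 2) x)%:E))%E).
    apply: le_esum => x [Ax Gx]; rewrite -EFinM lee_fin /gterm -expRD ler_expR.
    have : B < Q x.
      by rewrite ltNge; apply/negP => h; apply: Gx; split => //; exact: shortV.
    move=> h; have : 0 <= pi * t * (Q x - B) by rewrite mulr_ge0 ?mulr_ge0 ?pi_ge0 ?subr_ge0 ?(ltW t0) ?(ltW h).
    nra.
  rewrite esumZl ?expR_ge0//; last by move=> x _; rewrite lee_fin gterm_ge0.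
  by apply: lee_wpmul2l; [rewrite lee_fin expR_ge0|apply: esum_setS => x []].
have hA := @rTheta_half A s dg (t / 2) sA finA hs AE (eq_leq ss) t20.
rewrite (_ : 2 * (t / 2) = t) in hA; last by field.
(* The constant 8 (n + 2) in B gives t B >= (n + 2) / 4. Each dimension contributes e^(-pi/8) sqrt 2
   <= 1, and the 2 added to n accounts for the factor 1/2. *)
have small : expR (- (pi * t / 2 * B)) * Num.sqrt 2 ^+ dg <= 1 / 2.
  apply: (@le_trans _ _ (expR (- (pi * (dg + 2)%:R / 8)) * Num.sqrt 2 ^+ dg)).
    rewrite ler_wpM2r ?exprn_ge0 ?sqrtr_ge0// ler_expR lerN2.
    rewrite (_ : pi * t / 2 * B = pi / 2 * (t * B)); last by ring.
    rewrite (_ : pi * (dg + 2)%:R / 8 = pi / 2 * ((dg + 2)%:R / 4)); last by field.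
    by rewrite ler_wpM2l// divr_ge0// pi_ge0.
  pose p : R := expR (- (pi / 8)) * Num.sqrt 2.
  have p0 : 0 <= p by rewrite mulr_ge0 ?expR_ge0 ?sqrtr_ge0.
  have p1 : p <= 1.
    rewrite -(@expr_le1 _ 2)// /p exprMn sqr_sqrtr// -expRM_natl.
    rewrite (_ : 2%:R * - (pi / 8) = - (pi / 4)); last by field.
    rewrite expRN ler_pdivrMl ?expR_gt0// mulr1 -ler_sqr ?nnegrE ?expR_ge0// -expRM_natl.
    rewrite (_ : 2%:R * (pi / 4) = pi / 2); last by field.
    apply: (@le_trans _ _ (expR (3 / 2))); first by rewrite (le_trans _ (ltW expR_3half))//; lra.
    by rewrite ler_expR; have := pi_ge3; lra.
  have -> : expR (- (pi * (dg + 2)%:R / 8)) * Num.sqrt 2 ^+ dg = p ^+ (dg + 2) / 2.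
    rewrite /p exprMn -expRM_natl [Num.sqrt 2 ^+ (_ + _)]exprD sqr_sqrtr// !mulrA mulfK//.
    by congr (expR _ * _); rewrite mulrN; congr (- _); field.
  by rewrite ler_pdivrMr// div1r mulVf// exprn_ile1.
have A0 := rTheta_ge0 A t.
have A2G : rTheta A t <= 2 * rTheta G t.
  have : expR (- (pi * t / 2 * B)) * rTheta A (t / 2) <= 1 / 2 * rTheta A t.
    apply: (@le_trans _ _ (expR (- (pi * t / 2 * B)) * (Num.sqrt 2 ^+ dg * rTheta A t))).
      by rewrite ler_wpM2l// expR_ge0.
    by rewrite mulrA ler_wpM2r.
  by move: rest; lra.
have kg := kappa_le_g t0; rewrite /g in kg.
have := GT j; rewrite -/t => hG.
have [m nE] : exists m, dg = m.+2 by case: (dg) n2 => [//|[//|m]] _; exists m.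
have {}kg : kappa <= Num.sqrt t ^+ dg * (4 * (Num.sqrt 2 ^+ dg.-1) ^+ j).
  apply: (le_trans kg); rewrite ler_wpM2l ?exprn_ge0 ?sqrtr_ge0//; move: A2G hG; lra.
have {}kg : kappa ^+ 2 <= t ^+ dg * (16 * 2 ^+ (dg.-1 * j)).
  have : kappa ^+ 2 <= (Num.sqrt t ^+ dg * (4 * (Num.sqrt 2 ^+ dg.-1) ^+ j)) ^+ 2.
    by apply: lerXn2r => //; rewrite nnegrE ?(ltW kappa_gt0)// (le_trans (ltW kappa_gt0) kg).
  have sqE (T : R) : 0 <= T ->
      (Num.sqrt T ^+ dg * (4 * (Num.sqrt 2 ^+ dg.-1) ^+ j)) ^+ 2 = T ^+ dg * (16 * 2 ^+ (dg.-1 * j)).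
    move=> T0; rewrite exprMn sqrtX2// exprMn -[(_ ^+ dg.-1) ^+ j]exprM sqrtX2//.
    by rewrite (_ : 4 ^+ 2 = 16 :> R)//; ring.
  by rewrite sqE ?(ltW t0).
have tn : t ^+ dg = (2 ^+ (j.+1 * dg))^-1 by rewrite exprM -tE exprVn invrK.
have P0 : 0 < (2 : R) ^+ (j.+1 * dg) by rewrite exprn_gt0.
(* With t = 2^-(j+1) the bound becomes kappa^2 2^(j+n) <= 16, which contradicts 2^(j+1) kappa^2 > 16
   because 2^n >= 4. *)
move: kg; rewrite tn ler_pdivlMl// nE /= mul_expand.
rewrite exprD -mulrA [16 * _]mulrC ler_pM2l ?exprn_gt0// exprD => kg.
have m4 : 4 <= (2 : R) ^+ m.+2.
  have := exprn_ege1 m (ler1n R 2 : 1 <= 2 :> R); rewrite !exprS; move: (2 ^+ m : R) => w; lra.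
have jX' : 16 < 2 ^+ j.+1 * kappa ^+ 2 by rewrite -ltr_pdivrMr.
rewrite exprS in jX'; set w := 2 ^+ j * kappa ^+ 2.
have w0 : 0 <= w by rewrite mulr_ge0 ?exprn_ge0// ltW.
have : w * 4 <= w * 2 ^+ m.+2 by rewrite ler_wpM2l.
have -> : w * 2 ^+ m.+2 = 2 ^+ j * 2 ^+ m.+2 * kappa ^+ 2 by rewrite /w; ring.
rewrite -mulrA -/w in jX'; move: kg jX'; move: (2 ^+ j * 2 ^+ m.+2 * kappa ^+ 2) => y; lra.
Qed.

Lemma expR_le3 (u : R) : 0 <= u <= 1 -> expR u <= 1 + 3 * u.
Proof.
move=> /andP[u0 u1]; have c0 : 0 < (1 - u / 2) ^+ 2 by rewrite exprn_gt0//; lra.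
rewrite -(ler_pM2r c0).
have h : (1 - u / 2) ^+ 2 <= expR (- u).
  rewrite (_ : - u = 2%:R * - (u / 2)); last by field.
  rewrite expRM_natl; apply: lerXn2r; rewrite ?nnegrE ?expR_ge0//; first by lra.
  exact: expR_ge1Dx.
apply: (@le_trans _ _ 1).
  apply: (@le_trans _ _ (expR u * expR (- u))); first by rewrite ler_wpM2l// expR_ge0.
  by rewrite -expRD subrr expR0.
have -> : (1 + 3 * u) * (1 - u / 2) ^+ 2 = 1 + u * ((1 - u) * (2 - 3 / 4 * u)) by field.
by rewrite lerDl mulr_ge0// mulr_ge0//; lra.
Qed.

(** Put u = pi K t / 3 with K = 8 n^2 (n + 2) / kappa^2. For u <= 1, e^u <= 1 + 3 u and kappa < 1
    give kappa + 3 u; for u > 1, the bound g <= 2 is weaker than 3 u. Finally 3 u <= 4 K t, whence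
    32 = 4 * 8. *)
Lemma g_bound (t : R) : 0 < t <= 1 ->
  kappa <= g t <= kappa + 32 * dg%:R ^+ 2 * (dg + 2)%:R / kappa ^+ 2 * t.
Proof.
move=> /andP[t0 t1]; rewrite kappa_le_g//=.
have [ys [fy sy yP]] := short_basis.
have hK := short_reps sA fy sy yP; rewrite -dgE in hK.
set K := _ * _ in hK.
have k20 : 0 < kappa ^+ 2 by rewrite exprn_gt0.
have K0 : 0 <= K by rewrite mulr_ge0 ?exprn_ge0// divr_ge0 ?mulr_ge0// ltW.
set u := pi * K / 3 * t.
have gu : g t <= kappa * expR u by exact: g_upper.
have u0 : 0 <= u.
  by apply: mulr_ge0; [apply: divr_ge0 => //; apply: mulr_ge0 => //; exact: pi_ge0|exact: ltW].
apply: (@le_trans _ _ (kappa + 3 * u)); last first.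
  rewrite lerD2l (_ : 3 * u = pi * (K * t)); last by rewrite /u; field.
  rewrite (_ : 32 * _ * _ / _ * t = 4 * (K * t)); last by rewrite /K; field; rewrite gt_eqF.
  have Kt : 0 <= K * t by apply: mulr_ge0 => //; exact: ltW.
  by rewrite ler_wpM2r//; have := pihalf_lt2 R; lra.
have [u1|u1] := leP u 1.
  apply: (le_trans gu); have u01 : 0 <= u <= 1 by rewrite u0.
  have := ler_wpM2l (ltW kappa_gt0) (expR_le3 u01).
  have : kappa * u <= 1 * u by rewrite ler_wpM2r// ltW// kappa_lt1.
  rewrite (_ : kappa * (1 + 3 * u) = kappa + 3 * (kappa * u)); last by ring.
  by rewrite mul1r; lra.
have t01 : 0 < t <= 1 by rewrite t0.
by have := g_le2 t01; have := kappa_gt0; lra.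
Qed.

End MinimalLattice.

End ThetaBounds.

(** * The bounds for inverse ideals, and comparison of degree and discriminant *)

Section LatticeBounds.
Variables (R : realType) (L : fieldExtType rat).
Local Notation n := (\dim {:L}).
Local Notation cabs := (@Normc.normc R).
Variables (sg : 'I_n -> {rmorphism L -> R[i]}) (cj : 'I_n -> 'I_n).
Hypothesis sg_cj : forall i x, sg (cj i) x = ((sg i x)^* )%C.
Local Notation O := (@ring_of_integers L).
Variable c0 : R.
Hypotheses (c0_gt0 : 0 < c0) (O_dens : has_dens sg cj O c0) (n2 : (2 <= n)%N).
Implicit Types (J : set L) (tau : 'I_n -> R).

Lemma enorm2 : enorm sg 2 = 2 ^+ n.
Proof.
rewrite /enorm; under eq_bigr => i _.
  rewrite rmorph_nat -[2](rmorph_nat (real_complex R)) cabs_real ger0_norm//.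
  over.
by rewrite prodr_const card_ord.
Qed.

(** The limit of t^(n/2) Theta(t) at 0: for weights of product N(J)^2 the covolume factor in
    [ntheta] is N(J). *)
Definition kappa J : R := dens sg cj (inv_ideal J) / (ideal_norm J)%:R.

Lemma kappa_ge J : nonzero_ideal J -> c0 <= kappa J.
Proof.
move=> nJ; have [h _] := dens_inverse sg_cj c0_gt0 O_dens nJ.
have [e N0] := ideal_norm_dens sg_cj c0_gt0 O_dens nJ.
have [_ d0] := fractional_dens sg_cj c0_gt0 O_dens (ideal_fractional nJ).
have N0' : 0 < (ideal_norm J)%:R :> R by rewrite ltr0n.
rewrite /kappa ler_pdivlMr// -(ler_pM2l d0); apply: le_trans h.
by rewrite mulrCA [dens _ _ _ * _]mulrC e expr2.
Qed.

Lemma inv_ideal_norm_ge1 J x : nonzero_ideal J -> inv_ideal J x -> x != 0 ->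
  nonzero_ideal [set x * y | y in J] /\ 1 <= enorm sg x * (ideal_norm J)%:R.
Proof.
move=> nJ Jx x0.
have nxJ : nonzero_ideal [set x * y | y in J].
  have [JO J0 JD JM [y Jy y0]] := nJ; split.
  - by move=> _ [z Jz <-]; exact: Jx.
  - by exists 0; rewrite ?mulr0.
  - by move=> _ _ [u Ju <-] [v Jv <-]; exists (u + v); [exact: JD|rewrite mulrDr].
  - by move=> r _ Or [u Ju <-]; exists (r * u); [exact: JM|rewrite mulrCA].
  - by exists (x * y); [exists y|rewrite mulf_neq0].
split=> //; rewrite -(ideal_norm_scale sg_cj c0_gt0 O_dens nJ x0 nxJ) ler1n.
by have [] := ideal_norm_dens sg_cj c0_gt0 O_dens nxJ.
Qed.

(** The terms of Q(x) have product (|N x| N(J))^2, which is at least 1 because x J is an integral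
    ideal; the inequality of means does the rest. *)
Lemma sqf_min J tau x : nonzero_ideal J -> weight cj tau ->
  \prod_i tau i = (ideal_norm J)%:R ^+ 2 -> inv_ideal J x -> x != 0 -> n%:R <= sqf sg tau x.
Proof.
move=> nJ wt pt Jx x0; have [_ h1] := inv_ideal_norm_ge1 nJ Jx x0.
have tp := wt.1.
pose F i := tau i * cabs (sg i x) ^+ 2.
have F0 i : 0 <= F i by rewrite mulr_ge0 ?sqr_ge0// ltW.
have h := (leif_AGM (A := 'I_n) (E := F) (fun i _ => F0 i)).1; rewrite card_ord in h.
have nn0 : 0 < n%:R :> R by rewrite ltr0n (leq_trans _ n2).
have e : \prod_i F i = (enorm sg x * (ideal_norm J)%:R) ^+ 2.
  by rewrite /F big_split/= pt prodrXl exprMn mulrC.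
have : 1 <= ((\sum_i F i) / n%:R) ^+ n.
  by apply: le_trans h; rewrite e exprn_ege1.
rewrite expr_ge1 ?(leq_trans _ n2)//; last by rewrite divr_ge0// sumr_ge0.
by rewrite ler_pdivlMr// mul1r.
Qed.

Lemma lattice_bounds J tau : nonzero_ideal J -> weight cj tau ->
  \prod_i tau i = (ideal_norm J)%:R ^+ 2 ->
  [/\ kappa J * Num.sqrt 2 ^+ n < 2,
      forall t, 0 < t -> Theta sg tau (inv_ideal J) t = (rTheta sg tau (inv_ideal J) t)%:E,
      forall t, 1 / 2 <= t -> rTheta sg tau (inv_ideal J) t <= 1 + expR (- (pi * n%:R * (t - 1 / 2))) &
      forall t, 0 < t <= 1 -> kappa J <= Num.sqrt t ^+ n * rTheta sg tau (inv_ideal J) t <=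
        kappa J + 32 * n%:R ^+ 2 * (n + 2)%:R / (kappa J) ^+ 2 * t].
Proof.
move=> nJ wt pt; set A := inv_ideal J.
have fA : fractional A := inv_ideal_fractional nJ.
have [sA _ _ _] := fA.
have [hA A0] := fractional_dens sg_cj c0_gt0 O_dens fA.
have [_ N0] := ideal_norm_dens sg_cj c0_gt0 O_dens nJ.
set N : R := (ideal_norm J)%:R in pt.
have N0' : 0 < N by rewrite ltr0n.
have cov : covol tau = N by rewrite /covol pt sqrtr_sqr ger0_norm// ltW.
have k0 : 0 < kappa J by apply: lt_le_trans (kappa_ge nJ).
have lim (t : R) (t0 : 0 < t) : (\forall k \near \oo, (Theta sg tau A (t * 2^-1 ^+ k) < +oo)%E) /\
   (fun k => N * (Num.sqrt (t * 2^-1 ^+ k) ^+ n * rTheta sg tau A (t * 2^-1 ^+ k))) @ \oo --> dens sg cj A.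
  have := hA (dscale t tau) 0 (weight_dscale t0 wt).
  have e k : ntheta sg (dscale (2^-1 ^+ k) (dscale t tau)) A 0 =
      ((N * Num.sqrt (t * 2^-1 ^+ k) ^+ n)%:E * Theta sg tau A (t * 2^-1 ^+ k))%E.
    rewrite dscaleA [_ * t]mulrC /ntheta theta_dscale covol_dscale; last by rewrite mulr_ge0 ?exprn_ge0// ltW.
    by rewrite cov [N * _]mulrC.
  have p0 k : 0 < N * Num.sqrt (t * 2^-1 ^+ k) ^+ n.
    by rewrite mulr_gt0// exprn_gt0// sqrtr_gt0 mulr_gt0// exprn_gt0.
  under eq_fun do rewrite e.
  move=> /fine_cvgP[h1 h2].
  have h1' : \forall k \near \oo, (Theta sg tau A (t * 2^-1 ^+ k) < +oo)%E.
    near=> k; have : ((N * Num.sqrt (t * 2^-1 ^+ k) ^+ n)%:E * Theta sg tau A (t * 2^-1 ^+ k))%E \is a fin_num.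
      by near: k.
    have := Theta_ge0 sg tau A (t * 2^-1 ^+ k).
    case: (Theta _ _ _ _) => [r| |]//; first by rewrite ltry.
    by rewrite mulry gtr0_sg// mul1e.
  split => //; apply: cvg_trans h2; apply: near_eq_cvg; near=> k => /=.
  have : (Theta sg tau A (t * 2^-1 ^+ k) < +oo)%E by near: k.
  move=> hf; rewrite mulrA /rTheta fineM//.
  by rewrite ge0_fin_numE ?Theta_ge0.
(* The finite limit only gives finiteness at t / 2^k for large k; the series decreases in t, so
   finiteness passes to t. *)
have finA t : 0 < t -> (Theta sg tau A t < +oo)%E.
  move=> t0; have [[k _ hk] _] := lim t t0.
  apply: le_lt_trans (hk k (leqnn k)); apply: Theta_anti; first exact: wt.1.
  by rewrite ler_piMr ?(ltW t0)// exprn_ile1 ?invr_ge0// invf_le1// ler1n.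
have n20 : (2 : L) != 0 := two_neq0 L.
have A2A : [set 2 * x | x in A] `<=` A.
  by move=> _ [x Ax <-]; rewrite mulr_natl; exact: (subgroup_mulrn 2 sA Ax).
have f2 : fractional [set 2 * x | x in A].
  have [_ OA [x Ax x0] [y y0 yA]] := fA; split.
  - exact: subgroup_scale.
  - by move=> a _ Oa [z Az <-]; exists (a * z); [exact: OA|rewrite mulrCA].
  - by exists (2 * x); [exists x|rewrite mulf_neq0].
  - by exists y => // z /A2A; exact: yA.
have [s [hs sE ds]] := index_exists sg_cj c0_gt0 O_dens f2 fA A2A.
(* The index of 2 A in A is a ratio of densities, that is the norm 2^n of 2. *)
have ss : size s = (2 ^ n)%N.
  move: ds; rewrite (dens_scale sg_cj c0_gt0 O_dens fA n20) enorm2 => ds.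
  have n0 : (2 : R) ^+ n != 0 by rewrite expf_neq0.
  have A0' : dens sg cj A != 0 by rewrite gt_eqF.
  have : (size s)%:R = (2 ^ n)%N%:R :> R.
    apply: (mulIf A0'); rewrite natrX.
    by rewrite [in RHS]ds [RHS]mulrC -[RHS]mulrA divfK.
  by move=> /eqP; rewrite eqr_nat => /eqP.
have minQ x : A x -> x != 0 -> n%:R <= sqf sg tau x by exact: sqf_min.
have glim (t e : R) : 0 < t -> 0 < e -> exists k0, forall k, (k0 <= k)%N ->
    `|Num.sqrt (t * 2^-1 ^+ k) ^+ n * rTheta sg tau A (t * 2^-1 ^+ k) - kappa J| <= e.
  move=> t0 e0; have [_ h] := lim t t0.
  have eN : 0 < e * N by rewrite mulr_gt0.
  move/cvgrPdist_le : h => /(_ _ eN) [k1 _ hk]; exists k1 => k /hk /=.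
  move=> h; rewrite -(ler_pM2r N0') -{1}(gtr0_norm N0') -normrM; apply: le_trans h.
  by rewrite mulrBl distrC /kappa -/N mulfVK ?gt_eqF// [_ * N]mulrC.
split.
- exact: (kappa_lt sA finA hs sE ss n2 minQ glim).
- by move=> t t0; exact: rThetaE.
- move=> t t2; have h12 : 0 < 1 / 2 :> R by lra.
  have := rTheta_decay sA finA minQ h12 t2.
  have := rTheta_half_lt2 sA finA hs sE ss n2 minQ.
  have := expR_ge0 (- (pi * n%:R * (t - 1 / 2))); move: (expR _) => E E0 T2 h.
  by apply: (le_trans h); rewrite lerD2l ler_piMr// lerBlDr ltW.
- move=> t t01; exact: (g_bound wt.1 erefl sA finA hs sE ss n2 minQ k0 glim t01).
Unshelve. all: by end_near.
Qed.

(** [kappa_lt] for the ideal O and the weight 1 gives 2^n < 4 d. With n = m + 2 this says 2^m < d,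
    and m < 2^m. *)
Lemma dim_disc (d : nat) : c0 = (Num.sqrt d%:R)^-1 -> (n <= d)%N /\ (2 <= d)%N.
Proof.
move=> c0E.
have nO : nonzero_ideal O := fractional_ideal (roi_fractional L) (@subset_refl _ _).
have NO : ideal_norm O = 1%N.
  have [e _] := ideal_norm_dens sg_cj c0_gt0 O_dens nO.
  move: e; rewrite (dens_roi O_dens) => /eqP; rewrite -subr_eq0 -{2}[c0]mul1r -mulrBl mulf_eq0.
  by rewrite (gt_eqF c0_gt0) orbF subr_eq0 pnatr_eq1 => /eqP.
have pt : \prod_(i < n) ((fun=> 1 : R) i) = (ideal_norm O)%:R ^+ 2 :> R by rewrite big1// NO expr1n.
have [h _ _ _] := lattice_bounds nO (weight1 R cj) pt.
have k0 := kappa_ge nO.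
have s0 : 0 <= Num.sqrt 2 ^+ n :> R by rewrite exprn_ge0// sqrtr_ge0.
have {}h : c0 * Num.sqrt 2 ^+ n < 2 by apply: le_lt_trans h; rewrite ler_wpM2r.
have d0 : 0 < Num.sqrt d%:R :> R by rewrite -invr_gt0 -c0E.
have {}h : Num.sqrt 2 ^+ n < 2 * Num.sqrt d%:R :> R.
  by move: h; rewrite c0E mulrC ltr_pdivrMr.
have : 2 ^+ n < 4 * d%:R :> R.
  have : (Num.sqrt 2 ^+ n) ^+ 2 < (2 * Num.sqrt d%:R) ^+ 2 :> R.
    by rewrite ltr_sqr ?nnegrE// mulr_ge0// ltW.
  by rewrite sqrtX2// exprMn sqr_sqrtr// (_ : 2 ^+ 2 = 4 :> R)//; ring.
rewrite -[4 * _]natrM -natrX ltr_nat => {}h.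
have [m nE] : exists m, n = m.+2 by case: (n) n2 => [//|[//|m]] _; exists m.
rewrite nE in h *; have hm : (m < 2 ^ m)%N by exact: ltn_expl.
move: h hm; rewrite !expnS; move: (2 ^ m)%N; clear; lia.
Qed.

End LatticeBounds.

(** * Integration over the weights and unfolding over the units *)

Section Unfolding.
Variables (R : realType) (L : fieldExtType rat).
Local Notation n := (\dim {:L}).
Local Notation cabs := (@Normc.normc R).
Variables (sg : 'I_n -> {rmorphism L -> R[i]}) (cj : 'I_n -> 'I_n).
Hypothesis sg_cj : forall i x, sg (cj i) x = ((sg i x)^* )%C.
Hypothesis cjK : involutive cj.
Local Notation O := (@ring_of_integers L).
Variable c0 : R.
Hypotheses (c0_gt0 : 0 < c0) (O_dens : has_dens sg cj O c0) (n2 : (2 <= n)%N).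
Variable X : translation_space R n.
Local Notation T := (ts_type X).
Local Notation m := (ts_measure X).
Local Notation c := (@ts_coord R n X).
Implicit Types (J I : set L) (x y u : L) (v : T) (w : R).

(* tauv v w runs through the conjugation-invariant weights of product e^(2 w).
   The coordinate csum and the differences c i - c (cj i) do not enter the
   weight; hcut makes them integrable.  Multiplication by x becomes the
   translation by ashift x together with a shift of w by ln |N x|. *)
Definition csum v : R := \sum_i c i v.
Definition cdir i v : R := c i v + c (cj i) v - 2 / n%:R * csum v.
Definition tauv v w : 'I_n -> R := fun i => expR (cdir i v + 2 * w / n%:R).
Definition hcut v : R := expR (- (`|csum v| + \sum_i `|c i v - c (cj i) v|)).
Definition Ev v w x : R := expR (- (pi * sqf sg (tauv v w) x)).
Definition ashift x : 'I_n -> R := fun i => ln (cabs (sg i x)) - ln (enorm sg x) / n%:R.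

Lemma n_gt0 : 0 < n%:R :> R.
Proof. by rewrite ltr0n (leq_trans _ n2). Qed.

Lemma sumr_constR (a : R) : \sum_(i < n) a = n%:R * a.
Proof. by rewrite sumr_const card_ord mulr_natl. Qed.

Lemma sum_cj (F : 'I_n -> R) : \sum_i F (cj i) = \sum_i F i.
Proof. by rewrite [RHS](reindex_inj (inv_inj cjK)). Qed.

Lemma tauv_weight v w : weight cj (tauv v w).
Proof.
split => i; first exact: expR_gt0.
by rewrite /tauv /cdir cjK [c (cj i) v + _]addrC.
Qed.

Lemma cdir_sum v : \sum_i cdir i v = 0.
Proof.
rewrite /cdir sumrB big_split/= (sum_cj (fun i => c i v)) sumr_constR -/(csum v).
by move: (n%:R) n_gt0 (csum v) => k k0 y; field; rewrite gt_eqF.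
Qed.

Lemma tauv_prod v w : \prod_i tauv v w i = expR w ^+ 2.
Proof.
rewrite /tauv -expR_sum -expRM_natl; congr expR.
rewrite big_split/= cdir_sum add0r sumr_constR.
by move: (n%:R) n_gt0 => k k0; field; rewrite gt_eqF.
Qed.

Lemma tauv_scale v w w' : tauv v (w + w') = dscale (expR (2 * w' / n%:R)) (tauv v w).
Proof.
apply/funext => i; rewrite /dscale /tauv -expRD; congr expR.
by rewrite mulrDr mulrDl addrA addrC.
Qed.

Lemma ashift_sum x : x != 0 -> \sum_i ashift x i = 0.
Proof.
move=> x0; rewrite /ashift sumrB sumr_constR.
rewrite (_ : \sum_i ln (cabs (sg i x)) = ln (enorm sg x)); last first.
  rewrite /enorm [in RHS](eq_bigr (fun i => expR (ln (cabs (sg i x))))) -?expR_sum ?expRK//.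
  by move=> i _; rewrite lnK// posrE cabs_sg_gt0.
by move: (n%:R) n_gt0 (ln (enorm sg x)) => k k0 y; field; rewrite gt_eqF.
Qed.

Lemma ashift_cj x i : ashift x (cj i) = ashift x i.
Proof. by rewrite /ashift sg_cj cabs_conj. Qed.

Lemma csum_trans x v : x != 0 -> csum (ts_trans (ashift x) v) = csum v.
Proof.
move=> x0; rewrite /csum; under eq_bigr do rewrite ts_coord_trans.
by rewrite big_split/= ashift_sum// addr0.
Qed.

Lemma hcut_trans x v : x != 0 -> hcut (ts_trans (ashift x) v) = hcut v.
Proof.
move=> x0; rewrite /hcut csum_trans//; congr (expR (- (_ + _))).
by apply: eq_bigr => i _; rewrite !ts_coord_trans ashift_cj; congr `|_|; ring.
Qed.

Lemma Ev_trans x y v w : x != 0 ->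
  Ev (ts_trans (ashift x) v) (w + ln (enorm sg x)) y = Ev v w (x * y).
Proof.
move=> x0; have e : tauv (ts_trans (ashift x) v) (w + ln (enorm sg x)) = twist sg (tauv v w) x; last first.
  by rewrite /Ev sqf_twist e.
apply/funext => i; rewrite /twist /tauv /cdir csum_trans// !ts_coord_trans ashift_cj.
have -> : cabs (sg i x) ^+ 2 = expR (2%:R * ln (cabs (sg i x))).
  by rewrite expRM_natl lnK// posrE cabs_sg_gt0.
rewrite -expRD; congr expR; rewrite /ashift.
move: (n%:R) n_gt0 (ln (enorm sg x)) (ln (cabs (sg i x))) (c i v) (c (cj i) v) (csum v).
by move=> k k0 lN l a b z; field; rewrite gt_eqF.
Qed.

Lemma measurable_csum : measurable_fun setT csum.
Proof. by apply: measurable_sum => i; exact: ts_coord_meas. Qed.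

Lemma measurable_cdir i : measurable_fun setT (cdir i).
Proof.
apply: measurable_funB; first by apply: measurable_funD; exact: ts_coord_meas.
by apply: measurable_funM => //; exact: measurable_csum.
Qed.

Lemma measurable_hcut : measurable_fun setT hcut.
Proof.
apply: measurableT_comp => //; apply: measurableT_comp => //; apply: measurable_funD.
  by apply: measurableT_comp => //; exact: measurable_csum.
apply: measurable_sum => i; apply: measurableT_comp => //.
by apply: measurable_funB; exact: ts_coord_meas.
Qed.

Lemma measurable_Ev w x : measurable_fun setT (fun v => Ev v w x).
Proof.
apply: measurableT_comp => //; apply: measurableT_comp => //.
apply: measurable_funM => //; apply: measurable_sum => i.
apply: measurable_funM => //; apply: measurableT_comp => //.
by apply: measurable_funD => //; exact: measurable_cdir.
Qed.

Lemma Ev_gt0 v w x : 0 < Ev v w x. Proof. exact: expR_gt0. Qed.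
Lemma hcut_gt0 v : 0 < hcut v. Proof. exact: expR_gt0. Qed.

Lemma Ev_ge0 v w x : 0 <= Ev v w x. Proof. exact: expR_ge0. Qed.
Lemma hcut_ge0 v : 0 <= hcut v. Proof. exact: expR_ge0. Qed.

(** The archimedean weight: its transform plays the role of the Gamma factors in the completed zeta
    function. *)
Definition phie w : \bar R := (\int[m]_v (hcut v * Ev v w 1)%:E)%E.

(** The translation by [ashift x] preserves the measure and [hcut], so after integration x survives
    only through its norm. *)
Lemma phie_shift w x : x != 0 ->
  (\int[m]_v (hcut v * Ev v w x)%:E = phie (w + ln (enorm sg x)))%E.
Proof.
move=> x0; rewrite /phie -[RHS](ts_integral_trans (ashift x)); last 2 first.
- by apply/measurable_EFinP; apply: measurable_funM; [exact: measurable_hcut|exact: measurable_Ev].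
- by move=> v; rewrite lee_fin; exact: mulr_ge0 (hcut_ge0 _) (Ev_ge0 _ _ _).
by apply: eq_integral => v _; rewrite hcut_trans// Ev_trans// mulr1.
Qed.

Definition units : set L := [set u | [/\ O u, O u^-1 & u != 0]].

Lemma units1 : units 1.
Proof. by split; rewrite ?invr1; [exact: roi1|exact: roi1|exact: oner_neq0]. Qed.

Lemma unitsM u u' : units u -> units u' -> units (u * u').
Proof.
by move=> [? ? ?] [? ? ?]; split; [exact: roiM|rewrite invfM; exact: roiM|rewrite mulf_neq0].
Qed.

Lemma unitsV u : units u -> units u^-1.
Proof. by move=> [? ? ?]; split; rewrite ?invrK ?invr_eq0. Qed.

(** u O and O are the same set, so they have the same density. *)
Lemma units_norm u : units u -> enorm sg u = 1.
Proof.
move=> [Ou Ou' u0].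
have : dens sg cj [set u * y | y in O] = dens sg cj O.
  congr (dens _ _ _); apply/seteqP; split => [_ [y Oy <-]|y Oy]; first exact: roiM.
  by exists (u^-1 * y); [exact: roiM|rewrite mulrA mulfV// mul1r].
rewrite (dens_scale sg_cj c0_gt0 O_dens (roi_fractional L) u0) (dens_roi O_dens) => e.
have N0 := enorm_gt0 sg u0.
have : c0 * enorm sg u = c0 by rewrite -{1}e mulfVK// gt_eqF.
by move=> /eqP; rewrite -subr_eq0 -{2}[c0]mulr1 -mulrBr mulf_eq0 (gt_eqF c0_gt0)/= subr_eq0 => /eqP.
Qed.

Lemma units_Ev u y v w : units u -> Ev (ts_trans (ashift u) v) w y = Ev v w (u * y).
Proof.
move=> hu; have [_ _ u0] := hu.
by have := Ev_trans y v w u0; rewrite (units_norm hu) ln1 addr0.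
Qed.

Definition usum v : \bar R := (\esum_(u in units) (Ev v 0 u)%:E)%E.

Lemma countable_L (A : set L) : countable A.
Proof.
apply/countable_injP; exists (fun x : L => choice.pickle (rVof (vbasis {:L}) x)) => x y _ _.
by move=> /(pcan_inj choice.pickleK)/(can_inj (rVofK (vbasisP _))).
Qed.

Lemma roi_ideal : nonzero_ideal O.
Proof. exact: fractional_ideal (roi_fractional L) (@subset_refl _ _). Qed.

Lemma ideal_norm_roi : ideal_norm O = 1%N.
Proof.
have [e _] := ideal_norm_dens sg_cj c0_gt0 O_dens roi_ideal.
move: e; rewrite (dens_roi O_dens) => /eqP; rewrite -subr_eq0 -{2}[c0]mul1r -mulrBl mulf_eq0.
by rewrite (gt_eqF c0_gt0) orbF subr_eq0 pnatr_eq1 => /eqP.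
Qed.

Lemma inv_ideal_roi : inv_ideal O = O.
Proof.
apply/seteqP; split => x; first by move=> /(_ _ (roi1 L)); rewrite mulr1.
by move=> Ox z Oz; exact: roiM.
Qed.

Lemma usum_fin v : (0 < usum v < +oo)%E.
Proof.
apply/andP; split.
  apply: (@lt_le_trans _ _ (Ev v 0 1)%:E); first by rewrite lte_fin Ev_gt0.
  rewrite -(@esum_set1 R _ (1 : L) (fun u => (Ev v 0 u)%:E)); last by rewrite lee_fin; exact: Ev_ge0.
  by apply: esum_setS => _ ->; exact: units1.
have pt : \prod_i tauv v 0 i = (ideal_norm O)%:R ^+ 2.
  by rewrite tauv_prod expR0 ideal_norm_roi.
have [_ h _ _] := lattice_bounds sg_cj c0_gt0 O_dens n2 roi_ideal (tauv_weight v 0) pt.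
apply: (@le_lt_trans _ _ (Theta sg (tauv v 0) (inv_ideal O) 1)); last by rewrite h ?ltry.
rewrite inv_ideal_roi /Theta; apply: (@le_trans _ _ (\esum_(u in O) (Ev v 0 u)%:E)%E).
  by apply: esum_setS => u [].
by apply: le_esum => u _; rewrite /gterm mulr1.
Qed.

Lemma usum_trans u v : units u -> usum (ts_trans (ashift u) v) = usum v.
Proof.
move=> hu; have [Ou Ou' u0] := hu.
rewrite /usum [RHS](@reindex_esum R _ _ units units (fun y => u * y)); last first.
  split; [by move=> y; exact: unitsM|by move=> y z _ _ /(mulfI u0)|].
  move=> y hy; exists (u^-1 * y); first by apply: unitsM => //; exact: unitsV.
  by rewrite mulrA mulfV// mul1r.
by apply: eq_esum => y _; rewrite units_Ev.
Qed.

(* The translates of omega by the units sum to 1: this replaces a fundamental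
   domain, so that Dirichlet's unit theorem is not needed. *)
Definition omega v : R := Ev v 0 1 / fine (usum v).

Lemma fine_usum_gt0 v : 0 < fine (usum v).
Proof. by rewrite fine_gt0// usum_fin. Qed.

Lemma omega_gt0 v : 0 < omega v.
Proof. by rewrite divr_gt0 ?Ev_gt0 ?fine_usum_gt0. Qed.

Lemma measurable_omega : measurable_fun setT omega.
Proof.
apply: measurable_funM; first exact: measurable_Ev.
(* Writing the inverse as an exponential of a logarithm reduces its measurability to that of [usum],
   which is positive. *)
have -> : (fun v => (fine (usum v))^-1) = (fun v => expR (- ln (fine (usum v)))).
  by apply/funext => v; rewrite expRN lnK// posrE fine_usum_gt0.
apply: measurableT_comp => //; apply: measurableT_comp => //; apply: measurableT_comp => //.
apply: measurableT_comp => //; apply: measurable_esum; first exact: countable_L.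
  by move=> u _; apply/measurable_EFinP; exact: measurable_Ev.
by move=> u v _; rewrite lee_fin; exact: Ev_ge0.
Qed.

Lemma omega_sum v : (\esum_(u in units) (omega (ts_trans (ashift u) v))%:E = 1)%E.
Proof.
have /andP[u0 uf] := usum_fin v.
have e u : units u -> (omega (ts_trans (ashift u) v))%:E = ((fine (usum v))^-1%:E * (Ev v 0 u)%:E)%E.
  by move=> hu; rewrite /omega usum_trans// units_Ev// mulr1 mulrC EFinM.
under eq_esum => u hu do rewrite e//.
rewrite esumZl ?invr_ge0 ?(ltW (fine_usum_gt0 v))//; last by move=> u _; rewrite lee_fin; exact: Ev_ge0.
rewrite -/(usum v) -[X in (_ * X)%E]fineK ?ge0_fin_numE ?(ltW u0)// -EFinM mulVf// gt_eqF//.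
exact: fine_usum_gt0.
Qed.

Definition hw v : R := hcut v * omega v.

Lemma hw_gt0 v : 0 < hw v. Proof. by rewrite mulr_gt0 ?hcut_gt0 ?omega_gt0. Qed.

Lemma measurable_hw : measurable_fun setT hw.
Proof. by apply: measurable_funM; [exact: measurable_hcut|exact: measurable_omega]. Qed.

(** Translating each integral by the unit moves the unit from the argument of [Ev] into [omega],
    whose translates add up to 1. *)
Lemma unfold_units w x : x != 0 ->
  (\esum_(u in units) \int[m]_v (hw v * Ev v w (u * x))%:E = phie (w + ln (enorm sg x)))%E.
Proof.
move=> x0; rewrite -phie_shift//.
rewrite (@reindex_esum R _ _ units units (fun u => u^-1)); last first.
  split; [by move=> u; exact: unitsV|by move=> u u' _ _ /invr_inj|].
  by move=> u hu; exists u^-1; [exact: unitsV|rewrite invrK].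
have e u : units u -> (\int[m]_v (hw v * Ev v w (u^-1 * x))%:E =
   \int[m]_v ((hcut v * Ev v w x)%:E * (omega (ts_trans (ashift u) v))%:E))%E.
  move=> hu; have [_ _ u0] := hu.
  rewrite -(ts_integral_trans (ashift u)); last 2 first.
  - by apply/measurable_EFinP; apply: measurable_funM; [exact: measurable_hw|exact: measurable_Ev].
  - by move=> v; rewrite lee_fin; exact: mulr_ge0 (ltW (hw_gt0 _)) (Ev_ge0 _ _ _).
  apply: eq_integral => v _; rewrite /hw hcut_trans// units_Ev//.
  by rewrite (_ : u * (u^-1 * x) = x) ?mulVKf// -EFinM; congr (_%:E); exact: mulrAC.
under eq_esum => u hu do rewrite e//.
rewrite -integral_esum; last 3 first.
- exact: countable_L.
- move=> u _; apply: emeasurable_funM; apply/measurable_EFinP.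
    by apply: measurable_funM; [exact: measurable_hcut|exact: measurable_Ev].
  by apply: (measurableT_comp measurable_omega); exact: ts_trans_meas.
- move=> u v _; rewrite -EFinM lee_fin.
  exact: mulr_ge0 (mulr_ge0 (hcut_ge0 _) (Ev_ge0 _ _ _)) (ltW (omega_gt0 _)).
apply: eq_integral => v _; rewrite esumZl; last 2 first.
- exact: mulr_ge0 (hcut_ge0 _) (Ev_ge0 _ _ _).
- by move=> u _; rewrite lee_fin; exact: ltW (omega_gt0 _).
by rewrite omega_sum mule1.
Qed.

End Unfolding.

(** * The sum over ideal classes *)

Section IdealClasses.
Variables (R : realType) (L : fieldExtType rat).
Local Notation n := (\dim {:L}).
Local Notation cabs := (@Normc.normc R).
Variables (sg : 'I_n -> {rmorphism L -> R[i]}) (cj : 'I_n -> 'I_n).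
Hypothesis sg_cj : forall i x, sg (cj i) x = ((sg i x)^* )%C.
Hypothesis cjK : involutive cj.
Local Notation O := (@ring_of_integers L).
Variable c0 : R.
Hypotheses (c0_gt0 : 0 < c0) (O_dens : has_dens sg cj O c0) (n2 : (2 <= n)%N).
Variable X : translation_space R n.
Local Notation T := (ts_type X).
Local Notation m := (ts_measure X).
Local Notation c := (@ts_coord R n X).
Local Notation idx := [set I : set L | nonzero_ideal I].
Local Notation units := (@units L).
Local Notation Ev := (@Ev R L sg cj X).
Local Notation hw := (@hw R L sg cj X).
Local Notation phie := (@phie R L sg cj X).
Local Notation tauv := (@tauv R L cj X).
Local Notation hcut := (@hcut R L cj X).
Local Notation cdir := (@cdir R L cj X).
Local Notation csum := (@csum R L X).
Implicit Types (J I : set L) (x y u : L) (v : T) (w : R).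

Definition scl x I : set L := [set x * y | y in I].

Lemma sclA x y I : scl x (scl y I) = scl (x * y) I.
Proof.
apply/seteqP; split => [_ [_ [z Iz <-] <-]|_ [z Iz <-]]; first by exists z => //; rewrite mulrA.
by exists (y * z); [exists z|rewrite mulrA].
Qed.

Lemma scl1 I : scl 1 I = I.
Proof. by apply/seteqP; split => [_ [z Iz <-]|z Iz]; [rewrite mul1r|exists z; rewrite ?mul1r]. Qed.

Definition cls I : set (set L) := [set J | nonzero_ideal J /\ exists2 x, x != 0 & J = scl x I].

Lemma cls_scl I x : x != 0 -> cls (scl x I) = cls I.
Proof.
move=> x0; apply/seteqP; split => J [nJ [y y0 JE]]; split => //.
  by exists (y * x); [rewrite mulf_neq0|rewrite JE sclA].
by exists (y / x); [rewrite mulf_neq0 ?invr_eq0|rewrite JE sclA divfK].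
Qed.

(** The choice depends on the set [cls I] only, so proportional ideals receive the same
    representative. *)
Definition rep I : set L := xget set0 (cls I).

Lemma repP I : nonzero_ideal I -> cls I (rep I).
Proof.
by move=> nI; apply: xgetPex; exists I; split => //; exists 1; [exact: oner_neq0|rewrite scl1].
Qed.

Lemma rep_scl I x : x != 0 -> rep (scl x I) = rep I.
Proof. by move=> x0; rewrite /rep cls_scl. Qed.

Definition gen I : L := xget 0 [set x | x != 0 /\ I = scl x (rep I)].

Lemma genP I : nonzero_ideal I -> gen I != 0 /\ I = scl (gen I) (rep I).
Proof.
move=> /repP[_ [x x0 e]]; apply: (@xgetPex _ 0 [set x | x != 0 /\ I = scl x (rep I)]).
by exists x^-1; split; [rewrite invr_eq0|rewrite [in RHS]e sclA mulVf// scl1].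
Qed.

Definition reps : set (set L) := [set J | nonzero_ideal J /\ rep J = J].

Lemma rep_reps I : nonzero_ideal I -> reps (rep I).
Proof. by move=> nI; have [nJ [x x0 e]] := repP nI; split => //; rewrite {1}e rep_scl. Qed.

Lemma scl_unit u I : units u -> nonzero_ideal I -> scl u I = I.
Proof.
move=> [Ou Ou' u0] [_ _ _ IM _]; apply/seteqP; split => [_ [z Iz <-]|z Iz]; first exact: IM.
by exists (u^-1 * z); [exact: IM|rewrite mulVKf].
Qed.

Lemma scl_eq_unit J x y : nonzero_ideal J -> x != 0 -> y != 0 -> scl x J = scl y J ->
  units (x / y).
Proof.
have key x' y' : nonzero_ideal J -> y' != 0 -> scl x' J = scl y' J -> O (x' / y').
  move=> nJ y0 e; apply: (stable_integral sg_cj c0_gt0 O_dens (ideal_fractional nJ)) => z Jz.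
  have : scl x' J (x' * z) by exists z.
  by rewrite e => -[t Jt te]; rewrite mulrAC -te [y' * t]mulrC mulfK.
move=> nJ x0 y0 e; split; [exact: key|rewrite invfM invrK mulrC; exact: key|].
by rewrite mulf_neq0 ?invr_eq0.
Qed.

Definition invx J : set L := [set x | inv_ideal J x /\ x != 0].

(** A nonzero x in the inverse of J gives the integral ideal x J in the class of J, and x is
    determined by that ideal up to a unit. Sums over ideals and units thus become sums over
    representatives and lattice vectors. *)
Lemma class_bij : set_bij ([set: idx] `*`` (fun=> units)) (reps `*`` invx)
  (fun p => (rep (val p.1), p.2 * gen (val p.1))).
Proof.
have genE (I : idx) := genP (set_mem (valP I)).
split.
- move=> [I u] [_ [Ou Ou' u0]] /=; have [g0 gI] := genE I.
  have nI := set_mem (valP I); split => /=; first exact: rep_reps.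
  split; last by rewrite mulf_neq0.
  move=> z Jz; rewrite -mulrA; apply: roiM => //; have [IO _ _ _ _] := nI; apply: IO.
  by rewrite [X in X _]gI; exists z.
- move=> [I u] [I' u']; rewrite !inE/= => -[_ hu] [_ hu'] [eJ eg].
  have [g0 gI] := genE I; have [g0' gI'] := genE I'.
  have nI := set_mem (valP I); have nI' := set_mem (valP I').
  have eI : I = I'.
    apply: val_inj; rewrite -(scl_unit hu nI) -(scl_unit hu' nI').
    by rewrite [X in scl u X]gI [X in scl u' X]gI' !sclA eg eJ.
  by move: eg; rewrite eI => /mulIf; rewrite eI in g0 => /(_ g0) ->.
- move=> [J x] [[nJ rJ] [/= xJ x0]].
  have nI : nonzero_ideal (scl x J).
    have [JO J0 JD JM [y Jy y0]] := nJ; split.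
    + by move=> _ [z Jz <-]; exact: xJ.
    + by exists 0; rewrite ?mulr0.
    + by move=> _ _ [a Ja <-] [b Jb <-]; exists (a + b); [exact: JD|rewrite mulrDr].
    + by move=> a _ Oa [b Jb <-]; exists (a * b); [exact: JM|rewrite mulrCA].
    + by exists (x * y); [exists y|rewrite mulf_neq0].
  have [g0 gI] := genP nI.
  have rI : rep (scl x J) = J by rewrite rep_scl.
  rewrite rI in gI.
  exists (SigSub (mem_set nI : scl x J \in idx), x / gen (scl x J)); rewrite ?SubK/=.
    by split => //=; exact: scl_eq_unit gI.
  by rewrite rI divfK.
Qed.

Definition lnN I : R := ln (ideal_norm I)%:R.
(** A shift by ln N(I) multiplies the transform by N(I)^(-s), so the transform of this sum is zeta
    times that of [phie]. *)
Definition Psi w : \bar R := (\esum_(I in [set: idx]) phie (w + lnN (val I)))%E.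

Lemma norm_gt0 I : nonzero_ideal I -> 0 < (ideal_norm I)%:R :> R.
Proof. by move=> nI; rewrite ltr0n (ideal_norm_dens sg_cj c0_gt0 O_dens nI).2. Qed.

Lemma hw_ge0 v : 0 <= hw v.
Proof. exact: ltW (hw_gt0 sg_cj cjK c0_gt0 O_dens n2 _). Qed.

Let mhw : measurable_fun setT hw.
Proof. exact: (measurable_hw sg_cj cjK c0_gt0 O_dens n2). Qed.

Lemma Psi_reps w :
  (Psi w = \esum_(J in reps) \esum_(x in invx J) \int[m]_v (hw v * Ev v (w + lnN J) x)%:E)%E.
Proof.
have F0 J x : (0 <= \int[m]_v (hw v * Ev v (w + lnN J) x)%:E)%E.
  by apply: integral_ge0 => v _; rewrite lee_fin; exact: mulr_ge0 (hw_ge0 _) (Ev_ge0 _ _ _ _ _).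
rewrite (@esum_esum R _ _ reps invx)//.
rewrite (reindex_esum _ _ _ _ class_bij) /=.
rewrite -(@esum_esum R _ _ [set: idx] (fun=> units) (fun (I : idx) u =>
  \int[m]_v (hw v * Ev v (w + lnN (rep (val I))) (u * gen (val I)))%:E)%E)//.
apply: eq_esum => I _; have nI := set_mem (valP I); have [g0 gI] := genP nI.
have nJ := (rep_reps nI).1.
have h := unfold_units sg_cj cjK c0_gt0 O_dens n2 X (w + lnN (rep (val I))) g0.
apply: (etrans _ (esym h)).
have -> // : w + lnN (val I) = w + lnN (rep (val I)) + ln (enorm sg (gen (val I))).
have e : (ideal_norm (val I))%:R = enorm sg (gen (val I)) * (ideal_norm (rep (val I)))%:R :> R.
  have := ideal_norm_scale sg_cj c0_gt0 O_dens nJ g0.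
  by rewrite -[X in nonzero_ideal X -> _]gI -[X in ideal_norm X]gI; exact.
have N0 := norm_gt0 nJ; have e0 := enorm_gt0 sg g0.
by rewrite -addrA /lnN e lnM// [X in _ + X]addrC.
Qed.

(** The change of variable t = e^(2 w / n), for which t^(n/2) = e^w. *)
Definition tw w : R := expR (2 * w / n%:R).
Definition rT J v w : R := rTheta sg (tauv v (lnN J)) (inv_ideal J) (tw w).

Lemma tauv_norm J v : nonzero_ideal J -> \prod_i tauv v (lnN J) i = (ideal_norm J)%:R ^+ 2.
Proof. by move=> nJ; rewrite (tauv_prod cjK n2) /lnN lnK// posrE norm_gt0. Qed.

Let LB J v (nJ : nonzero_ideal J) := lattice_bounds sg_cj c0_gt0 O_dens n2 nJ
  (tauv_weight cjK v (lnN J)) (tauv_norm v nJ).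

Lemma gterm_Ev J v w x : gterm sg (tauv v (lnN J)) (tw w) x = Ev v (w + lnN J) x.
Proof. by rewrite /gterm /Ev addrC tauv_scale sqf_dscale mulrA. Qed.

Lemma esum_invx (f : L -> \bar R) J : (forall x, 0 <= f x)%E ->
  (\esum_(x in inv_ideal J) f x = f 0%R + \esum_(x in invx J) f x)%E.
Proof.
move=> f0; have I0 : inv_ideal J 0 by move=> z _; rewrite mul0r; exact: roi0.
have -> : inv_ideal J = [set 0] `|` invx J.
  apply/seteqP; split => x; last by move=> [->|[]].
  by have [->|x0] := eqVneq x 0; [left|right].
rewrite esum_setU// ?esum_set1//.
by apply/disj_setPS => x [-> []]; rewrite eqxx.
Qed.

Lemma rT_sum J v w : nonzero_ideal J ->
  ((rT J v w)%:E = 1 + \esum_(x in invx J) (Ev v (w + lnN J) x)%:E)%E.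
Proof.
move=> nJ; have [_ h _ _] := LB v nJ; rewrite -h ?expR_gt0// /Theta esum_invx; last first.
  by move=> x; rewrite lee_fin expR_ge0.
have -> : gterm sg (tauv v (lnN J)) (tw w) 0 = 1.
  rewrite /gterm /sqf big1 ?mulr0 ?oppr0 ?expR0// => i _; rewrite rmorph0.
  by rewrite /Normc.normc /= expr0n addr0 sqrtr0 expr0n mulr0.
by apply: congr1; apply: eq_esum => x _; rewrite gterm_Ev.
Qed.

Lemma rT_ge1 J v w : nonzero_ideal J -> 1 <= rT J v w.
Proof.
move=> nJ; rewrite -lee_fin rT_sum//; apply: leeDl; apply: esum_ge0 => x _.
by rewrite lee_fin; exact: Ev_ge0.
Qed.

Lemma measurable_rT J w : nonzero_ideal J -> measurable_fun setT (fun v => rT J v w).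
Proof.
move=> nJ; apply/measurable_EFinP.
rewrite (_ : EFin \o _ = (fun v => 1 + \esum_(x in invx J) (Ev v (w + lnN J) x)%:E)%E); last first.
  by apply/funext => v /=; exact: rT_sum.
apply: emeasurable_funD => //; apply: measurable_esum; first exact: countable_L.
  by move=> x _; apply/measurable_EFinP; exact: measurable_Ev.
by move=> x v _; rewrite lee_fin; exact: Ev_ge0.
Qed.

(** Subtracting 1 removes the zero vector, which corresponds to no ideal. *)
Definition Psi_class J w : \bar R := (\int[m]_v (hw v * (rT J v w - 1))%:E)%E.

Lemma Psi_sum_classes w : (Psi w = \esum_(J in reps) Psi_class J w)%E.
Proof.
rewrite Psi_reps; apply: eq_esum => J [nJ _].
rewrite -integral_esum; last 3 first.
- exact: countable_L.
- move=> x _; apply/measurable_EFinP; apply: measurable_funM => //; exact: measurable_Ev.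
- by move=> x v _; rewrite lee_fin; exact: mulr_ge0 (hw_ge0 _) (Ev_ge0 _ _ _ _ _).
apply: eq_integral => v _; under eq_esum do rewrite EFinM.
rewrite esumZl ?hw_ge0//; last by move=> x _; rewrite lee_fin; exact: Ev_ge0.
have -> : ((hw v * (rT J v w - 1))%:E = (hw v)%:E * ((rT J v w)%:E - 1))%E by rewrite EFinM EFinB.
by rewrite rT_sum// [(1 + _ - 1)%E]addeAC -EFinB subrr add0e.
Qed.

(** An extended real: its finiteness only follows in [theta_transform], from that of [Psi]. For this
    reason the lemmas below add the mass on one side instead of subtracting it on the other. *)
Definition cut_mass : \bar R := (\int[m]_v (hw v)%:E)%E.

Lemma cut_mass_gt0 : (0 < cut_mass)%E.
Proof.
apply: integral_gt0; [exact/measurable_EFinP| |exact: ts_nonzero].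
by move=> v; rewrite lte_fin (hw_gt0 sg_cj cjK c0_gt0 O_dens n2).
Qed.

Lemma integral_hwM (a : R) : 0 <= a -> (\int[m]_v (hw v * a)%:E = a%:E * cut_mass)%E.
Proof.
move=> a0; under eq_integral do rewrite mulrC EFinM.
rewrite ge0_integralZl//; first exact/measurable_EFinP.
by move=> v _; rewrite lee_fin hw_ge0.
Qed.

Lemma integral_hw_le (f g : T -> R) : measurable_fun setT f -> measurable_fun setT g ->
  (forall v, 0 <= f v) -> (forall v, f v <= g v) ->
  (\int[m]_v (hw v * f v)%:E <= \int[m]_v (hw v * g v)%:E)%E.
Proof.
move=> mf mg f0 fg; apply: ge0_le_integral => //.
- by move=> v _; rewrite lee_fin mulr_ge0// hw_ge0.
- by apply/measurable_EFinP; exact: measurable_funM.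
- by apply/measurable_EFinP; exact: measurable_funM.
- by move=> v _; rewrite lee_fin ler_wpM2l// hw_ge0.
Qed.

Lemma Psi_class_cut_mass J w : nonzero_ideal J -> (Psi_class J w + cut_mass = \int[m]_v (hw v * rT J v w)%:E)%E.
Proof.
move=> nJ; have mr := measurable_rT w nJ; rewrite /Psi_class /cut_mass -ge0_integralD//; last 4 first.
- by move=> v _; rewrite lee_fin mulr_ge0 ?hw_ge0// subr_ge0 rT_ge1.
- by apply/measurable_EFinP; apply: measurable_funM => //; exact: measurable_funB.
- by move=> v _; rewrite lee_fin hw_ge0.
- exact/measurable_EFinP.
by apply: eq_integral => v _; rewrite -EFinD; congr (_%:E); rewrite mulrBr mulr1 subrK.
Qed.

Definition decay w : R := expR (- (pi * n%:R * (tw w - 1 / 2))).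
Definition theta_err : R := 32 * n%:R ^+ 2 * (n + 2)%:R / c0 ^+ 2.

Lemma tw_ge1 w : 0 <= w -> 1 <= tw w.
Proof.
move=> w0; rewrite -expR0 ler_expR divr_ge0 ?mulr_ge0//.
Qed.

Lemma tw_le1 w : w <= 0 -> tw w <= 1.
Proof.
move=> w0; rewrite -expR0 ler_expR; apply: mulr_le0_ge0; last by rewrite invr_ge0.
exact: mulr_ge0_le0.
Qed.

Lemma sqrt_tw w : Num.sqrt (tw w) ^+ n = expR w.
Proof.
have -> : tw w = expR (w / n%:R) ^+ 2 by rewrite -expRM_natl mulrA.
rewrite sqrtr_sqr ger0_norm ?expR_ge0// -expRM_natl; congr expR.
by rewrite mulrC divfK// gt_eqF// n_gt0.
Qed.

Lemma rT_decay J v w : nonzero_ideal J -> 0 <= w -> rT J v w - 1 <= decay w.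
Proof.
move=> nJ w0; have [_ _ h _] := LB v nJ; rewrite lerBlDl; apply: h.
by apply: le_trans (tw_ge1 w0); rewrite ler_pdivrMr// mul1r ler1n.
Qed.

Lemma rT_between J v w : nonzero_ideal J -> w <= 0 ->
  kappa sg cj J * expR (- w) <= rT J v w <= kappa sg cj J * expR (- w) + theta_err * tw w * expR (- w).
Proof.
move=> nJ w0; have [_ _ _ h] := LB v nJ.
have /h/andP[] : 0 < tw w <= 1 by rewrite expR_gt0 tw_le1.
rewrite sqrt_tw -/(rT J v w) => h1 h2.
have kc := kappa_ge sg_cj c0_gt0 O_dens nJ.
have e0 : 0 < expR w by exact: expR_gt0.
rewrite expRN ler_pdivrMr// -mulrDl ler_pdivlMr// ![_ * expR w]mulrC h1/=.
apply: (le_trans h2); rewrite lerD2l ler_wpM2r ?expR_ge0// /theta_err.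
rewrite ler_wpM2l ?mulr_ge0 ?exprn_ge0// lef_pV2 ?posrE ?exprn_gt0 ?(lt_le_trans c0_gt0)//.
by rewrite lerXn2r// nnegrE ltW// (lt_le_trans c0_gt0).
Qed.

Lemma kappa_gt0 J : nonzero_ideal J -> 0 < kappa sg cj J.
Proof. by move=> nJ; exact: lt_le_trans (kappa_ge sg_cj c0_gt0 O_dens nJ). Qed.

Lemma theta_err_ge0 : 0 <= theta_err.
Proof. by rewrite divr_ge0 ?exprn_ge0 ?(ltW c0_gt0)// !mulr_ge0 ?exprn_ge0. Qed.

Lemma theta_err_tw_ge0 w : 0 <= theta_err * tw w * expR (- w).
Proof. exact: mulr_ge0 (mulr_ge0 theta_err_ge0 (expR_ge0 _)) (expR_ge0 _). Qed.

Lemma Psi_class_ge0 J w : nonzero_ideal J -> (0 <= Psi_class J w)%E.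
Proof.
move=> nJ; apply: integral_ge0 => v _; rewrite lee_fin mulr_ge0 ?hw_ge0//.
by rewrite subr_ge0 rT_ge1.
Qed.

Lemma Psi_class_decay J w : nonzero_ideal J -> 0 <= w -> (Psi_class J w <= (decay w)%:E * cut_mass)%E.
Proof.
move=> nJ w0; rewrite -integral_hwM ?expR_ge0//; apply: integral_hw_le => //.
- by apply: measurable_funB => //; exact: measurable_rT.
- by move=> v; rewrite subr_ge0 rT_ge1.
- by move=> v; exact: rT_decay.
Qed.

Lemma Psi_class_lower J w : nonzero_ideal J -> w <= 0 ->
  ((expR (- w))%:E * ((kappa sg cj J)%:E * cut_mass) <= Psi_class J w + cut_mass)%E.
Proof.
move=> nJ w0; rewrite Psi_class_cut_mass// muleA -EFinM -integral_hwM; last first.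
  by rewrite mulr_ge0 ?expR_ge0// ltW// kappa_gt0.
apply: integral_hw_le => //; first exact: measurable_rT.
  by move=> v; rewrite mulr_ge0 ?expR_ge0// ltW// kappa_gt0.
by move=> v; rewrite mulrC; have /andP[] := rT_between v nJ w0.
Qed.

Lemma Psi_class_upper J w : nonzero_ideal J -> w <= 0 ->
  (Psi_class J w + cut_mass <= (expR (- w))%:E * ((kappa sg cj J)%:E * cut_mass) + (theta_err * tw w * expR (- w))%:E * cut_mass)%E.
Proof.
move=> nJ w0; rewrite Psi_class_cut_mass// muleA -EFinM -ge0_muleDl ?lee_fin; last 2 first.
- by rewrite mulr_ge0 ?expR_ge0// ltW// kappa_gt0.
- exact: theta_err_tw_ge0.
rewrite -EFinD -integral_hwM; last first.
  by rewrite addr_ge0 ?theta_err_tw_ge0// mulr_ge0 ?expR_ge0// ltW// kappa_gt0.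
apply: integral_hw_le => //; first exact: measurable_rT.
  by move=> v; rewrite (le_trans ler01)// rT_ge1.
by move=> v; rewrite [expR _ * _]mulrC; have /andP[] := rT_between v nJ w0.
Qed.

(** For such w every theta value is at least 2, so removing the zero vector leaves at least 1. *)
Lemma Psi_class_cut_mass_le J w : nonzero_ideal J -> w <= 0 -> 2 <= c0 * expR (- w) -> (cut_mass <= Psi_class J w)%E.
Proof.
move=> nJ w0 h; rewrite -[cut_mass]mul1e -integral_hwM//; apply: integral_hw_le => //.
  by apply: measurable_funB => //; exact: measurable_rT.
move=> v; have /andP[h1 _] := rT_between v nJ w0.
have : c0 * expR (- w) <= kappa sg cj J * expR (- w).
  by rewrite ler_wpM2r ?expR_ge0// (kappa_ge sg_cj c0_gt0 O_dens nJ).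
by move=> h2; rewrite lerBrDr; apply: le_trans h1; apply: le_trans h2; apply: le_trans h.
Qed.

Definition Vtot : \bar R := (\esum_(J in reps) cut_mass)%E.
Definition rtot : \bar R := (\esum_(J in reps) ((kappa sg cj J)%:E * cut_mass))%E.

Let cut_mass_ge0 : (0 <= cut_mass)%E := ltW cut_mass_gt0.

Lemma kappa_mass_ge0 J : nonzero_ideal J -> (0 <= (kappa sg cj J)%:E * cut_mass)%E.
Proof. by move=> nJ; rewrite mule_ge0// lee_fin ltW// kappa_gt0. Qed.

Lemma Psi_decay w : 0 <= w -> (Psi w <= (decay w)%:E * Vtot)%E.
Proof.
move=> w0; rewrite Psi_sum_classes -esumZl ?expR_ge0//; apply: le_esum => J [nJ _].
exact: Psi_class_decay.
Qed.

Lemma Psi_lower w : w <= 0 -> ((expR (- w))%:E * rtot <= Psi w + Vtot)%E.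
Proof.
move=> w0; rewrite Psi_sum_classes /rtot -esumZl ?expR_ge0//; last by move=> J [nJ _]; exact: kappa_mass_ge0.
rewrite -esumD//; last by move=> J [nJ _]; exact: Psi_class_ge0.
by apply: le_esum => J [nJ _]; exact: Psi_class_lower.
Qed.

Lemma Psi_upper w : w <= 0 ->
  (Psi w + Vtot <= (expR (- w))%:E * rtot + (theta_err * tw w * expR (- w))%:E * Vtot)%E.
Proof.
have a0 := theta_err_tw_ge0 w.
move=> w0; rewrite Psi_sum_classes /rtot /Vtot -!esumZl ?expR_ge0//; last by move=> J [nJ _]; exact: kappa_mass_ge0.
rewrite -!esumD//; last 3 first.
- by move=> J [nJ _]; rewrite mule_ge0 ?lee_fin ?expR_ge0// kappa_mass_ge0.
- by move=> J _; rewrite mule_ge0.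
- by move=> J [nJ _]; exact: Psi_class_ge0.
by apply: le_esum => J [nJ _]; exact: Psi_class_upper.
Qed.

(* This is where the finiteness of the class number is hidden: Psi is finite. *)
Lemma Vtot_le w : w <= 0 -> 2 <= c0 * expR (- w) -> (Vtot <= Psi w)%E.
Proof. by move=> w0 h; rewrite Psi_sum_classes; apply: le_esum => J [nJ _]; exact: Psi_class_cut_mass_le. Qed.

Lemma Vtot_gt0 : (0 < Vtot)%E.
Proof.
apply: (lt_le_trans cut_mass_gt0); rewrite -(@esum_set1 R _ (rep O) (fun=> cut_mass))//.
by apply: esum_setS => _ ->; exact: rep_reps (roi_ideal L).
Qed.

Lemma rtot_ge : (c0%:E * Vtot <= rtot)%E.
Proof.
rewrite /Vtot -(esumZl (ltW c0_gt0))//; apply: le_esum => J [nJ _].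
by rewrite lee_wpmul2r// lee_fin (kappa_ge sg_cj c0_gt0 O_dens nJ).
Qed.

End IdealClasses.

(** * Decay of the archimedean weight, and the pair phi, psi *)

Section ThetaTransform.
Variables (R : realType) (L : fieldExtType rat).
Local Notation n := (\dim {:L}).
Local Notation cabs := (@Normc.normc R).
Variables (sg : 'I_n -> {rmorphism L -> R[i]}) (cj : 'I_n -> 'I_n).
Hypothesis sg_cj : forall i x, sg (cj i) x = ((sg i x)^* )%C.
Hypothesis cjK : involutive cj.
Local Notation O := (@ring_of_integers L).
Variable c0 : R.
Hypotheses (c0_gt0 : 0 < c0) (O_dens : has_dens sg cj O c0) (n2 : (2 <= n)%N).
Variable X : translation_space R n.
Local Notation T := (ts_type X).
Local Notation m := (ts_measure X).
Local Notation c := (@ts_coord R n X).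
Local Notation idx := [set I : set L | nonzero_ideal I].
Local Notation Ev := (@Ev R L sg cj X).
Local Notation phie := (@phie R L sg cj X).
Local Notation tauv := (@tauv R L cj X).
Local Notation hcut := (@hcut R L cj X).
Local Notation cdir := (@cdir R L cj X).
Local Notation csum := (@csum R L X).
Local Notation Psi := (@Psi R L sg cj X).
Implicit Types (v : T) (w : R).

(** The exponential is nonnegative and above 4 z - 8, hence above a z - 8 for every slope a in
    [0, 4]. The slopes k/2 + e and k/2 - e, chosen by the sign of p, produce the term e |p|. *)
Lemma exp_tangent_le (p y k e : R) : 0 <= e -> e <= k / 2 -> k / 2 + e <= 4 ->
  k / 2 * p + k * y + e * `|p| - 2 * e * `|y| - 8 <= expR (p + 2 * y).
Proof.
move=> e0 ek k4; have z0 := expR_ge0 (p + 2 * y).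
have z4 : 4 * (p + 2 * y) - 8 <= expR (p + 2 * y).
  have [z2|z2] := leP (p + 2 * y) (- 2); first by lra.
  have h := expR_ge1Dx ((p + 2 * y) / 2).
  have -> : expR (p + 2 * y) = expR ((p + 2 * y) / 2) ^+ 2.
    by rewrite -expRM_natl; congr expR; field.
  have : (1 + (p + 2 * y) / 2) ^+ 2 <= expR ((p + 2 * y) / 2) ^+ 2.
    by rewrite lerXn2r// nnegrE; lra.
  (* With z = p + 2 y, the square (z/2 - 3)^2 is (1 + z/2)^2 - (4 z - 8). *)
  have := sqr_ge0 ((p + 2 * y) / 2 - 3); move: (expR _ ^+ 2) => E; rewrite !expr2; lra.
move: (expR _) z0 z4 => E z0 z4.
have key a : 0 <= a <= 4 -> a * (p + 2 * y) - 8 <= E.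
  move=> /andP[a0 a4]; have [h|h] := leP 0 (p + 2 * y).
    by apply: le_trans z4; rewrite lerD2r ler_wpM2r.
  have : a * (p + 2 * y) <= 0 by rewrite mulr_ge0_le0// ltW.
  by lra.
have ey : 0 <= e * `|y| by rewrite mulr_ge0.
have ey1 : e * y <= e * `|y| by rewrite ler_wpM2l// ler_norm.
have ey2 : - (e * y) <= e * `|y| by rewrite -mulrN ler_wpM2l// -normrN ler_norm.
have [p0|p0] := leP 0 p.
  have /key : 0 <= k / 2 + e <= 4 by lra.
  by rewrite (ger0_norm p0); lra.
have /key : 0 <= k / 2 - e <= 4 by lra.
by rewrite (ltr0_norm p0); lra.
Qed.

(** Tangent bounds with p = [cdir i v] and y = w / n are summed over i: the linear terms in p cancel
    because the [cdir] have sum 0, while the terms e |p| survive and provide decay in v. *)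
Lemma Ev_bound v w (k e : R) : 0 <= e -> e <= k / 2 -> k / 2 + e <= 4 ->
  Ev v w 1 <= expR (8 * n%:R - k * w + 2 * e * `|w| - e * \sum_i `|cdir i v|).
Proof.
move=> e0 ek k4; rewrite ler_expR.
have n0 : 0 < n%:R :> R by exact: n_gt0.
have c1 : cabs 1 = 1 by have := cabs_real (1 : R); rewrite rmorph1 normr1.
have sE : sqf sg (tauv v w) 1 = \sum_i tauv v w i.
  by apply: eq_bigr => i _; rewrite rmorph1 c1 expr1n mulr1.
have S0 : 0 <= \sum_i tauv v w i by apply: sumr_ge0 => i _; exact: expR_ge0.
have : \sum_i tauv v w i <= pi * sqf sg (tauv v w) 1.
  by rewrite sE ler_peMl// (le_trans _ (pi_ge3 R))// ler1n.
have : \sum_(i < n) (k / 2 * cdir i v + k * (w / n%:R) + e * `|cdir i v|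
        - 2 * e * `|w / n%:R| - 8) <= \sum_i tauv v w i.
  apply: ler_sum => i _; apply: (le_trans (exp_tangent_le _ _ e0 ek k4)).
  by rewrite /tauv mulrA.
rewrite !sumrB !big_split/= !sumr_constR//.
rewrite -2!mulr_sumr (cdir_sum cjK n2) mulr0 add0r normrM normfV (gtr0_norm n0).
have -> : n%:R * (k * (w / n%:R)) = k * w by field; rewrite gt_eqF.
have -> : n%:R * (2 * e * (`|w| / n%:R)) = 2 * e * `|w|.
  by move: (n%:R) n0 `|w| => q q0 y; field; rewrite gt_eqF.
move: (\sum_i tauv v w i) (pi * _) (\sum_i _) (e * _) (n%:R) => a b s es q h1 h2.
by lra.
Qed.

Lemma phie_bound (k e : R) : 0 < e -> e <= 1 / 2 -> e <= k / 2 -> k / 2 + e <= 4 ->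
  exists2 C : R, 0 < C & forall w, (phie w <= (C * expR (- (k * w) + 2 * e * `|w|))%:E)%E.
Proof.
move=> e0 e2 ek k4.
have ge0 : 0 < 2 * e by lra.
pose I := (\int[m]_v (expR (- (2 * e * \sum_i `|c i v|)))%:E)%E.
have If : (I < +oo)%E by exact: ts_exp_fin.
have I0 : (0 <= I)%E by apply: integral_ge0 => v _; rewrite lee_fin expR_ge0.
have mE : measurable_fun setT (fun v => expR (- (2 * e * \sum_i `|c i v|))).
  apply: measurableT_comp => //; apply: measurableT_comp => //; apply: measurable_funM => //.
  by apply: measurable_sum => i; apply: measurableT_comp => //; exact: ts_coord_meas.
exists (expR (8 * n%:R) * (fine I + 1)).
  by rewrite mulr_gt0 ?expR_gt0// ltr_pwDr// fine_ge0.
move=> w; set A := expR (- (k * w) + _).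
apply: (@le_trans _ _ (\int[m]_v ((expR (8 * n%:R) * A)%:E * (expR (- (2 * e * \sum_i `|c i v|)))%:E))%E).
  apply: ge0_le_integral => //.
  - by move=> v _; rewrite lee_fin; exact: mulr_ge0 (hcut_ge0 _ _) (Ev_ge0 _ _ _ _ _).
  - by apply/measurable_EFinP; apply: measurable_funM; [exact: measurable_hcut|exact: measurable_Ev].
  - by apply: emeasurable_funM => //; apply/measurable_EFinP.
  move=> v _; rewrite -EFinM lee_fin.
  have h := Ev_bound v w (ltW e0) ek k4.
  apply: (@le_trans _ _ (hcut v * expR (8 * n%:R - k * w + 2 * e * `|w| - e * \sum_i `|cdir i v|))).
    exact: ler_wpM2l (hcut_ge0 _ _) _ _ h.
  rewrite /hcut /A -!expRD ler_expR.
  have n0 : 0 < n%:R :> R by exact: n_gt0.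
  (* Each coordinate is recovered from [cdir i], the difference c i - c (cj i) and [csum]; the last
     two are controlled by [hcut], for which e <= 1/2 is enough. *)
  have : \sum_i (2 * `|c i v|) <= \sum_(i < n) (`|cdir i v| + `|c i v - c (cj i) v| + 2 / n%:R * `|csum v|).
    apply: ler_sum => i _.
    have -> : 2 * `|c i v| = `|cdir i v + (c i v - c (cj i) v) + 2 / n%:R * csum v|.
      rewrite -[X in X * `|_|](@ger0_norm _ 2)// -normrM; congr `|_|; rewrite /cdir; ring.
    apply: (le_trans (ler_normD _ _)); rewrite normrM (@ger0_norm _ (2 / n%:R)) ?divr_ge0//.
    by rewrite lerD2r ler_normD.
  rewrite !big_split/= sumr_constR// -mulr_sumr.
  have -> : n%:R * (2 / n%:R * `|csum v|) = 2 * `|csum v|.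
    by move: (n%:R) n0 `|_| => q q0 y; field; rewrite gt_eqF.
  have D0 : 0 <= \sum_i `|c i v - c (cj i) v| by apply: sumr_ge0.
  move: (\sum_i _) (\sum_(i < n) `|cdir i v|) (\sum_(i < n) _) `|csum v| (normr_ge0 (csum v)) (n%:R) `|w| D0.
  move=> S P D s s0 q aw D0 h1; rewrite -subr_ge0.
  have h2 : 0 <= e * (P + D + 2 * s - 2 * S) by rewrite mulr_ge0 ?subr_ge0// ltW.
  have h3 : 0 <= (1 / 2 - e) * (D + 2 * s) by rewrite mulr_ge0 ?subr_ge0// addr_ge0// mulr_ge0.
  by lra.
rewrite ge0_integralZl//; last 2 first.
- exact/measurable_EFinP.
- by rewrite lee_fin mulr_ge0 ?expR_ge0.
rewrite -/I -[I]fineK ?ge0_fin_numE// -EFinM lee_fin mulrAC ler_wpM2r ?expR_ge0//.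
by rewrite ler_wpM2l ?expR_ge0// lerDl.
Qed.

Lemma phie_ge0 w : (0 <= phie w)%E.
Proof. by apply: integral_ge0 => v _; rewrite lee_fin; exact: mulr_ge0 (hcut_ge0 _ _) (Ev_ge0 _ _ _ _ _). Qed.

Lemma phie_anti w w' : w <= w' -> (phie w' <= phie w)%E.
Proof.
move=> ww; apply: ge0_le_integral => //.
- by move=> v _; rewrite lee_fin; exact: mulr_ge0 (hcut_ge0 _ _) (Ev_ge0 _ _ _ _ _).
- by apply/measurable_EFinP; apply: measurable_funM; [exact: measurable_hcut|exact: measurable_Ev].
- by apply/measurable_EFinP; apply: measurable_funM; [exact: measurable_hcut|exact: measurable_Ev].
move=> v _; rewrite lee_fin; apply: ler_wpM2l; first exact: hcut_ge0.
rewrite ler_expR lerN2 ler_wpM2l ?pi_ge0//; apply: ler_sum => i _.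
rewrite ler_wpM2r ?sqr_ge0// ler_expR lerD2l ler_wpM2r ?invr_ge0//.
by rewrite ler_wpM2l.
Qed.

Lemma theta_transform (B : R) :
  (\esum_(I in [set: idx]) (expR (- (2 * lnN R (val I))))%:E <= B%:E)%E ->
  exists (phi psi : R -> R) (V rho C : R), [/\ 0 < V /\ c0 * V <= rho,
    [/\ (forall w, 0 < phi w), (forall w w', w <= w' -> phi w' <= phi w),
      (forall w, w <= 0 -> phi w <= C * expR (- (w / 4))) &
      (forall w, 0 <= w -> phi w <= C * expR (- (3 * w)))],
    (forall w, (\esum_(I in [set: idx]) (phi (w + lnN R (val I)))%:E = (psi w)%:E)%E),
    (forall w, 0 <= w -> psi w <= decay L w * V) &
    (forall w, w <= 0 -> rho * expR (- w) <= psi w + V <=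
       rho * expR (- w) + theta_err L c0 * tw L w * expR (- w) * V)].
Proof.
move=> hB.
(* The first choice gives the rate e^(-w/4) for w <= 0, the second e^(-3 w) for w >= 0; they
   determine the strip 1/4 < Re s < 3 used later. *)
have [C1 C10 h1] := @phie_bound (1 / 8) (1 / 16) ltac:(lra) ltac:(lra) ltac:(lra) ltac:(lra).
have [C2 C20 h2] := @phie_bound 4 (1 / 2) ltac:(lra) ltac:(lra) ltac:(lra) ltac:(lra).
pose C := C1 + C2.
have b1 w : w <= 0 -> (phie w <= (C * expR (- (w / 4)))%:E)%E.
  move=> w0; apply: (le_trans (h1 w)); rewrite lee_fin.
  apply: ler_pM; [exact: ltW|exact: expR_ge0|by rewrite lerDl ltW|].
  by rewrite ler_expR ler0_norm//; lra.
have b2 w : 0 <= w -> (phie w <= (C * expR (- (3 * w)))%:E)%E.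
  move=> w0; apply: (le_trans (h2 w)); rewrite lee_fin.
  apply: ler_pM; [exact: ltW|exact: expR_ge0|by rewrite lerDr ltW|].
  by rewrite ler_expR ger0_norm//; lra.
have C0 : 0 < C by rewrite addr_gt0.
have b3 w : (phie w <= (C * expR (- (2 * w)))%:E)%E.
  have [w0|w0] := leP 0 w; [apply: (le_trans (b2 w w0))|apply: (le_trans (b1 w (ltW w0)))];
  by rewrite lee_fin ler_pM2l// ler_expR; lra.
have phif w : phie w \is a fin_num by rewrite ge0_fin_numE ?phie_ge0// (le_lt_trans (b3 w)) ?ltry.
(* As phi is at most C e^(-2 w) everywhere, [Psi] is bounded by the Dirichlet series at 2, whose
   convergence is the hypothesis. *)
have Psif w : (Psi w <= (C * expR (- (2 * w)) * B)%:E)%E.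
  have Ce : 0 <= C * expR (- (2 * w)) by rewrite mulr_ge0 ?expR_ge0// ltW.
  apply: (@le_trans _ _ ((C * expR (- (2 * w)))%:E *
    \esum_(I in [set: idx]) (expR (- (2 * lnN R (val I))))%:E)%E).
    rewrite -esumZl//; apply: le_esum => I _; apply: (le_trans (b3 _)).
    by rewrite -EFinM lee_fin -mulrA -expRD mulrDr opprD.
  by rewrite [X in (_ <= X)%E]EFinM lee_wpmul2l.
have Psi0 w : (0 <= Psi w)%E by apply: esum_ge0 => I _; exact: phie_ge0.
have Psin w : Psi w \is a fin_num by rewrite ge0_fin_numE// (le_lt_trans (Psif w)) ?ltry.
have Vf : Vtot sg cj X \is a fin_num.
  rewrite ge0_fin_numE ?(ltW (Vtot_gt0 sg_cj cjK c0_gt0 O_dens n2 X))//.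
  (* Negative enough that c0 e^(-w0) >= 2, as [Vtot_le] requires. *)
  pose w0 := Num.min 0 (- ln (2 / c0)).
  have w00 : w0 <= 0 by rewrite ge_min lexx.
  have w01 : w0 <= - ln (2 / c0) by rewrite ge_min lexx orbT.
  have h : 2 <= c0 * expR (- w0).
    have : 2 / c0 <= expR (- w0).
      by rewrite -[leLHS]lnK ?posrE ?divr_gt0// ler_expR lerNr.
    by rewrite ler_pdivrMr// mulrC.
  apply: (le_lt_trans (Vtot_le sg_cj cjK c0_gt0 O_dens n2 X w00 h)).
  by rewrite (le_lt_trans (Psif w0)) ?ltry.
have V0 := Vtot_gt0 sg_cj cjK c0_gt0 O_dens n2 X.
have rc := rtot_ge sg_cj cjK c0_gt0 O_dens n2 X.
have r0 : (0 <= rtot sg cj X)%E by apply: (le_trans _ rc); apply: mule_ge0; [rewrite lee_fin|]; exact: ltW.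
have rf : rtot sg cj X \is a fin_num.
  have := Psi_lower sg_cj cjK c0_gt0 O_dens n2 X (lexx 0); rewrite oppr0 expR0 mul1e => h.
  by rewrite ge0_fin_numE// (le_lt_trans h)// lte_add_pinfty// -ge0_fin_numE// ltW.
exists (fun w => fine (phie w)), (fun w => fine (Psi w)), (fine (Vtot sg cj X)), (fine (rtot sg cj X)), C.
split.
- split; first by apply: fine_gt0; rewrite V0 -ge0_fin_numE ?Vf//; exact: ltW.
  by rewrite -lee_fin EFinM (fineK Vf) (fineK rf).
- split.
  + move=> w; apply: fine_gt0; apply/andP; split; last exact: le_lt_trans (b3 w) (ltry _).
    apply: integral_gt0; last exact: ts_nonzero.
      by apply/measurable_EFinP; apply: measurable_funM; [exact: measurable_hcut|exact: measurable_Ev].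
    by move=> v; rewrite lte_fin; exact: mulr_gt0 (hcut_gt0 _ _) (Ev_gt0 _ _ _ _ _).
  + by move=> w w' ww; apply: fine_le (phif _) (phif _) (phie_anti ww).
  + by move=> w w0; rewrite -lee_fin (fineK (phif w)); exact: b1.
  + by move=> w w0; rewrite -lee_fin (fineK (phif w)); exact: b2.
- by move=> w; rewrite (fineK (Psin w)); apply: eq_esum => I _; rewrite (fineK (phif _)).
- move=> w w0; rewrite -lee_fin EFinM (fineK (Psin w)) (fineK Vf).
  exact: (Psi_decay sg_cj cjK c0_gt0 O_dens n2 X w0).
- move=> w w0; apply/andP; split; rewrite -lee_fin !EFinD (fineK (Psin w)) (fineK Vf).
    rewrite EFinM (fineK rf) muleC; exact: (Psi_lower sg_cj cjK c0_gt0 O_dens n2 X w0).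
  rewrite [((fine _ * _)%R)%:E]EFinM (fineK rf) [(rtot sg cj X * _)%E]muleC.
  rewrite [X in (_ <= _ + X)%E]EFinM (fineK Vf).
  exact: (Psi_upper sg_cj cjK c0_gt0 O_dens n2 X w0).
Qed.

End ThetaTransform.

(** * The transform of psi as the product of zeta and the transform of phi *)

Section DirichletLaplace.
Variables (R : realType) (I : choiceType).
Local Notation cabs := (@Normc.normc R).
Local Notation mu := (@lebesgue_measure R).
Implicit Types (A B : {fset I}) (s : R[i]) (w sg : R).

Lemma cexp_real (x : R) : cexp (x%:C)%C = ((expR x)%:C)%C.
Proof.
by rewrite /cexp /= cos0 sin0; apply: complex_ext; rewrite /= ?mulr1 ?mulr0 ?mul0r ?subr0 ?addr0.
Qed.

Lemma has_sum_approx (x : I -> R[i]) (l : R[i]) (e : R) : has_sum x l -> 0 < e ->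
  exists A, forall B, (A `<=` B)%fset -> cabs (l - \sum_(i <- B) x i) < e.
Proof.
move=> h e0; have eC : 0 < (e%:C)%C :> R[i] by rewrite ltcR.
move/cvgrPdist_lt : h => /(_ totally_filter _ eC) [A _ hA]; exists A => B AB.
by have := hA B AB; rewrite norm_cabs ltcR /partial_sum (big_seq_fsetE _ B predT).
Qed.

Lemma sum_fset_le (f : I -> R) A B : (forall i, 0 <= f i) -> (A `<=` B)%fset ->
  \sum_(i <- A) f i <= \sum_(i <- B) f i.
Proof.
move=> f0 /fsubsetP AB; rewrite (bigID (fun i => i \in A) xpredT f (r := B))/= -[leLHS]addr0 lerD//.
  rewrite -[leRHS]big_filter le_eqVlt; apply/orP; left; apply/eqP; apply: perm_big.
  apply: uniq_perm; rewrite ?filter_uniq ?fset_uniq// => i; rewrite mem_filter.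
  by case: (boolP (i \in A)) => // /AB ->.
by apply: sumr_ge0.
Qed.

Lemma fset_esum_le (f : I -> R) A :
  ((\sum_(i <- A) f i)%:E <= \esum_(i in [set: I]) (f i)%:E)%E.
Proof.
have := @esum_lb R I [set: I] [set` A] (fun i => (f i)%:E) (conj (finite_fset A) (@subsetT _ _)).
by rewrite (fsbig_finite _ _ (finite_fset A)) set_fsetK sumEFin.
Qed.

(** Only finitely many terms of a convergent positive sum exceed 1 / (k + 1). Applied to the
    Dirichlet series at a real point, this makes the set of ideals countable, so sum and integral
    can be exchanged. *)
Lemma esum_countable (f : I -> R) (M : R) : (forall i, 0 < f i) ->
  (\esum_(i in [set: I]) (f i)%:E <= M%:E)%E -> countable [set: I].
Proof.
move=> f0 fM.
have -> : [set: I] = \bigcup_(k in [set: nat]) [set i | k.+1%:R^-1 <= f i].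
  apply/seteqP; split => // i _; exists (Num.truncn (f i)^-1) => //=.
  rewrite -[leRHS]invrK lef_pV2 ?posrE ?invr_gt0//; exact: ltW (truncnS_gt _).
apply: bigcup_countable => // k _; apply: finite_set_countable; apply: contrapT => inf.
pose m := (Num.truncn (M * k.+1%:R)).+1.
have [B BA mB] := infinite_set_fset m inf.
have : ((\sum_(i <- B) f i)%:E <= M%:E)%E.
  exact: le_trans (fset_esum_le _ _) fM.
rewrite lee_fin leNgt => /negP; apply.
have h : m%:R * k.+1%:R^-1 <= \sum_(i <- B) f i.
  apply: (@le_trans _ _ (\sum_(i <- B) k.+1%:R^-1)).
    by rewrite big_const_seq count_predT iter_addr_0 -[leRHS]mulr_natl ler_wpM2r ?invr_ge0// ler_nat.
  by rewrite big_seq [leRHS]big_seq; apply: ler_sum => i /BA.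
by apply: lt_le_trans h; rewrite ltr_pdivlMr// truncnS_gt.
Qed.

Variables (a : I -> R) (Z : R[i] -> R[i]).
Hypothesis ZE : forall s, 1 < complex.Re s -> has_sum (fun i => cexp (- s * ((a i)%:C)%C)) (Z s).

Lemma cexp_term sg i : cexp (- (sg%:C)%C * ((a i)%:C)%C) = ((expR (- (sg * a i)))%:C)%C.
Proof. by rewrite -cexp_real -rmorphN -rmorphM mulNr. Qed.

Lemma dirichlet_le sg : 1 < sg ->
  (\esum_(i in [set: I]) (expR (- (sg * a i)))%:E <= (complex.Re (Z (sg%:C)%C))%:E)%E.
Proof.
move=> s1; apply: esum_ub => F [finF _].
rewrite (fsbig_finite _ _ finF)/= sumEFin lee_fin leNgt; apply/negP => lt.
set S := \sum_(i <- _) _ in lt.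
have e0 : 0 < S - complex.Re (Z (sg%:C)%C) by rewrite subr_gt0.
have [A hA] := has_sum_approx (ZE (s := (sg%:C)%C) s1) e0.
have := hA (A `|` fset_set F)%fset (fsubsetUl _ _).
have SB : S <= \sum_(i <- (A `|` fset_set F)%fset) expR (- (sg * a i)).
  by apply: sum_fset_le; [move=> i; exact: expR_ge0|exact: fsubsetUr].
under eq_bigr do rewrite cexp_term.
rewrite -rmorph_sum; move: (\sum_(i <- _) _) SB => S' SB h.
have := le_lt_trans (Re_le_cabs _) h; rewrite cReB /= => h'.
by move: h'; rewrite ltr_norml => /andP[]; lra.
Qed.

Variables (phi psi : R -> R) (C : R).
Hypotheses (phi_gt0 : forall w, 0 < phi w) (phi_anti : forall w w', w <= w' -> phi w' <= phi w).
Hypothesis phi_neg : forall w, w <= 0 -> phi w <= C * expR (- (w / 4)).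
Hypothesis phi_pos : forall w, 0 <= w -> phi w <= C * expR (- (3 * w)).
Hypothesis psiE : forall w, (\esum_(i in [set: I]) (phi (w + a i))%:E = (psi w)%:E)%E.

Let phi_ge0 w : 0 <= phi w := ltW (phi_gt0 w).

Lemma measurable_phi : measurable_fun setT phi.
Proof. by apply: nonincreasing_measurable => // w w'; exact: phi_anti. Qed.

Lemma psi_ge0 w : 0 <= psi w.
Proof. by rewrite -lee_fin -psiE; apply: esum_ge0 => i _; rewrite lee_fin. Qed.

Lemma measurable_psi : measurable_fun setT psi.
Proof.
apply: nonincreasing_measurable => // w w' ww; rewrite -lee_fin -!psiE; apply: le_esum => i _.
by rewrite lee_fin phi_anti// lerD2r.
Qed.

Lemma lap_dom_abs (h : R -> R) sg (B k : R) : measurable_fun setT h -> (forall w, 0 <= h w) -> 0 < k ->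
  (forall w, h w * expR (sg * w) <= B * expR (- (k * `|w|))) -> lap_dom h sg.
Proof.
move=> mh h0 k0 hB.
have mE : measurable_fun setT (fun w : R => expR (- (k * `|w|))).
  apply: measurableT_comp => //; apply: measurableT_comp => //.
  by apply: measurable_funM => //; exact: measurableT_comp.
have iE : mu.-integrable setT (EFin \o (fun w : R => expR (- (k * `|w|)))).
  apply/integrableP; split; first exact/measurable_EFinP.
  under eq_integral => w _ do rewrite /= ger0_norm ?expR_ge0//.
  exact: integral_expR_abs.
apply: (le_integrable measurableT _ _ (integrableZ B iE)) => /=.
  by apply/measurable_EFinP; apply: measurable_funM => //; apply: measurableT_comp.
move=> w _ /=; rewrite lee_fin ger0_norm ?mulr_ge0 ?expR_ge0//.
exact: le_trans (hB w) (ler_norm _).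
Qed.

Lemma phi_dom sg : 1 / 4 < sg < 3 -> lap_dom phi sg.
Proof.
move=> /andP[s1 s2]; have [k [k0 k1 k2]] : exists k : R, [/\ 0 < k, k <= sg - 1 / 4 & k <= 3 - sg].
  have [h|h] := leP (sg - 1 / 4) (3 - sg); [exists (sg - 1 / 4)|exists (3 - sg)]; split; lra.
have C0 : 0 <= C.
  by have := phi_neg (lexx 0); rewrite mul0r oppr0 expR0 mulr1; apply: le_trans; exact: ltW.
apply: (@lap_dom_abs _ _ C k measurable_phi) => // w.
have [w0|w0] := leP 0 w.
  apply: (@le_trans _ _ (C * expR (- (3 * w)) * expR (sg * w))).
    by rewrite ler_wpM2r ?expR_ge0// phi_pos.
  rewrite -mulrA -expRD ler_wpM2l// ler_expR ger0_norm//.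
  have : 0 <= (3 - sg - k) * w by rewrite mulr_ge0// subr_ge0.
  by lra.
apply: (@le_trans _ _ (C * expR (- (w / 4)) * expR (sg * w))).
  by rewrite ler_wpM2r ?expR_ge0// phi_neg// ltW.
rewrite -mulrA -expRD ler_wpM2l// ler_expR ltr0_norm//.
have : (sg - 1 / 4 - k) * w <= 0 by rewrite mulr_ge0_le0 ?subr_ge0// ltW.
by lra.
Qed.

Lemma lap_domE (h : R -> R) sg : lap_dom h sg ->
  (\int[mu]_w (h w * expR (sg * w))%:E = (\int[mu]_w (h w * expR (sg * w)))%:E)%E.
Proof. by move=> hd; rewrite /Rintegral fineK// integrable_fin_num. Qed.

Definition phi_mellin sg : R := \int[mu]_w (phi w * expR (sg * w)).

Lemma phi_shift_expR sg b w :
  phi (w + b) * expR (sg * w) = expR (- (sg * b)) * (phi (w + b) * expR (sg * (w + b))).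
Proof. by rewrite mulrCA -expRD; congr (_ * expR _); ring. Qed.

Lemma measurable_phi_expR sg : measurable_fun setT (fun w => phi w * expR (sg * w)).
Proof.
by apply: measurable_funM; [exact: measurable_phi|apply: measurableT_comp => //; exact: measurable_funM].
Qed.

Lemma psi_int sg : 1 < sg < 3 -> (\int[mu]_w (psi w * expR (sg * w))%:E =
  \esum_(i in [set: I]) (expR (- (sg * a i)) * phi_mellin sg)%:E)%E.
Proof.
move=> /andP[s1 s3].
have cI : countable [set: I].
  by apply: (esum_countable _ (dirichlet_le s1)) => i; exact: expR_gt0.
transitivity (\int[mu]_w \esum_(i in [set: I]) (phi (w + a i) * expR (sg * w))%:E)%E.
  apply: eq_integral => w _; rewrite mulrC EFinM -psiE -esumZl ?expR_ge0//; last by move=> i _; rewrite lee_fin.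
  by apply: eq_esum => i _; rewrite -EFinM mulrC.
rewrite integral_esum//; last 2 first.
- move=> i _; apply/measurable_EFinP; apply: measurable_funM; last first.
    by apply: measurableT_comp => //; exact: measurable_funM.
  by apply: (measurableT_comp measurable_phi); exact: measurable_shift.
- by move=> i w _; rewrite lee_fin mulr_ge0 ?expR_ge0.
apply: eq_esum => i _; under eq_integral do rewrite phi_shift_expR EFinM.
have mp : measurable_fun setT (fun w => (phi w * expR (sg * w))%:E).
  by apply/measurable_EFinP; exact: measurable_phi_expR.
rewrite ge0_integralZl ?lee_fin ?expR_ge0//; last 2 first.
- by apply: (measurableT_comp mp); exact: measurable_shift.
- by move=> w _; rewrite lee_fin mulr_ge0 ?expR_ge0.
rewrite (@ge0_integral_shift _ (fun w => (phi w * expR (sg * w))%:E))//; last first.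
  by move=> w; rewrite lee_fin mulr_ge0 ?expR_ge0.
by rewrite lap_domE// phi_dom//; lra.
Qed.

Lemma psi_dom sg : 1 < sg < 3 -> lap_dom psi sg.
Proof.
move=> s13; have /andP[s1 _] := s13; apply/integrableP; split.
  apply/measurable_EFinP; apply: measurable_funM; first exact: measurable_psi.
  by apply: measurableT_comp => //; exact: measurable_funM.
under eq_integral => w _ do rewrite /= ger0_norm ?mulr_ge0 ?expR_ge0 ?psi_ge0//.
have G0 : 0 <= phi_mellin sg by apply: Rintegral_ge0 => w _; rewrite mulr_ge0 ?expR_ge0.
rewrite psi_int//; under eq_esum do rewrite mulrC EFinM.
rewrite esumZl//.
rewrite (le_lt_trans (y := ((phi_mellin sg)%:E * (complex.Re (Z (sg%:C)%C))%:E)%E))//.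
  by rewrite lee_wpmul2l// dirichlet_le.
exact: ltry.
Qed.

Lemma lap_sum s (r : seq I) : 1 / 4 < complex.Re s < 3 ->
  [/\ measurable_fun setT (fun w => \sum_(i <- r) phi (w + a i)),
   lap_dom (fun w => \sum_(i <- r) phi (w + a i)) (complex.Re s) &
   lap (fun w => \sum_(i <- r) phi (w + a i)) s =
     (\sum_(i <- r) cexp (- s * ((a i)%:C)%C)) * lap phi s].
Proof.
move=> hs; have pd := phi_dom hs; elim: r => [|i r [IHm IHd IHl]].
  have e : (fun w => \sum_(i <- [::]) phi (w + a i)) = (fun w => 0 * phi w).
    by apply/funext => w; rewrite big_nil mul0r.
  split; rewrite e.
  - by apply: measurable_funM => //; exact: measurable_phi.
  - have := integrableZ 0 pd; rewrite /lap_dom.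
    by rewrite (_ : (fun w => 0 * (phi w * _)) = (fun w => 0 * phi w * expR (complex.Re s * w)))//;
      apply/funext => w; rewrite mulrA.
  - by rewrite lapZ//; [rewrite big_nil !mul0r|exact: measurable_phi].
have e : (fun w => \sum_(j <- i :: r) phi (w + a j)) =
         (fun w => phi (w + a i) + \sum_(j <- r) phi (w + a j)).
  by apply/funext => w; rewrite big_cons.
have mi : measurable_fun setT (fun w => phi (w + a i)).
  by apply: (measurableT_comp measurable_phi); exact: measurable_shift.
have di : lap_dom (fun w => phi (w + a i)) (complex.Re s).
  have := integrableZ (expR (- (complex.Re s * a i))) (integrable_shift (a i) pd).
  by congr (_.-integrable _ (EFin \o _)); apply/funext => w; rewrite -phi_shift_expR.
split; rewrite e.
- exact: measurable_funD.
- have := integrable_addR di IHd; rewrite /lap_dom.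
  by congr (_.-integrable _ (EFin \o _)); apply/funext => w; rewrite mulrDl.
- rewrite lapD//; last by move=> w; apply: sumr_ge0.
  by rewrite IHl lap_shift//; [rewrite big_cons mulrDl|exact: measurable_phi].
Qed.

(** The remainder psi minus a finite partial sum is nonnegative, so its transform at s is controlled
    by the one at Re s, which becomes small by [psi_int]. A single finite set approximates both this
    integral and the Dirichlet series. *)
Lemma lap_psi s : 1 < complex.Re s < 3 -> lap psi s = Z s * lap phi s.
Proof.
move=> hs; have hs4 : 1 / 4 < complex.Re s < 3 by lra.
have /andP[s1 s3] := hs.
set x := complex.Re s in hs hs4 s1 s3 *.
have pd := psi_dom hs.
pose P := \int[mu]_w (psi w * expR (x * w)).
have bound (A : {fset I}) : cabs (lap psi s - (\sum_(i <- A) cexp (- s * ((a i)%:C)%C)) * lap phi s) <=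
    2 * (P - (\sum_(i <- A) expR (- (x * a i))) * phi_mellin x).
  have [mA dA lA] := lap_sum A hs4.
  have /= [_ _ lAx] := @lap_sum (x%:C)%C A hs4.
  have iA : \int[mu]_w ((\sum_(i <- A) phi (w + a i)) * expR (x * w)) =
      (\sum_(i <- A) expR (- (x * a i))) * phi_mellin x.
    move: lAx; under [in RHS]eq_bigr do rewrite cexp_term.
    by rewrite !lap_real -rmorph_sum -rmorphM => /complexI.
  have A0 w : 0 <= \sum_(i <- A) phi (w + a i) by apply: sumr_ge0.
  have Ap w : \sum_(i <- A) phi (w + a i) <= psi w.
    by rewrite -lee_fin -psiE; exact: fset_esum_le.
  rewrite -lA -lapB//; [|exact: measurable_psi|exact: psi_ge0].
  have hd : lap_dom (fun w => psi w - \sum_(i <- A) phi (w + a i)) x.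
    have := integrable_subR pd dA; rewrite /lap_dom.
    by congr (_.-integrable _ (EFin \o _)); apply/funext => w; rewrite mulrBl.
  apply: le_trans (lap_bound _ _ hd) _.
  - by apply: measurable_funB => //; exact: measurable_psi.
  - by move=> w; rewrite subr_ge0.
  rewrite ler_wpM2l// /P -iA -RintegralB//.
  by under eq_Rintegral do rewrite mulrBl.
apply/eqP; rewrite -subr_eq0 -[_ == 0]negbK -cabs_gt0; apply/negP => D0.
set D := cabs _ in D0.
have K0 : 0 < cabs (lap phi s) + 1 by rewrite ltr_wpDl// cabs_ge0.
(* The series contributes at most D / 4, and twice the remainder D / 8 another D / 4; together this
   is less than D. *)
have e1 : 0 < D / (4 * (cabs (lap phi s) + 1)) by rewrite divr_gt0// mulr_gt0.
have [A1 hA1] := has_sum_approx (ZE s1) e1.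
have e2 : 0 < D / 8 by rewrite divr_gt0.
have sumE : (\esum_(i in [set: I]) (expR (- (x * a i)) * phi_mellin x)%:E = P%:E)%E.
  by rewrite -psi_int// lap_domE.
have supf : ereal_sup [set (\sum_(i \in F) (expR (- (x * a i)) * phi_mellin x)%:E)%E | F in fsets [set: I]]
    \is a fin_num by move: sumE; rewrite /esum => ->.
have [_ [F [finF _] <-]] := ub_ereal_sup_adherent e2 supf.
move: sumE; rewrite {1}/esum => -> ; rewrite (fsbig_finite _ _ finF)/= sumEFin -EFinB lte_fin => hF.
have G0 : 0 <= phi_mellin x by apply: Rintegral_ge0 => w _; rewrite mulr_ge0 ?expR_ge0.
pose B := (A1 `|` fset_set F)%fset.
have hB := bound B.
have hB1 := hA1 B (fsubsetUl _ _).
have FB : \sum_(i <- fset_set F) expR (- (x * a i)) * phi_mellin x <= (\sum_(i <- B) expR (- (x * a i))) * phi_mellin x.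
  rewrite mulr_suml; apply: sum_fset_le; last exact: fsubsetUr.
  by move=> i; rewrite mulr_ge0 ?expR_ge0.
move: hB hB1; set S := \sum_(i <- B) cexp _ => hB hB1.
have : D <= cabs (lap psi s - S * lap phi s) + cabs (Z s - S) * cabs (lap phi s).
  rewrite -cabsM -[in leRHS](cabsN ((Z s - S) * _)).
  apply: (le_trans _ (cabsD _ _)); rewrite /D le_eqVlt; apply/orP; left; apply/eqP; congr cabs; ring.
have : cabs (Z s - S) * cabs (lap phi s) <= D / 4.
  apply: (@le_trans _ _ (D / (4 * (cabs (lap phi s) + 1)) * (cabs (lap phi s) + 1))).
    by apply: ler_pM; rewrite ?cabs_ge0 ?(ltW hB1)// lerDl.
  by rewrite invfM mulrA divfK// gt_eqF.
by lra.
Qed.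

End DirichletLaplace.

(** * Continuation of the transform identity to a real zero near 1 *)

Section RealZero.
Variable R : realType.
Local Notation cabs := (@Normc.normc R).
Local Notation mu := (@lebesgue_measure R).
Implicit Types (s : R[i]) (w sg : R) (h : R -> R).

Lemma lap_domZ h (c sg : R) : lap_dom h sg -> lap_dom (fun w => c * h w) sg.
Proof.
move=> hd; have := integrableZ c hd; rewrite /lap_dom.
by congr (_.-integrable _ (EFin \o _)); apply/funext => w; rewrite mulrA.
Qed.

Lemma lap_dom_expR h (c sg : R) : lap_dom h (sg + c) -> lap_dom (fun w => h w * expR (c * w)) sg.
Proof.
rewrite /lap_dom; congr (_.-integrable _ (EFin \o _)); apply/funext => w.
by rewrite -mulrA -expRD mulrDl addrC.
Qed.

Lemma lap_dom_le h h' sg : measurable_fun setT h -> (forall w, 0 <= h w <= h' w) ->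
  lap_dom h' sg -> lap_dom h sg.
Proof.
move=> mh hh; apply: le_integrable => //=.
  by apply/measurable_EFinP; apply: measurable_funM => //; apply: measurableT_comp.
move=> w _ /=; have /andP[h0 h1] := hh w.
by rewrite lee_fin !ger0_norm ?mulr_ge0 ?expR_ge0 ?(le_trans h0)// ler_wpM2r ?expR_ge0.
Qed.

Lemma neg_ind1 w : w < 0 -> neg_ind w = 1.
Proof. by rewrite /neg_ind => ->. Qed.

Lemma neg_ind0 w : 0 <= w -> neg_ind w = 0.
Proof. by rewrite /neg_ind ltNge => ->. Qed.

Lemma neg_ind_int (x : R) : 0 < x -> \int[mu]_w (neg_ind w * expR (x * w)) = x^-1.
Proof.
move=> x0; apply: complexI; rewrite -lap_real lap_neg_ind//.
by rewrite fmorphV.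
Qed.

Lemma cabs_lt (z : R[i]) (r : R) : 0 <= r ->
  complex.Re z ^+ 2 + complex.Im z ^+ 2 < r ^+ 2 -> cabs z < r.
Proof. by case: z => x y r0 /= h; rewrite -(ger0_norm r0) -sqrtr_sqr ltr_sqrt// (le_lt_trans _ h)// addr_ge0// sqr_ge0. Qed.

Variables (Z Gm : R[i] -> R[i]) (psi : R -> R) (V rho M q : R).
Hypothesis Zh : forall s, s != 1 -> holomorphic_at Z s.
Hypothesis Gh : forall s, 1 / 4 < complex.Re s < 3 -> holomorphic_at Gm s.
Hypotheses (mpsi : measurable_fun setT psi) (psi0 : forall w, 0 <= psi w).
Hypothesis psid : forall sg, 1 < sg < 3 -> lap_dom psi sg.
Hypothesis psil : forall s, 1 < complex.Re s < 3 -> lap psi s = Z s * Gm s.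
Hypotheses (V0 : 0 < V) (rho0 : 0 <= rho) (M0 : 0 <= M) (q2 : 2 <= q).
Hypothesis psi_up : forall w, 0 <= w -> psi w <= V * expR (- (6 * w)).
Hypothesis psi_lo : forall w, w <= 0 -> rho * expR (- w) <= psi w + V <=
  rho * expR (- w) + M * expR (2 * w / q) * expR (- w) * V.

Let mneg : measurable_fun setT (@neg_ind R) := @measurable_neg_ind R.

Definition psi_plus w : R := (1 - neg_ind w) * psi w.
Definition psi_reg w : R := neg_ind w * (psi w + V - rho * expR (- w)).

Lemma measurable_psi_plus : measurable_fun setT psi_plus.
Proof. by apply: measurable_funM => //; apply: measurable_funB. Qed.

Lemma measurable_psi_reg : measurable_fun setT psi_reg.
Proof.
apply: measurable_funM => //; apply: measurable_funB; first exact: measurable_funD.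
by apply: measurable_funM => //; apply: measurableT_comp => //; apply: measurableT_comp.
Qed.

Lemma psi_plus_ge0 w : 0 <= psi_plus w.
Proof.
rewrite /psi_plus; have [w0|w0] := leP 0 w; first by rewrite neg_ind0// subr0 mul1r.
by rewrite neg_ind1// subrr mul0r.
Qed.

Lemma psi_reg_ge0 w : 0 <= psi_reg w.
Proof.
rewrite /psi_reg; have [w0|w0] := leP 0 w; first by rewrite neg_ind0// mul0r.
by rewrite neg_ind1// mul1r subr_ge0; have /andP[] := psi_lo (ltW w0).
Qed.

Lemma psi_plus_dom sg : sg < 5 -> lap_dom psi_plus sg.
Proof.
move=> s5; apply: (@lap_dom_abs _ _ _ V 1 measurable_psi_plus psi_plus_ge0) => // w.
rewrite /psi_plus; have [w0|w0] := leP 0 w; last first.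
  by rewrite neg_ind1// subrr !mul0r mulr_ge0 ?expR_ge0// ltW.
rewrite neg_ind0// subr0 mul1r ger0_norm//.
apply: (@le_trans _ _ (V * expR (- (6 * w)) * expR (sg * w))).
  by rewrite ler_wpM2r ?expR_ge0// psi_up.
rewrite -mulrA -expRD ler_pM2l// ler_expR.
have : 0 <= (5 - sg) * w by rewrite mulr_ge0// subr_ge0 ltW.
by lra.
Qed.

Lemma psi_reg_le w : psi_reg w <= M * V * (neg_ind w * expR ((2 / q - 1) * w)).
Proof.
rewrite /psi_reg; have [w0|w0] := leP 0 w; first by rewrite neg_ind0// !mul0r mulr0.
rewrite neg_ind1// !mul1r lerBlDl; have /andP[_ h] := psi_lo (ltW w0).
apply: (le_trans h); rewrite lerD2l -!mulrA ler_wpM2l// mulrA -expRD mulrC ler_wpM2l ?(ltW V0)//.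
by rewrite ler_expR le_eqVlt; apply/orP; left; apply/eqP; ring.
Qed.

Let neg_shift_dom sg : 1 - 2 / q < sg -> lap_dom (fun w => neg_ind w * expR ((2 / q - 1) * w)) sg.
Proof. by move=> h; apply: lap_dom_expR; apply: lap_neg_ind_dom; lra. Qed.

Lemma psi_reg_dom sg : 1 - 2 / q < sg -> lap_dom psi_reg sg.
Proof.
move=> h; apply: (lap_dom_le measurable_psi_reg _ (lap_domZ (M * V) (neg_shift_dom h))) => w.
by rewrite psi_reg_ge0 psi_reg_le.
Qed.

(** psi is cut at w = 0, and the two terms subtracted on the negative side give the poles at 1 and
    0. The form (s - 0)^-1 matches [holo_inv_subr]. *)
Lemma mellin_split s : 1 < complex.Re s < 3 ->
  Z s * Gm s = lap psi_plus s + lap psi_reg s + (rho%:C)%C * (s - 1)^-1 - (V%:C)%C * (s - 0)^-1.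
Proof.
move=> hs; have /andP[s1 s3] := hs.
have q0 : 0 < 2 / q by rewrite divr_gt0// (lt_le_trans _ q2).
have mp : measurable_fun setT (fun w => neg_ind w * psi w) by exact: measurable_funM.
have p0 w : 0 <= neg_ind w * psi w by rewrite mulr_ge0// neg_ind_ge0.
have pd : lap_dom (fun w => neg_ind w * psi w) (complex.Re s).
  apply: (lap_dom_le mp _ (psid hs)) => w; rewrite p0/=.
  by have [w0|w0] := leP 0 w; [rewrite neg_ind0// mul0r|rewrite neg_ind1// mul1r].
have nd : lap_dom (@neg_ind R) (complex.Re s) by apply: lap_neg_ind_dom; lra.
have md1 : measurable_fun setT (fun w => neg_ind w * expR (-1 * w)).
  by apply: measurable_funM => //; apply: measurableT_comp => //; exact: measurable_funM.
have d1 : lap_dom (fun w => neg_ind w * expR (-1 * w)) (complex.Re s).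
  by apply: lap_dom_expR; apply: lap_neg_ind_dom; lra.
have d10 w : 0 <= neg_ind w * expR (-1 * w) by rewrite mulr_ge0 ?expR_ge0 ?neg_ind_ge0.
have e1 : lap psi s = lap psi_plus s + lap (fun w => neg_ind w * psi w) s.
  rewrite -lapD//; [|exact: measurable_psi_plus|exact: psi_plus_ge0|apply: psi_plus_dom; lra].
  by congr lap; apply/funext => w; rewrite -mulrDl subrK mul1r.
(* The V-term is moved to the left so that all four functions are nonnegative, as [lapD]
   requires. *)
have e2 : lap (fun w => neg_ind w * psi w) s + (V%:C)%C * s^-1 = lap psi_reg s + (rho%:C)%C * (s - 1)^-1.
  have -> : (V%:C)%C * s^-1 = lap (fun w => V * neg_ind w) s.
    by rewrite lapZ// lap_neg_ind//; lra.
  have -> : (rho%:C)%C * (s - 1)^-1 = lap (fun w => rho * (neg_ind w * expR (-1 * w))) s.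
    rewrite lapZ// lap_expR rmorphN rmorph1 lap_neg_ind//.
    by rewrite cReB /=; lra.
  rewrite -lapD//; last 3 first.
  - exact: measurable_funM.
  - by move=> w; rewrite mulr_ge0 ?neg_ind_ge0// ltW.
  - exact: lap_domZ.
  rewrite -lapD//; last 6 first.
  - exact: measurable_psi_reg.
  - exact: measurable_funM.
  - exact: psi_reg_ge0.
  - by move=> w; rewrite mulr_ge0.
  - by apply: psi_reg_dom; lra.
  - exact: lap_domZ.
  congr lap; apply/funext => w; rewrite /psi_reg mulN1r; ring.
rewrite -psil// e1 subr0; apply: (addIr ((V%:C)%C * s^-1)).
by rewrite subrK -!addrA e2.
Qed.

Let Fz s := Z s * Gm s - (lap psi_plus s + lap psi_reg s + (rho%:C)%C * (s - 1)^-1 - (V%:C)%C * (s - 0)^-1).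

Lemma mellin_holo s : s != 1 -> 1 / 4 < complex.Re s < 3 -> 1 - 2 / q < complex.Re s ->
  holomorphic_at Fz s.
Proof.
move=> s1 s3 sq; have /andP[s3a s3b] := s3.
apply: holoB; first by apply: holoM; [exact: Zh|exact: Gh].
apply: holoB; last first.
  apply: holoM; first exact: holo_cst.
  by apply: holo_inv_subr; apply/eqP => s0; move: s3a; rewrite s0 /=; lra.
apply: holoD; last by apply: holoM; [exact: holo_cst|exact: holo_inv_subr].
apply: holoD.
  apply: (@lap_holomorphic _ psi_plus (1 / 4) 3) => //.
  - exact: measurable_psi_plus.
  - exact: psi_plus_ge0.
  - by move=> sg h; apply: psi_plus_dom; lra.
apply: (@lap_holomorphic _ psi_reg (1 - 2 / q) 3).
- exact: measurable_psi_reg.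
- exact: psi_reg_ge0.
- by move=> sg /andP[h _]; exact: psi_reg_dom.
- by rewrite sq.
Qed.

(* Two overlapping squares, of sizes proportional to the distance from beta
   to 1, lead from the half-plane of convergence around the pole to beta. *)
Lemma mellin_continued (beta : R) : 0 < beta < 1 -> 1 - beta < 1 / (8 * q) -> Fz (beta%:C)%C = 0.
Proof.
move=> /andP[b0 b1] hd; set d := 1 - beta in hd.
have d0 : 0 < d by rewrite subr_gt0.
have q0 : 0 < q by exact: lt_le_trans q2.
have qi : 0 < q^-1 <= 1 / 2 by rewrite invr_gt0 q0/= div1r lef_pV2 ?posrE.
have d8 : 8 * d < q^-1.
  have e : 1 / (8 * q) = q^-1 / 8 by field; rewrite gt_eqF.
  by move: hd; rewrite e; lra.
have bE : beta = 1 - d by rewrite /d; ring.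
(* Since 8 d < 1/q <= 1/2, this band lies inside the strip 1/4 < Re s < 3 and to the right of 1 -
   2/q. *)
have hol (s : R[i]) : s != 1 -> 1 - 99 / 10 * d <= complex.Re s -> complex.Re s <= 1 + 8 * d ->
    holomorphic_at Fz s.
  move=> s1 sa sb; by apply: mellin_holo => //; lra.
have near s : 1 < complex.Re s < 3 -> Fz s = 0 by move=> h; rewrite /Fz mellin_split// subrr.
have dd : 0 < d ^+ 2 by rewrite exprn_gt0.
have d10 : 0 < d / 10 by lra.
(* The first square stays at height at least d / 10, hence above the pole. *)
have step1 z : cabs (z - Complex (1 + d / 10) (8 * d)) < 79 / 10 * d -> Fz z = 0.
  move=> hz; apply: (identity_square d10 _ _ hz).
    move=> s /and3P[/andP[r1 r2] i1 i2]; apply: hol; try lra.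
    by apply/eqP => sE; move: i1; rewrite sE /=; lra.
  move=> h hh; apply: near; rewrite cReD /=.
  by have := le_lt_trans (Re_le_cabs h) hh; rewrite ltr_norml => /andP[]; lra.
(* The second square ends at abscissa 1 - d / 10, to the left of the pole. Its centre is at distance
   below 76/10 d from the first centre, and beta lies at offset (4 d, -5/2 d) from it, within 49/10
   d. *)
apply: (@identity_square _ _ (1 - 5 * d) (5 / 2 * d) (49 / 10 * d) (d / 10) _ d10).
- move=> s /and3P[/andP[r1 r2] i1 i2]; apply: hol; try lra.
  by apply/eqP => sE; move: r2; rewrite sE /=; lra.
- move=> h hh; apply: step1.
  have -> : Complex (1 - 5 * d) (5 / 2 * d) + h - Complex (1 + d / 10) (8 * d) =
      Complex (- (51 / 10) * d) (- (55 / 10) * d) + h.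
    by apply: complex_ext; rewrite !(cReD, cImD, cReB, cImB) /=; lra.
  apply: (le_lt_trans (cabsD _ _)).
  have : cabs (Complex (- (51 / 10) * d) (- (55 / 10) * d)) < 76 / 10 * d.
    by apply: cabs_lt => /=; [lra|rewrite !exprMn; lra].
  by lra.
- by apply: cabs_lt; [lra|rewrite cReB cImB /= bE; nra].
Qed.

Lemma psi_plus_int (beta : R) : 0 < beta < 1 -> \int[mu]_w (psi_plus w * expR (beta * w)) <= V.
Proof.
move=> hb; have bd : lap_dom psi_plus beta by apply: psi_plus_dom; lra.
rewrite -lee_fin -(lap_domE bd).
apply: (@le_trans _ _ (\int[mu]_w (V%:E * (exponential_pdf 1 w)%:E))%E).
  apply: ge0_le_integral => //.
  - by move=> w _; rewrite lee_fin mulr_ge0 ?expR_ge0 ?psi_plus_ge0.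
  - apply/measurable_EFinP; apply: measurable_funM; first exact: measurable_psi_plus.
    by apply: measurableT_comp => //; exact: measurable_funM.
  - by apply: emeasurable_funM => //; apply/measurable_EFinP; exact: measurable_exponential_pdf.
  move=> w _; rewrite -EFinM lee_fin /psi_plus; have [w0|w0] := leP 0 w; last first.
    by rewrite neg_ind1// subrr !mul0r mulr_ge0 ?exponential_pdf_ge0// ltW.
  rewrite neg_ind0// subr0 mul1r exponential_pdfE//= mul1r.
  apply: (@le_trans _ _ (V * expR (- (6 * w)) * expR (beta * w))).
    by rewrite ler_wpM2r ?expR_ge0// psi_up.
  rewrite -mulrA -expRD ler_pM2l// ler_expR.
  have : 0 <= (1 - beta) * w by rewrite mulr_ge0//; lra.
  by lra.
rewrite ge0_integralZl//; last 3 first.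
- by apply/measurable_EFinP; exact: measurable_exponential_pdf.
- by move=> w _; rewrite lee_fin exponential_pdf_ge0.
- by rewrite lee_fin ltW.
by rewrite integral_exponential_pdf// mule1.
Qed.

Lemma psi_reg_int (beta : R) : 1 - 2 / q < beta ->
  \int[mu]_w (psi_reg w * expR (beta * w)) <= M * V / (2 / q - (1 - beta)).
Proof.
move=> hb; have x0 : 0 < beta + (2 / q - 1) by lra.
rewrite (_ : 2 / q - (1 - beta) = beta + (2 / q - 1)); last by ring.
rewrite -(neg_ind_int x0) -RintegralZl//; last exact: lap_neg_ind_dom.
apply: le_Rintegral => //; first exact: psi_reg_dom.
  by apply: integrableZ; exact: lap_neg_ind_dom.
move=> w _; apply: (@le_trans _ _ (M * V * (neg_ind w * expR ((2 / q - 1) * w)) * expR (beta * w))).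
  by rewrite ler_wpM2r ?expR_ge0// psi_reg_le.
by rewrite -!mulrA -expRD -mulrDl [2 / q - 1 + beta]addrC.
Qed.

Lemma real_zero_bound (beta : R) : 0 < beta < 1 -> Z (beta%:C)%C = 0 ->
  1 - beta < 1 / (8 * q) -> rho / (1 - beta) <= M * V * q.
Proof.
move=> hb Z0 hd; have /andP[b0 b1] := hb; have q0 : 0 < q by exact: lt_le_trans q2.
have d0 : 0 < 1 - beta by rewrite subr_gt0.
have dq : 1 - beta < q^-1.
  apply: (lt_le_trans hd); rewrite div1r lef_pV2 ?posrE ?mulr_gt0//; lra.
have q1 : 0 < q^-1 by rewrite invr_gt0.
have := mellin_continued hb hd; rewrite /Fz Z0 mul0r sub0r => /eqP; rewrite oppr_eq0 => /eqP.
rewrite !lap_real subr0 -[X in (_%:C)%C - X](rmorph1 (real_complex R)).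
set A := \int[mu]_w _; set B := \int[mu]_w _ => e.
have {}e : A + B + rho / (beta - 1) - V / beta = 0.
  apply: complexI; rewrite rmorph0 -[RHS]e.
  by rewrite !(rmorphB, rmorphD, rmorphM, fmorphV) /= rmorph1.
have hA : A <= V by exact: psi_plus_int.
have hB : B <= M * V * q.
  have h2 : 1 - 2 / q < beta by lra.
  apply: (le_trans (psi_reg_int h2)); rewrite ler_wpM2l ?mulr_ge0 ?(ltW V0)//.
  by rewrite -[leRHS]invrK lef_pV2 ?posrE//; lra.
(* V / beta absorbs the bound V on A, so only M V q remains. *)
have hV : V <= V / beta by rewrite ler_pdivlMr// ler_piMr// ltW.
have r : rho / (beta - 1) = - (rho / (1 - beta)) by rewrite -opprB invrN mulrN.
by rewrite r in e; lra.
Qed.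

End RealZero.

(** * The final numerical bound *)

Lemma absolute_disc_junk (L : fieldExtType rat) : ~ (exists b, @integral_basis L b) ->
  absolute_disc L = 0.
Proof.
move=> nb; rewrite /absolute_disc xgetPN => [|b bP]; last by apply: nb; exists b.
rewrite /basis_disc; set A := \matrix_(i, j) _.
(* The default value of [xget] is the zero tuple, so all traces in the matrix are 0. *)
have -> : A = 0.
  apply/matrixP => i j; rewrite !mxE !nth_nseq !ltn_ord mul0r /field_trace.
  by rewrite linear0 linear0 mxtrace0.
have det00 k : (0 < k)%N -> \det (0 : 'M[rat]_k) = 0 by case: k => // k _; exact: det0.
by rewrite det00 ?normr0// adim_gt0.
Qed.

Lemma dim_ge2 (L : fieldExtType rat) : {:L}%VS != 1%VS -> (2 <= \dim {:L})%N.
Proof.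
apply: contraNT; rewrite -ltnNge ltnS => d1.
by rewrite eq_sym eqEdim subvf dimv1.
Qed.

(** With n <= d both alternatives are at most 64 times a power of d, and d >= 2 gives 64 <= d^6: the
    first yields 64 d <= d^11, the second 64 d^5 sqrt d <= d^11 sqrt d. The resulting exponent 11.5
    leaves room up to 11.7. *)
Lemma disc_power_bound (R : realType) (n d : nat) (dl : R) : (2 <= n)%N -> (n <= d)%N -> (0 < dl) ->
  1 / (8 * n%:R) <= dl \/ dl^-1 <= Num.sqrt d%:R * (32 * n%:R ^+ 2 * (n + 2)%:R * d%:R * n%:R) ->
  (d%:R : R) `^ (- (117%:R / 10%:R)) <= dl.
Proof.
move=> n2 nd dl0 h.
have d2 : (2 <= d)%N := leq_trans n2 nd.
have d1 : 1 <= d%:R :> R by rewrite ler1n (leq_trans _ d2).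
have d0 : 0 < d%:R :> R by apply: lt_le_trans d1.
have s1 : 1 <= Num.sqrt d%:R :> R by rewrite -[leLHS]sqrtr1 ler_sqrt.
have e : (d ^ 11)%:R * Num.sqrt d%:R <= (d%:R : R) `^ (117%:R / 10%:R).
  rewrite -powR12_sqrt// natrX -powR_mulrn// -powRD; last by rewrite (gt_eqF d0) implybT.
  by apply: ler_powR => //; lra.
rewrite powRN -[leRHS]invrK lef_pV2 ?posrE ?invr_gt0 ?powR_gt0//; apply: le_trans e.
have p0 : 0 <= (d ^ 11)%:R :> R by [].
have d64 : (64 <= d ^ 6)%N by rewrite (@leq_exp2r 2 d 6).
have [{}h|{}h] := h.
  apply: (@le_trans _ _ (8 * n%:R)).
    have n0 : 0 < 8 * n%:R :> R by rewrite mulr_gt0// ltr0n (leq_trans _ n2).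
    by rewrite -[leRHS]invrK lef_pV2 ?posrE ?invr_gt0// -div1r.
  apply: (@le_trans _ _ (d ^ 11)%:R); last by rewrite ler_peMr.
  rewrite -natrM ler_nat (@leq_trans (64 * d))//; first by rewrite leq_mul.
  rewrite (_ : (11 = 6 + 5)%N)// expnD leq_mul//.
  by rewrite -[leqLHS]expn1 leq_pexp2l// (leq_trans _ d2).
apply: (le_trans h); rewrite mulrC ler_wpM2r ?sqrtr_ge0//.
rewrite -natrX -!natrM ler_nat.
apply: (@leq_trans (32 * d ^ 2 * (2 * d) * d * d)%N).
  rewrite !leq_mul// ?leq_sqr//.
  by rewrite mul2n -addnn leq_add.
rewrite (_ : 32 * d ^ 2 * (2 * d) * d * d = 64 * d ^ 5)%N; last by rewrite !expnS expn0; clear; lia.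
by rewrite (_ : (11 = 6 + 5)%N)// expnD leq_mul.
Qed.

Theorem theorem1p4 (R : realType) (L : fieldExtType rat)
    (L_neq_Q : {:L}%VS != 1%VS)
    (zeta_L : R[i] -> R[i]) (zeta_LP : is_dedekind_zeta L zeta_L)
    (beta1 : R) (beta1_01 : 0 < beta1 < 1)
    (beta1_zero : zeta_L (beta1%:C)%C = 0) :
  1 - beta1 >= ratr (absolute_disc L) `^ (- (117%:R / 10%:R)).
Proof.
have /andP[b0 b1] := beta1_01.
have dl0 : 0 < 1 - beta1 by rewrite subr_gt0.
have [[b bP]|nb] := pselect (exists b, @integral_basis L b); last first.
  (* The discriminant then has value 0, and [powR] of 0 with nonzero exponent is 0. *)
  rewrite absolute_disc_junk// rmorph0 powR0; first exact: ltW.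
  by rewrite lt_eqF//; lra.
have {b}bP := xgetPex [tuple of nseq _ 0] (ex_intro _ b bP).
rewrite /absolute_disc; set b := xget _ _ in bP *.
have [sg [cj [th [sg_cj sg_inj]]]] := embeddings_exist R L.
have [d d0 dE] := integral_basis_disc_int sg_inj bP.
have cjK : involutive cj.
  by move=> i; apply: sg_inj; rewrite !sg_cj conjcK.
have n2 := dim_ge2 L_neq_Q.
have O_dens := roi_has_dens sg_cj sg_inj bP.
rewrite dE ratr_nat in O_dens *.
set c0 : R := (Num.sqrt d%:R)^-1 in O_dens.
have sd : 0 < Num.sqrt d%:R :> R by rewrite sqrtr_gt0 ltr0n.
have c00 : 0 < c0 by rewrite invr_gt0.
have [nd d2] := dim_disc sg_cj c00 O_dens n2 erefl.
have [Zs Zh] := zeta_LP.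
pose a (I : [set I : set L | nonzero_ideal I]) := lnN R (val I).
have Zs' s : 1 < complex.Re s -> has_sum (fun I => cexp (- s * ((a I)%:C)%C)) (zeta_L s) by exact: Zs.
(* Convergence of the series at 2 supplies the bound asked for by [theta_transform]. *)
have s2 : 1 < 2 :> R by rewrite ltr1n.
have [phi [psi [V [rho [C [[V0 Vr] [p1 p2 p3 p4] psiE up lo]]]]]] :=
  theta_transform sg_cj cjK c00 O_dens n2 (translation_spaceN R _) (dirichlet_le Zs' s2).
apply: (disc_power_bound n2 nd dl0).
have [h|h] := leP (1 / (8 * (\dim {:L})%:R)) (1 - beta1); [by left|right].
have n0 : 0 < (\dim {:L})%:R :> R by rewrite ltr0n (leq_trans _ n2).
have n2R : 2 <= (\dim {:L})%:R :> R by rewrite ler_nat.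
have rho0 : 0 <= rho by apply: le_trans Vr; rewrite mulr_ge0 ?ltW.
have M0 := theta_err_ge0 L c00.
(* With t = e^(2 w / n) >= 1 + 2 w / n and pi >= 3, one gets pi n (t - 1/2) >= 3 (n/2 + 2 w) >= 6
   w. *)
have up' w : 0 <= w -> psi w <= V * expR (- (6 * w)).
  move=> w0; apply: (le_trans (up w w0)); rewrite mulrC ler_pM2l// ler_expR lerN2.
  have := expR_ge1Dx (2 * w / (\dim {:L})%:R); rewrite -/(tw L w).
  have := pi_ge3 R; move: (pi) (tw L w) (\dim {:L})%:R n0 => p t k k0 p3' ht.
  have ht' : k + 2 * w <= k * t.
    by have := ler_wpM2l (ltW k0) ht; rewrite mulrDr mulr1 mulrC divfK ?gt_eqF.
  have : 3 * (k * (t - 1 / 2)) <= p * (k * (t - 1 / 2)) by rewrite ler_wpM2r// mulrBr; lra.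
  by rewrite -mulrA mulrBr; lra.
have Gh s : 1 / 4 < complex.Re s < 3 -> holomorphic_at (lap phi) s.
  apply: lap_holomorphic => //; [exact: measurable_phi|by move=> w; exact: ltW|].
  by move=> x hx; exact: (phi_dom p1 p2 p3 p4 hx).
have := real_zero_bound Zh Gh (measurable_psi p2 psiE) (psi_ge0 p1 psiE)
  (psi_dom Zs' p1 p2 p3 p4 psiE) (lap_psi Zs' p1 p2 p3 p4 psiE) V0 rho0 M0 n2R up' lo beta1_01 beta1_zero h.
move=> hb.
have : c0 * V / (1 - beta1) <= theta_err L c0 * V * (\dim {:L})%:R.
  by apply: le_trans hb; rewrite ler_pM2r ?invr_gt0.
rewrite mulrAC [leRHS]mulrAC ler_pM2r// {1}/c0 ler_pdivrMl//.
by rewrite /theta_err /c0 exprVn invrK sqr_sqrtr.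
Qed.
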